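(* Let $T>0$. Assume (A1), (A2) and (A3) (stated in the context). Then the free boundary problem $(\mathrm{P})(u_0,s_0,b)$ has a unique solution $(s,u)$ on $[0,T]$ satisfying $0\le u\le b^*/\gamma$ on $Q_s(T)$.
   Context: Let $\sigma(r)=r$ if $r\ge 0$ and $\sigma(r)=0$ if $r<0$. Assumptions: (A1) $a_0,\gamma,\beta,T$ are positive constants. (A2) $b\in W^{1,2}(0,T)$ with $b_*\le b\le b^*$ on $(0,T)$, where $b_*,b^*$ are positive constants. (A3) $s_0>0$ and $u_0\in H^1(0,s_0)$ with $0\le u_0\le b^*/\gamma$ on $[0,s_0]$. For a positive function $s$ on $[0,T]$ put $Q_s(T)=\{(t,z): 0<t<T,\ 0<z<s(t)\}$. A pair $(s,u)$, with $s$ a function on $[0,T]$ and $u$ a function on $Q_s(T)$, is a solution of $(\mathrm{P})(u_0,s_0,b)$ on $[0,T]$ if: (S1) $s\in W^{1,\infty}(0,T)$, $s>0$ on $[0,T]$, $u\in L^\infty(Q_s(T))$, $u_t,u_{zz}\in L^2(Q_s(T))$, and $t\in[0,T]\mapsto |u_z(t,\cdot)|_{L^2(0,s(t))}$ is bounded; (S2) $u_t-u_{zz}=0$ on $Q_s(T)$; (S3) $-u_z(t,0)=\beta(b(t)-\gamma u(t,0))$ for a.e. $t\in[0,T]$; (S4) $-u_z(t,s(t))=u(t,s(t))\,s_t(t)$ for a.e. $t\in[0,T]$; (S5) $s_t(t)=a_0\,\sigma(u(t,s(t)))$ for a.e. $t\in[0,T]$; (S6) $s(0)=s_0$ and $u(0,z)=u_0(z)$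 for $z\in[0,s_0]$. *)

(* Defs.v *)
From mathcomp Require Import all_boot all_order all_algebra.
From mathcomp Require Import all_classical all_reals all_analysis.
Import Order.TTheory GRing.Theory Num.Theory.
Import numFieldNormedType.Exports.

Set Implicit Arguments.
Unset Strict Implicit.
Unset Printing Implicit Defensive.

Local Open Scope classical_set_scope.
Local Open Scope ring_scope.

Section sobolev.
Context {R : realType}.

Local Notation leb := (@lebesgue_measure R).

Definition leb2 := (leb \x leb)%E.

(* All iterated directional derivatives exist and are continuous. *)
Definition smooth (V : normedModType R) (phi : V -> R) : Prop :=
  forall vs : seq V,
    let psi := foldr (fun v g => 'D_v g) phi vs in
    continuous psi /\ forall x v, derivable psi x v.

(* C_c^oo(A), for A open; functions are extended by 0 outside A. *)
Definition test_function (V : normedModType R) (A : set V) (phi : V -> R) :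
    Prop :=
  smooth phi /\
  exists K : set V, [/\ compact K, K `<=` A & forall x, ~ K x -> phi x = 0].

(* g is the distributional derivative of f on the open set A. *)
Definition weak_derivative1 (A : set R) (f g : R -> R) : Prop :=
  forall phi : R -> R, test_function A phi ->
    (\int[leb]_(x in A) (f x * derive1 phi x)%:E =
     - \int[leb]_(x in A) (g x * phi x)%:E)%E.

(* g is the distributional derivative of f in the direction v on A. *)
Definition weak_derivative2 (A : set (R * R)) (v : R * R) (f g : R * R -> R) :
    Prop :=
  forall phi : R * R -> R, test_function A phi ->
    (\int[leb2]_(x in A) (f x * 'D_v phi x)%:E =
     - \int[leb2]_(x in A) (g x * phi x)%:E)%E.

Definition in_Lp1 (p : \bar R) (A : set R) (f : R -> R) : Prop :=
  f \_ A \in Lfun leb p.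

Definition in_Lp2 (p : \bar R) (A : set (R * R)) (f : R * R -> R) : Prop :=
  f \_ A \in Lfun leb2 p.

(* f is in W^{1,p}(a, b) with weak derivative f'.  As usual in dimension one,
   f is taken to be the representative that is continuous on [a, b]. *)
Definition W1p_deriv (p : \bar R) (a b : R) (f f' : R -> R) : Prop :=
  [/\ {within `[a, b], continuous f}, in_Lp1 p `]a, b[ f,
      in_Lp1 p `]a, b[ f' & weak_derivative1 `]a, b[ f f'].

Definition W1p (p : \bar R) (a b : R) (f : R -> R) : Prop :=
  exists f', W1p_deriv p a b f f'.

(* The class of f on (a, b) has a representative continuous on [a, b], whose
   value at c is l. *)
Definition has_trace (a b : R) (f : R -> R) (c l : R) : Prop :=
  exists g : R -> R,
    [/\ {within `[a, b], continuous g},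
        {ae leb, forall x, x \in `]a, b[ -> f x = g x} & g c = l].

End sobolev.

Section free_boundary_problem.
Context {R : realType}.

Local Notation leb := (@lebesgue_measure R).

Definition sigma (r : R) : R := if 0 <= r then r else 0.

(* Points are (t, z). *)
Definition Q (s : R -> R) (T : R) : set (R * R) :=
  [set p | 0 < p.1 < T /\ 0 < p.2 < s p.1].

Definition Qclosed (s : R -> R) (T : R) : set (R * R) :=
  [set p | 0 <= p.1 <= T /\ 0 <= p.2 <= s p.1].

(* (S1), with ds, ut, uz, uzz the weak derivatives of s and u.  The bounds on
   u, u_t and u_z imply that u has a (unique) representative continuous on the
   closure of Q_s(T), lying in H^1(0, s(t)) for every t in [0, T]; u denotes that
   representative, which gives a meaning to u(t, .) for every t and to u(t, 0),
   u(t, s(t)) and u(0, z). *)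
Record solution_regularity (T : R) (s ds : R -> R) (u ut uz uzz : R * R -> R) :
    Prop := SolutionRegularity {
  s_W1oo : W1p_deriv +oo%E 0 T s ds;
  s_gt0 : forall t, t \in `[0, T] -> 0 < s t;
  u_continuous : {within Qclosed s T, continuous u};
  u_Loo : in_Lp2 +oo%E (Q s T) u;
  ut_weak : weak_derivative2 (Q s T) (1, 0) u ut;
  ut_L2 : in_Lp2 2%:E (Q s T) ut;
  uz_weak : weak_derivative2 (Q s T) (0, 1) u uz;
  uz_L2 : in_Lp2 2%:E (Q s T) uz;
  uzz_weak : weak_derivative2 (Q s T) (0, 1) uz uzz;
  uzz_L2 : in_Lp2 2%:E (Q s T) uzz;
  uz_slice : forall t, t \in `[0, T] ->
    W1p_deriv 2%:E 0 (s t) (fun z => u (t, z)) (fun z => uz (t, z));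
  uz_bounded : exists C : R, forall t, t \in `[0, T] ->
    (Lnorm leb 2%:E (EFin \o ((fun z => uz (t, z)) \_ `]0%R, s t[)) <= C%:E)%E
}.

Record solution_equations (a0 gamma beta T : R) (b : R -> R) (s0 : R)
    (u0 : R -> R) (s ds : R -> R) (u ut uz uzz : R * R -> R) : Prop :=
  SolutionEquations {
  heat_equation : {ae leb2, forall p, Q s T p -> ut p - uzz p = 0};
  flux_at_0 : {ae leb, forall t, t \in `[0, T] ->
    exists2 q, has_trace 0 (s t) (fun z => uz (t, z)) 0 q &
      - q = beta * (b t - gamma * u (t, 0))};
  flux_at_s : {ae leb, forall t, t \in `[0, T] ->
    exists2 q, has_trace 0 (s t) (fun z => uz (t, z)) (s t) q &
      - q = u (t, s t) * ds t};
  free_boundary : {ae leb, forall t, t \in `[0, T] ->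
    ds t = a0 * sigma (u (t, s t))};
  s_initial : s 0 = s0;
  u_initial : forall z, z \in `[0, s0] -> u (0, z) = u0 z
}.

(* Only the values of s on [0, T] and of u on the closure of Q_s(T) matter. *)
Definition is_solution (a0 gamma beta T : R) (b : R -> R) (s0 : R)
    (u0 : R -> R) (s : R -> R) (u : R * R -> R) : Prop :=
  exists (ds : R -> R) (ut uz uzz : R * R -> R),
    solution_regularity T s ds u ut uz uzz /\
    solution_equations a0 gamma beta T b s0 u0 s ds u ut uz uzz.

End free_boundary_problem.

(* Main.v *)
(** Existence.  Run an explicit finite difference scheme on a fixed grid, with
    space step [h] and time step [h^2 / 8], extending the discrete state by a
    constant to the right of the free boundary.  It obeys the maximum principle
    [0 <= u <= bmax / gamma] and a discrete energy estimate for
    [1/2 \int u_z^2 + a0 u(s)^3 / 3 + beta gamma u(0)^2 / 2 - beta b u(0)].  The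
    discrete states are therefore equicontinuous and converge along an ultrafilter
    of step sizes; [u_t] comes from the Riesz representation of the limit of the
    discrete time increments.  Testing with [eta(t) (Z - z)^+] shows that, for
    almost every [t], [u_z(t, _)] is a primitive of [u_t(t, _)] with the
    prescribed boundary values.

    Uniqueness.  The increments in time of the moments [\int_0^s (z - y)^+ u dy] are
    exact integrals in which only [b], [u(t, 0)] and [u(t, z)] enter, because the
    motion of the front cancels the flux through it.  Let [w(t, z)] be the integral
    of [u(t, _)] over [z, s(t)].  First, [w >= 0], because
    [\int (w^-)^3 / 3 + (w(t, 0)^-)^3 / (3 beta gamma)] does not increase; hence
    [u(t, s(t)) >= 0] and [s_t = a0 u(t, s(t))].  Next,
    [U = \int_0^z (w + 1_{y < s} / a0) dy + w(t, 0) / (beta gamma)] satisfies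
    [U_t = b / gamma - u 1_{z < s}].  For two solutions, integration by parts gives
    [d/dt 1/2 \int (U1 - U2)^2 = - (w1 - w2)(t, 0)^2 / (beta gamma)
      - \int (w1 - w2) (w1 - w2 + (1_{z < s1} - 1_{z < s2}) / a0)],
    and the last integrand is nonnegative since [w1] and [w2] are nonnegative and
    vanish beyond their fronts. *)

Require Import Defs.
From mathcomp Require Import all_boot all_order all_algebra.
From mathcomp Require Import all_classical all_reals all_analysis.
From mathcomp Require Import measurable_realfun.
From mathcomp Require Import ring lra zify.
Import Order.TTheory GRing.Theory Num.Theory.
Import numFieldNormedType.Exports.
Local Open Scope classical_set_scope.
Local Open Scope ring_scope.

Set Implicit Arguments.
Unset Strict Implicit.

(** * Smooth functions *)

Section smooth_functions.
Context {R : realType}.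
Implicit Types (f g : R -> R) (x y : R).

(** Existence. A fixed grid keeps the discrete unknown in one space while the domain moves, and the
    constant extension fills the nodes that the front uncovers without adding any gradient. In the
    energy, [a0 u^3 / 3] absorbs the flux [- a0 u^2] at the front and the terms at [z = 0] absorb
    the Robin flux, so only the variation of [b] has to be paid for. With time step [h^2 / 8] the
    dissipation covers all errors of the explicit step and half of it remains. The hat [(Z - z)^+]
    is used because its second derivative is a point mass: the discrete Laplacian collapses to
    values of [u], which converge uniformly, and no limit of gradients is taken at the boundary.

    Uniqueness. The solutions compared are arbitrary, with no sign given, whereas the law of [U]
    needs the front speed without the truncation [sigma]; hence [w >= 0] comes first. A solution is
    known only through test functions inside the domain and traces at almost every time, so nothing
    is differentiated in time: each law is an identity between increments, and each inequality
    [dE/dt <= 0] becomes a bound of the increments of [E] by arbitrarily small multiples of those of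
    a fixed function. *)

Definition Cinf f := exists2 F : nat -> R -> R,
  F 0%N = f & forall n x, is_derive x 1 (F n) (F n.+1 x).

(** Differentiability of the bump at the points where it vanishes rests on this flatness. *)
Lemma is_derive0_quadratic f x (C : R) : f x = 0 ->
  (forall y, `|f y| <= C * (y - x) ^+ 2) -> is_derive x 1 f 0.
Proof.
move=> fx fC; have C0 : 0 <= C.
  have := fC (x + 1); rewrite [x + 1]addrC addrK expr1n mulr1; exact: le_trans.
have cv : h^-1 *: ((f \o shift x) (h *: (1 : R)) - f x) @[h --> (0:R)^'] --> (0 : R).
  apply/cvgrPdist_le => /= e e0; near=> h.
  rewrite sub0r normrN fx subr0 /= normrZ.
  have h0 : h != 0 by near: h; exact: nbhs_dnbhs_neq.
  have := fC (h *: 1 + x); rewrite addrK -[h *: 1]/(h * 1) mulr1 => fh.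
  apply: (@le_trans _ _ (`|h^-1| * (C * h ^+ 2))); first exact: ler_wpM2l.
  have -> : `|h^-1| * (C * h ^+ 2) = C * `|h|.
    by rewrite -[h ^+ 2]real_normK ?num_real// normfV; field; rewrite normr_eq0.
  apply: (@le_trans _ _ ((C + 1) * `|h|)); first by rewrite ler_wpM2r// lerDl.
  rewrite -ler_pdivlMl; last by rewrite ltr_wpDl.
  near: h; apply: dnbhs0_le; rewrite mulr_gt0// invr_gt0 ltr_wpDl//.
apply: DeriveDef; first by apply/cvg_ex; exists 0.
exact: cvg_lim.
Unshelve. all: by end_near. Qed.

Lemma poly_bounded01 (P : {poly R}) :
  exists2 C : R, 0 <= C & forall y, 0 <= y <= 1 -> `|P.[y]| <= C.
Proof.
elim/poly_ind: P => [|P c [C C0 PC]].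
  by exists 0 => // y _; rewrite horner0 normr0.
exists (C + `|c|); first by rewrite addr_ge0.
move=> y /[dup] y01 /andP[y0 y1]; rewrite hornerMXaddC.
rewrite (le_trans (ler_normD _ _))// lerD2r normrM.
by rewrite -[C]mulr1 ler_pM ?PC// ger0_norm.
Qed.

(* This family is closed under differentiation, which makes its members smooth. *)
Definition bumpf (P : {poly R}) m x : R :=
  if 0 < x < 1 then P.[x] * (x * (1 - x)) ^- m * expR (- (x * (1 - x))^-1)
  else 0.

(** For [x] outside [(0, 1)] one has [v = y (1 - y) <= |y - x|], and
    [v^-m exp (- 1/v) <= (m + 2)! v^2] because the exponential series at [1/v] dominates its term of
    order [m + 2]. The constant is uniform in [x]. *)
Lemma bump_quadratic P m : exists C : R, forall x y, ~~ (0 < x < 1) ->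
  `|bumpf P m y| <= C * (y - x) ^+ 2.
Proof.
have [C C0 PC] := poly_bounded01 P.
exists (C * (m.+2)`!%:R) => x y x01; rewrite /bumpf.
case: ifPn => [/andP[y0 y1]|_]; last first.
  by rewrite normr0 mulr_ge0// ?sqr_ge0// mulr_ge0.
set v := y * (1 - y).
have v0 : 0 < v by rewrite mulr_gt0// subr_gt0.
have vx : v ^+ 2 <= (y - x) ^+ 2.
  suff : v <= `|y - x|.
    by move=> vx; rewrite -[leRHS]real_normK ?num_real// lerXn2r ?nnegrE// ltW.
  move: x01; rewrite negb_and -!leNgt => /orP[x0|x1].
    rewrite ger0_norm; last lra.
    rewrite /v; nra.
  rewrite ler0_norm; last lra.
  rewrite /v; nra.
rewrite !normrM -mulrA (@le_trans _ _ (C * (m.+2)`!%:R * v ^+ 2))//; last first.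
  by rewrite ler_wpM2l// mulr_ge0.
rewrite -!mulrA; apply: ler_pM => //; first by rewrite PC// !ltW.
rewrite [X in X * _]ger0_norm; last by rewrite invr_ge0 exprn_ge0// ltW.
rewrite ger0_norm ?expR_ge0//.
have := expR_ge1Dxn m.+1 (ltW (_ : 0 < v^-1)); rewrite invr_gt0 => /(_ v0) ev.
rewrite expRN; rewrite ler_pdivrMr ?expR_gt0//.
have F0 : 0 < (m.+2)`!%:R :> R by rewrite ltr0n fact_gt0.
apply: (@le_trans _ _ ((m.+2)`!%:R * v ^+ 2 * (v^-1 ^+ m.+2 / (m.+2)`!%:R))).
  rewrite exprVn.
  have -> : (m.+2)`!%:R * v ^+ 2 * (v ^- m.+2 / (m.+2)`!%:R) = v ^+ 2 * v ^- m.+2.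
    by field; rewrite ?gt_eqF// exprn_gt0.
  rewrite -[m.+2]addn2 exprD; have vm : v ^+ m != 0 by rewrite expf_neq0// gt_eqF.
  have v20 : v ^+ 2 != 0 by rewrite expf_neq0// gt_eqF.
  have -> : v ^+ 2 * (v ^+ m * v ^+ 2)^-1 = v ^- m by field; rewrite vm gt_eqF.
  by [].
rewrite ler_wpM2l//; first by rewrite mulr_ge0// ?sqr_ge0.
by apply: le_trans ev; rewrite lerDr.
Qed.

(** With [v = x (1 - x)], the common denominator of the three terms of the product rule is
    [v^(m + 2)], which is why the index grows by two. *)
Lemma bump_derive P m x : is_derive x 1 (bumpf P m)
  (bumpf (P^`() * ('X * (1 - 'X)) ^+ 2
         - m%:R *: (P * (1 - 2%:R *: 'X) * ('X * (1 - 'X)))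
         + P * (1 - 2%:R *: 'X)) m.+2 x).
Proof.
have [x01|x01] := boolP (0 < x < 1); last first.
  have [C bC] := bump_quadratic P m.
  rewrite /bumpf (negbTE x01); apply: (@is_derive0_quadratic _ _ C).
    by rewrite /bumpf (negbTE x01).
  by move=> y; exact: bC.
rewrite {2}/bumpf x01; case/andP: x01 => x0 x1.
pose v y : R := y * (1 - y).
have v0 : 0 < v x by rewrite mulr_gt0// subr_gt0.
have v'0 : v x != 0 by rewrite gt_eqF.
have dv : is_derive x 1 v (1 - 2 * x).
  rewrite /v; apply: is_derive_eq.
  by rewrite /GRing.scale/=; ring.
have dvi : is_derive x 1 (fun y => (v y)^-1) (- (v x) ^- 2 * (1 - 2 * x)).
  by have := is_deriveV v'0 dv; rewrite /GRing.scale/=.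
apply: (@near_eq_is_derive _ _ _ (fun y => P.[y] * (v y)^-1 ^+ m * expR (- (v y)^-1))).
- near=> y; rewrite /bumpf; have -> : 0 < y < 1.
    by apply/andP; split; near: y; [exact: lt_nbhsr|exact: lt_nbhsl].
  by rewrite exprVn.
- have de : is_derive x 1 (fun y => expR (- (v y)^-1))
     (expR (- (v x)^-1) * ((v x) ^- 2 * (1 - 2 * x))).
    have -> : (fun y => expR (- (v y)^-1)) = expR \o (fun y => - (v y)^-1) by [].
    apply: is_derive_eq; rewrite /GRing.scale/=.
    rewrite /GRing.scale/=; ring.
  have -> : (fun y => P.[y] * (v y)^-1 ^+ m * expR (- (v y)^-1)) =
      horner P * (fun y => (v y)^-1) ^+ m * (fun y => expR (- (v y)^-1)).
    by apply/funext => y; rewrite !fctE.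
  apply: (is_derive_eq
    (is_deriveM (is_deriveM (is_derive_poly P x) (is_deriveX m dvi)) de)).
  rewrite !fctE /GRing.scale/= !(hornerE, hornerMn) /= -/(v x).
  have x'0 : x != 0 by rewrite gt_eqF.
  have x''0 : 1 - x != 0 by rewrite gt_eqF// subr_gt0.
  clear dv dvi de; rewrite /v.
  move: (expR _) P.[x] P^`().[x] => e p p'; rewrite -[_ ^- m.+2]exprVn.
  case: m => [|m]. rewrite !expr0. by field; rewrite ?x'0 ?x''0.
  rewrite [m.+1.-1]/= !exprS; set w := (_ ^-1 ^+ m). by field; rewrite ?x'0 ?x''0.
Unshelve. all: by end_near. Qed.

Lemma Cinf_bump P m : Cinf (bumpf P m).
Proof.
pose N (Pm : {poly R} * nat) : {poly R} * nat :=
  (Pm.1^`() * ('X * (1 - 'X)) ^+ 2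
         - Pm.2%:R *: (Pm.1 * (1 - 2%:R *: 'X) * ('X * (1 - 'X)))
         + Pm.1 * (1 - 2%:R *: 'X), Pm.2.+2).
exists (fun n => bumpf (iter n N (P, m)).1 (iter n N (P, m)).2) => //.
by move=> n x; rewrite iterS; exact: bump_derive.
Qed.

Lemma is_derive_affine f (l a b x : R) :
  is_derive (a * x + b) 1 f l -> is_derive x 1 (fun y => f (a * y + b)) (a * l).
Proof.
move=> fl; have -> : (fun y => f (a * y + b)) = f \o (fun y => a * y + b) by [].
have h : is_derive x 1 (fun y => a * y + b) a.
  by apply: is_derive_eq; rewrite /GRing.scale/=; ring.
by apply: is_derive_eq; rewrite /GRing.scale/= mulrC.
Qed.

Lemma Cinf_affine f (a b : R) : Cinf f -> Cinf (fun y => f (a * y + b)).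
Proof.
move=> [F F0 dF]; exists (fun n y => a ^+ n * F n (a * y + b)).
  by apply/funext => y; rewrite expr0 mul1r F0.
move=> n x; have h := is_derive_affine (dF n (a * x + b)).
apply: is_derive_eq; rewrite /GRing.scale/= exprSr; ring.
Qed.

Lemma CinfB f g : Cinf f -> Cinf g -> Cinf (fun y => f y - g y).
Proof.
move=> [F F0 dF] [G G0 dG]; exists (fun n y => F n y - G n y).
  by rewrite F0 G0.
by move=> n x; have := dF n x; have := dG n x => *; exact: is_derive_eq.
Qed.

Lemma Cinf_prim f g : (forall x, is_derive x 1 f (g x)) -> Cinf g -> Cinf f.
Proof.
move=> fg [G G0 dG]; exists (fun n => if n is k.+1 then G k else f) => //.
by move=> [|n] x /=; rewrite ?G0//.
Qed.

Lemma is_derive_continuous f g : (forall x, is_derive x 1 f (g x)) -> continuous f.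
Proof.
move=> fg x; apply/differentiable_continuous/derivable1_diffP.
exact: (@ex_derive _ _ _ _ _ _ _ (fg x)).
Qed.

Lemma Cinf_continuous f : Cinf f -> continuous f.
Proof. by move=> [F <- dF]; exact: is_derive_continuous (dF 0%N). Qed.

(** On the line the derivative in the direction [v] is [v] times the ordinary one, so every iterated
    directional derivative is a multiple of some [F n]. *)
Lemma Cinf_smooth f : Cinf f -> smooth (f : R^o -> R).
Proof.
move=> [F F0 dF] vs /=.
have Cf n : continuous (F n) by exact: is_derive_continuous (dF n).
have D n (c v x : R) : is_derive (x : R^o) (v : R^o) (fun y => c * F n y) (v * c * F n.+1 x).
  have h : is_derive x 1 (fun y => c * F n y) (c * F n.+1 x).
    by have := dF n x => ?; exact: is_derive_eq.
  have /derivable1_diffP hd := @ex_derive _ _ _ _ _ _ _ h.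
  apply: DeriveDef; first exact: diff_derivable.
  rewrite deriveE// -[v]mulr1 -[v * 1]/(v *: (1 : R^o)) linearZ/= -deriveE//.
  by rewrite derive_val /GRing.scale/= mulr1 mulrA.
have : exists n c, foldr (fun (v : R^o) (g : R^o -> R) => 'D_v g) f vs = (fun y => c * F n y).
  elim: vs => [|v vs [n [c IH]]] /=.
    by exists 0%N, 1; rewrite F0; apply/funext => y; rewrite mul1r.
  exists n.+1, (v * c); rewrite IH; apply/funext => x.
  exact: (@derive_val _ _ _ _ _ _ _ (D n c v x)).
move=> [n [c ->]]; split.
  by move=> x; apply: cvgM; [exact: cvg_cst|exact: Cf].
by move=> x v; exact: (@ex_derive _ _ _ _ _ _ _ (D n c v x)).
Qed.

(** The span of the products [F i x * G j y] is stable under directional derivatives. [S] evaluates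
    such a sum, coded by a list of coefficients and orders of derivation, and [N v] differentiates
    one of its terms. *)
Lemma smooth_product f g : Cinf f -> Cinf g ->
  smooth ((fun p => f p.1 * g p.2) : R^o * R^o -> R).
Proof.
move=> [F F0 dF] [G G0 dG] vs /=.
pose V := (R^o * R^o)%type.
have comp (L : {linear V -> R^o}) (h : R -> R) (l : R) (p : V) : continuous L ->
    is_derive (L p) 1 h l -> differentiable (h \o L : V -> R) p /\
    forall v : V, 'd (h \o L : V -> R) p v = L v * l.
  move=> cL hl; have /derivable1_diffP hd := @ex_derive _ _ _ _ _ _ _ hl.
  have dL : differentiable L p by exact: linear_differentiable.
  split; first exact: differentiable_comp.
  move=> v; rewrite diff_comp// /= diff_lin//.
  rewrite -[L v]mulr1 -[L v * 1]/(L v *: (1 : R^o)) linearZ/= -deriveE//.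
  by rewrite (@derive_val _ _ _ _ _ _ _ hl) /GRing.scale/= mulr1.
have dfF n (p : V) : differentiable ((fun p => F n p.1) : V -> R) p /\
    forall v : V, 'd ((fun p => F n p.1) : V -> R) p v = v.1 * F n.+1 p.1.
  by apply: (comp (fst : R^o * R^o -> R^o)) (dF _ _) => q; exact: cvg_fst.
have dfG n (p : V) : differentiable ((fun p => G n p.2) : V -> R) p /\
    forall v : V, 'd ((fun p => G n p.2) : V -> R) p v = v.2 * G n.+1 p.2.
  by apply: (comp (snd : R^o * R^o -> R^o)) (dG _ _) => q; exact: cvg_snd.
pose T (t : R * nat * nat) (p : V) : R := t.1.1 * (F t.1.2 p.1 * G t.2 p.2).
pose S (s : seq (R * nat * nat)) (p : V) := \sum_(t <- s) T t p.
pose N (v : V) (t : R * nat * nat) : seq (R * nat * nat) :=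
  [:: (t.1.1 * v.1, t.1.2.+1, t.2); (t.1.1 * v.2, t.1.2, t.2.+1)].
have DT t (p v : V) : differentiable (T t) p /\ 'D_v (T t) p = S (N v t) p.
  have [d1 e1] := dfF t.1.2 p; have [d2 e2] := dfG t.2 p.
  have e : T t = t.1.1 \*: ((fun p : V => F t.1.2 p.1) * (fun p : V => G t.2 p.2)).
    by apply/funext => q; rewrite /T !fctE.
  have dT : differentiable (T t) p.
    by rewrite e; apply: differentiableZ; exact: differentiableM.
  split => //; rewrite e deriveZ; last first.
    by apply: diff_derivable; exact: differentiableM.
  rewrite deriveM; [|exact: diff_derivable..].
  have := deriveE v d1; rewrite e1 => ->; have := deriveE v d2; rewrite e2 => ->.
  rewrite /S /N /T !big_cons big_nil /GRing.scale/=; ring.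
have DS s (p v : V) : differentiable (S s) p /\ 'D_v (S s) p = S (flatten (map (N v) s)) p.
  elim: s => [|t s [d IH]].
    have -> : S [::] = cst 0 by apply/funext => q; rewrite /S big_nil.
    by split; [exact: differentiable_cst|rewrite derive_cst].
  have [d1 e1] := DT t p v.
  have -> : S (t :: s) = T t + S s.
    by apply/funext => q; rewrite /S big_cons !fctE.
  split; first exact: differentiableD.
  rewrite deriveD; [|exact: diff_derivable..].
  by rewrite e1 IH /S -big_cat.
have : exists s, foldr (fun (v : V) (g : V -> R) => 'D_v g)
    ((fun p => f p.1 * g p.2) : V -> R) vs = S s.
  elim: vs => [|v vs [s IH]] /=.
    exists [:: (1, 0%N, 0%N)]; apply/funext => p.
    by rewrite /S /T big_cons big_nil /= addr0 mul1r F0 G0.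
  exists (flatten (map (N v) s)); rewrite IH; apply/funext => p.
  exact: (DS s p v).2.
move=> [s ->]; split.
  by move=> p; apply: differentiable_continuous; exact: (DS s p 0).1.
by move=> p v; apply: diff_derivable; exact: (DS s p v).1.
Qed.
End smooth_functions.

(** * Integration on intervals *)

Section general_integral.
Context d (T : measurableType d) (R : realType) (mu : {measure set T -> \bar R}).
Implicit Types (f g : T -> R) (D : set T).

Lemma Rintegral_dominated D (f_ : nat -> T -> R) f g : measurable D ->
  (forall n, measurable_fun D (f_ n)) -> measurable_fun D f ->
  {ae mu, forall x, D x -> f_ n x @[n --> \oo] --> f x} ->
  (forall n x, D x -> `|f_ n x| <= g x) ->
  mu.-integrable D (EFin \o g) ->
  (\int[mu]_(x in D) f_ n x) @[n --> \oo] --> \int[mu]_(x in D) f x.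
Proof.
move=> mD mf_ mf cf fg ig.
have [] := @dominated_convergence _ _ _ mu D mD (fun n => EFin \o f_ n) (EFin \o f) (EFin \o g).
- by move=> n; exact/measurable_EFinP.
- exact/measurable_EFinP.
- by move: cf; apply: filterS => x h Dx; apply: cvg_EFin; [exact: nearW|exact: h].
- by [].
- by apply: aeW => x Dx n; rewrite /= lee_fin fg.
by move=> int_f _ h; apply: fine_cvg; rewrite fineK//; exact: integrable_fin_num.
Qed.

Lemma ae_eq_Rintegral D f g : measurable D ->
  measurable_fun D f -> measurable_fun D g ->
  {ae mu, forall x, D x -> f x = g x} ->
  \int[mu]_(x in D) f x = \int[mu]_(x in D) g x.
Proof.
move=> mD mf mg fg; congr fine; apply: ae_eq_integral => //.
- exact/measurable_EFinP.
- exact/measurable_EFinP.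
- by move: fg; apply: filterS => x h Dx; rewrite h.
Qed.

Lemma integrable_le D f g : measurable D -> measurable_fun D f ->
  (forall x, D x -> `|f x| <= g x) -> mu.-integrable D (EFin \o g) ->
  mu.-integrable D (EFin \o f).
Proof.
move=> mD mf fg; apply: le_integrable => //; first exact/measurable_EFinP.
by move=> x Dx; rewrite /= lee_fin (le_trans (fg x Dx))// ler_norm.
Qed.

Lemma integrableRD D f g : measurable D -> mu.-integrable D (EFin \o f) ->
  mu.-integrable D (EFin \o g) -> mu.-integrable D (EFin \o (fun x => f x + g x)).
Proof. by move=> mD fi gi; exact: (integrableD mD fi gi). Qed.

Lemma integrableRB D f g : measurable D -> mu.-integrable D (EFin \o f) ->
  mu.-integrable D (EFin \o g) -> mu.-integrable D (EFin \o (fun x => f x - g x)).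
Proof. by move=> mD fi gi; exact: (integrableB mD fi gi). Qed.

Lemma integrableRZ D f (r : R) : measurable D -> mu.-integrable D (EFin \o f) ->
  mu.-integrable D (EFin \o (fun x => r * f x)).
Proof. by move=> mD fi; exact: (integrableZl mD r fi). Qed.

Lemma ae_mono (P Q : T -> Prop) : (forall x, P x -> Q x) ->
  {ae mu, forall x, P x} -> {ae mu, forall x, Q x}.
Proof. by move=> PQ; apply: filterS. Qed.

Lemma ae_and (P Q : T -> Prop) : {ae mu, forall x, P x} ->
  {ae mu, forall x, Q x} -> {ae mu, forall x, P x /\ Q x}.
Proof. exact: filterI. Qed.

Lemma ae_countable (I : countType) (P : I -> T -> Prop) :
  (forall i, {ae mu, forall x, P i x}) -> {ae mu, forall x, forall i, P i x}.
Proof.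
move=> h; have H : {ae mu, forall x, forall n, if unpickle n is Some i then P i x else True}.
  apply/ae_foralln => n; case: (unpickle n) => [i|]; first exact: h.
  exact: aeW.
by apply: ae_mono H => x Hx i; have := Hx (pickle i); rewrite pickleK.
Qed.

End general_integral.

Section interval_integral.
Context {R : realType}.
Notation leb := (@lebesgue_measure R).
Implicit Types (f g k c : R -> R) (a b p q x : R).

Lemma integrable_within f a b : {within `[a, b], continuous f} ->
  leb.-integrable `[a, b] (EFin \o f).
Proof. by apply: continuous_compact_integrable; exact: segment_compact. Qed.

Lemma integrable_continuous f a b : continuous f ->
  leb.-integrable `[a, b] (EFin \o f).
Proof. by move=> cf; apply: integrable_within; exact: continuous_subspaceT. Qed.

Lemma integrable_itvS f a b p q : a <= p -> q <= b ->
  leb.-integrable `[a, b] (EFin \o f) -> leb.-integrable `[p, q] (EFin \o f).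
Proof.
move=> ap qb; apply: integrableS => // x /=; rewrite !in_itv/= => /andP[px xq].
by rewrite (le_trans ap px) (le_trans xq qb).
Qed.

Lemma Rintegral_split f a (m : R) b : a <= m -> m <= b ->
  leb.-integrable `[a, b] (EFin \o f) ->
  \int[leb]_(x in `[a, b]) f x =
  \int[leb]_(x in `[a, m]) f x + \int[leb]_(x in `[m, b]) f x.
Proof.
move=> ac cb fi; apply/eqP; rewrite addrC -subr_eq; apply/eqP.
have cf : leb.-integrable `]m, b] (EFin \o f).
  apply: integrableS fi => // x /=; rewrite !in_itv/= => /andP[cx ->].
  by rewrite andbT (le_trans ac)// ltW.
rewrite Rintegral_itvB ?bnd_simp//.
by rewrite -[RHS]Rintegral_itv_obnd_cbnd.
Qed.

Lemma Rintegral_itv_cst a b (r : R) : a <= b ->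
  \int[leb]_(x in `[a, b]) r = r * (b - a).
Proof.
move=> ab; rewrite Rintegral_cst//; congr (_ * _).
rewrite /= lebesgue_measure_itv/= lte_fin; case: ltP => //= ba.
by apply/esym/eqP; rewrite subr_eq0 eq_le ab ba. 
Qed.

Lemma Rintegral_itv_bound f a b (M : R) : a <= b ->
  leb.-integrable `[a, b] (EFin \o f) ->
  (forall x, a <= x <= b -> `|f x| <= M) ->
  `|\int[leb]_(x in `[a, b]) f x| <= M * (b - a).
Proof.
move=> ab fi fM; apply: le_trans (le_normr_Rintegral _ fi) _ => //.
rewrite -Rintegral_itv_cst//; apply: le_Rintegral => //.
- exact: integrable_norm.
- by apply: integrable_continuous => x; exact: cvg_cst.
Qed.

Lemma Rintegral_itv_ge0 f a b : (forall x, a <= x <= b -> 0 <= f x) ->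
  0 <= \int[leb]_(x in `[a, b]) f x.
Proof. by move=> f0; apply: Rintegral_ge0 => x /=; rewrite in_itv/=; exact: f0. Qed.

Lemma Rintegral_point f a : \int[leb]_(x in `[a, a]) f x = 0.
Proof. by rewrite set_itv1 Rintegral_set1. Qed.

Lemma Rintegral_FTC2 f g a b : a <= b -> continuous g ->
  (forall x, is_derive x 1 f (g x)) ->
  \int[leb]_(x in `[a, b]) g x = f b - f a.
Proof.
rewrite le_eqVlt => /predU1P[-> _ _|ab cg fg].
  by rewrite Rintegral_point subrr.
have cf : continuous f by exact: is_derive_continuous fg.
rewrite /Rintegral (@continuous_FTC2 _ g f a b)//=.
- exact: continuous_subspaceT.
- split.
  + by move=> x _; exact: (@ex_derive _ _ _ _ _ _ _ (fg x)).
  + exact: cvg_at_right_filter (cf a).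
  + exact: cvg_at_left_filter (cf b).
- by move=> x _; rewrite derive1E (@derive_val _ _ _ _ _ _ _ (fg x)).
Qed.

Lemma is_derive_prim f a x : a < x -> continuous f ->
  is_derive x 1 (fun y => \int[leb]_(t in `[a, y]) f t) (f x).
Proof.
move=> ax cf; have xx1 : x < x + 1 by rewrite ltrDl.
have fi : leb.-integrable `[a, x + 1] (EFin \o f) by exact: integrable_continuous.
have [dF eF] := @continuous_FTC1_closed R f a x (x + 1) xx1 fi ax (cf x).
exact: (DeriveDef dF (etrans (esym (derive1E _ _)) eF)).
Qed.

(** Lebesgue differentiation, applied to the extension of [k] by zero to the whole line. *)
Lemma ae_zero_of_primitive k a b : leb.-integrable `[a, b] (EFin \o k) ->
  (forall x, a <= x <= b -> \int[leb]_(t in `[a, x]) k t = 0) ->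
  {ae leb, forall x, x \in `[a, b] -> k x = 0}.
Proof.
move=> ik k0; pose h := k \_ `[a, b].
have ih : leb.-integrable setT (EFin \o h).
  by have := ik; rewrite integrable_mkcond//= -restrict_EFin.
have lh : locally_integrable setT h.
  by apply: integrable_locally ik => //; exact: measurable_itv.
have hint y : \int[leb]_(t in `]-oo, y]) h t = 0.
  rewrite /h -Rintegral_mkcondr.
  have [ya|ay] := ltP y a.
    rewrite (_ : _ `&` _ = set0) ?Rintegral_set0//.
    apply/seteqP; split => // t /=; rewrite !in_itv/= => -[ty /andP[at_ _]].
    by move: (le_lt_trans (le_trans at_ ty) ya); rewrite ltxx.
  have [yb|yb] := leP y b.
    rewrite (_ : _ `&` _ = `[a, y]%classic); first by rewrite k0// ay yb.
    apply/seteqP; split => t /=; rewrite !in_itv/=.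
      by move=> [-> /andP[-> _]].
    by move=> /andP[-> ty]; rewrite ty (le_trans ty).
  rewrite (_ : _ `&` _ = `[a, b]%classic).
    have [ab|ba] := leP a b; first by rewrite k0// ab lexx.
    by rewrite set_itv_ge ?Rintegral_set0// bnd_simp -ltNge.
  apply/seteqP; split => t /=; rewrite !in_itv/=; first by move=> [].
  by move=> /andP[-> tb]; rewrite tb (le_trans tb)// ltW.
have ihy y : leb.-integrable `]-oo, y] (EFin \o h) by apply: integrableS ih.
have /= H := @FTC1Ny R h ihy lh; apply: ae_mono H => x [_ hx] xab.
have <- : h x = k x by rewrite /h patchE mem_setE xab.
rewrite -hx (_ : (fun _ => _) = cst 0) ?derive1_cst//.
by apply/funext => y; exact: hint.
Qed.

End interval_integral.

(** * Mollifiers *)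

Section plateau.
Context {R : realType}.
Notation leb := (@lebesgue_measure R).
Implicit Types (f g k c : R -> R) (a b p q x : R) (n : nat).

(** The base point is [-1] and not [0], so that every [x >= 0] lies strictly to its right when the
    primitive is differentiated. *)
Definition step_mass : R := \int[leb]_(t in `[-1, 1]) bumpf 1 0 t.
Definition step x : R := (\int[leb]_(t in `[-1, x]) bumpf 1 0 t) / step_mass.
Definition dstep x : R := bumpf 1 0 x / step_mass.

Lemma bump1_ge0 x : 0 <= bumpf 1 0 x :> R.
Proof.
rewrite /bumpf; case: ifPn => // _.
by rewrite hornerE expr0 invr1 !mul1r expR_ge0.
Qed.

Lemma bump1_out x : (x <= 0) || (1 <= x) -> bumpf 1 0 x = 0 :> R.
Proof.
rewrite /bumpf; case: ifPn => // /andP[x0 x1].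
by rewrite !leNgt x0 x1.
Qed.

Lemma continuous_bump (P : {poly R}) m : continuous (bumpf P m).
Proof. exact/Cinf_continuous/Cinf_bump. Qed.

Lemma int_bump_le0 x : x <= 0 -> \int[leb]_(t in `[-1, x]) bumpf 1 0 t = 0.
Proof.
move=> x0; rewrite (@eq_Rintegral _ _ _ _ _ (cst 0)).
  by rewrite Rintegral_cst// mul0r.
move=> t; rewrite inE/= in_itv/= => /andP[_ tx].
by rewrite bump1_out// (le_trans tx).
Qed.

Lemma int_bump_ge1 x : 1 <= x -> \int[leb]_(t in `[-1, x]) bumpf 1 0 t = step_mass.
Proof.
move=> x1; have m11 : -1 <= 1 :> R by lra.
rewrite (Rintegral_split m11 x1); last exact/integrable_continuous/continuous_bump.
rewrite [X in _ + X](@eq_Rintegral _ _ _ _ _ (cst 0)).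
  by rewrite Rintegral_cst// mul0r addr0.
move=> t; rewrite inE/= in_itv/= => /andP[tx _].
by rewrite bump1_out// tx orbT.
Qed.

Lemma is_derive_int_bump x :
  is_derive x 1 (fun y => \int[leb]_(t in `[-1, y]) bumpf 1 0 t) (bumpf 1 0 x).
Proof.
have [x0|x0] := ltP x 0; last first.
  by apply: is_derive_prim; [lra|exact: continuous_bump].
rewrite bump1_out; last by rewrite ltW.
apply: (@near_eq_is_derive _ _ _ (cst 0)).
  near=> y; rewrite int_bump_le0// ltW//.
  by near: y; exact: lt_nbhsl.
Unshelve. all: by end_near. Qed.

Lemma step_mass_gt0 : 0 < step_mass.
Proof.
pose F (y : R) := \int[leb]_(t in `[-1, y]) bumpf 1 0 t.
have [|||c] := @MVT R F (bumpf 1 0) 0 1.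
- exact: ltr01.
- by move=> x _; exact: is_derive_int_bump.
- apply: continuous_subspaceT; apply: is_derive_continuous => x.
  exact: is_derive_int_bump.
rewrite in_itv/= => c01; have -> : F 0 = 0 by exact: int_bump_le0.
rewrite -[F 1]/step_mass !subr0 mulr1 => ->.
by rewrite /bumpf c01 hornerE expr0 invr1 !mul1r expR_gt0.
Qed.

Lemma is_derive_step x : is_derive x 1 step (dstep x).
Proof.
have := is_derive_int_bump x => h.
rewrite (_ : step = fun y => step_mass^-1 * \int[leb]_(t in `[-1, y]) bumpf 1 0 t).
  by apply: is_derive_eq; rewrite /GRing.scale/= mulrC.
by apply/funext => y; rewrite mulrC.
Qed.

Lemma Cinf_step : Cinf step.
Proof.
apply: Cinf_prim is_derive_step _.
rewrite (_ : dstep = fun y => step_mass^-1 * bumpf 1 0 y); last first.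
  by apply/funext => y; rewrite mulrC.
have [F F0 dF] := @Cinf_bump R 1 0.
exists (fun n y => step_mass^-1 * F n y); first by rewrite F0.
by move=> n x; have := dF n x => h; exact: is_derive_eq.
Qed.

Lemma dstep_ge0 x : 0 <= dstep x.
Proof. by rewrite divr_ge0 ?bump1_ge0// ltW// step_mass_gt0. Qed.

Lemma dstep_out x : (x <= 0) || (1 <= x) -> dstep x = 0.
Proof. by move=> h; rewrite /dstep bump1_out// mul0r. Qed.

Lemma continuous_dstep : continuous dstep.
Proof. by move=> x; apply: cvgM; [exact: continuous_bump|exact: cvg_cst]. Qed.

Lemma step_le0 x : x <= 0 -> step x = 0.
Proof. by move=> x0; rewrite /step int_bump_le0// mul0r. Qed.

Lemma step_ge1 x : 1 <= x -> step x = 1.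
Proof. by move=> x1; rewrite /step int_bump_ge1// divff// gt_eqF// step_mass_gt0. Qed.

Lemma step_le x y : x <= y -> step x <= step y.
Proof.
move=> xy; have E := Rintegral_FTC2 xy continuous_dstep is_derive_step.
by rewrite -subr_ge0 -E; apply: Rintegral_ge0 => t _; exact: dstep_ge0.
Qed.

Lemma step_itv x : 0 <= step x <= 1.
Proof.
apply/andP; split.
  have [x0|x0] := leP x 0; first by rewrite step_le0.
  by rewrite -(@step_le0 0)// step_le// ltW.
have [x1|x1] := leP 1 x; first by rewrite step_ge1.
by rewrite -(@step_ge1 1)// step_le// ltW.
Qed.

(** With [k] the slope, [plat] climbs from 0 to 1 on [[p + 1/k, p + 2/k]] and descends on
    [[q - 2/k, q - 1/k]]. The margins [1/k] give it compact support in []p, q[], and the factor 4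
    keeps the two ramps apart. *)
Definition slope p q n : R := n.+1%:R * (4 / (q - p)).
Definition plat p q n x : R :=
  step (slope p q n * x + (- slope p q n * p - 1)) -
  step (slope p q n * x + (2 - slope p q n * q)).
Definition dplat1 p q n x : R :=
  slope p q n * dstep (slope p q n * x + (- slope p q n * p - 1)).
Definition dplat2 p q n x : R :=
  slope p q n * dstep (slope p q n * x + (2 - slope p q n * q)).

Section plateau_properties.
Variables (p q : R) (n : nat).
Hypothesis pq : p < q.
Let k := slope p q n.

Lemma slope_gt0 : 0 < k.
Proof. by rewrite mulr_gt0// divr_gt0// subr_gt0. Qed.

Lemma slope_ge4 : 4 <= k * (q - p).
Proof.
rewrite /k /slope -mulrA divfK ?gt_eqF ?subr_gt0//.
by rewrite ler_peMl// ler1n.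
Qed.

Lemma Cinf_plat : Cinf (plat p q n).
Proof. by apply: CinfB; apply: Cinf_affine; exact: Cinf_step. Qed.

Lemma is_derive_plat x :
  is_derive x 1 (plat p q n) (dplat1 p q n x - dplat2 p q n x).
Proof.
have := @is_derive_affine R step _ _ _ x (is_derive_step (k * x + (- k * p - 1))) => h1.
have := @is_derive_affine R step _ _ _ x (is_derive_step (k * x + (2 - k * q))) => h2.
exact: is_derive_eq.
Qed.

Lemma plat_itv x : 0 <= plat p q n x <= 1.
Proof.
have k4 := slope_ge4; have k0 := slope_gt0.
rewrite /plat subr_ge0 step_le /=; last by rewrite -/k; lra.
have /andP[_ s1] := step_itv (k * x + (- k * p - 1)).
have /andP[s2 _] := step_itv (k * x + (2 - k * q)).
by rewrite -/k; lra.
Qed.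

Lemma plat_out x : (x <= p + k^-1) || (q - k^-1 <= x) -> plat p q n x = 0.
Proof.
have k4 := slope_ge4; have k0 := slope_gt0.
have kk : k * k^-1 = 1 by rewrite divff// gt_eqF.
move=> /orP[xp|qx]; rewrite /plat -/k.
  have h : k * x <= k * (p + k^-1) by rewrite ler_pM2l.
  rewrite mulrDr kk in h.
  by rewrite !step_le0 ?subrr//; lra.
have h : k * (q - k^-1) <= k * x by rewrite ler_pM2l.
rewrite mulrBr kk in h.
by rewrite !step_ge1 ?subrr//; lra.
Qed.

Lemma plat_in x : p + 2 / k <= x <= q - 2 / k -> plat p q n x = 1.
Proof.
have k4 := slope_ge4; have k0 := slope_gt0.
have kk : k * (2 / k) = 2 by rewrite mulrCA divff ?mulr1// gt_eqF.
move=> /andP[xp qx]; rewrite /plat -/k.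
have h : k * (p + 2 / k) <= k * x by rewrite ler_pM2l.
rewrite mulrDr kk in h.
have h' : k * x <= k * (q - 2 / k) by rewrite ler_pM2l.
rewrite mulrBr kk in h'.
by rewrite step_ge1 ?step_le0 ?subr0//; lra.
Qed.

Lemma dplat1_ge0 x : 0 <= dplat1 p q n x.
Proof. by rewrite mulr_ge0 ?dstep_ge0// ltW// slope_gt0. Qed.

Lemma dplat2_ge0 x : 0 <= dplat2 p q n x.
Proof. by rewrite mulr_ge0 ?dstep_ge0// ltW// slope_gt0. Qed.

Lemma dplat1_out x : p + 2 / k <= x -> dplat1 p q n x = 0.
Proof.
have k0 := slope_gt0.
have kk : k * (2 / k) = 2 by rewrite mulrCA divff ?mulr1// gt_eqF.
move=> h; have {}h : k * (p + 2 / k) <= k * x by rewrite ler_pM2l.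
rewrite mulrDr kk in h.
rewrite /dplat1 dstep_out ?mulr0// -/k; apply/orP; right; lra.
Qed.

Lemma dplat2_out x : x <= q - 2 / k -> dplat2 p q n x = 0.
Proof.
have k0 := slope_gt0.
have kk : k * (2 / k) = 2 by rewrite mulrCA divff ?mulr1// gt_eqF.
move=> h; have {}h : k * x <= k * (q - 2 / k) by rewrite ler_pM2l.
rewrite mulrBr kk in h.
rewrite /dplat2 dstep_out ?mulr0// -/k; apply/orP; left; lra.
Qed.

Lemma continuous_affine_dstep (c d : R) : continuous (fun x => k * dstep (c * x + d)).
Proof.
move=> x; apply: cvgM; first exact: cvg_cst.
apply: (@continuous_comp _ _ _ (fun y => c * y + d)); last exact: continuous_dstep.
by apply: cvgD; [apply: cvgM; [exact: cvg_cst|exact: cvg_id]|exact: cvg_cst].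
Qed.

Lemma continuous_dplat1 : continuous (dplat1 p q n).
Proof. exact: continuous_affine_dstep. Qed.

Lemma continuous_dplat2 : continuous (dplat2 p q n).
Proof. exact: continuous_affine_dstep. Qed.

Lemma int_dplat1 : \int[leb]_(x in `[p, q]) dplat1 p q n x = 1.
Proof.
have k4 := slope_ge4; have k0 := slope_gt0.
have d x : is_derive x 1 (fun y => step (k * y + (- k * p - 1))) (dplat1 p q n x).
  exact/is_derive_affine/is_derive_step.
rewrite (Rintegral_FTC2 (ltW pq) continuous_dplat1 d).
by rewrite step_ge1 ?step_le0 ?subr0//; lra.
Qed.

Lemma int_dplat2 : \int[leb]_(x in `[p, q]) dplat2 p q n x = 1.
Proof.
have k4 := slope_ge4; have k0 := slope_gt0.
have d x : is_derive x 1 (fun y => step (k * y + (2 - k * q))) (dplat2 p q n x).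
  exact/is_derive_affine/is_derive_step.
rewrite (Rintegral_FTC2 (ltW pq) continuous_dplat2 d).
by rewrite step_ge1 ?step_le0 ?subr0//; lra.
Qed.

End plateau_properties.

Lemma near_slope p q (e : R) : p < q -> 0 < e ->
  \forall n \near \oo, 2 / slope p q n < e.
Proof.
move=> pq e0; near=> n.
have k0 := slope_gt0 n pq.
rewrite ltr_pdivrMr// /slope mulrCA -ltr_pdivrMr; last first.
  by rewrite mulr_gt0// divr_gt0// subr_gt0.
apply: (@lt_trans _ _ n%:R); last by rewrite ltr_nat.
by near: n; exact: nbhs_infty_gtr.
Unshelve. all: by end_near. Qed.

Lemma plat_cvg p q x : p < x < q -> plat p q n x @[n --> \oo] --> (1 : R).
Proof.
move=> /andP[px xq]; have pq := lt_trans px xq.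
apply: cvg_near_cst; near=> n.
have h1 : 2 / slope p q n < x - p.
  by near: n; apply: near_slope => //; rewrite subr_gt0.
have h2 : 2 / slope p q n < q - x.
  by near: n; apply: near_slope => //; rewrite subr_gt0.
by apply: plat_in => //; apply/andP; split; lra.
Unshelve. all: by end_near. Qed.

End plateau.

(** * Weak derivatives and increments on an interval *)

Section increments.
Context {R : realType}.
Notation leb := (@lebesgue_measure R).
Implicit Types (f g k c : R -> R) (a b p q x : R) (n : nat).

Lemma integrable_itvM g f a b : leb.-integrable `[a, b] (EFin \o g) ->
  {within `[a, b], continuous f} ->
  leb.-integrable `[a, b] (EFin \o (fun x => g x * f x)).
Proof.
move=> ig cf.
have := @integrableMl _ _ R leb `[a, b] _ (EFin \o g) f ig.
apply => //.
- exact: subspace_continuous_measurable_fun.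
- have /compact_bounded[M [_ mrt]] := continuous_compact cf (@segment_compact R a b).
  by exists M; split; rewrite ?num_real // => y My x xab; apply: (mrt _ My); exists x.
Qed.

Lemma integrable_itvMc g f a b : leb.-integrable `[a, b] (EFin \o g) ->
  continuous f -> leb.-integrable `[a, b] (EFin \o (fun x => g x * f x)).
Proof. by move=> ig cf; apply: integrable_itvM => //; exact: continuous_subspaceT. Qed.

(** [r] is a probability density, and [c] is constrained only where [r] is nonzero; this lets the
    densities concentrate at an end point of [[p, q]]. *)
Lemma mollify c (r : R -> R) p q (l e : R) : p <= q -> 0 <= e ->
  {within `[p, q], continuous c} -> continuous r -> (forall x, 0 <= r x) ->
  \int[leb]_(x in `[p, q]) r x = 1 ->
  (forall x, p <= x <= q -> r x != 0 -> `|c x - l| <= e) ->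
  `|\int[leb]_(x in `[p, q]) (c x * r x) - l| <= e.
Proof.
move=> pq e0 cc cr r0 r1 hc.
have ir := integrable_continuous p q cr.
have icr : leb.-integrable `[p, q] (EFin \o (fun x => c x * r x)).
  by apply: integrable_itvMc cr; exact: integrable_within.
have ilr : leb.-integrable `[p, q] (EFin \o (fun x => l * r x)).
  by apply: integrable_continuous => x; apply: cvgM; [exact: cvg_cst|exact: cr].
have ier : leb.-integrable `[p, q] (EFin \o (fun x => e * r x)).
  by apply: integrable_continuous => x; apply: cvgM; [exact: cvg_cst|exact: cr].
have -> : l = \int[leb]_(x in `[p, q]) (l * r x) by rewrite RintegralZl// r1 mulr1.
rewrite -RintegralB//.
have -> : e = \int[leb]_(x in `[p, q]) (e * r x) by rewrite RintegralZl// r1 mulr1.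
have iB : leb.-integrable `[p, q] (EFin \o (fun x => c x * r x - l * r x)).
  exact: integrableRB.
apply: le_trans (le_normr_Rintegral _ iB) _ => //.
apply: le_Rintegral => //; first exact: integrable_norm.
move=> x /=; rewrite in_itv/= => xpq.
rewrite -mulrBl normrM (ger0_norm (r0 x)).
have [->|rx] := eqVneq (r x) 0; first by rewrite !mulr0.
by rewrite ler_wpM2r// hc.
Qed.

Section core.
Variables (p q : R).
Hypothesis pq : p < q.

Lemma cvg_int_dplat1 c : {within `[p, q], continuous c} ->
  \int[leb]_(x in `[p, q]) (c x * dplat1 p q n x) @[n --> \oo] --> c p.
Proof.
move=> cc; have [_ cp _] := (continuous_within_itvP c pq).1 cc.
apply/cvgrPdist_le => e e0.
move/cvgrPdist_le : cp => /(_ e e0)[d /= d0 hd].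
near=> n; rewrite distrC; apply: mollify => //.
- exact: ltW.
- exact: ltW.
- exact: continuous_dplat1.
- by move=> x; exact: dplat1_ge0.
- exact: int_dplat1.
move=> x /andP[]; rewrite le_eqVlt => /predU1P[<- _ _|px xq dx].
  by rewrite subrr normr0 ltW.
rewrite distrC; apply: hd => //=.
rewrite distrC ger0_norm ?subr_ge0 ?(ltW px)//.
have : 2 / slope p q n < d by near: n; exact: near_slope.
have : x < p + 2 / slope p q n.
  by rewrite ltNge; apply: contra dx => /(dplat1_out pq) ->.
by lra.
Unshelve. all: by end_near. Qed.

Lemma cvg_int_dplat2 c : {within `[p, q], continuous c} ->
  \int[leb]_(x in `[p, q]) (c x * dplat2 p q n x) @[n --> \oo] --> c q.
Proof.
move=> cc; have [_ _ cq] := (continuous_within_itvP c pq).1 cc.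
apply/cvgrPdist_le => e e0.
move/cvgrPdist_le : cq => /(_ e e0)[d /= d0 hd].
near=> n; rewrite distrC; apply: mollify => //.
- exact: ltW.
- exact: ltW.
- exact: continuous_dplat2.
- by move=> x; exact: dplat2_ge0.
- exact: int_dplat2.
move=> x /andP[px]; rewrite le_eqVlt => /predU1P[-> _|xq dx].
  by rewrite subrr normr0 ltW.
rewrite distrC; apply: hd => //=.
rewrite ger0_norm ?subr_ge0 ?(ltW xq)//.
have : 2 / slope p q n < d by near: n; exact: near_slope.
have : q - 2 / slope p q n < x.
  by rewrite ltNge; apply: contra dx => /(dplat2_out pq) ->.
by lra.
Unshelve. all: by end_near. Qed.

Lemma cvg_int_plat g : leb.-integrable `[p, q] (EFin \o g) ->
  \int[leb]_(x in `[p, q]) (g x * plat p q n x) @[n --> \oo] -->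
  \int[leb]_(x in `[p, q]) g x.
Proof.
move=> ig; have mg : measurable_fun `[p, q] g.
  by apply/measurable_EFinP; exact: measurable_int ig.
apply: (@Rintegral_dominated _ _ _ leb `[p, q]%classic
  (fun n x => g x * plat p q n x) g (fun x => `|g x|)) => //.
- move=> n; have := integrable_itvMc ig (Cinf_continuous (Cinf_plat p q n)).
  by move=> /(measurable_int leb) /measurable_EFinP.
- have nz : forall z : R, {ae leb, forall x, x != z}.
    move=> z; exists [set z]; split => //; first exact: lebesgue_measure_set1.
    by move=> x /= /negP; rewrite negbK => /eqP.
  apply: ae_mono (ae_and (nz p) (nz q)) => x /= [xp xq].
  rewrite in_itv/= => /andP[px xq'].
  rewrite -[X in _ --> X]mulr1; apply: cvgM; first exact: cvg_cst.
  by apply: plat_cvg; rewrite lt_neqAle eq_sym xp px lt_neqAle xq.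
- move=> n x _ /=; rewrite normrM ler_piMr//.
  by have /andP[h0 h1] := plat_itv n pq x; rewrite ger0_norm.
- exact: integrable_norm.
Qed.

(** The derivative of a plateau is the difference of two densities that concentrate at [p] and at
    [q], while the plateau tends to the indicator of the interval. Plateaus alone thus recover the
    increment. *)
Lemma increment_of_plateaux c g : {within `[p, q], continuous c} ->
  leb.-integrable `[p, q] (EFin \o g) ->
  (forall n, \int[leb]_(x in `[p, q]) (c x * (dplat1 p q n x - dplat2 p q n x)) =
    - \int[leb]_(x in `[p, q]) (g x * plat p q n x)) ->
  c q - c p = \int[leb]_(x in `[p, q]) g x.
Proof.
move=> cc ig h; have ic := integrable_within cc.
have E n : \int[leb]_(x in `[p, q]) (c x * (dplat1 p q n x - dplat2 p q n x)) =
    \int[leb]_(x in `[p, q]) (c x * dplat1 p q n x) -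
    \int[leb]_(x in `[p, q]) (c x * dplat2 p q n x).
  rewrite -RintegralB//.
  - by apply: eq_Rintegral => x _; rewrite mulrBr.
  - by apply: integrable_itvMc ic _; exact: continuous_dplat1.
  - by apply: integrable_itvMc ic _; exact: continuous_dplat2.
pose A n := \int[leb]_(x in `[p, q]) (c x * (dplat1 p q n x - dplat2 p q n x)).
have c1 : A @ \oo --> - \int[leb]_(x in `[p, q]) g x.
  rewrite (_ : A = - (fun n => \int[leb]_(x in `[p, q]) (g x * plat p q n x))).
    by apply: cvgN; exact: cvg_int_plat.
  by apply/funext => n; exact: h.
have c2 : A @ \oo --> c p - c q.
  rewrite (_ : A = (fun n => \int[leb]_(x in `[p, q]) (c x * dplat1 p q n x)) -
    (fun n => \int[leb]_(x in `[p, q]) (c x * dplat2 p q n x))).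
    by apply: cvgB; [exact: cvg_int_dplat1|exact: cvg_int_dplat2].
  by apply/funext => n; exact: E.
have e := cvg_unique (@norm_hausdorff _ _) c1 c2.
by rewrite -[RHS]opprK e opprB.
Qed.

End core.

Lemma dplat_out p q n x : p < q -> (x <= p) || (q <= x) ->
  dplat1 p q n x - dplat2 p q n x = 0.
Proof.
move=> pq xpq.
have k0 := slope_gt0 n pq; have k4 := slope_ge4 n pq.
set k := slope p q n in k0 k4 *.
rewrite /dplat1 /dplat2 -/k !dstep_out ?mulr0 ?subrr//.
  by case/orP: xpq => h; apply/orP; [left|right]; nra.
by case/orP: xpq => h; apply/orP; [left|right]; nra.
Qed.

Definition in_open_support a b (phi : R -> R) :=
  exists p q, [/\ a < p, q < b & forall x, ~~ (p <= x <= q) -> phi x = 0].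

Lemma plat_support p q n a b : p < q -> a <= p -> q <= b ->
  in_open_support a b (plat p q n).
Proof.
move=> pq ap qb; have k0 := slope_gt0 n pq.
have i0 : 0 < (slope p q n)^-1 by rewrite invr_gt0.
exists (p + (slope p q n)^-1), (q - (slope p q n)^-1); split; [lra|lra|].
move=> x; rewrite negb_and -!ltNge => h; apply: plat_out => //.
by case/orP: h => h; apply/orP; [left|right]; exact: ltW.
Qed.

(** Plateaus on [[a, x]] tend to its indicator, so every primitive of [k] from [a] vanishes. *)
Lemma du_bois_reymond k a b : leb.-integrable `[a, b] (EFin \o k) ->
  (forall phi, Cinf phi -> in_open_support a b phi ->
    \int[leb]_(x in `[a, b]) (k x * phi x) = 0) ->
  {ae leb, forall x, x \in `[a, b] -> k x = 0}.
Proof.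
move=> ik k0; apply: ae_zero_of_primitive => // x /andP[].
rewrite le_eqVlt => /predU1P[<- _|ax xb]; first exact: Rintegral_point.
have ikx : leb.-integrable `[a, x] (EFin \o k) by exact: integrable_itvS ik.
have z n : \int[leb]_(t in `[a, x]) (k t * plat a x n t) = 0.
  have cp : continuous (plat a x n) by exact/Cinf_continuous/Cinf_plat.
  have := k0 _ (Cinf_plat a x n) (plat_support n ax (lexx a) xb).
  rewrite (Rintegral_split (ltW ax) xb); last exact: integrable_itvMc.
  rewrite [X in _ + X](@eq_Rintegral _ _ _ _ _ (cst 0)).
    by rewrite Rintegral_cst// mul0r addr0.
  move=> t; rewrite inE/= in_itv/= => /andP[xt _].
  rewrite plat_out ?mulr0//; apply/orP; right; rewrite (le_trans _ xt)// gerBl.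
  by rewrite invr_ge0 ltW// slope_gt0.
have := cvg_int_plat ax ikx; under eq_fun do rewrite z.
move=> c1; exact: (cvg_unique (@norm_hausdorff _ _) c1 (cvg_cst 0)).
Qed.

Lemma test_function_Cinf (phi : R -> R) a b : Cinf phi -> in_open_support a b phi ->
  test_function (`]a, b[ : set R) phi.
Proof.
move=> cphi [p [q [ap qb h]]]; split; first exact: Cinf_smooth.
exists `[p, q]%classic; split.
- exact: segment_compact.
- move=> x /=; rewrite !in_itv/= => /andP[px xq].
  by rewrite (lt_le_trans ap px) (le_lt_trans xq qb).
- by move=> x /= xpq; apply: h; apply/negP => xpq'; apply: xpq; rewrite in_itv.
Qed.

(** Plateaus on [[p, q]] have compact support in []p, q[], so they are admissible even when [p = a]
    or [q = b]; the continuity of [f] makes the identity exact for all [p] and [q]. *)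
Lemma increment_of_weak_derivative f g a b : {within `[a, b], continuous f} ->
  leb.-integrable `[a, b] (EFin \o g) -> weak_derivative1 `]a, b[ f g ->
  forall p q, a <= p -> p <= q -> q <= b ->
    f q - f p = \int[leb]_(x in `[p, q]) g x.
Proof.
move=> cf ig wd p q ap pq qb; move: pq.
rewrite le_eqVlt => /predU1P[<-|pq]; first by rewrite Rintegral_point subrr.
have cfpq : {within `[p, q], continuous f}.
  by apply: continuous_subspaceW cf; exact: subset_itv.
have igpq := integrable_itvS ap qb ig.
apply: increment_of_plateaux => // n.
have tf := test_function_Cinf (Cinf_plat p q n) (plat_support n pq ap qb).
have := wd _ tf.
have cd : continuous (fun x => dplat1 p q n x - dplat2 p q n x).
  by move=> x; apply: cvgB; [exact: continuous_dplat1|exact: continuous_dplat2].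
have cp : continuous (plat p q n) by exact/Cinf_continuous/Cinf_plat.
have ab : a < b by exact: le_lt_trans ap (lt_le_trans pq qb).
have restr (h1 h2 : R -> R) : leb.-integrable `[a, b] (EFin \o h1) ->
    (forall x, (x <= p) || (q <= x) -> h1 x = 0) -> (forall x, h1 x = h2 x) ->
    (\int[leb]_(x in `]a, b[) (h2 x)%:E = (\int[leb]_(x in `[p, q]) h1 x)%:E)%E.
  move=> i1 z e.
  have i1pq := integrable_itvS ap qb i1.
  have -> : (\int[leb]_(x in `]a, b[) (h2 x)%:E = \int[leb]_(x in `]a, b[) (h1 x)%:E)%E.
    by apply: eq_integral => x _; rewrite e.
  rewrite -(@integral_itv_bndoo _ _ _ _ true false); last first.
    apply: measurable_funS (measurable_int leb i1) => //.
    exact: subset_itv_oo_cc.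
  rewrite -[LHS]fineK; last exact: integrable_fin_num.
  congr EFin; rewrite -/(Rintegral _ _ _).
  have aq : a <= q by lra.
  rewrite (Rintegral_split aq qb)// (Rintegral_split ap (ltW pq)); last first.
    exact: integrable_itvS i1.
  rewrite [X in X + _ + _](@eq_Rintegral _ _ _ _ _ (cst 0)); last first.
    by move=> t; rewrite inE/= in_itv/= => /andP[_ tx]; rewrite z// tx.
  rewrite [X in _ + _ + X](@eq_Rintegral _ _ _ _ _ (cst 0)); last first.
    by move=> t; rewrite inE/= in_itv/= => /andP[tx _]; rewrite z// tx orbT.
  by rewrite !Rintegral_cst// !mul0r add0r addr0.
rewrite (restr (fun x => f x * (dplat1 p q n x - dplat2 p q n x))).
- rewrite (restr (fun x => g x * plat p q n x)) => [[]|||] //.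
  + exact: integrable_itvMc.
  + move=> x h; rewrite plat_out ?mulr0//.
    have i0 : 0 < (slope p q n)^-1 by rewrite invr_gt0 slope_gt0.
    by case/orP: h => h; apply/orP; [left|right]; lra.
- exact/integrable_itvMc/cd/integrable_within.
- by move=> x h; rewrite dplat_out ?mulr0.
- move=> x; rewrite derive1E.
  by rewrite (@derive_val _ _ _ _ _ _ _ (is_derive_plat p q n x)).
Qed.

End increments.

(** * The difference scheme *)

Section finite_sums.
Context {R : realFieldType}.
Implicit Types (x y : nat -> R) (n : nat).

Lemma sqr_sum_le x n : (\sum_(i < n) x i) ^+ 2 <= n%:R * \sum_(i < n) x i ^+ 2.
Proof.
elim: n => [|n IH]; first by rewrite !big_ord0 mul0r expr0n.
rewrite !big_ord_recr /= sqrrD -natr1 mulrDl mul1r.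
set S := \sum_(i < n) x i; set Q := \sum_(i < n) x i ^+ 2.
rewrite -/S -/Q in IH.
have Q0 : 0 <= Q by apply: sumr_ge0 => i _; exact: sqr_ge0.
suff : S * x n *+ 2 <= Q + n%:R * x n ^+ 2 by rewrite mulrDr; lra.
have [n0|n0] := eqVneq n 0%N; first by rewrite {1}/S n0 big_ord0 !mul0r mul0rn addr0.
have n0' : 0 < n%:R :> R by rewrite ltr0n lt0n.
have h : 0 <= (S - n%:R * x n) ^+ 2 by exact: sqr_ge0.
rewrite -(ler_pM2l n0'); move: IH h; rewrite !expr2 -mulr_natr; lra.
Qed.

(** [F] is the flux to the right of a node and [G] the flux to its left; [r] is the flux to the
    right of the last node, where a boundary condition prescribes it. *)
Lemma summation_by_parts (d F G : nat -> R) (r : R) n :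
  (forall j, G j.+1 = F j) ->
  \sum_(j < n) d j * (F j - G j) + d n * (r - G n) =
  d n * r - d 0%N * G 0%N - \sum_(j < n) F j * (d j.+1 - d j).
Proof.
move=> GF; elim: n r => [|n IH] r; first by rewrite !big_ord0; ring.
rewrite !big_ord_recr /= GF; have := IH (F n); lra.
Qed.

Lemma exists_le_sum x n (c : R) : \sum_(i < n.+1) x i <= c ->
  exists2 i : nat, (i <= n)%N & x i * n.+1%:R <= c.
Proof.
move=> h; apply: contrapT => /forall2NP hn.
suff : c < \sum_(i < n.+1) x i by rewrite ltNge h.
apply: (@le_lt_trans _ _ (\sum_(i < n.+1) c / n.+1%:R)).
  by rewrite sumr_const card_ord -[leRHS]mulr_natr divfK// pnatr_eq0.
apply: ltr_sum; first by apply/hasP; exists ord0 => //; rewrite mem_index_enum.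
move=> i _; rewrite ltr_pdivrMr// ltNge; apply/negP => hi.
by have [/(_ (ltn_ord i))|/(_ hi)] := hn i.
Qed.

(** One energy step with its sums replaced by letters: [x] and [y] are the values at the front and
    at 0, [d] and [e] their increments, [D] the dissipation, [P] the cross term of the gradients,
    [W] the squared increments of the gradient. Of the loss [8 D], the term [W / 2] takes back at
    most [2 D] and the Taylor remainders of the boundary terms at most [2 D]. *)
Lemma energy_algebra (h a0 beta gamma M x d y e b1 b2 D P W c E0 : R) :
  8 * D = - (h * a0 * x ^+ 2 * d) + h * beta * (b1 - gamma * y) * e - P ->
  W <= 4 * D ->
  h * beta * gamma * e ^+ 2 <= h * beta * gamma * D ->
  h * a0 * M * D + h * beta * gamma * D <= 2 * D ->
  0 <= h * beta * gamma * D ->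
  0 <= h * a0 * M * D ->
  h * a0 * (d ^+ 2 * ((2 * x + (x + d)) / 3)) <= h * a0 * M * D ->
  - (h * beta * (y + e) * (b2 - b1)) <= h * beta * M * c ->
  (E0 + 2 * P + W) / 2 + h * (a0 * (x + d) ^+ 3 / 3 +
    beta * gamma / 2 * (y + e) ^+ 2 - beta * b2 * (y + e)) <=
  E0 / 2 + h * (a0 * x ^+ 3 / 3 + beta * gamma / 2 * y ^+ 2 - beta * b1 * y)
    - 4 * D + h * beta * M * c.
Proof.
move=> e1 e2 e3 e4 e5 e6 e7 e8.
pose t := d ^+ 2 * ((2 * x + (x + d)) / 3).
have E7 : (x + d) ^+ 3 / 3 = x ^+ 3 / 3 + x ^+ 2 * d + t by rewrite /t; field.
have E9 : (y + e) ^+ 2 = y ^+ 2 + 2 * (y * e) + e ^+ 2 by ring.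
have -> : h * (a0 * (x + d) ^+ 3 / 3 + beta * gamma / 2 * (y + e) ^+ 2 - beta * b2 * (y + e))
  = h * (a0 * x ^+ 3 / 3) + h * a0 * x ^+ 2 * d + h * a0 * t +
    h * beta * gamma / 2 * y ^+ 2 + h * beta * gamma * y * e + h * beta * gamma * e ^+ 2 / 2
    - h * beta * b2 * (y + e).
  by rewrite -[a0 * _ / 3]mulrA E7 E9; field.
have -> : h * (a0 * x ^+ 3 / 3 + beta * gamma / 2 * y ^+ 2 - beta * b1 * y) =
  h * (a0 * x ^+ 3 / 3) + h * beta * gamma / 2 * y ^+ 2 - h * beta * b1 * y by ring.
have E8 : h * beta * b2 * (y + e) = h * beta * b1 * y + h * beta * b1 * e
    + h * beta * (y + e) * (b2 - b1) by ring.
have E1 : h * beta * (b1 - gamma * y) * e = h * beta * b1 * e - h * beta * gamma * y * e by ring.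
rewrite -/t in e7; move: e1 e8; rewrite E8 E1.
set z1 := h * beta * (y + e) * _; set z2 := h * beta * b1 * e.
set z3 := h * beta * gamma * y * e; set z4 := h * a0 * x ^+ 2 * d.
set z5 := h * a0 * t; set z6 := h * beta * b1 * y.
set z7 := h * beta * M * c; set z8 := h * beta * gamma / 2 * y ^+ 2.
set z9 := h * (a0 * x ^+ 3 / 3).
move: e3 e4 e5 e6 e7; rewrite -/z5.
set w1 := h * beta * gamma * e ^+ 2; set w2 := h * beta * gamma * D.
set w3 := h * a0 * M * D.
move: z1 z2 z3 z4 z5 z6 z7 z8 z9 w1 w2 w3 => *; lra.
Qed.

Lemma sum_subrange (f : nat -> R) a n m : (forall l, 0 <= f l) -> (a + n <= m)%N ->
  \sum_(l < n) f (a + l)%N <= \sum_(l < m) f l.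
Proof.
move=> f0 anm; rewrite -(subnKC anm) !big_split_ord /=.
rewrite -addrA addrCA lerDl.
by rewrite addr_ge0//; apply: sumr_ge0 => i _; exact: f0.
Qed.

(** A block of [r + 1] nodes close to [j], over which to average. It ends at [j], or starts at 0
    when [j] is too close to the left end. Distances are bounded without subtraction. *)
Lemma window (n j r : nat) : (j <= n)%N -> (r <= n)%N -> exists i0 : nat,
  forall l : nat, (l <= r)%N ->
  [/\ (i0 + l <= n)%N, (i0 + l <= j + r)%N & (j <= i0 + l + r)%N].
Proof.
move=> jn rn; exists (if (r <= j)%N then (j - r)%N else 0%N) => l lr.
by case: (leqP r j) => rj; split; lia.
Qed.

End finite_sums.

Section scheme.
Context {R : realType}.
Variables (a0 gamma beta M h s0 : R) (b : nat -> R) (v0 : nat -> R).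

(* Node [j] stands for [j h] and step [k] for [k h^2 / 8].  The state is extended
   by a constant to the right of the front node, so that the grid never moves;
   by (S5) the flux [u_z = - u s_t] at the front is [- a0 u^2]. *)
Definition front (s : R) : nat := Num.truncn (s / h).

Definition flux_right n (v : nat -> R) j : R :=
  if (j < n)%N then v j.+1 - v j else - (h * a0 * v j ^+ 2).

(** At node 0 this is [h u_z (t, 0)] as imposed by the boundary condition (S3). *)
Definition flux_left (bk : R) (v : nat -> R) j : R :=
  if j is i.+1 then v j - v i else - (h * beta * (bk - gamma * v 0%N)).

Definition heat_step (bk : R) n (v : nat -> R) j : R :=
  v j + (flux_right n v j - flux_left bk v j) / 8.

Fixpoint scheme k : (nat -> R) * R :=
  if k is k'.+1 then
    let: (v, s) := scheme k' in
    (fun j => heat_step (b k') (front s) v (minn j (front s)),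
     s + h ^+ 2 / 8 * a0 * v (front s))
  else (fun j => v0 (minn j (front s0)), s0).

Definition U k j := (scheme k).1 j.
Definition Sk k := (scheme k).2.
Definition Nk k := front (Sk k).
Definition delta k j := U k.+1 j - U k j.

Lemma US k j : U k.+1 j = heat_step (b k) (Nk k) (U k) (minn j (Nk k)).
Proof. by rewrite /U /Nk /Sk /=; case: (scheme k). Qed.

Lemma SS k : Sk k.+1 = Sk k + h ^+ 2 / 8 * a0 * U k (Nk k).
Proof. by rewrite /U /Nk /Sk /=; case: (scheme k). Qed.

Hypothesis (a0_gt0 : 0 < a0) (gamma_gt0 : 0 < gamma) (beta_gt0 : 0 < beta).
Hypothesis (M_gt0 : 0 < M) (h_gt0 : 0 < h) (s0_gt0 : 0 < s0).
Hypothesis (hbg : h * beta * gamma <= 1) (haM : h * a0 * M <= 1).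
Hypothesis b_itv : forall k, 0 <= b k <= gamma * M.
Hypothesis v0_itv : forall j, 0 <= v0 j <= M.

(** Each of the two fluxes, counted inwards, lies between [- v j] and [M - v j], so a small multiple
    of their sum keeps the new value between 0 and [M]. For the boundary fluxes this comes from
    [haM], [hbg] and [b <= gamma M]. *)
Lemma heat_step_itv k n v j : (forall i, 0 <= v i <= M) ->
  0 <= heat_step (b k) n v j <= M.
Proof.
move=> vM; have /andP[vj0 vjM] := vM j; have /andP[b0 bM] := b_itv k.
have r : - v j <= flux_right n v j <= M - v j.
  rewrite /flux_right; case: ifP => _; first by have := vM j.+1; lra.
  have h1 : h * a0 * v j <= 1.
    by apply: le_trans haM; rewrite ler_pM2l// mulr_gt0.
  have : h * a0 * v j * v j <= v j by rewrite ler_piMl.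
  have : 0 <= h * a0 * v j * v j by rewrite !mulr_ge0// ltW.
  rewrite expr2 !mulrA; lra.
have l : - v j <= - flux_left (b k) v j <= M - v j.
  rewrite /flux_left; case: j vj0 vjM {r} => [|j] vj0 vjM.
    rewrite opprK mulrBr.
    have : h * beta * b k <= h * beta * (gamma * M) by rewrite ler_pM2l// mulr_gt0.
    have : 0 <= h * beta * b k by rewrite !mulr_ge0// ltW.
    have : h * beta * gamma * (M - v 0%N) <= M - v 0%N.
      by rewrite ler_piMl// subr_ge0.
    have : h * beta * gamma * v 0%N <= v 0%N by rewrite ler_piMl.
    rewrite !mulrA mulrBr; lra.
  by have := vM j; lra.
rewrite /heat_step; lra.
Qed.

Lemma U_itv k j : 0 <= U k j <= M.
Proof.
elim: k j => [|k IH] j; first exact: v0_itv.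
by rewrite US; exact: heat_step_itv.
Qed.

Lemma Sk_le k : Sk k <= Sk k.+1.
Proof.
have /andP[u0 _] := U_itv k (Nk k).
by rewrite SS lerDl !mulr_ge0 ?sqr_ge0 ?invr_ge0// ltW.
Qed.

Lemma Sk_homo k m : (k <= m)%N -> Sk k <= Sk m.
Proof.
elim: m => [|m IH]; first by rewrite leqn0 => /eqP ->.
rewrite leq_eqVlt => /predU1P[-> //|km]; exact: le_trans (IH km) (Sk_le m).
Qed.

Lemma Sk_ge k : s0 <= Sk k. Proof. exact: (Sk_homo (leq0n k)). Qed.

Lemma Sk_gt0 k : 0 < Sk k. Proof. by rewrite (lt_le_trans s0_gt0)// Sk_ge. Qed.

Lemma Sk_increment k m : Sk (k + m) - Sk k <= m%:R * (h ^+ 2 / 8) * (a0 * M).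
Proof.
elim: m => [|m IH]; first by rewrite addn0 subrr !mul0r.
rewrite addnS SS -[m.+1%:R]natr1.
have /andP[_ hM] := U_itv (k + m) (Nk (k + m)).
have : h ^+ 2 / 8 * a0 * U (k + m) (Nk (k + m)) <= h ^+ 2 / 8 * a0 * M.
  by rewrite ler_wpM2l// !mulr_ge0 ?sqr_ge0// ltW.
move: IH; rewrite !mulrDl !mul1r -!mulrA; lra.
Qed.

Lemma Nk_itv k : (Nk k)%:R * h <= Sk k < (Nk k)%:R * h + h.
Proof.
have /(@truncn_itv R) : 0 <= Sk k / h by rewrite divr_ge0// ltW// Sk_gt0.
by rewrite -/(front _) -/(Nk k) ler_pdivlMr// ltr_pdivrMr// -natr1 mulrDl mul1r.
Qed.

Lemma Nk_homo k m : (k <= m)%N -> (Nk k <= Nk m)%N.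
Proof. by move=> km; apply: le_truncn; rewrite ler_pM2r ?invr_gt0// Sk_homo. Qed.

(** Nodes beyond the old front copy its node, and the front never recedes. *)
Lemma U_front k j : (Nk k <= j)%N -> U k j = U k (Nk k).
Proof.
case: k => [|k] Nj.
  by rewrite /U /= (minn_idPr Nj) /Nk /Sk /= minnn.
by rewrite !US (minn_idPr (leq_trans (Nk_homo (leqnSn k)) Nj)) (minn_idPr (Nk_homo _)).
Qed.

Lemma delta_inner k j : (j <= Nk k)%N ->
  8 * delta k j = flux_right (Nk k) (U k) j - flux_left (b k) (U k) j.
Proof. by move=> jN; rewrite /delta US (minn_idPl jN) /heat_step; lra. Qed.

(** These sums and [energy] carry a common factor [h]: [dirichlet] stands for [h] times the integral
    of [u_z^2], and the sum of [dissipation] over the steps for [h / 8] times the integral of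
    [u_t^2]. *)
Definition dirichlet k := \sum_(j < Nk k) (U k j.+1 - U k j) ^+ 2.
Definition dissipation k := \sum_(j < (Nk k).+1) delta k j ^+ 2.
Definition energy k := dirichlet k / 2 +
  h * (a0 * U k (Nk k) ^+ 3 / 3 + beta * gamma / 2 * U k 0%N ^+ 2
       - beta * b k * U k 0%N).

(** Between the old front and the new one the new state is constant, so the advance of the front
    adds nothing to the sum. *)
Lemma dirichletS k : dirichlet k.+1 = \sum_(j < Nk k) (U k.+1 j.+1 - U k.+1 j) ^+ 2.
Proof.
rewrite /dirichlet -(subnKC (Nk_homo (leqnSn k))) big_split_ord /=.
rewrite [X in _ + X]big1 ?addr0// => j _.
rewrite !US !(minn_idPr _) ?subrr ?expr0n//; first exact: leq_addr.
by rewrite -addnS leq_addr.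
Qed.

(** The scheme is multiplied by its own increment and summed by parts over the nodes. *)
Lemma delta_sum_flux k : 8 * dissipation k =
  - (h * a0 * U k (Nk k) ^+ 2 * delta k (Nk k))
  + h * beta * (b k - gamma * U k 0%N) * delta k 0%N
  - \sum_(j < Nk k) (U k j.+1 - U k j) * (delta k j.+1 - delta k j).
Proof.
have := @summation_by_parts R (delta k) (fun j => U k j.+1 - U k j)
  (flux_left (b k) (U k)) (- (h * a0 * U k (Nk k) ^+ 2)) (Nk k) (fun j => erefl).
move=> E.
rewrite /dissipation big_ord_recr /= mulrDr mulr_sumr.
transitivity (\sum_(j < Nk k) delta k j *
    (U k j.+1 - U k j - flux_left (b k) (U k) j) +
    delta k (Nk k) * (- (h * a0 * U k (Nk k) ^+ 2) - flux_left (b k) (U k) (Nk k))).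
  congr (_ + _).
    apply: eq_bigr => j _; rewrite expr2 mulrCA delta_inner ?(ltnW (ltn_ord j))//.
    by rewrite /flux_right ltn_ord.
  by rewrite expr2 mulrCA delta_inner// /flux_right ltnn.
rewrite E /=; ring.
Qed.

Lemma sum_delta_diff k :
  \sum_(j < Nk k) (delta k j.+1 - delta k j) ^+ 2 <= 4 * dissipation k.
Proof.
have h1 : \sum_(j < Nk k) delta k j ^+ 2 <= dissipation k.
  by rewrite /dissipation big_ord_recr /= lerDl sqr_ge0.
have h2 : \sum_(j < Nk k) delta k j.+1 ^+ 2 <= dissipation k.
  by rewrite /dissipation big_ord_recl /= lerDr sqr_ge0.
apply: (@le_trans _ _ (\sum_(j < Nk k) (2 * delta k j.+1 ^+ 2 + 2 * delta k j ^+ 2))).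
  apply: ler_sum => j _; have := sqr_ge0 (delta k j.+1 + delta k j).
  rewrite !expr2; lra.
rewrite big_split /= -!mulr_sumr; lra.
Qed.

(** The boundary terms of [energy] are primitives in [u] of the fluxes at the front and at 0. What
    remains is their Taylor remainder, quadratic in the increments and so controlled by the
    dissipation, and the change of [b]. *)
Lemma energy_step k : h * a0 * M + h * beta * gamma <= 2 ->
  energy k.+1 <= energy k - 4 * dissipation k + h * beta * M * `|b k.+1 - b k|.
Proof.
move=> hsmall.
have D0 : 0 <= dissipation k by apply: sumr_ge0 => j _; exact: sqr_ge0.
have dN : delta k (Nk k) ^+ 2 <= dissipation k.
  rewrite /dissipation big_ord_recr /= lerDr.
  by apply: sumr_ge0 => j _; exact: sqr_ge0.
have d0 : delta k 0%N ^+ 2 <= dissipation k.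
  rewrite /dissipation big_ord_recl /= lerDl.
  by apply: sumr_ge0 => j _; exact: sqr_ge0.
have E := delta_sum_flux k; have Q := sum_delta_diff k.
have dir : dirichlet k.+1 = dirichlet k
   + 2 * (\sum_(j < Nk k) (U k j.+1 - U k j) * (delta k j.+1 - delta k j))
   + \sum_(j < Nk k) (delta k j.+1 - delta k j) ^+ 2.
  rewrite dirichletS /dirichlet mulr_sumr -!big_split /=.
  by apply: eq_bigr => j _; rewrite /delta; ring.
have UN : U k.+1 (Nk k.+1) = U k (Nk k) + delta k (Nk k).
  by rewrite /delta !US minnn (minn_idPr (Nk_homo _))//; ring.
have U0 : U k.+1 0%N = U k 0%N + delta k 0%N by rewrite /delta; ring.
have /andP[uN0 uNM] := U_itv k (Nk k); have /andP[vN0 vNM] := U_itv k.+1 (Nk k.+1).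
have /andP[v00 v0M] := U_itv k.+1 0%N.
(* The factor of [h * a0] on the left is the Taylor remainder of [x^3 / 3], written through the two
   values of [u] at the front, both in [[0, M]]. *)
have haN : h * a0 * (delta k (Nk k) ^+ 2 * ((2 * U k (Nk k) + U k.+1 (Nk k.+1)) / 3))
   <= h * a0 * M * dissipation k.
  rewrite -[leRHS]mulrA ler_pM2l ?mulr_gt0// mulrC.
  by apply: ler_pM => //; [lra|exact: sqr_ge0|lra].
have hb0 : h * beta * gamma * delta k 0%N ^+ 2 <= h * beta * gamma * dissipation k.
  by rewrite ler_pM2l// !mulr_gt0.
have hb : - (h * beta * U k.+1 0%N * (b k.+1 - b k)) <=
    h * beta * M * `|b k.+1 - b k|.
  rewrite -mulrN -!mulrA !ler_pM2l//; apply: (@le_trans _ _ (U k.+1 0%N * `|b k.+1 - b k|)).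
    by rewrite ler_wpM2l// -normrN ler_norm.
  by rewrite ler_wpM2r.
rewrite /energy dir; move: haN hb; rewrite UN U0 in vN0 vNM *.
set x := U k (Nk k) in E *; set d := delta k (Nk k) in E *.
set y := U k 0%N in E *; set e := delta k 0%N in E hb0 *.
set P := \sum_(j < Nk k) _ in E *; set W := \sum_(j < Nk k) _ in Q *.
set D := dissipation k in E Q D0 hb0 *.
set c := `|_|.
have hD : (h * a0 * M + h * beta * gamma) * D <= 2 * D by rewrite ler_wpM2r.
have hD' : 0 <= h * beta * gamma * D by rewrite !mulr_ge0// ltW.
have hD'' : 0 <= h * a0 * M * D by rewrite !mulr_ge0// ltW.
rewrite mulrDl in hD.
move: E Q hb0 hD hD' hD''; exact: energy_algebra.
Qed.

Lemma energy_ge k : - (h * (beta * gamma * M ^+ 2)) <= energy k - dirichlet k / 2.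
Proof.
have /andP[uN0 uNM] := U_itv k (Nk k); have /andP[u00 u0M] := U_itv k 0%N.
have /andP[b0 bM] := b_itv k.
rewrite /energy [X in _ <= X]addrAC subrr add0r -mulrN ler_pM2l//.
have : beta * b k * U k 0%N <= beta * gamma * M ^+ 2.
  rewrite -!mulrA ler_pM2l// expr2 mulrA; exact: ler_pM.
have : 0 <= a0 * U k (Nk k) ^+ 3 by rewrite mulr_ge0 ?exprn_ge0// ltW.
have : 0 <= beta * gamma * U k 0%N ^+ 2 by rewrite mulr_ge0 ?sqr_ge0// ltW// mulr_gt0.
lra.
Qed.

Variables (D B : R).
Hypothesis hsmall : h * a0 * M + h * beta * gamma <= 2.
Hypothesis v0_dirichlet : \sum_(j < front s0) (v0 j.+1 - v0 j) ^+ 2 <= h * D.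
Hypothesis b_variation : forall K, \sum_(k < K) `|b k.+1 - b k| <= B.

(** Twice the sum of three bounds: [D / 2 + a0 M^3 / 3 + beta gamma M^2 / 2] for the initial energy,
    [beta gamma M^2] for its negative part at later times, and [beta M B] for the variation of [b].
    The doubling is due to the factor one half of the Dirichlet sum; [2 / 3] is rounded up to 1. *)
Definition energy_bound := D + a0 * M ^+ 3 + 3 * (beta * gamma * M ^+ 2) + 2 * (beta * M * B).
Let C := energy_bound.

Lemma energy0 : energy 0 <= h * (D / 2 + a0 * M ^+ 3 / 3 + beta * gamma * M ^+ 2 / 2).
Proof.
have /andP[uN0 uNM] := U_itv 0 (Nk 0); have /andP[u00 u0M] := U_itv 0 0%N.
have /andP[b0 bM] := b_itv 0.
have hd : dirichlet 0 <= h * D.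
  apply: le_trans v0_dirichlet; rewrite /dirichlet; apply: ler_sum => j _.
  have jN : (j < front s0)%N := ltn_ord j.
  by rewrite /U /= (minn_idPl jN) (minn_idPl (ltnW jN)).
rewrite /energy.
have h1 : h * (a0 * U 0 (Nk 0) ^+ 3) <= h * (a0 * M ^+ 3).
  by rewrite !ler_pM2l// lerXn2r ?nnegrE// ltW.
have h2 : h * (beta * gamma * U 0 0%N ^+ 2) <= h * (beta * gamma * M ^+ 2).
  by rewrite !ler_pM2l ?mulr_gt0// lerXn2r ?nnegrE// ltW.
have h3 : 0 <= h * (beta * b 0%N * U 0 0%N) by rewrite !mulr_ge0// ltW.
move: h1 h2 h3 hd; rewrite mulrBr 2!mulrDr; lra.
Qed.

Lemma energy_sum K : energy K + 4 * \sum_(k < K) dissipation k <=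
  energy 0 + h * beta * M * \sum_(k < K) `|b k.+1 - b k|.
Proof.
elim: K => [|K IH]; first by rewrite !big_ord0 !mulr0 !addr0.
rewrite !big_ord_recr /= !mulrDr; have := energy_step K hsmall; lra.
Qed.

Lemma energy_estimate K :
  dirichlet K <= h * C /\ \sum_(k < K) dissipation k <= h * C.
Proof.
have e1 := energy_sum K; have e2 := energy_ge K; have e3 := energy0.
have e4 : h * beta * M * \sum_(k < K) `|b k.+1 - b k| <= h * (beta * M * B).
  by rewrite -!mulrA !ler_pM2l//; exact: b_variation.
have dir0 : 0 <= dirichlet K by apply: sumr_ge0 => j _; exact: sqr_ge0.
have dis0 : 0 <= \sum_(k < K) dissipation k.
  by apply: sumr_ge0 => k _; apply: sumr_ge0 => j _; exact: sqr_ge0.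
have a3 : 0 <= h * (a0 * M ^+ 3) by rewrite !mulr_ge0 ?exprn_ge0// ltW.
have g3 : 0 <= h * (beta * gamma * M ^+ 2) by rewrite !mulr_ge0 ?exprn_ge0// ltW.
move: e2 e3; rewrite /C /energy_bound; move: dir0 dis0 e1 e4 a3 g3.
set X := dirichlet K; set Y := \sum_(k < K) dissipation k.
rewrite !(mulrDr h) => *; split; lra.
Qed.

(** Cauchy-Schwarz over the nodes from [i] to [j]: Hölder continuity of order one half in space. *)
Lemma U_space k i j : (i <= j)%N -> (U k j - U k i) ^+ 2 <= (j - i)%:R * (h * C).
Proof.
move=> ij; have -> : U k j - U k i = \sum_(l < j - i) (U k (i + l).+1 - U k (i + l)%N).
  rewrite -{1}(subnKC ij); elim: (j - i)%N => [|n IH].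
    by rewrite addn0 subrr big_ord0.
  by rewrite big_ord_recr /= -IH addnS; ring.
apply: le_trans (sqr_sum_le (fun l => U k (i + l).+1 - U k (i + l)%N) _) _.
apply: ler_wpM2l => //.
apply: le_trans (energy_estimate k).1.
pose f l := (U k l.+1 - U k l) ^+ 2.
have f0 l : 0 <= f l by exact: sqr_ge0.
apply: (@le_trans _ _ (\sum_(l < maxn j (Nk k)) f l)).
  have -> : \sum_(l < j - i) (U k (i + l).+1 - U k (i + l)%N) ^+ 2 =
    \sum_(l < j - i) f (i + l)%N by [].
  by apply: sum_subrange; rewrite // subnKC// leq_maxl.
rewrite -(subnKC (leq_maxr j (Nk k))) big_split_ord /=.
rewrite [X in _ + X]big1 ?addr0// => l _.
by rewrite /f !U_front ?subrr ?expr0n// -?addnS leq_addr.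
Qed.

(** The dissipation bounds increments in time only after summation over the nodes. Among [r + 1]
    nodes near [j], one does no worse than the average; [U_space] can then carry the estimate from
    [i] back to [j]. *)
Lemma U_time k m j r : (j <= Nk k)%N -> (r <= Nk k)%N ->
  exists i : nat, [/\ (i <= Nk k)%N, (i <= j + r)%N, (j <= i + r)%N &
    (U (k + m) i - U k i) ^+ 2 * r.+1%:R <= m%:R * (h * C)].
Proof.
move=> jN rN; have [i0 i0r] := window jN rN.
have : \sum_(l < r.+1) (U (k + m) (i0 + l)%N - U k (i0 + l)%N) ^+ 2 <= m%:R * (h * C).
  apply: (@le_trans _ _ (\sum_(l < r.+1) m%:R * \sum_(n < m) delta (k + n) (i0 + l) ^+ 2)).
    apply: ler_sum => l _.
    have -> : U (k + m) (i0 + l)%N - U k (i0 + l)%N = \sum_(n < m) delta (k + n) (i0 + l).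
      elim: (m) => [|n IH]; first by rewrite addn0 subrr big_ord0.
      by rewrite big_ord_recr /= -IH addnS /delta; ring.
    exact: (sqr_sum_le (fun n => delta (k + n) (i0 + l))).
  rewrite -mulr_sumr; apply: ler_wpM2l => //.
  rewrite exchange_big /=; apply: le_trans (energy_estimate (k + m)).2.
  apply: (@le_trans _ _ (\sum_(n < m) dissipation (k + n))); last first.
    apply: (@sum_subrange _ dissipation) => // n.
    by apply: sumr_ge0 => l _; exact: sqr_ge0.
  apply: ler_sum => n _; have [hr _ _] := i0r r (leqnn r).
  apply: (@sum_subrange _ (fun l => delta (k + n) l ^+ 2)).
    by move=> l; exact: sqr_ge0.
  by rewrite addnS ltnS (leq_trans hr)// Nk_homo// leq_addr.
move=> /(@exists_le_sum _ (fun l => (U (k + m) (i0 + l)%N - U k (i0 + l)%N) ^+ 2))[l lr hl]; have [h1 h2 h3] := i0r l lr.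
by exists (i0 + l)%N; split.
Qed.

End scheme.

(** * Ultralimits and Riesz representation *)

Section ultralimits.
Context {R : realType}.
Implicit Types (F : set_system nat) (x : nat -> R).

(** The sequence stays in a compact interval, and a cluster point of an ultrafilter is a limit. *)
Lemma ultra_cvg F x (C : R) : UltraFilter F -> (forall n, `|x n| <= C) ->
  exists l : R, x @ F --> l.
Proof.
move=> FU xC; have Fx : F (x @^-1` `[- C, C]).
  by apply: filterE => n; rewrite /= in_itv/= -ler_norml.
have [l [_ hl]] := @segment_compact R (- C) C (x @ F) _ Fx.
exists l => V Vl; have [//|h] := in_ultra_setVsetC (x @^-1` V) FU.
have [y []] := hl (~` V) V h Vl; by [].
Qed.

End ultralimits.

Section square_integrable.
Context d (T : measurableType d) (R : realType) (mu : {measure set T -> \bar R}).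
Variable D : set T.
Hypothesis mD : measurable D.
Implicit Types (f g : T -> R).

Definition sqint f := measurable_fun D f /\
  mu.-integrable D (EFin \o (fun x => f x ^+ 2)).

Lemma sqintD f g : sqint f -> sqint g -> sqint (fun x => f x + g x).
Proof.
move=> [mf f2] [mg g2]; split; first exact: measurable_funD.
apply: (@integrable_le _ _ _ _ _ _ (fun x => 2 * f x ^+ 2 + 2 * g x ^+ 2)) => //.
- by apply: measurable_funX; exact: measurable_funD.
- move=> x _; rewrite ger0_norm ?sqr_ge0//; have := sqr_ge0 (f x - g x); rewrite !expr2; lra.
- by apply: integrableRD => //; exact: integrableRZ.
Qed.

Lemma sqintZ f (r : R) : sqint f -> sqint (fun x => r * f x).
Proof.
move=> [mf f2]; split; first exact: measurable_funM.
rewrite (_ : _ \o _ = EFin \o (fun x => r ^+ 2 * f x ^+ 2)); first exact: integrableRZ.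
by apply/funext => x /=; rewrite exprMn.
Qed.

Lemma sqintB f g : sqint f -> sqint g -> sqint (fun x => f x - g x).
Proof.
move=> hf hg; rewrite (_ : (fun x => _) = fun x => f x + (-1) * g x).
  by apply: sqintD => //; exact: sqintZ.
by apply/funext => x; rewrite mulN1r.
Qed.

Lemma sqintM f g : sqint f -> sqint g ->
  mu.-integrable D (EFin \o (fun x => f x * g x)).
Proof.
move=> [mf f2] [mg g2].
apply: (@integrable_le _ _ _ _ _ _ (fun x => f x ^+ 2 + g x ^+ 2)) => //.
- exact: measurable_funM.
- move=> x _; rewrite normrM -(@real_normK _ (f x)) ?num_real//.
  rewrite -(@real_normK _ (g x)) ?num_real//.
  have := sqr_ge0 (`|f x| - `|g x|); have := sqr_ge0 (`|f x|); have := sqr_ge0 (`|g x|).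
  rewrite !expr2; lra.
- exact: integrableRD.
Qed.

Lemma le_weighted_square (a : R) n : `|a| <= 2^-1 ^+ n + 2 ^+ n * a ^+ 2.
Proof.
have h0 : 0 < 2 ^+ n :> R by rewrite exprn_gt0.
rewrite exprVn -(@real_normK _ a) ?num_real//.
rewrite -(ler_pM2l h0) mulrDr divff ?gt_eqF//.
have := sqr_ge0 (2 ^+ n * `|a| - 1); have := sqr_ge0 (2 ^+ n * `|a|).
rewrite !expr2; set z := 2 ^+ n; set y := `|a|; lra.
Qed.

(** The increments [a n] have squared norm at most [4^-n], so the series of [2^n a_n^2] has a finite
    integral and is finite almost everywhere. Up to a geometric series it dominates the series of
    [|a_n|], whence convergence almost everywhere; Fatou's lemma carries the rate to the limit. *)
Lemma l2_limit (f : nat -> T -> R) : (forall n, sqint (f n)) ->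
  (forall n k, (n <= k)%N -> \int[mu]_(x in D) (f k x - f n x) ^+ 2 <= 4^-1 ^+ n) ->
  exists2 g, sqint g &
    forall n, \int[mu]_(x in D) (f n x - g x) ^+ 2 <= 4^-1 ^+ n.
Proof.
move=> sf cf.
pose a n x := f n.+1 x - f n x.
have sa n : sqint (a n) by exact: sqintB.
pose h n x := (2 ^+ n * (a n x) ^+ 2)%:E.
have ih n : mu.-integrable D (h n) by apply: integrableRZ => //; exact: (sa n).2.
have mh n : measurable_fun D (h n) by exact: measurable_int (ih n).
have h0 n x : D x -> (0 <= h n x)%E by rewrite lee_fin mulr_ge0 ?sqr_ge0// exprn_ge0.
pose H x := (\sum_(n <oo) h n x)%E.
have mH : measurable_fun D H.
  have := @ge0_emeasurable_sum _ T R D h xpredT (fun k x Dx _ => h0 k x Dx) (fun k _ => mh k).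
  exact.
have iH : (\int[mu]_(x in D) H x <= 2%:E)%E.
  rewrite /H integral_nneseries//.
  apply: (@le_trans _ _ (\sum_(n <oo) (2 / (2 ^ (n + 1))%:R)%:E)%E).
    apply: lee_nneseries => n; first by move=> _ _; apply: integral_ge0 => x; exact: h0.
    move=> _; rewrite -[leLHS]fineK; last exact: integrable_fin_num (ih n).
    rewrite lee_fin -/(Rintegral _ _ _) RintegralZl//; last exact: (sa n).2.
    have := cf n n.+1 (leqnSn n) => c.
    apply: (@le_trans _ _ (2 ^+ n * 4^-1 ^+ n)); first by rewrite ler_wpM2l// exprn_ge0.
    rewrite addn1 natrX exprS (_ : 4^-1 = 2^-1 * 2^-1 :> R); last by field.
    rewrite exprMn mulrA -exprMn divff// expr1n mul1r exprVn.
    by rewrite invfM mulrA divff// mul1r.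
  rewrite -[leLHS]/(limn (eseries (fun k : nat => (2 / (2 ^ (k + 1))%:R)%:E))).
  by rewrite (cvg_lim _ (@cvg_geometric_eseries_half R 2 0))// expr0 divr1.
have Hint : mu.-integrable D H.
  apply/integrableP; split => //.
  rewrite (eq_integral H); first by rewrite (le_lt_trans iH)// ltry.
  by move=> x; rewrite inE => Dx; rewrite gee0_abs// nneseries_ge0// => n _ _; exact: h0.
have Hfin := integrable_ae mD Hint.
pose fe n x := (f n x)%:E.
(* The upper limit is measurable whether or not the sequence converges, and equals the limit
   wherever it does. *)
pose g x := fine (limn_esup (fe ^~ x)).
have mfe n : measurable_fun D (fe n) by apply/measurable_EFinP; exact: (sf n).1.
have mg : measurable_fun D g.
  by apply: measurableT_comp; [exact: fine_measurable|exact: measurable_fun_limn_esup].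
have fg : {ae mu, forall x, D x -> f n x @[n --> \oo] --> g x}.
  apply: ae_mono Hfin => x /[swap] Dx /(_ Dx) Hx.
  have cv : cvgn (series (fun n => a n x)).
    apply: normed_cvg.
    apply: nondecreasing_is_cvgn.
      by apply: nondecreasing_series => n _ _; exact: normr_ge0.
    exists (2 + fine (H x)) => _ [n _ <-].
    apply: (@le_trans _ _ (\sum_(0 <= i < n) (2^-1 ^+ i + 2 ^+ i * a i x ^+ 2))).
      by apply: ler_sum => i _; exact: le_weighted_square.
    rewrite big_split /=; apply: lerD.
      have := @geometric_seriesE R 1 2^-1; rewrite /series/= /geometric/=.
      move=> /(_ _)/(congr1 (fun F => F n)) /= E.
      under eq_bigr do rewrite -[_ ^+ _]mul1r.
      rewrite E; last by apply/eqP; lra.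
      have : 0 <= 2^-1 ^+ n :> R by rewrite exprn_ge0.
      set z := _ ^+ n; rewrite (_ : 1 - 2^-1 = 2^-1 :> R) ?invrK; last by field.
      lra.
    rewrite -lee_fin fineK// -sumEFin.
    by apply: nneseries_lim_ge => i _ _; exact: h0.
  have cf' : cvgn (fun n => f n x).
    rewrite (_ : (fun n => f n x) = (fun n => f 0%N x + series (fun n => a n x) n)).
      by apply: is_cvgD => //; exact: is_cvg_cst.
    apply/funext => n; rewrite /series/= /a telescope_sumr//; ring.
  have ce : fe n x @[n --> \oo] --> (limn (fun n => f n x))%:E.
    by apply: cvg_EFin; [exact: nearW|exact: cf'].
  rewrite /g is_cvg_limn_esupE; last by apply/cvg_ex; eexists; exact: ce.
  by rewrite (cvg_lim _ ce).
have fatn n : (\int[mu]_(x in D) ((f n x - g x) ^+ 2)%:E <= (4^-1 ^+ n)%:E)%E.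
  pose u k x := ((f n x - f (n + k)%N x) ^+ 2)%:E.
  have mu_ k : measurable_fun D (u k).
    apply/measurable_EFinP; apply: measurable_funX; apply: measurable_funB.
      exact: (sf n).1.
    exact: (sf _).1.
  have u0 k x : D x -> (0 <= u k x)%E by rewrite lee_fin sqr_ge0.
  have mlim : measurable_fun D (fun x => limn_einf (u ^~ x)).
    rewrite (_ : (fun x => _) = (fun x => - limn_esup (fun k => - u k x)))%E.
      apply: measurableT_comp => //.
      apply: measurable_fun_limn_esup => k; exact: measurableT_comp.
    by apply/funext => x; rewrite limn_esupN oppeK.
  rewrite (@ae_eq_integral _ _ _ mu D (fun x => limn_einf (u ^~ x)))//; last 2 first.
  - apply/measurable_EFinP; apply: measurable_funX; apply: measurable_funB => //.
    exact: (sf n).1.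
  - apply: ae_mono fg => x h' Dx; have {}h' := h' Dx.
    have cu : u k x @[k --> \oo] --> ((f n x - g x) ^+ 2)%:E.
      apply: cvg_EFin; first exact: nearW.
      rewrite /comp /=.
      suff cd : f n x - f (n + k)%N x @[k --> \oo] --> f n x - g x.
        by rewrite expr2; under eq_fun do rewrite expr2; exact: cvgM.
      apply: cvgB; first exact: cvg_cst.
      have := h'; rewrite -(cvg_shiftn n) /=.
      by under eq_fun do rewrite addnC.
    by rewrite is_cvg_limn_einfE; [rewrite (cvg_lim _ cu)|apply/cvg_ex; eexists; exact: cu].
  apply: le_trans (fatou mu mD mu_ u0) _.
  have iu k : (\int[mu]_(x in D) u k x <= (4^-1 ^+ n)%:E)%E.
    have iuk : mu.-integrable D (u k) by exact: (sqintB (sf n) (sf _)).2.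
    rewrite -[leLHS]fineK; last exact: integrable_fin_num iuk.
    rewrite lee_fin; apply: le_trans (cf n (n + k)%N (leq_addr _ _)).
    rewrite /Rintegral le_eqVlt; apply/orP; left; apply/eqP; congr fine.
    by apply: eq_integral => x _; rewrite /u -sqrrN opprB.
  rewrite limn_einf_lim; apply: lime_le; first exact: is_cvg_einfs.
  apply: nearW => k; apply: le_trans (iu k); apply: ereal_inf_lbound.
  by exists k => /=.
have sfg n : sqint (fun x => f n x - g x).
  split; first by apply: measurable_funB => //; exact: (sf n).1.
  apply/integrableP; split.
    apply/measurable_EFinP; apply: measurable_funX; apply: measurable_funB => //.
    exact: (sf n).1.
  apply: le_lt_trans (ltry (4^-1 ^+ n)); apply: le_trans (fatn n).
  by rewrite le_eqVlt; apply/orP; left; apply/eqP; apply: eq_integral => x _ /=; rewrite ger0_norm ?sqr_ge0.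
exists g; last first.
  move=> n; rewrite -lee_fin /Rintegral fineK; first exact: fatn.
  exact: integrable_fin_num (sfg n).2.
rewrite (_ : g = fun x => f 0%N x - (f 0%N x - g x)); first exact: sqintB.
by apply/funext => x; ring.
Qed.

Lemma Rintegral_sqr_lin f g (a b : R) : sqint f -> sqint g ->
  \int[mu]_(x in D) (a * f x + b * g x) ^+ 2 =
  a ^+ 2 * \int[mu]_(x in D) f x ^+ 2 + 2 * a * b * \int[mu]_(x in D) (f x * g x) +
  b ^+ 2 * \int[mu]_(x in D) g x ^+ 2.
Proof.
move=> sf sg.
have i1 : mu.-integrable D (EFin \o (fun x => a ^+ 2 * f x ^+ 2)).
  by apply: integrableRZ => //; exact: sf.2.
have i2 : mu.-integrable D (EFin \o (fun x => 2 * a * b * (f x * g x))).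
  by apply: integrableRZ => //; exact: sqintM.
have i3 : mu.-integrable D (EFin \o (fun x => b ^+ 2 * g x ^+ 2)).
  by apply: integrableRZ => //; exact: sg.2.
rewrite -(RintegralZl _ mD sf.2) -(RintegralZl _ mD sg.2) -(RintegralZl _ mD (sqintM sf sg)).
rewrite -RintegralD// -RintegralD//; last exact: integrableRD.
by apply: eq_Rintegral => x _; ring.
Qed.

Section riesz.
Variables (S : set (T -> R)) (L : (T -> R) -> R) (C : R).
Hypothesis S_sqint : forall f, S f -> sqint f.
Hypothesis S_zero : S (cst 0).
Hypothesis S_lin : forall f g (a b : R), S f -> S g -> S (fun x => a * f x + b * g x).
Hypothesis L_lin : forall f g (a b : R), S f -> S g ->
  L (fun x => a * f x + b * g x) = a * L f + b * L g.
Hypothesis L_bound : forall f, S f -> 2 * L f <= C + \int[mu]_(x in D) f x ^+ 2.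

(* The representative is the L2 limit of a minimising sequence of [J]. *)
Theorem riesz_representation : exists2 g, sqint g &
  \int[mu]_(x in D) g x ^+ 2 <= C /\
  forall f, S f -> L f = \int[mu]_(x in D) (g x * f x).
Proof.
pose J f := \int[mu]_(x in D) f x ^+ 2 - 2 * L f.
have J_ge f : S f -> - C <= J f by move=> /L_bound; rewrite /J; lra.
pose m := inf (J @` S).
have hinf : has_inf (J @` S).
  split; first by exists (J (cst 0)); exists (cst 0).
  by exists (- C) => _ [f Sf <-]; exact: J_ge.
have J_m f : S f -> m <= J f by move=> Sf; apply: ge_inf; [exact: hinf.2|exists f].
have e_gt0 n : 0 < 4^-1 ^+ n / 4 :> R by rewrite divr_gt0// exprn_gt0.
have /choice[p hp] : forall n : nat, exists f, S f /\ J f < m + 4^-1 ^+ n / 4.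
  move=> n; have [_ [f Sf <-] hf] := inf_adherent (e_gt0 n) hinf.
  by exists f.
have Sp n : S (p n) := (hp n).1.
have sp n : sqint (p n) := S_sqint (Sp n).
have Jlin f g (a b : R) : S f -> S g -> J (fun x => a * f x + b * g x) =
  a ^+ 2 * \int[mu]_(x in D) f x ^+ 2 + 2 * a * b * \int[mu]_(x in D) (f x * g x) +
  b ^+ 2 * \int[mu]_(x in D) g x ^+ 2 - 2 * (a * L f + b * L g).
  move=> Sf Sg; rewrite /J L_lin// Rintegral_sqr_lin//; exact: S_sqint.
(* Parallelogram identity: the midpoint of [p n] and [p k] has [J >= m], and the tolerance
   [4^-n / 4] in the choice of [p] yields the rate that [l2_limit] requires. *)
have cp n k : (n <= k)%N -> \int[mu]_(x in D) (p k x - p n x) ^+ 2 <= 4^-1 ^+ n.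
  move=> nk.
  have -> : \int[mu]_(x in D) (p k x - p n x) ^+ 2 =
      \int[mu]_(x in D) (1 * p k x + (-1) * p n x) ^+ 2.
    by apply: eq_Rintegral => x _; rewrite mul1r mulN1r.
  rewrite Rintegral_sqr_lin//.
  have h1 := (hp n).2; have h2 := (hp k).2.
  have h3 := J_m _ (@S_lin _ _ 2^-1 2^-1 (Sp k) (Sp n)).
  rewrite Jlin// in h3.
  have h4 : 4^-1 ^+ k <= 4^-1 ^+ n :> R.
    by apply: ler_wiXn2l => //; lra.
  move: h1 h2 h3; rewrite /J; set X := Rintegral _ _ _; set Y := Rintegral _ _ _.
  set Z := Rintegral _ _ _.
  rewrite (_ : 2^-1 ^+ 2 = 4^-1 :> R); last by field.
  rewrite !expr1n sqrrN expr1n; lra.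
have [g sg hg] := l2_limit sp cp.
have key f n : S f -> `|\int[mu]_(x in D) (g x * f x) - \int[mu]_(x in D) (p n x * f x)| <=
    2^-1 ^+ n * (\int[mu]_(x in D) f x ^+ 2 + 1) /\
    `|\int[mu]_(x in D) (p n x * f x) - L f| <= 2^-1 ^+ n * (\int[mu]_(x in D) f x ^+ 2 + 1).
  move=> Sf; have sf := S_sqint Sf.
  set P := \int[mu]_(x in D) f x ^+ 2.
  have P0 : 0 <= P by apply: Rintegral_ge0 => x _; exact: sqr_ge0.
  have t0 : 0 < 2^-1 ^+ n :> R by rewrite exprn_gt0.
  have q0 : 4^-1 ^+ n = 2^-1 ^+ n * 2^-1 ^+ n :> R.
    by rewrite -exprMn; congr (_ ^+ _); field.
  split.
    have sd : sqint (fun x => p n x - g x) by exact: sqintB.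
    have Q (e : R) : 0 <= (2^-1 ^+ n)^-1 ^+ 2 * 4^-1 ^+ n + 2 * (2^-1 ^+ n)^-1 * e *
        (\int[mu]_(x in D) ((p n x - g x) * f x)) + e ^+ 2 * P.
      apply: (@le_trans _ _ (\int[mu]_(x in D) ((2^-1 ^+ n)^-1 * (p n x - g x) + e * f x) ^+ 2)).
        by apply: Rintegral_ge0 => x _; exact: sqr_ge0.
      by rewrite Rintegral_sqr_lin// lerD2r lerD2r ler_wpM2l// sqr_ge0.
    have E : \int[mu]_(x in D) ((p n x - g x) * f x) =
        \int[mu]_(x in D) (p n x * f x) - \int[mu]_(x in D) (g x * f x).
      rewrite -RintegralB//; [|exact: sqintM..].
      by apply: eq_Rintegral => x _; rewrite mulrBl.
    have := Q 1; have := Q (-1); rewrite E q0.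
    set A := \int[mu]_(x in D) (g x * f x); set B := \int[mu]_(x in D) (p n x * f x).
    have -> : (2^-1 ^+ n)^-1 ^+ 2 * (2^-1 ^+ n * 2^-1 ^+ n) = 1 :> R.
      by rewrite -expr2 -exprMn mulVf ?expr1n// gt_eqF.
    rewrite !expr1n sqrrN expr1n !mul1r !mulr1 => h1 h2.
    have {}h1 : (2^-1 ^+ n)^-1 * (A - B) * -2 <= 1 + P by move: h1 h2; lra.
    have {}h2 : (2^-1 ^+ n)^-1 * (A - B) * 2 <= 1 + P by move: h2; lra.
    have : `|(2^-1 ^+ n)^-1 * (A - B)| <= P + 1 by rewrite ler_norml; apply/andP; split; lra.
    by rewrite normrM ger0_norm ?invr_ge0 ?(ltW t0)// ler_pdivrMl.
  have Q (e : R) : 0 <= e ^+ 2 * P + 2 * e * (\int[mu]_(x in D) (p n x * f x) - L f)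
      + 4^-1 ^+ n.
    have h1 := (hp n).2.
    have := J_m _ (@S_lin _ _ 1 e (Sp n) Sf); rewrite Jlin// -/P => h3.
    move: h1 h3 (e_gt0 n); rewrite /J; set X := Rintegral _ _ _.
    rewrite expr1n; lra.
  have P1 : 0 < P + 1 by rewrite ltr_wpDl.
  (* The multiple of [f] that minimises the quadratic, except for the [+ 1], which keeps the
     denominator positive. *)
  have := Q (- (\int[mu]_(x in D) (p n x * f x) - L f) / (P + 1)).
  set A := _ - L f; rewrite q0 => h.
  have {}h : A ^+ 2 <= (2^-1 ^+ n * (P + 1)) ^+ 2.
    have : A ^+ 2 / (P + 1) <= 2^-1 ^+ n * 2^-1 ^+ n.
      have e1 : (- A / (P + 1)) ^+ 2 * P + 2 * (- A / (P + 1)) * A =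
        - (A ^+ 2 / (P + 1)) - (A / (P + 1)) ^+ 2 by field; rewrite gt_eqF.
      rewrite e1 in h; have := sqr_ge0 (A / (P + 1)); lra.
    rewrite ler_pdivrMr// => h'; apply: le_trans h' _.
    rewrite exprMn -expr2 ler_wpM2l ?sqr_ge0// expr2 ler_peMl ?(ltW P1)//.
    by rewrite lerDr.
  rewrite -(@ler_pXn2r _ 2)// ?nnegrE ?mulr_ge0 ?(ltW t0) ?(ltW P1)//.
  by rewrite real_normK// num_real.
have small (c e : R) : 0 < e -> exists n : nat, 2^-1 ^+ n * c < e.
  move=> e0; have c1 : 0 < `|c| + 1 by rewrite ltr_wpDl.
  have h : \forall n \near \oo, `|0 - 2^-1 ^+ n| < e / (`|c| + 1).
    apply: (@cvgr_dist_lt _ _ _ _ _ (fun n : nat => 2^-1 ^+ n : R)); last by rewrite divr_gt0.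
    by apply: cvg_expr; rewrite ger0_norm; lra.
  have [n _ /(_ n (leqnn n)) /=] := h.
  rewrite sub0r normrN ger0_norm ?exprn_ge0// ltr_pdivlMr// => hn; exists n.
  apply: le_lt_trans hn; rewrite ler_wpM2l ?exprn_ge0//.
  by rewrite (le_trans (ler_norm c))// lerDl.
have gL f : S f -> L f = \int[mu]_(x in D) (g x * f x).
  move=> Sf; apply/eqP; rewrite -subr_eq0 -normr_eq0.
  rewrite eq_le normr_ge0 andbT; apply/ler_addgt0Pr => e e0; rewrite add0r.
  have [n hn] := small (2 * (\int[mu]_(x in D) f x ^+ 2 + 1)) e e0.
  have [h1 h2] := key f n Sf; apply: le_trans (ltW hn).
  rewrite distrC; apply: le_trans (ler_distD (\int[mu]_(x in D) (p n x * f x)) _ _) _; lra.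
exists g => //; split => //.
apply/ler_addgt0Pr => e e0; have [n hn] := small 1 e e0.
have h1 := hg n; have h2 := L_bound (Sp n); rewrite gL// in h2.
have h3 : 4^-1 ^+ n <= 2^-1 ^+ n :> R by apply: lerXn2r; rewrite ?nnegrE; lra.
have E : \int[mu]_(x in D) (p n x - g x) ^+ 2 =
    \int[mu]_(x in D) (1 * p n x + (-1) * g x) ^+ 2.
  by apply: eq_Rintegral => x _; rewrite mul1r mulN1r.
move: h1; rewrite E Rintegral_sqr_lin//.
have -> : \int[mu]_(x in D) (p n x * g x) = \int[mu]_(x in D) (g x * p n x).
  by apply: eq_Rintegral => x _; rewrite mulrC.
rewrite !expr1n sqrrN expr1n; rewrite mulr1 in hn; move: h2 h3 hn.
set X := Rintegral _ _ _; set Y := Rintegral _ _ _; set Z := Rintegral _ _ _; lra.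
Qed.

End riesz.
End square_integrable.

(** * Uniform continuity, Riemann sums and equicontinuity along an ultrafilter *)

Section uniform_continuity.
Context {R : realType} {X : pseudoMetricType R}.

Lemma compact_unif_continuous (K : set X) (f : X -> R) : compact K ->
  {within K, continuous f} -> forall e : R, 0 < e ->
  exists2 d : R, 0 < d & forall x y, K x -> K y -> ball x d y -> `|f x - f y| < e.
Proof.
move=> cK cf e e0.
pose P (d : R) (x : X) := K x -> forall y, K y -> ball x d y -> `|f x - f y| < e.
have : \forall d \near 0^'+, K `<=` P d.
  have /compact_near_coveringP := cK; apply => x Kx.
  have /(_ x) := (subspace_continuousP _ _).1 cf => /(_ Kx) /cvgrPdist_lt.
  move=> /(_ (e / 2)); rewrite divr_gt0// => /(_ isT).
  rewrite near_withinE => /nbhs_ballP[r /= r0 hr].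
  exists (ball x (r / 2), [set d | 0 < d < r / 2]).
    split => /=; first by apply: nbhsx_ballx; rewrite divr_gt0.
    near=> d; apply/andP; split; near: d; first exact: nbhs_right_gt.
    by apply: nbhs_right_lt; rewrite divr_gt0.
  move=> [z d] /= [xz /andP[d0 dr]] Kz y Ky zy.
  rewrite -(subrKA (f x)) (le_lt_trans (ler_normD _ _))//.
  rewrite [ltRHS](splitr e) ltrD// ?[`|f z - _|]distrC; apply: hr => //.
    by apply: le_ball xz; lra.
  apply: (@le_ball _ _ _ (r / 2 + d)); first by lra.
  exact: ball_triangle xz zy.
rewrite /at_right near_withinE => /nbhs_ballP[r /= r0 hr].
exists (r / 2); first by rewrite divr_gt0.
move=> x y Kx Ky xy; apply: (hr (r / 2) _ _ x Kx Kx y Ky xy).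
  by rewrite /ball/= sub0r normrN gtr0_norm; lra.
by rewrite divr_gt0.
Unshelve. all: by end_near. Qed.

End uniform_continuity.

Section truncation.
Context {R : realType}.
Implicit Types (x y h : R).

Lemma truncn_dist x y : (Num.truncn x)%:R - (Num.truncn y)%:R <= `|x - y| + 1 :> R.
Proof.
have [x0|x0] := ltP x 0.
  have -> : Num.truncn x = 0%N by rewrite truncn_floor leNgt x0.
  by rewrite sub0r (@le_trans _ _ 0)// ?oppr_le0 ?ler0n// addr_ge0.
have /andP[h1 _] := truncn_itv x0.
have h2 := truncnS_gt y; rewrite -natr1 in h2.
have := ler_norm (x - y); lra.
Qed.

Lemma truncn_mul n h : 0 < h -> Num.truncn (n%:R * h / h) = n.
Proof. by move=> h0; rewrite mulfK ?gt_eqF// natrK. Qed.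

Lemma truncn_div_itv x h : 0 < h -> 0 <= x ->
  (Num.truncn (x / h))%:R * h <= x < (Num.truncn (x / h))%:R * h + h.
Proof.
move=> h0 x0; have /andP[] := truncn_itv (divr_ge0 x0 (ltW h0)).
rewrite ler_pdivlMr// ltr_pdivrMr// -natr1 mulrDl mul1r => -> ->//.
Qed.

End truncation.

Section riemann_sums.
Context {R : realType}.
Notation leb := (@lebesgue_measure R).
Implicit Types (f : R -> R) (h L e : R).

Lemma Rintegral_cells f h n : 0 <= h -> continuous f ->
  \int[leb]_(x in `[0, n%:R * h]) f x =
  \sum_(i < n) \int[leb]_(x in `[i%:R * h, i.+1%:R * h]) f x.
Proof.
move=> h0 cf; elim: n => [|n IH]; first by rewrite big_ord0 mul0r Rintegral_point.
rewrite big_ord_recr /= -IH; apply: Rintegral_split.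
- by rewrite mulr_ge0.
- by rewrite ler_wpM2r// ler_nat.
- exact: integrable_continuous.
Qed.

Lemma riemann_sum_cells f h n e : 0 <= h -> continuous f ->
  (forall (i : nat) x, (i < n)%N -> i%:R * h <= x <= i.+1%:R * h ->
     `|f (i%:R * h) - f x| <= e) ->
  `|\sum_(i < n) h * f (i%:R * h) - \int[leb]_(x in `[0, n%:R * h]) f x|
    <= n%:R * h * e.
Proof.
move=> h0 cf fe; rewrite Rintegral_cells// -sumrB.
apply: le_trans (ler_norm_sum _ _ _) _.
apply: (@le_trans _ _ (\sum_(i < n) h * e)); last first.
  by rewrite sumr_const card_ord -[leLHS]mulr_natl mulrA.
apply: ler_sum => i _.
have ii : i%:R * h <= i.+1%:R * h by rewrite ler_wpM2r// ler_nat.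
have hh : i.+1%:R * h - i%:R * h = h by rewrite -natr1; ring.
have -> : h * f (i%:R * h) = \int[leb]_(x in `[i%:R * h, i.+1%:R * h]) f (i%:R * h).
  by rewrite Rintegral_itv_cst// hh mulrC.
have ic : leb.-integrable `[i%:R * h, i.+1%:R * h] (EFin \o (fun=> f (i%:R * h))).
  by apply: integrable_continuous => x; exact: cvg_cst.
have iF : leb.-integrable `[i%:R * h, i.+1%:R * h] (EFin \o f).
  exact: integrable_continuous.
rewrite -RintegralB//.
apply: le_trans (Rintegral_itv_bound (M := e) ii _ _) _.
- exact: integrableRB.
- by move=> x xi; exact: fe.
- by rewrite hh mulrC.
Qed.

End riemann_sums.

Section ascoli.
Context {R : realType}.
Variable F : set_system nat.
Hypothesis FU : UltraFilter F.
Local Instance FF : ProperFilter F := @ultra_proper _ _ FU.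

Lemma filter_forall_seq (I : eqType) (r : seq I) (P : I -> nat -> Prop) :
  (forall i, i \in r -> F [set n | P i n]) -> F [set n | forall i, i \in r -> P i n].
Proof.
elim: r => [|i r IH] h; first by apply: filterE.
have h1 : F [set n | P i n] by apply: h; rewrite mem_head.
have h2 : F [set n | forall j, j \in r -> P j n].
  by apply: IH => j jr; apply: h; rewrite in_cons jr orbT.
apply: filterS2 h1 h2 => n /= Pi Pr j; rewrite in_cons => /predU1P[->//|].
exact: Pr.
Qed.

(* Along an ultrafilter no subsequence has to be extracted. *)
Lemma ultra_ascoli (f : nat -> R * R -> R) :
  (forall p, exists C : R, forall n, `|f n p| <= C) ->
  (forall e : R, 0 < e -> exists2 d : R, 0 < d &
     F [set n | forall p q, `|p.1 - q.1| <= d -> `|p.2 - q.2| <= d ->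
       `|f n p - f n q| <= e]) ->
  exists g : R * R -> R, [/\ forall p, f n p @[n --> F] --> g p,
    (forall e : R, 0 < e -> exists2 d : R, 0 < d & forall p q,
       `|p.1 - q.1| <= d -> `|p.2 - q.2| <= d -> `|g p - g q| <= e) &
    (forall L e : R, 0 <= L -> 0 < e -> F [set n | forall p,
       0 <= p.1 <= L -> 0 <= p.2 <= L -> `|f n p - g p| <= e])].
Proof.
move=> bf ef.
have /choice[g hg] : forall p, exists l : R, f n p @[n --> F] --> l.
  by move=> p; have [C hC] := bf p; exact: ultra_cvg FU hC.
have ug : forall e : R, 0 < e -> exists2 d : R, 0 < d & forall p q,
    `|p.1 - q.1| <= d -> `|p.2 - q.2| <= d -> `|g p - g q| <= e.
  move=> e e0; have [d d0 hd] := ef e e0; exists d => // p q h1 h2.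
  have c : `|f n p - f n q| @[n --> F] --> `|g p - g q|.
    by apply: cvg_norm; apply: cvgB; exact: hg.
  apply: (cvgr_to_le c); apply: filterS hd => n; exact.
exists g; split => // L e L0 e0.
have e3 : 0 < e / 3 by rewrite divr_gt0.
have [d1 d10 hd1] := ef _ e3; have [d2 d20 hd2] := ug _ e3.
pose d := Num.min d1 d2; have d0 : 0 < d by rewrite lt_min d10.
pose m := (Num.truncn (L / d)).+1.
(* A finite grid of mesh [d] suffices: finitely many pointwise convergences hold on one common set
   of the filter, and equicontinuity fills the cells. *)
pose r := [seq (i%:R * d, j%:R * d) | i <- iota 0 m, j <- iota 0 m].
have hr : F [set n | forall p, p \in r -> `|f n p - g p| <= e / 3].
  apply: filter_forall_seq => p _.
  have := hg p => /cvgrPdist_le /(_ _ e3); apply: filterS => n /=.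
  by rewrite distrC.
apply: filterS2 hd1 hr => n /= h1 h2 [x y] /= /[dup] xL /andP[x0 xL'] /andP[y0 yL'].
pose p := ((Num.truncn (x / d))%:R * d, (Num.truncn (y / d))%:R * d).
have pr : p \in r.
  have mi z : z <= L -> Num.truncn (z / d) \in iota 0 m.
    move=> zL; rewrite mem_iota add0n ltnS; apply: le_truncn.
    by rewrite ler_pM2r ?invr_gt0.
  by apply/allpairsP; exists (Num.truncn (x / d), Num.truncn (y / d)); split;
    [exact: mi|exact: mi|].
have /andP[a1 a2] := truncn_div_itv d0 x0; have /andP[b1 b2] := truncn_div_itv d0 y0.
have near1 : `|x - p.1| <= d by rewrite ger0_norm /p/=; lra.
have near2 : `|y - p.2| <= d by rewrite ger0_norm /p/=; lra.
have [dd1 dd2] : d <= d1 /\ d <= d2 by rewrite /d; split; rewrite ge_min lexx ?orbT.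
have A := h1 (x, y) p (le_trans near1 dd1) (le_trans near2 dd1).
have B := h2 p pr.
have C := hd2 (x, y) p (le_trans near1 dd2) (le_trans near2 dd2).
apply: le_trans (ler_distD (f n p) _ _) _.
apply: le_trans (lerD (lexx _) (ler_distD (g p) _ _)) _.
rewrite [`|g p - _|]distrC; lra.
Qed.

End ascoli.

(** * Square-integrable functions on a subset, and samples of the data *)

Section Lfun_sqint.
Context d (T : measurableType d) (R : realType) (mu : {measure set T -> \bar R}).
Variable D : set T.
Hypothesis mD : measurable D.
Implicit Types (f g : T -> R).

Lemma sqr_restrict f : (fun x => (f \_ D) x ^+ 2) = (fun x => f x ^+ 2) \_ D.
Proof. by apply/funext => x; rewrite !patchE; case: ifP => // _; rewrite expr0n. Qed.

Lemma integrable_restrictT f :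
  mu.-integrable D (EFin \o f) <-> mu.-integrable setT (EFin \o (f \_ D)).
Proof.
have h := integrable_mkcond (EFin \o f) mD.
by rewrite -restrict_EFin.
Qed.

Lemma sqint_of_Lfun f : f \_ D \in Lfun mu 2%:E -> sqint mu D f.
Proof.
move=> fD; have mf : measurable_fun D f.
  move: fD; rewrite inE => /andP[+ _]; rewrite inE/= => mf.
  exact/(measurable_restrictT _ mD).
split => //; apply/integrable_restrictT.
by have := Lfun2_integrable_sqr fD; rewrite sqr_restrict.
Qed.

Lemma Lnorm2_restrict f : sqint mu D f ->
  Lnorm mu 2%:E (EFin \o (f \_ D)) = (Num.sqrt (\int[mu]_(x in D) f x ^+ 2))%:E.
Proof.
move=> [mf f2]; rewrite unlock /=.
rewrite (_ : (\int[mu]_x _)%E = (\int[mu]_(x in D) f x ^+ 2)%:E).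
  rewrite poweR_EFin; congr EFin.
  by rewrite powR12_sqrt// Rintegral_ge0// => x _; exact: sqr_ge0.
rewrite /Rintegral fineK; last exact: integrable_fin_num f2.
rewrite [RHS]integral_mkcond; apply: eq_integral => x _.
rewrite /= !patchE; case: ifP => _; rewrite ?normr0.
  by rewrite powR_mulrn// real_normK// num_real.
by rewrite powR0.
Qed.

Lemma Lfun_of_sqint f : sqint mu D f -> f \_ D \in Lfun mu 2%:E.
Proof.
move=> sf; rewrite inE; apply/andP; split; rewrite inE/=.
  exact/(measurable_restrictT _ mD)/sf.1.
by rewrite /finite_norm Lnorm2_restrict// ltry.
Qed.

Lemma Lfun_pinfty_of_bounded f (M : R) : measurable_fun D f ->
  (forall x, D x -> `|f x| <= M) -> f \_ D \in Lfun mu +oo%E.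
Proof.
move=> mf fM; rewrite inE; apply/andP; split; rewrite inE/=.
  exact/(measurable_restrictT _ mD).
rewrite /finite_norm unlock /=; case: ifPn => // _.
apply: (@le_lt_trans _ _ (`|M|%:E)); last exact: ltry.
apply/ess_sup_inf.ess_supP; apply: aeW => x /=.
rewrite lee_fin patchE; case: ifPn => [|_]; last by rewrite normr0.
by rewrite inE => Dx; rewrite (le_trans (fM x Dx))// ler_norm.
Qed.

End Lfun_sqint.

Section interval_data.
Context {R : realType}.
Notation leb := (@lebesgue_measure R).
Implicit Types (f g : R -> R) (a b x y : R).

Lemma integrable_oo_cc f a b :
  leb.-integrable `]a, b[ (EFin \o f) -> leb.-integrable `[a, b] (EFin \o f).
Proof.
move=> /integrableP[mf fi].
have mf' : measurable_fun `]a, b[ f by exact/measurable_EFinP.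
apply/integrableP; split.
  apply/measurable_EFinP; exact: measurable_fun_itv_cc mf'.
rewrite integral_itv_bndoo//; apply/measurable_EFinP.
exact: measurableT_comp.
Qed.

Lemma sqint_oo_cc f a b : sqint leb `]a, b[ f -> sqint leb `[a, b] f.
Proof.
by move=> [mf f2]; split; [exact: measurable_fun_itv_cc mf|exact: integrable_oo_cc].
Qed.

Lemma sqint_cc_oo f a b : sqint leb `[a, b] f -> sqint leb `]a, b[ f.
Proof.
move=> [mf f2]; split; first by apply: measurable_funS mf => //; exact: subset_itv_oo_cc.
by apply: integrableS f2 => //; exact: subset_itv_oo_cc.
Qed.

Lemma sqint_itv_integrable f a b : sqint leb `[a, b] f ->
  leb.-integrable `[a, b] (EFin \o f).
Proof.
move=> [mf f2]; apply: (@integrable_le _ _ _ leb `[a, b]%classic f (fun x => 1 + f x ^+ 2)) => //.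
- move=> x _; rewrite -(@real_normK _ (f x)) ?num_real//.
  have := sqr_ge0 (`|f x| - 1); have := sqr_ge0 (`|f x|); rewrite !expr2; lra.
- by apply: integrableRD => //; apply: integrable_continuous => x; exact: cvg_cst.
Qed.

Lemma sqr_Rintegral_le f a b : a <= b -> sqint leb `[a, b] f ->
  (\int[leb]_(x in `[a, b]) f x) ^+ 2 <= (b - a) * \int[leb]_(x in `[a, b]) f x ^+ 2.
Proof.
rewrite le_eqVlt => /predU1P[->|ab sf]; first by rewrite !Rintegral_point expr0n subrr mul0r.
have sc : sqint leb `[a, b] (fun=> 1 : R).
  split => //; rewrite expr1n; apply: integrable_continuous => x; exact: cvg_cst.
have ba : 0 < b - a by rewrite subr_gt0.
set I := \int[leb]_(x in `[a, b]) f x.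
have := @Rintegral_sqr_lin _ _ _ leb `[a, b]%classic (measurable_itv _) f (fun=> 1) (b - a) (- I) sf sc.
move=> E.
have : 0 <= \int[leb]_(x in `[a, b]) ((b - a) * f x + - I * 1) ^+ 2.
  by apply: Rintegral_ge0 => x _; exact: sqr_ge0.
rewrite E expr1n Rintegral_itv_cst ?(ltW ab)// mul1r.
have -> : \int[leb]_(x in `[a, b]) (f x * 1) = I by apply: eq_Rintegral => x _; rewrite mulr1.
set Q := \int[leb]_(x in `[a, b]) f x ^+ 2.
move=> hh; rewrite -subr_ge0 -(pmulr_rge0 _ ba); apply: le_trans hh _.
by rewrite le_eqVlt; apply/orP; left; apply/eqP; ring.
Qed.

Definition clamp a b x : R := Num.max a (Num.min b x).

Lemma clamp_itv a b x : a <= b -> a <= clamp a b x <= b.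
Proof. by move=> ab; rewrite /clamp le_max lexx ge_max ab ge_min lexx. Qed.

Lemma clamp_id a b x : a <= x <= b -> clamp a b x = x.
Proof. by move=> /andP[ax xb]; rewrite /clamp min_r// max_r. Qed.

Lemma clamp_le a b x y : x <= y -> clamp a b x <= clamp a b y.
Proof.
by move=> xy; rewrite /clamp ge_max le_max lexx/= le_max le_min !ge_min lexx xy !orbT.
Qed.

Lemma clamp_dist a b x y : `|clamp a b x - clamp a b y| <= `|x - y|.
Proof.
wlog xy : x y / x <= y.
  move=> H; case/orP: (le_total x y) => [/H //|/H].
  by rewrite distrC [`|y - x|]distrC.
rewrite distrC [leRHS]distrC !ger0_norm ?subr_ge0 ?clamp_le//.
rewrite /clamp !maxEle !minEle; do 4 case: ifPn; rewrite -?ltNge => *; lra.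
Qed.

Lemma continuous_clamp a b : continuous (clamp a b).
Proof.
move=> x; apply/cvgrPdist_le => e e0; near=> y.
apply: le_trans (clamp_dist _ _ _ _) _; near: y.
by apply: cvgr_dist_le => //; exact: cvg_id.
Unshelve. all: by end_near. Qed.

Lemma continuous_comp_clamp f a b : a <= b -> {within `[a, b], continuous f} ->
  continuous (f \o clamp a b).
Proof.
move=> ab cf x; apply/cvgrPdist_lt => e e0.
have [d d0 hd] := compact_unif_continuous (@segment_compact R a b) cf e0.
near=> y; apply: hd => /=; rewrite ?in_itv/= ?clamp_itv//.
rewrite /ball/=; apply: le_lt_trans (clamp_dist _ _ _ _) _; near: y.
by apply: cvgr_dist_lt => //; exact: cvg_id.
Unshelve. all: by end_near. Qed.

(** The clamped times are still nondecreasing, so the increments are taken over adjacent intervals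
    within [[a, b]]. *)
Lemma variation_clamp f g a b (t : nat -> R) K : a <= b ->
  leb.-integrable `[a, b] (EFin \o g) ->
  (forall p q, a <= p -> p <= q -> q <= b -> f q - f p = \int[leb]_(x in `[p, q]) g x) ->
  (forall k, t k <= t k.+1) ->
  \sum_(k < K) `|f (clamp a b (t k.+1)) - f (clamp a b (t k))| <=
    \int[leb]_(x in `[a, b]) `|g x|.
Proof.
move=> ab ig fg tle.
have ing : leb.-integrable `[a, b] (EFin \o (fun x => `|g x|)) by exact: integrable_norm.
have bound (x : R) : a <= x <= b -> \int[leb]_(y in `[a, x]) `|g y| <= \int[leb]_(y in `[a, b]) `|g y|.
  move=> /andP[ax xb]; rewrite [leRHS](Rintegral_split ax xb)// lerDl.
  exact: Rintegral_itv_ge0.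
suff H : \sum_(k < K) `|f (clamp a b (t k.+1)) - f (clamp a b (t k))| <=
    \int[leb]_(x in `[a, clamp a b (t K)]) `|g x|.
  by apply: le_trans H _; apply: bound; exact: clamp_itv.
elim: K => [|K IH]; first by rewrite big_ord0; apply: Rintegral_itv_ge0 => x _.
rewrite big_ord_recr /=.
have /andP[h1 h2] := clamp_itv (t K) ab; have /andP[h3 h4] := clamp_itv (t K.+1) ab.
have h5 := clamp_le a b (tle K).
rewrite (Rintegral_split h1 h5); last exact: integrable_itvS ing.
rewrite lerD// fg//; apply: le_normr_Rintegral => //.
exact: integrable_itvS ig.
Qed.

(** Cauchy-Schwarz on each cell. *)
Lemma dirichlet_samples f g h n : 0 < h ->
  sqint leb `[0, n%:R * h] g ->
  (forall p q, 0 <= p -> p <= q -> q <= n%:R * h -> f q - f p = \int[leb]_(x in `[p, q]) g x) ->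
  \sum_(j < n) (f (j.+1%:R * h) - f (j%:R * h)) ^+ 2 <=
    h * \int[leb]_(x in `[0, n%:R * h]) g x ^+ 2.
Proof.
move=> h0 sg fg.
suff H m : (m <= n)%N -> \sum_(j < m) (f (j.+1%:R * h) - f (j%:R * h)) ^+ 2 <=
    h * \int[leb]_(x in `[0, m%:R * h]) g x ^+ 2 by exact: H.
elim: m => [|m IH] mn; first by rewrite big_ord0 mul0r Rintegral_point mulr0.
have m0 : 0 <= m%:R * h by rewrite mulr_ge0// ltW.
have mm : m%:R * h <= m.+1%:R * h by rewrite ler_pM2r// ler_nat.
have mN : m.+1%:R * h <= n%:R * h by rewrite ler_pM2r// ler_nat.
rewrite big_ord_recr /= (Rintegral_split m0 mm); last first.
  exact: integrable_itvS (lexx _) mN sg.2.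
rewrite mulrDr; apply: lerD; first exact/IH/ltnW.
rewrite fg//; have e : m.+1%:R * h - m%:R * h = h by rewrite -natr1; ring.
rewrite -[X in _ <= X * _]e; apply: sqr_Rintegral_le => //; split.
  by apply: measurable_funS sg.1 => //; exact: subset_itv.
exact: integrable_itvS sg.2.
Qed.

End interval_data.

(** * Integration in the plane *)

Section finite_part.
Context d (T : measurableType d) (R : realType) (mu : {measure set T -> \bar R}).

Lemma integrable_fine (D : set T) (g : T -> \bar R) : measurable D ->
  mu.-integrable D g -> mu.-integrable D (EFin \o (fine \o g)) /\
  (\int[mu]_(x in D) (fine (g x))%:E = \int[mu]_(x in D) g x)%E.
Proof.
move=> mD ig; have mg := measurable_int _ ig.
have mf : measurable_fun D (EFin \o (fine \o g)).
  by apply/measurable_EFinP; apply: measurableT_comp mg; exact: fine_measurable.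
split.
  apply: (le_integrable mD mf _ ig) => x _ /=; case: (g x) => [r| |] //=.
  - by rewrite normr0 leey.
  - by rewrite normr0 leey.
apply: ae_eq_integral => //.
by apply: ae_mono (integrable_ae mD ig) => x h Dx /=; rewrite fineK// h.
Qed.

End finite_part.

Section ae_comparison.
Context d (T : measurableType d) (R : realType) (mu : {measure set T -> \bar R}).

Lemma ae_le_Rintegral (D : set T) (f g : T -> R) : measurable D ->
  mu.-integrable D (EFin \o f) -> mu.-integrable D (EFin \o g) ->
  {ae mu, forall x, D x -> f x <= g x} ->
  \int[mu]_(x in D) f x <= \int[mu]_(x in D) g x.
Proof.
move=> mD i_f ig fg.
have /measurable_EFinP mf := measurable_int _ i_f.
have /measurable_EFinP mg := measurable_int _ ig.
have mm : measurable_fun D (fun x => Num.min (f x) (g x)) by exact: measurable_minr.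
have -> : \int[mu]_(x in D) f x = \int[mu]_(x in D) Num.min (f x) (g x).
  by apply: ae_eq_Rintegral => //; apply: ae_mono fg => x h /h /min_idPl.
apply: le_Rintegral => //; last by move=> x _; rewrite ge_min lexx orbT.
apply: (integrable_le (g := fun x => `|f x| + `|g x|)) => //; last first.
  by apply: integrableRD => //; exact: integrable_norm.
move=> x _; rewrite /Num.min; case: ifP => _; first by rewrite lerDl.
by rewrite lerDr.
Qed.

End ae_comparison.

Lemma integrable_fubini_G d1 d2 (T1 : measurableType d1) (T2 : measurableType d2) (R : realType)
  (m1 : {sigma_finite_measure set T1 -> \bar R}) (m2 : {sigma_finite_measure set T2 -> \bar R})
  (f : T1 * T2 -> \bar R) : (m1 \x m2)%E.-integrable setT f ->
  m2.-integrable setT (fubini_G m1 f).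
Proof.
move=> i_f; have mf := measurable_int _ i_f.
apply/integrableP; split; first exact: measurable_fubini_G i_f.
apply: le_lt_trans ((integrable21ltyP m1 m2 mf).1 i_f).
apply: ge0_le_integral => //.
- by apply: measurableT_comp => //; exact: measurable_fubini_G i_f.
- apply: (measurable_fun_fubini_tonelli_G (m1 := m1) (abse \o f)) => //=.
  exact: measurableT_comp.
- move=> y _; apply: le_abse_integral => //.
  exact: (measurableT_comp mf (pair2_measurable y)).
Qed.

Section plane.
Context {R : realType}.
Notation leb := (@lebesgue_measure R).
Notation leb2 := (@leb2 R).

Lemma continuous_slice1 (f : R * R -> R) (y : R) : continuous f -> continuous (fun x => f (x, y)).
Proof.
move=> cf x; have h : ((x0, y) @[x0 --> x] --> (x, y)) by exact: (cvg_pair cvg_id (cvg_cst _)).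
exact: (cvg_comp _ _ h (cf _)).
Qed.

Lemma continuous_slice2 (f : R * R -> R) (x : R) : continuous f -> continuous (fun y => f (x, y)).
Proof.
move=> cf y; have h : ((x, y0) @[y0 --> y] --> (x, y)) by exact: (cvg_pair (cvg_cst _) cvg_id).
exact: (cvg_comp _ _ h (cf _)).
Qed.

(** Rounding the second coordinate down to a multiple of [1 / (n + 1)] gives functions whose
    preimages are countable unions of rectangles; they converge pointwise by continuity in the
    second variable. *)
Lemma measurable_continuous2 (f : R * R -> R) : continuous f -> measurable_fun setT f.
Proof.
move=> cf; pose g n (p : R * R) := f (p.1, (Num.floor (n.+1%:R * p.2))%:~R / n.+1%:R).
apply: (@measurable_fun_cvg _ _ _ setT (g : nat -> _)) => //.
  move=> n _ A mA; rewrite setTI.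
  pose r (k : int) := [set x : R | A (f (x, k%:~R / n.+1%:R))] `*`
     [set y : R | k%:~R / n.+1%:R <= y < (k + 1)%:~R / n.+1%:R].
  have rE (y : R) (k : int) : (k%:~R / n.+1%:R <= y < (k + 1)%:~R / n.+1%:R) =
      (Num.floor (n.+1%:R * y) == k).
    by rewrite ler_pdivrMr// ltr_pdivlMr// mulrC; apply/idP/eqP => [/Num.Theory.floor_def//|<-];
      exact: Num.Theory.floor_itv.
  rewrite (_ : _ @^-1` _ = \bigcup_k (r k)).
    apply: countable_bigcupT_measurable => [|k]; first exact: countableP.
    apply: measurableX.
      rewrite -[X in measurable X]setTI.
      apply: (@continuous_measurable_fun R (fun x => f (x, k%:~R / n.+1%:R))) => //.
      exact: continuous_slice1.
    rewrite (_ : [set y : R | _] = `[k%:~R / n.+1%:R, (k + 1)%:~R / n.+1%:R[%classic); first exact: measurable_itv.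
    by apply/seteqP; split => y /=; rewrite in_itv.
  apply/seteqP; split => [p /= Ap|p [k _ [/=]]].
    by exists (Num.floor (n.+1%:R * p.2)) => //; split => //=; rewrite rE.
  by move=> Ak; rewrite rE /g => /eqP ->.
move=> p _; rewrite /g.
have -> : f p = f (p.1, p.2) by case: p.
have c2 : {for p.2, continuous (fun y => f (p.1, y))}.
  exact: continuous_slice2.
apply: (@cvg_comp _ _ _ (fun n : nat => (Num.floor (n.+1%:R * p.2))%:~R / n.+1%:R)
  (fun y => f (p.1, y)) _ (nbhs p.2)); last exact: c2.
apply/cvgrPdist_le => e e0; near=> n.
have /andP[h1 h2] := Num.Theory.floor_itv (n.+1%:R * p.2).
have h : (Num.floor (n.+1%:R * p.2))%:~R / n.+1%:R <= p.2.
  by rewrite ler_pdivrMr// [leRHS]mulrC.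
rewrite ger0_norm ?subr_ge0// lerBlDr.
apply: (@le_trans _ _ ((Num.floor (n.+1%:R * p.2) + 1)%:~R / n.+1%:R)).
  by rewrite ler_pdivlMr// mulrC ltW.
rewrite intrD mulrDl addrC lerD2r div1r invf_ple// ?posrE//.
apply: (@le_trans _ _ n%:R); last by rewrite ler_nat.
by near: n; exact: nbhs_infty_ger.
Unshelve. all: by end_near. Qed.

Variables (s : R -> R) (T : R).
Hypothesis cs : continuous s.

Lemma measurable_Q : measurable (Q s T).
Proof.
rewrite (_ : Q s T = (`]0, T[ `*` setT) `&`
  ((fun p => 0 < p.2) @^-1` [set true] `&` (fun p => p.2 < s p.1) @^-1` [set true])).
  apply: measurableI; first exact: measurableX.
  have ms : measurable_fun setT (s \o @fst R R).
    by apply: measurableT_comp; [exact: continuous_measurable_fun|exact: measurable_fst].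
  apply: measurableI; rewrite -[X in measurable X]setTI.
    by apply: measurable_fun_ltr => //; exact: measurable_snd.
  by apply: measurable_fun_ltr => //; exact: measurable_snd.
apply/seteqP; split => p; rewrite /Q /=.
  by move=> [h1 /andP[h2 h3]]; rewrite in_itv.
by rewrite in_itv /= => -[[h1 _] [-> ->]].
Qed.
Hint Resolve measurable_Q : core.

Lemma Rintegral_oo_cc (f : R -> R) (a b : R) : measurable_fun `]a, b[ f ->
  \int[leb]_(x in `]a, b[) f x = \int[leb]_(x in `[a, b]) f x.
Proof.
move=> mf; have [ab|ab] := ltP a b; last first.
  rewrite set_itv_ge ?Rintegral_set0 -?leNgt ?bnd_simp//.
  move: ab; rewrite le_eqVlt => /orP[/eqP ->|ab]; first by rewrite Rintegral_point.
  by rewrite set_itv_ge ?Rintegral_set0// bnd_simp -ltNge.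
rewrite /Rintegral integral_itv_bndo_bndc; last exact/measurable_EFinP.
rewrite integral_itv_obnd_cbnd//.
move/measurable_EFinP : mf => mf.
have -> : `]a, b]%classic = `]a, b[%classic `|` [set b].
  by apply/seteqP; split => y /=; rewrite !in_itv/=; [move=> /andP[-> yb]; rewrite (lt_neqAle y); case: eqP => [->|_]; [right|left]|case => [/andP[-> /ltW]|->]; rewrite ?ab ?lexx].
apply/measurable_funU => //; split => //; exact: measurable_fun_set1.
Qed.

(* [h] is [k] cut off outside a region bounded by two graphs. *)
Lemma iterated_integral (h k : R -> R -> R) (a b : R) (c d : R -> R) :
  (forall t, measurable_fun setT (h t)) ->
  (forall t y, h t y = if a < t < b then ((k t) \_ `]c t, d t[) y else 0) ->
  {ae leb, forall t, leb.-integrable setT (EFin \o h t)} ->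
  leb.-integrable setT (fun t => \int[leb]_y (h t y)%:E)%E ->
  [/\ {ae leb, forall t, a < t < b -> leb.-integrable `[c t, d t] (EFin \o k t)},
      leb.-integrable `[a, b] (EFin \o (fun t => \int[leb]_(y in `[c t, d t]) k t y)) &
      (\int[leb]_t \int[leb]_y (h t y)%:E =
        (\int[leb]_(t in `[a, b]) \int[leb]_(y in `[c t, d t]) k t y)%:E)%E].
Proof.
move=> mh hE A B.
have A' : {ae leb, forall t, a < t < b -> leb.-integrable `[c t, d t] (EFin \o k t)}.
  apply: ae_mono A => t ht tT; apply: integrable_oo_cc; apply/integrable_restrictT => //.
  by apply: eq_integrable ht => // y _; rewrite /= hE tT.
have KE t : fine (\int[leb]_y (h t y)%:E)%E =
    ((fun t => \int[leb]_(y in `[c t, d t]) k t y) \_ `]a, b[) t.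
  rewrite patchE; case: ifPn; rewrite ?mem_setE ?in_itv/= => tT.
    rewrite -Rintegral_oo_cc.
      rewrite /Rintegral [in RHS]integral_mkcond; congr fine; apply: eq_integral => y _.
      by rewrite hE tT !patchE; case: ifP.
    have : measurable_fun `]c t, d t[ (h t) by exact: measurable_funTS (mh t).
    apply: eq_measurable_fun => y; rewrite inE/= in_itv/= => ys.
    by rewrite hE tT patchE mem_setE in_itv/= ys.
  rewrite integral0_eq// => y _; rewrite hE (negbTE tT)//.
have BK : leb.-integrable setT (EFin \o ((fun t => \int[leb]_(y in `[c t, d t]) k t y) \_ `]a, b[)).
  have [+ _] := integrable_fine measurableT B; apply: eq_integrable => // t _.
  by rewrite /= KE.
have BK' : leb.-integrable `]a, b[ (EFin \o (fun t => \int[leb]_(y in `[c t, d t]) k t y)).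
  exact/integrable_restrictT.
have BK2 := integrable_oo_cc BK'.
split => //.
rewrite -Rintegral_oo_cc; last by apply/measurable_EFinP; exact: measurable_int BK'.
rewrite /Rintegral fineK; last exact: integrable_fin_num.
rewrite -(integrable_fine measurableT B).2 [in RHS]integral_mkcond.
by apply: eq_integral => t _; rewrite KE !patchE; case: ifP.
Qed.

Lemma Fubini_Q (k : R * R -> R) : leb2.-integrable (Q s T) (EFin \o k) ->
  [/\ {ae leb, forall t, 0 < t < T -> leb.-integrable `[0, s t] (EFin \o (fun y => k (t, y)))},
      leb.-integrable `[0, T] (EFin \o (fun t => \int[leb]_(y in `[0, s t]) k (t, y))) &
      \int[leb2]_(p in Q s T) k p =
        \int[leb]_(t in `[0, T]) \int[leb]_(y in `[0, s t]) k (t, y)].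
Proof.
move=> ik; pose h := k \_ (Q s T).
have ih : leb2.-integrable setT (EFin \o h) by exact: (@integrable_restrictT _ _ R leb2 (Q s T) measurable_Q k).1 ik.
have /measurable_EFinP mh := measurable_int _ ih.
have QE t y : ((t, y) \in Q s T) = (0 < t < T) && (0 < y < s t).
  by apply/idP/idP; rewrite inE /Q/=; [move=> [-> ->]|move=> /andP[]].
have [||||A B C] := @iterated_integral (fun t y => h (t, y)) (fun t y => k (t, y)) 0 T (fun=> 0) s.
- by move=> t; exact: (measurableT_comp mh (pair1_measurable t)).
- by move=> t y; rewrite /h !patchE QE mem_setE in_itv/=; case: (0 < t < T).
- exact: ae_integrable1 ih.
- exact: integrable_fubini_F ih.
split => //.
have E : (\int[leb]_t \int[leb]_y (h (t, y))%:E = \int[leb2]_z (h z)%:E)%E by exact: integral12_prod_meas1 ih.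
rewrite /Rintegral integral_mkcond (_ : (\int[leb2]_z _ = \int[leb2]_z (h z)%:E)%E).
  by rewrite -E C.
by apply: eq_integral => z _; rewrite /h !patchE; case: ifP.
Qed.

Lemma Fubini_rect (k : R * R -> R) (t1 t2 z : R) :
  leb2.-integrable (`]t1, t2[%classic `*` `]0, z[%classic) (EFin \o k) ->
  [/\ {ae leb, forall t, t1 < t < t2 -> leb.-integrable `[0, z] (EFin \o (fun y => k (t, y)))},
      leb.-integrable `[t1, t2] (EFin \o (fun t => \int[leb]_(y in `[0, z]) k (t, y))),
      {ae leb, forall y, 0 < y < z -> leb.-integrable `[t1, t2] (EFin \o (fun t => k (t, y)))},
      leb.-integrable `[0, z] (EFin \o (fun y => \int[leb]_(t in `[t1, t2]) k (t, y))) &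
      \int[leb]_(t in `[t1, t2]) \int[leb]_(y in `[0, z]) k (t, y) =
      \int[leb]_(y in `[0, z]) \int[leb]_(t in `[t1, t2]) k (t, y)].
Proof.
set D := _ `*` _; have mD : measurable D by exact: measurableX.
move=> ik; pose h := k \_ D.
have ih : leb2.-integrable setT (EFin \o h) by exact: (@integrable_restrictT _ _ R leb2 D mD k).1 ik.
have /measurable_EFinP mh := measurable_int _ ih.
have DE t y : ((t, y) \in D) = (t1 < t < t2) && (0 < y < z).
  apply/idP/idP; rewrite inE /D/= !in_itv/=; first by move=> [-> ->].
  by move=> /andP[].
have [||||A B C] := @iterated_integral (fun t y => h (t, y)) (fun t y => k (t, y)) t1 t2 (fun=> 0) (fun=> z).
- by move=> t; exact: (measurableT_comp mh (pair1_measurable t)).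
- by move=> t y; rewrite /h !patchE DE mem_setE in_itv/=; case: (t1 < t < t2).
- exact: ae_integrable1 ih.
- exact: integrable_fubini_F ih.
have [||||A' B' C'] := @iterated_integral (fun y t => h (t, y)) (fun y t => k (t, y)) 0 z (fun=> t1) (fun=> t2).
- by move=> y; exact: (measurableT_comp mh (pair2_measurable y)).
- by move=> y t; rewrite /h !patchE DE mem_setE in_itv/= andbC; case: (0 < y < z).
- exact: ae_integrable2 ih.
- exact: integrable_fubini_G ih.
split => //; apply: EFin_inj; rewrite -C -C'; exact: Fubini ih.
Qed.

End plane.

(** * Absolute continuity and integration by parts *)

Section absolute_continuity.
Context {R : realType}.
Notation leb := (@lebesgue_measure R).
Implicit Types (f g k H V phi : R -> R) (a b p q x : R).

(** Stands in for [H' <= 0] when [H] has no derivative: over a fine partition the increments of [H]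
    sum to at most [e (V b - V a)], and [e] is arbitrary. [V] makes room for errors that are merely
    integrable in time. *)
Lemma le_of_increments H V a b : a <= b ->
  (forall e : R, 0 < e -> exists2 d : R, 0 < d & forall p q,
     a <= p -> p <= q -> q <= b -> q - p <= d -> H q - H p <= e * (V q - V p)) ->
  H b <= H a.
Proof.
move=> ab hH; rewrite -subr_le0.
have A (e : R) : 0 < e -> H b - H a <= e * (V b - V a).
  move=> e0; have [d d0 hd] := hH e e0.
  pose n := Num.truncn ((b - a) / d); pose t i := a + (b - a) * (i%:R / n.+1%:R).
  have t0 : t 0%N = a by rewrite /t mul0r mulr0 addr0.
  have tn : t n.+1 = b by rewrite /t divff// mulr1 addrC subrK.
  have tS i : t i.+1 - t i = (b - a) / n.+1%:R by rewrite /t -natr1; field.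
  have tle i : t i <= t i.+1 by rewrite -subr_ge0 tS divr_ge0// subr_ge0.
  have td i : t i.+1 - t i <= d.
    rewrite tS ler_pdivrMr// mulrC -ler_pdivrMr//; apply: ltW.
    exact: truncnS_gt.
  have ta i : a <= t i by elim: i => [|i IH]; [rewrite t0|exact: le_trans (tle i)].
  have tb i : (i <= n.+1)%N -> t i <= b.
    move=> hi; rewrite -tn /t lerD2l ler_wpM2l ?subr_ge0// ler_pM2r ?invr_gt0//.
    by rewrite ler_nat.
  have S i : (i <= n.+1)%N -> H (t i) - H a <= e * (V (t i) - V a).
    elim: i => [_|i IH hi]; first by rewrite t0 !subrr mulr0.
    have := IH (ltnW hi); have := hd _ _ (ta i) (tle i) (tb _ hi) (td i); lra.
  by have := S _ (leqnn _); rewrite tn.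
apply/ler_addgt0Pl => e e0; rewrite addr0.
pose v := `|V b - V a| + 1; have v0 : 0 < v by rewrite ltr_wpDl.
apply: le_trans (A (e / v) _) _; first exact: divr_gt0.
rewrite mulrAC ler_pdivrMr// ler_pM2l// (le_trans (ler_norm _))// lerDl//.
Qed.

Lemma continuous_itv_bound f a b : a <= b -> {within `[a, b], continuous f} ->
  exists2 A : R, 0 <= A & forall x, a <= x <= b -> `|f x| <= A.
Proof.
move=> ab cf; have cn : {within `[a, b], continuous (fun x => `|f x|)}.
  by move=> x; apply: (@continuous_comp _ _ _ (f : subspace _ -> R) (fun y => `|y|)); [exact: cf|exact: norm_continuous].
have [c _ hc] := EVT_max ab cn.
by exists `|f c| => // x xab; apply: hc; rewrite in_itv.
Qed.

(** The defect of the formula, as a function of the upper limit, has increments at most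
    [2 A (q - p)] times those of the primitive of [|g|], so it is constant by [le_of_increments].
    This covers an absolutely continuous [f] and a Lipschitz [phi]. *)
Lemma ac_by_parts_bounded f g phi dphi a b A : a <= b ->
  leb.-integrable `[a, b] (EFin \o g) ->
  (forall p q, a <= p -> p <= q -> q <= b -> f q - f p = \int[leb]_(x in `[p, q]) g x) ->
  leb.-integrable `[a, b] (EFin \o dphi) ->
  (forall p q, a <= p -> p <= q -> q <= b -> phi q - phi p = \int[leb]_(x in `[p, q]) dphi x) ->
  0 <= A -> (forall x, a <= x <= b -> `|dphi x| <= A) ->
  {within `[a, b], continuous f} -> {within `[a, b], continuous phi} ->
  \int[leb]_(x in `[a, b]) (g x * phi x) =
    f b * phi b - f a * phi a - \int[leb]_(x in `[a, b]) (f x * dphi x).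
Proof.
move=> ab ig fg id dp A0 hA cf cp.
have igp : leb.-integrable `[a, b] (EFin \o (fun x => g x * phi x)) by exact: integrable_itvM.
have ifd : leb.-integrable `[a, b] (EFin \o (fun x => f x * dphi x)).
  have -> : (fun x => f x * dphi x) = (fun x => dphi x * f x) by apply/funext => x; rewrite mulrC.
  exact: integrable_itvM.
have iag : leb.-integrable `[a, b] (EFin \o (fun x => `|g x|)) by exact: integrable_norm.
have phiA p q : a <= p -> p <= q -> q <= b -> `|phi q - phi p| <= A * (q - p).
  move=> ap pq qb; rewrite dp//.
  apply: Rintegral_itv_bound => //; first exact: integrable_itvS id.
  by move=> x /andP[px xq]; rewrite hA// (le_trans ap px) (le_trans xq qb).
pose V x := \int[leb]_(y in `[a, x]) `|g y|.
pose H x := f x * phi x - \int[leb]_(y in `[a, x]) (g y * phi y)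
   - \int[leb]_(y in `[a, x]) (f y * dphi y).
have key p q : a <= p -> p <= q -> q <= b ->
    `|H q - H p| <= 2 * A * (q - p) * (V q - V p).
  move=> ap pq qb; have aq := le_trans ap pq.
  have spq : (`[p, q]%classic : set R) `<=` `[a, b]%classic.
    by move=> y /=; rewrite !in_itv/= => /andP[py yq]; rewrite (le_trans ap py) (le_trans yq qb).
  have i1 h : leb.-integrable `[a, b] (EFin \o h) -> leb.-integrable `[p, q] (EFin \o h).
    exact: integrable_itvS.
  have spl h : leb.-integrable `[a, b] (EFin \o h) ->
      \int[leb]_(y in `[a, q]) h y - \int[leb]_(y in `[a, p]) h y = \int[leb]_(y in `[p, q]) h y.
    move=> ih; rewrite (Rintegral_split ap pq); first by rewrite addrC addKr.
    exact: integrable_itvS ih.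
  have -> : V q - V p = \int[leb]_(y in `[p, q]) `|g y| by exact: spl.
  have E1 : H q - H p = \int[leb]_(y in `[p, q]) (g y * (phi q - phi y)) +
      \int[leb]_(y in `[p, q]) (dphi y * (f p - f y)).
    pose s1 := fun y => phi q * g y; pose s2 := fun y => f p * dphi y.
    have is1 : leb.-integrable `[a, b] (EFin \o s1) by exact: integrableRZ.
    have is2 : leb.-integrable `[a, b] (EFin \o s2).
      exact: integrableRZ.
    have e1 : \int[leb]_(y in `[p, q]) (g y * (phi q - phi y)) =
        phi q * (f q - f p) - \int[leb]_(y in `[p, q]) (g y * phi y).
      rewrite fg// -RintegralZl//; last exact: i1.
      rewrite -RintegralB//; [|exact: i1|exact: i1].
      by apply: eq_Rintegral => y _; rewrite mulrBr [g y * phi q]mulrC.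
    have e2 : \int[leb]_(y in `[p, q]) (dphi y * (f p - f y)) =
        f p * (phi q - phi p) - \int[leb]_(y in `[p, q]) (f y * dphi y).
      rewrite dp// -RintegralZl//; last exact: i1.
      rewrite -RintegralB//; [|exact: i1|exact: i1].
      by apply: eq_Rintegral => y _; rewrite mulrBr [dphi y * f p]mulrC [dphi y * f y]mulrC.
    rewrite e1 e2 -(spl _ igp) -(spl _ ifd) /H; ring.
  have gpq : \int[leb]_(y in `[p, q]) `|g y| >= 0 by apply: Rintegral_itv_ge0.
  have b1 : `|\int[leb]_(y in `[p, q]) (g y * (phi q - phi y))| <=
      A * (q - p) * \int[leb]_(y in `[p, q]) `|g y|.
    have i3 : leb.-integrable `[p, q] (EFin \o (fun y => g y * (phi q - phi y))).
      apply: integrable_itvM; first exact: i1.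
      have cpq : {within `[p, q], continuous phi} by apply: continuous_subspaceW cp.
      by move=> y; apply: cvgB; [exact: cvg_cst|exact: cpq].
    apply: le_trans (le_normr_Rintegral _ i3) _ => //.
    rewrite -RintegralZl//; last exact: i1.
    apply: le_Rintegral => //; first exact: (integrable_norm i3).
      by apply: integrableRZ => //; exact: i1.
    move=> y; rewrite /= in_itv/= => /andP[py yq]; rewrite normrM mulrC ler_wpM2r//.
    by apply: le_trans (phiA _ _ (le_trans ap py) yq qb) _; rewrite ler_wpM2l// lerB.
  have b2 : `|\int[leb]_(y in `[p, q]) (dphi y * (f p - f y))| <=
      A * (\int[leb]_(y in `[p, q]) `|g y|) * (q - p).
    have iq : leb.-integrable `[p, q] (EFin \o (fun y => `|g y|)) by exact: i1.
    apply: Rintegral_itv_bound => //.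
      apply: integrable_itvM; first exact: i1.
      have cfq : {within `[p, q], continuous f} by apply: continuous_subspaceW cf.
      by move=> y; apply: cvgB; [exact: cvg_cst|exact: cfq].
    move=> y /andP[py yq]; rewrite normrM ler_pM//.
      by rewrite hA// (le_trans ap py) (le_trans yq qb).
    rewrite distrC fg//; last exact: le_trans yq qb.
    apply: le_trans (le_normr_Rintegral _ _) _ => //; first by apply: integrable_itvS ig => //; exact: le_trans yq qb.
    by rewrite [leRHS](Rintegral_split py yq)// lerDl Rintegral_itv_ge0.
  rewrite E1; apply: le_trans (ler_normD _ _) _.
  by apply: le_trans (lerD b1 b2) _; rewrite le_eqVlt; apply/orP; left; apply/eqP; ring.
have const e : e = 1 \/ e = -1 -> e * H b <= e * H a.
  move=> he; apply: (@le_of_increments (fun x => e * H x) V) => // d d0.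
  exists (d / (2 * A + 1)) => [|p q ap pq qb pqd]; first by rewrite divr_gt0// ltr_wpDl// mulr_ge0.
  have A1 : 0 < 2 * A + 1 by rewrite ltr_wpDl// mulr_ge0.
  have Vpq : 0 <= V q - V p.
    rewrite subr_ge0 /V (Rintegral_split ap pq) ?lerDl ?Rintegral_itv_ge0//.
    by apply: integrable_itvS iag.
  apply: (@le_trans _ _ `|H q - H p|).
    by rewrite -mulrBr; case: he => ->; rewrite ?mul1r ?mulN1r ?ler_norm// ler_normr lexx orbT.
  apply: le_trans (key p q ap pq qb) _; apply: ler_wpM2r => //.
  move: pqd; rewrite ler_pdivlMr//; have : 0 <= q - p by rewrite subr_ge0.
  lra.
have : H b = H a.
  by apply/eqP; rewrite eq_le; have := const 1 (or_introl erefl); have := const (-1) (or_intror erefl); lra.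
rewrite /H !Rintegral_point; lra.
Qed.

Lemma ac_by_parts f g phi dphi a b : a <= b ->
  leb.-integrable `[a, b] (EFin \o g) ->
  (forall p q, a <= p -> p <= q -> q <= b -> f q - f p = \int[leb]_(x in `[p, q]) g x) ->
  continuous dphi -> (forall x, is_derive x 1 phi (dphi x)) ->
  {within `[a, b], continuous f} ->
  \int[leb]_(x in `[a, b]) (g x * phi x) =
    f b * phi b - f a * phi a - \int[leb]_(x in `[a, b]) (f x * dphi x).
Proof.
move=> ab ig fg cd dp cf.
have [A A0 hA] := continuous_itv_bound ab (continuous_subspaceT cd).
apply: (ac_by_parts_bounded ab ig fg _ _ A0 hA cf) => [|p q _ pq _|].
- exact: integrable_continuous.
- by rewrite (Rintegral_FTC2 pq cd dp).
- by apply: continuous_subspaceT; exact: is_derive_continuous dp.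
Qed.

Lemma is_derive_ae f g a b : leb.-integrable `[a, b] (EFin \o g) ->
  (forall p q, a <= p -> p <= q -> q <= b -> f q - f p = \int[leb]_(x in `[p, q]) g x) ->
  {ae leb, forall x, a < x < b -> is_derive x 1 f (g x)}.
Proof.
move=> ik fg; pose h := g \_ `[a, b].
have ih : leb.-integrable setT (EFin \o h).
  by have := ik; rewrite integrable_mkcond//= -restrict_EFin.
have lh : locally_integrable setT h.
  by apply: integrable_locally ik => //; exact: measurable_itv.
have hint y : a <= y <= b -> \int[leb]_(t in `]-oo, y]) h t = f y - f a.
  move=> /andP[ay yb]; rewrite /h -Rintegral_mkcondr fg//.
  rewrite (_ : _ `&` _ = `[a, y]%classic)//.
  apply/seteqP; split => t /=; rewrite !in_itv/=.
    by move=> [-> /andP[-> _]].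
  by move=> /andP[-> ty]; rewrite ty (le_trans ty).
have ihy y : leb.-integrable `]-oo, y] (EFin \o h) by apply: integrableS ih.
have /= H := @FTC1Ny R h ihy lh; apply: ae_mono H => x [dx hx] /andP[ax xb].
have hxE : h x = g x by rewrite /h patchE mem_setE in_itv/= !ltW.
have D : is_derive x 1 (fun y => \int[leb]_(t in `]-oo, y]) h t + f a) (g x).
  have D := DeriveDef dx erefl; rewrite -derive1E hx hxE in D.
  by have := is_deriveD D (is_derive_cst (f a) x 1); rewrite addr0.
apply: near_eq_is_derive D; near=> y.
rewrite hint ?subrK//; apply/andP; split; apply: ltW; near: y.
  exact: lt_nbhsr.
exact: lt_nbhsl.
Unshelve. all: by end_near. Qed.

(** For identities that hold off a null set depending on a parameter: they are taken for rational
    parameters, at the price of a single null set, and then extended by continuity. *)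
Lemma rat_dense_zero (f : R -> R) (a b : R) : a < b -> continuous f ->
  (forall q : rat, a < ratr q < b -> f (ratr q) = 0) -> forall x, a <= x <= b -> f x = 0.
Proof.
move=> ab cf fq x /andP[ax xb]; apply: contrapT => /eqP fx.
have fx0 : 0 < `|f x| by rewrite normr_gt0.
have /cvgrPdist_lt /(_ _ fx0)[d /= d0 hd] : f z @[z --> x] --> f x by exact: cf.
have [q] : exists q : rat, ratr q \in `]Num.max a (x - d), Num.min b (x + d)[.
  by apply: rat_in_itvoo; rewrite gt_max !lt_min ab; lra.
rewrite in_itv/= gt_max lt_min => /andP[/andP[aq xq] /andP[qb qx]].
have : `|f x - f (ratr q)| < `|f x|.
  by apply: hd => /=; rewrite ltr_distl; apply/andP; split; lra.
by rewrite fq ?aq// subr0 ltxx.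
Qed.

End absolute_continuity.

(** * Riemann sums and continuity of slice integrals *)

Section square.
Context {R : realType}.
Notation leb := (@lebesgue_measure R).
Notation leb2 := (@leb2 R).
Implicit Types (Psi : R * R -> R) (L e : R).

Lemma compact_square L : compact ((`[0, L]%classic `*` `[0, L]%classic) : set (R * R)).
Proof. by apply: compact_setX; exact: segment_compact. Qed.

Lemma unif_continuous_square Psi L e : continuous Psi -> 0 < e ->
  exists2 d : R, 0 < d & forall t y t' y', 0 <= t <= L -> 0 <= y <= L ->
    0 <= t' <= L -> 0 <= y' <= L -> `|t - t'| <= d -> `|y - y'| <= d ->
    `|Psi (t, y) - Psi (t', y')| <= e.
Proof.
move=> cP e0.
have [d d0 hd] := compact_unif_continuous (@compact_square L) (continuous_subspaceT cP) e0.
exists (d / 2) => [|t y t' y' h1 h2 h3 h4 h5 h6]; first exact: divr_gt0.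
apply: ltW; apply: hd; rewrite /= ?in_itv//=.
have d2 : d / 2 < d by lra.
by split; rewrite /ball/= /ball_; [exact: le_lt_trans h5 _|exact: le_lt_trans h6 _].
Qed.

Lemma bounded_square Psi L : continuous Psi ->
  exists2 P : R, 0 < P & forall t y, 0 <= t <= L -> 0 <= y <= L -> `|Psi (t, y)| <= P.
Proof.
move=> cP.
have cs : compact (Psi @` (`[0, L]%classic `*` `[0, L]%classic)).
  by apply: continuous_compact (@compact_square L); exact: continuous_subspaceT.
have /compact_bounded[N [_ mrt]] := cs.
exists (`|N| + 1); first by rewrite ltr_wpDl.
move=> t y tL yL; apply: (mrt (`|N| + 1)); first by rewrite (le_lt_trans (ler_norm N))// ltrDl.
by exists (t, y) => //; split; rewrite /= in_itv.
Qed.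

(** Allows for everything that the scheme gets only approximately, namely sampled values and the end
    point of the slice, and is uniform in [t]. *)
Lemma riemann_sum2 Psi L e : continuous Psi -> 0 <= L -> 0 < e ->
  exists2 d : R, 0 < d & forall (t h z : R) n (B : nat -> R), 0 <= t <= L ->
    0 < h -> h <= d -> n%:R * h <= L -> 0 <= z <= L -> `|n%:R * h - z| <= d ->
    (forall i : nat, (i < n)%N -> `|B i - Psi (t, i%:R * h)| <= d) ->
    `|\sum_(i < n) h * B i - \int[leb]_(y in `[0, z]) Psi (t, y)| <= e.
Proof.
move=> cP L0 e0.
have [P P0 hP] := bounded_square L cP.
(* The sampling error and the cell error cost [L e1] each, the mismatch of end points [P e1]; the
   [+ 1] keeps the denominator positive. *)
pose e1 := e / (2 * L + P + 1).
have q0 : 0 < 2 * L + P + 1 by lra.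
have e10 : 0 < e1 by exact: divr_gt0.
have [d d0 hd] := unif_continuous_square L cP e10.
exists (Num.min d e1); first by rewrite lt_min d0.
move=> t h z n B tL h0; rewrite le_min => /andP[hd1 he1] nL zL; rewrite le_min => /andP[_ nz] hB.
have cs : continuous (fun y => Psi (t, y)) by exact: continuous_slice2.
have n0 : 0 <= n%:R * h by rewrite mulr_ge0// ltW.
have A : `|\sum_(i < n) h * B i - \sum_(i < n) h * Psi (t, i%:R * h)| <= n%:R * h * e1.
  rewrite -sumrB; apply: le_trans (ler_norm_sum _ _ _) _.
  apply: (@le_trans _ _ (\sum_(i < n) h * e1)); last first.
    by rewrite sumr_const card_ord -[leLHS]mulr_natl mulrA.
  apply: ler_sum => i _; rewrite -mulrBr normrM gtr0_norm// ler_pM2l//.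
  by have := hB i (ltn_ord i); rewrite le_min => /andP[].
have B1 : `|\sum_(i < n) h * Psi (t, i%:R * h) - \int[leb]_(y in `[0, n%:R * h]) Psi (t, y)|
    <= n%:R * h * e1.
  apply: (riemann_sum_cells (ltW h0) cs) => i x lin /andP[ix xi].
  have iL : i.+1%:R * h <= L by apply: le_trans nL; rewrite ler_pM2r// ler_nat.
  have i0 : 0 <= i%:R * h by rewrite mulr_ge0// ltW.
  have iL' : i%:R * h <= L by apply: le_trans (le_trans ix xi) iL.
  apply: hd; rewrite ?subrr ?normr0 ?(ltW d0) ?i0 ?iL' ?(le_trans i0 ix) ?(le_trans xi iL)//.
  rewrite distrC ger0_norm ?subr_ge0//; apply: le_trans hd1.
  by rewrite lerBlDl; apply: le_trans xi _; rewrite -natr1 mulrDl mul1r.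
have C : `|\int[leb]_(y in `[0, n%:R * h]) Psi (t, y) - \int[leb]_(y in `[0, z]) Psi (t, y)|
    <= P * e1.
  have key a b : 0 <= a -> a <= b -> b <= L -> `|a - b| <= e1 ->
     `|\int[leb]_(y in `[0, a]) Psi (t, y) - \int[leb]_(y in `[0, b]) Psi (t, y)| <= P * e1.
    move=> a0 ab bL abe; rewrite (Rintegral_split a0 ab); last exact: integrable_continuous.
    rewrite opprD addrA subrr sub0r normrN.
    apply: le_trans (Rintegral_itv_bound (M := P) ab _ _) _.
    - exact: integrable_continuous.
    - by move=> x /andP[ax xb]; rewrite hP// (le_trans a0 ax) (le_trans xb).
    - by rewrite ler_pM2l//; apply: le_trans abe; rewrite distrC ler_norm.
  have /andP[z0 zL'] := zL.
  case/orP: (le_total (n%:R * h) z) => ?; first exact: key.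
  by rewrite distrC; apply: key => //; rewrite distrC.
have D : n%:R * h * e1 <= L * e1 by rewrite ler_pM2r.
have -> : e = L * e1 + L * e1 + P * e1 + e1 by rewrite /e1; field; rewrite gt_eqF.
apply: le_trans (ler_distD (\sum_(i < n) h * Psi (t, i%:R * h)) _ _) _.
apply: le_trans (lerD (lexx _) (ler_distD (\int[leb]_(y in `[0, n%:R * h]) Psi (t, y)) _ _)) _.
lra.
Qed.

Lemma continuous_modulus (f : R -> R) :
  (forall e : R, 0 < e -> exists2 d : R, 0 < d & forall x y, `|x - y| <= d -> `|f x - f y| <= e) ->
  continuous f.
Proof.
move=> fm x; apply/cvgrPdist_le => e e0; have [d d0 hd] := fm e e0.
by exists d => // y xy; apply: hd; exact: ltW.
Qed.

Lemma continuous_slice_integral Psi (z : R -> R) T L : continuous Psi -> continuous z ->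
  0 <= T -> T <= L -> (forall t, 0 <= t <= T -> 0 <= z t <= L) ->
  continuous (fun t => \int[leb]_(y in `[0, z (clamp 0 T t)]) Psi (clamp 0 T t, y)).
Proof.
move=> cP cz T0 TL zL; apply: continuous_modulus => e e0.
have [P P0 hP] := bounded_square L cP.
pose e1 := e / (L + P + 1).
have q0 : 0 < L + P + 1 by lra.
have e10 : 0 < e1 by exact: divr_gt0.
have [d d0 hd] := unif_continuous_square L cP e10.
have cz2 : continuous (fun p : R * R => z p.1).
  by move=> p; apply: (cvg_comp fst z); [exact: cvg_fst|exact: cz].
have [d' d'0 hd'] := unif_continuous_square L cz2 e10.
exists (Num.min d d'); first by rewrite lt_min d0.
move=> x y; rewrite le_min => /andP[xd xd'].
set t := clamp 0 T x; set t' := clamp 0 T y.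
have tT : 0 <= t <= T by exact: clamp_itv.
have t'T : 0 <= t' <= T by exact: clamp_itv.
have tL : 0 <= t <= L by case/andP: tT => -> /= /le_trans ->.
have t'L : 0 <= t' <= L by case/andP: t'T => -> /= /le_trans ->.
have tt := clamp_dist 0 T x y; rewrite -/t -/t' in tt.
have zz : `|z t - z t'| <= e1.
  by apply: (hd' t 0 t' 0) => //; rewrite ?lexx ?(le_trans T0 TL)// ?subrr ?normr0 ?(ltW d'0)// (le_trans tt).
have /andP[z0 z1] := zL t tT; have /andP[z'0 z'1] := zL t' t'T.
have ic r a b : leb.-integrable `[a, b] (EFin \o (fun y => Psi (r, y))).
  by apply: integrable_continuous; exact: continuous_slice2.
have A : `|\int[leb]_(y in `[0, z t]) Psi (t, y) - \int[leb]_(y in `[0, z t']) Psi (t, y)| <= P * e1.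
  have key a b : 0 <= a -> a <= b -> b <= L -> `|a - b| <= e1 ->
     `|\int[leb]_(y in `[0, a]) Psi (t, y) - \int[leb]_(y in `[0, b]) Psi (t, y)| <= P * e1.
    move=> a0 ab bL abe; rewrite (Rintegral_split a0 ab)//.
    rewrite opprD addrA subrr sub0r normrN.
    apply: le_trans (Rintegral_itv_bound (M := P) ab _ _) _ => //.
      by move=> r /andP[ax xb]; rewrite hP// (le_trans a0 ax) (le_trans xb).
    by rewrite ler_pM2l//; apply: le_trans abe; rewrite distrC ler_norm.
  case/orP: (le_total (z t) (z t')) => ?; first exact: key.
  by rewrite distrC; apply: key => //; rewrite distrC.
have B : `|\int[leb]_(y in `[0, z t']) Psi (t, y) - \int[leb]_(y in `[0, z t']) Psi (t', y)| <= e1 * L.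
  rewrite -RintegralB//; apply: le_trans (Rintegral_itv_bound (M := e1) z'0 _ _) _.
  - by apply: integrableRB.
  - move=> r /andP[r0 rz]; apply: hd => //; rewrite ?r0 ?(le_trans rz)// ?subrr ?normr0 ?(ltW d0)//.
    exact: le_trans tt _.
  - by rewrite subr0 ler_pM2l.
have -> : e = P * e1 + e1 * L + e1 by rewrite /e1; field; rewrite gt_eqF.
apply: le_trans (ler_distD (\int[leb]_(y in `[0, z t']) Psi (t, y)) _ _) _.
apply: le_trans (lerD A B) _; lra.
Qed.

Lemma integrable_Q_bounded (s : R -> R) T (f : R * R -> R) L M : continuous s ->
  (forall t, 0 < t < T -> s t <= L) -> measurable_fun (Q s T) f ->
  (forall p, Q s T p -> `|f p| <= M) -> leb2.-integrable (Q s T) (EFin \o f).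
Proof.
move=> cs sL mf fM.
have mQ := @measurable_Q R s T cs.
have QL : Q s T `<=` `[0, T]%classic `*` `[0, L]%classic.
  move=> p [/andP[t0 tT] /andP[y0 ys]]; split; rewrite /= in_itv/= !ltW//.
  by apply: lt_le_trans ys _; apply: sL; rewrite t0.
have fin : (leb2 (Q s T) < +oo)%E.
  apply: (@le_lt_trans _ _ (leb2 (`[0, T]%classic `*` `[0, L]%classic))).
    by apply: le_measure => //; rewrite inE//; exact: measurableX.
  have -> : (leb2 (`[0%R, T]%classic `*` `[0%R, L]%classic) = leb `[0%R, T]%classic * leb `[0%R, L]%classic)%E.
    exact: product_measure1E.
  rewrite !lebesgue_measure_itv/=.
  by case: ifP => _; case: ifP => _; rewrite -?EFinB -?EFinM ?mul0e ?mule0 ltry.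
apply: (@integrable_le _ _ _ leb2 (Q s T) f (cst M)) => //.
apply/integrableP; split; first by apply/measurable_EFinP; exact: (@measurable_cst _ _ _ _ (Q s T) M).
rewrite (_ : (\int[leb2]_(x in Q s T) `|(EFin \o cst M) x|)%E = (\int[leb2]_(x in Q s T) (cst `|M|%:E) x)%E)//.
rewrite integral_cst//.
by apply: lte_mul_pinfty; rewrite ?lee_fin// fin.
Qed.

End square.

(** * Test functions *)

Section test_functions.
Context {R : realType}.
Notation leb := (@lebesgue_measure R).
Notation leb2 := (@leb2 R).

Lemma positive_margin (V : normedModType R) (K : set V) (m : V -> R) : compact K -> continuous m ->
  (forall p, K p -> 0 < m p) -> exists2 e : R, 0 < e & forall p, K p -> e <= m p.
Proof.
move=> cK cm mK; have [[p0 Kp0]|K0] := pselect (K !=set0).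
  have [c cK' hc] := @compact_EVT_min _ R m K (ex_intro _ _ Kp0) cK (continuous_subspaceT cm).
  rewrite inE in cK'.
  by exists (m c) => [|p Kp]; [exact: mK|apply: hc; rewrite inE].
by exists 1 => // p Kp; exfalso; apply: K0; exists p.
Qed.

Lemma test_function_C1 (phi : R -> R) (a b : R) : test_function (`]a, b[ : set R) phi ->
  [/\ continuous (derive1 phi), forall x : R, is_derive x 1 phi (derive1 phi x) &
      exists2 e : R, 0 < e & forall x, phi x != 0 -> a + e <= x <= b - e].
Proof.
move=> [sphi [K [cK Kab K0]]].
have [_ d1] := sphi [::]; have [c1 _] := sphi [:: 1].
split.
- have -> : derive1 phi = 'D_1 phi by apply/funext => y; rewrite derive1E.
  exact: c1.
- by move=> x; rewrite derive1E; apply/derivableP; exact: d1.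
- have [||e1 e10 h1] := @positive_margin _ K (fun x : R => Num.min (x - a) (b - x)) cK.
  + move=> x; apply: (@continuous_min _ _ (fun x : R => x - a) (fun x => b - x)).
      by apply: cvgB; [exact: cvg_id|exact: cvg_cst].
    by apply: cvgB; [exact: cvg_cst|exact: cvg_id].
  + by move=> x /Kab; rewrite /= in_itv/= => /andP[ax xb]; rewrite lt_min !subr_gt0 ax.
  exists e1 => // x px; have Kx : K x.
    by apply: contrapT => nK; move: px; rewrite K0// eqxx.
  by have := h1 x Kx; rewrite le_min => /andP[]; lra.
Qed.

Lemma smooth_partial1 (phi : R * R -> R) : smooth phi ->
  continuous (fun p => 'D_(1, 0) phi p) /\
  forall t y : R, is_derive t 1 (fun r => phi (r, y)) ('D_(1, 0) phi (t, y)).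
Proof.
move=> sphi; have [_ d1] := sphi [::]; have [c1 _] := sphi [:: (1, 0)].
split => // t y.
have dp := d1 (t, y) (1, 0).
have E : (fun h : R => h^-1 *: (((fun r => phi (r, y)) \o shift t) (h *: (1 : R^o)) - phi (t, y))) =
  (fun h : R => h^-1 *: ((phi \o shift (t, y)) (h *: ((1, 0) : R^o * R^o)) - phi (t, y))).
  apply/funext => h /=; congr (_ *: (_ - _)).
  by rewrite /shift/=; congr (phi (_, _)); rewrite /= scaler0 add0r.
by apply: DeriveDef; [rewrite /derivable E|rewrite /derive E].
Qed.

Lemma smooth_partial2 (phi : R * R -> R) : smooth phi ->
  continuous (fun p => 'D_(0, 1) phi p) /\
  forall t y : R, is_derive y 1 (fun r => phi (t, r)) ('D_(0, 1) phi (t, y)).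
Proof.
move=> sphi; have [_ d1] := sphi [::]; have [c1 _] := sphi [:: (0, 1)].
split => // t y.
have dp := d1 (t, y) (0, 1).
have E : (fun h : R => h^-1 *: (((fun r => phi (t, r)) \o shift y) (h *: (1 : R^o)) - phi (t, y))) =
  (fun h : R => h^-1 *: ((phi \o shift (t, y)) (h *: ((0, 1) : R^o * R^o)) - phi (t, y))).
  apply/funext => h /=; congr (_ *: (_ - _)).
  by rewrite /shift/=; congr (phi (_, _)); rewrite /= scaler0 add0r.
by apply: DeriveDef; [rewrite /derivable E|rewrite /derive E].
Qed.

Lemma test_function_margin (s : R -> R) T (phi : R * R -> R) : continuous s ->
  test_function (Q s T) phi -> exists2 e : R, 0 < e & forall t y, phi (t, y) != 0 ->
    e <= t <= T - e /\ e <= y <= s t - e.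
Proof.
move=> cs [_ [K [cK KQ K0]]].
pose m (p : R * R) := Num.min (Num.min p.1 (T - p.1)) (Num.min p.2 (s p.1 - p.2)).
have [||e e0 he] := @positive_margin _ K m cK.
- have c1 : continuous (fun p : R * R => p.1) by move=> p; exact: cvg_fst.
  have c2 : continuous (fun p : R * R => p.2) by move=> p; exact: cvg_snd.
  have cm (f g : R * R -> R) : continuous f -> continuous g -> continuous (fun p => Num.min (f p) (g p)).
    by move=> cf cg p; apply: (@continuous_min _ _ f g); [exact: cf|exact: cg].
  apply: (cm (fun p => Num.min p.1 (T - p.1)) (fun p => Num.min p.2 (s p.1 - p.2)) (cm _ _ _ _) (cm _ _ _ _)) => //.
  + by move=> p; apply: cvgB; [exact: cvg_cst|exact: c1].
  + by move=> p; apply: cvgB; [apply: (cvg_comp fst s); [exact: c1|exact: cs]|exact: c2].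
- move=> p /KQ[/andP[h1 h2] /andP[h3 h4]]; rewrite /m !lt_min h1 h3 !subr_gt0 h2//.
exists e => // t y h; have Kp : K (t, y).
  by apply: contrapT => nK; move: h; rewrite K0// eqxx.
by have := he _ Kp; rewrite /m !le_min /= => /andP[/andP[h1 h2] /andP[h3 h4]]; split; lra.
Qed.

Lemma Rintegral_EFin (a b : R) (f : R -> R) : leb.-integrable `[a, b] (EFin \o f) ->
  (\int[leb]_(x in `]a, b[) (f x)%:E = (\int[leb]_(x in `[a, b]) f x)%:E)%E.
Proof.
move=> i; have io : leb.-integrable `]a, b[ (EFin \o f).
  by apply: integrableS i => //; exact: subset_itv_oo_cc.
rewrite -Rintegral_oo_cc; last by apply/measurable_EFinP; exact: measurable_int io.
by rewrite /Rintegral fineK//; exact: integrable_fin_num.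
Qed.

Lemma weak_derivative1_of_C1 (f g : R -> R) (a b : R) : {within `[a, b], continuous f} ->
  leb.-integrable `[a, b] (EFin \o g) ->
  (forall (phi dphi : R -> R) (e : R), continuous dphi -> (forall x : R, is_derive x 1 phi (dphi x)) ->
    0 < e -> (forall x, phi x != 0 -> a + e <= x <= b - e) ->
    \int[leb]_(x in `[a, b]) (f x * dphi x) = - \int[leb]_(x in `[a, b]) (g x * phi x)) ->
  weak_derivative1 `]a, b[ f g.
Proof.
move=> cf ig h phi tp; have [c1 d1 [e e0 he]] := test_function_C1 tp.
have cp : continuous phi by exact: is_derive_continuous d1.
rewrite !Rintegral_EFin.
- by rewrite (h _ _ _ c1 d1 e0 he) EFinN.
- exact: integrable_itvMc.
- by apply: integrable_itvMc => //; exact: integrable_within.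
Qed.

Lemma difference_quotient (phi dphi : R * R -> R) (L e : R) : continuous dphi -> 0 < e ->
  (forall t y : R, is_derive t 1 (fun r => phi (r, y)) (dphi (t, y))) ->
  exists2 d : R, 0 < d & forall t y h : R, 0 <= t -> 0 < h -> h <= d -> t + h <= L ->
    0 <= y <= L -> `|(phi (t + h, y) - phi (t, y)) / h - dphi (t, y)| <= e.
Proof.
move=> cd e0 dp; have [d d0 hd] := unif_continuous_square L cd e0.
exists d => // t y h t0 h0 hhd thL yL.
have th : t < t + h by rewrite ltrDl.
have [x /=] := MVT th (fun x _ => dp x y) (continuous_subspaceT (is_derive_continuous (fun x => dp x y))).
rewrite in_itv/= addrAC subrr add0r => /andP[tx xt] ->; rewrite mulfK ?gt_eqF//.
apply: hd => //; rewrite ?subrr ?normr0 ?(ltW d0)//.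
- by rewrite (le_trans t0 (ltW tx)) (le_trans (ltW xt) thL).
- by rewrite t0 (le_trans _ thL)// lerDl ltW.
- by rewrite gtr0_norm ?subr_gt0//; apply: le_trans hhd; rewrite lerBlDl ltW.
Qed.

End test_functions.

(** * The limit of the scheme *)

Section limit_record.
Context {R : realType}.
Notation leb := (@lebesgue_measure R).
Notation leb2 := (@leb2 R).

(** What survives of the scheme in the limit, with no reference to the grid. Smooth test functions
    identify [ut] as the weak derivative in time, and the hats of [sl_hat] carry the equation
    together with both boundary conditions, without mentioning [u_z]. [Zm] lies at least 1 beyond
    the front, so that hats reaching past the front detect the flux there. *)
Record scheme_limit (a0 gamma beta M T s0 : R) (b u0 s : R -> R) (u ut : R * R -> R) : Prop :=
  SchemeLimit {
  sl_front_continuous : continuous s;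
  sl_continuous : continuous u;
  sl_front_ge : forall t, 0 <= t <= T -> s0 <= s t;
  sl_bounds : forall t y, 0 <= t <= T -> 0 <= y <= s t -> 0 <= u (t, y) <= M;
  sl_front : forall t, 0 <= t <= T -> s t = s0 + a0 * \int[leb]_(r in `[0, t]) u (r, s r);
  sl_initial : forall z, 0 <= z <= s0 -> u (0, z) = u0 z;
  sl_sqint : sqint leb2 (Q s T) ut;
  sl_weak : forall phi, test_function (Q s T) phi ->
    \int[leb2]_(p in Q s T) (ut p * phi p) =
      - \int[leb2]_(p in Q s T) (u p * 'D_(1, 0) phi p);
  sl_hat : exists2 Zm : R, (forall t, 0 <= t <= T -> s t + 1 <= Zm) &
    forall (eta : R -> R) (Z : R), continuous eta -> 0 <= Z <= Zm ->
    (forall t, 0 <= t <= T -> s t <= Z -> u (t, Z) = u (t, s t)) /\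
    \int[leb2]_(p in Q s T) (ut p * (eta p.1 * Num.max (Z - p.2) 0)) =
    \int[leb]_(t in `[0, T]) (eta t * (- (a0 * u (t, s t) ^+ 2 * Num.max (Z - s t) 0)
      + beta * (b t - gamma * u (t, 0)) * Z + (u (t, Z) - u (t, 0))));
  sl_slice : exists C : R, forall t, 0 <= t <= T -> exists2 g, sqint leb `[0, s t] g &
    \int[leb]_(y in `[0, s t]) g y ^+ 2 <= C /\
    weak_derivative1 `]0, s t[ (fun y => u (t, y)) g
}.

End limit_record.

(** * Equicontinuity and convergence of the discrete states *)

Section approximation.
Context {R : realType}.
Notation leb := (@lebesgue_measure R).
Variables (a0 gamma beta M s0 : R) (b u0 : R -> R) (D B : R).
Hypothesis (a0_gt0 : 0 < a0) (gamma_gt0 : 0 < gamma) (beta_gt0 : 0 < beta).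
Hypothesis (M_gt0 : 0 < M) (s0_gt0 : 0 < s0).
Hypothesis b_itv : forall t, 0 <= b t <= gamma * M.
Hypothesis u0_itv : forall z, 0 <= u0 z <= M.
Hypothesis u0_dirichlet : forall h : R, 0 < h ->
  \sum_(j < Num.truncn (s0 / h)) (u0 (j.+1%:R * h) - u0 (j%:R * h)) ^+ 2 <= h * D.
Hypothesis b_variation : forall (tau : R) K, 0 < tau ->
  \sum_(k < K) `|b (k.+1%:R * tau) - b (k%:R * tau)| <= B.

(* The first factor gives the stability conditions [beta * gamma * mesh n <= 1]
   and [a0 * M * mesh n <= 1]. *)
Definition mesh n : R := (1 + beta * gamma + a0 * M)^-1 / n.+1%:R.
Definition tick n : R := mesh n ^+ 2 / 8.
Definition Un n := U a0 gamma beta (mesh n) s0 (fun k => b (k%:R * tick n)) (fun j => u0 (j%:R * mesh n)).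
Definition Sn n := Sk a0 gamma beta (mesh n) s0 (fun k => b (k%:R * tick n)) (fun j => u0 (j%:R * mesh n)).
Definition Nn n := Nk a0 gamma beta (mesh n) s0 (fun k => b (k%:R * tick n)) (fun j => u0 (j%:R * mesh n)).
Definition dn n k j := Un n k.+1 j - Un n k j.

Let q_gt0 : 0 < 1 + beta * gamma + a0 * M.
Proof. by rewrite !addr_gt0// mulr_gt0. Qed.

Lemma mesh_gt0 n : 0 < mesh n.
Proof. by rewrite divr_gt0// invr_gt0. Qed.
Hint Resolve mesh_gt0 : core.

Lemma tick_gt0 n : 0 < tick n.
Proof. by rewrite divr_gt0// exprn_gt0. Qed.
Hint Resolve tick_gt0 : core.

Lemma mesh_le n : mesh n * (1 + beta * gamma + a0 * M) <= 1.
Proof.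
rewrite mulrAC mulVf ?gt_eqF// mul1r invf_le1//; last by rewrite ler1n.
Qed.

Let bg0 : 0 < beta * gamma. Proof. exact: mulr_gt0. Qed.
Let aM0 : 0 < a0 * M. Proof. exact: mulr_gt0. Qed.

Lemma mesh_small n :
  [/\ mesh n * beta * gamma <= 1, mesh n * a0 * M <= 1 &
      mesh n * a0 * M + mesh n * beta * gamma <= 2].
Proof.
have h := mesh_le n; have h1 := mesh_gt0 n.
have h2 : 0 < mesh n * (beta * gamma) by rewrite mulr_gt0.
have h3 : 0 < mesh n * (a0 * M) by rewrite mulr_gt0.
move: h; rewrite !mulrDr mulr1 !mulrA in h2 h3 * => h; split; lra.
Qed.

Let b_n n k : 0 <= b (k%:R * tick n) <= gamma * M. Proof. exact: b_itv. Qed.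
Let v_n n j : 0 <= u0 (j%:R * mesh n) <= M. Proof. exact: u0_itv. Qed.

Lemma Un_itv n k j : 0 <= Un n k j <= M.
Proof. by have [h1 h2 _] := mesh_small n; exact: (@U_itv R a0 gamma beta M (mesh n) s0 _ _ a0_gt0 beta_gt0 (mesh_gt0 n) h1 h2 (b_n n) (v_n n)). Qed.

Lemma Sn_ge n k : s0 <= Sn n k.
Proof. by have [h1 h2 _] := mesh_small n; exact: (@Sk_ge R a0 gamma beta M (mesh n) s0 _ _ a0_gt0 beta_gt0 (mesh_gt0 n) h1 h2 (b_n n) (v_n n)). Qed.

Lemma Sn_homo n k m : (k <= m)%N -> Sn n k <= Sn n m.
Proof. by have [h1 h2 _] := mesh_small n; exact: (@Sk_homo R a0 gamma beta M (mesh n) s0 _ _ a0_gt0 beta_gt0 (mesh_gt0 n) h1 h2 (b_n n) (v_n n)). Qed.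

Lemma Sn_increment n k m : Sn n (k + m) - Sn n k <= m%:R * tick n * (a0 * M).
Proof. by have [h1 h2 _] := mesh_small n; exact: (@Sk_increment R a0 gamma beta M (mesh n) s0 _ _ a0_gt0 beta_gt0 (mesh_gt0 n) h1 h2 (b_n n) (v_n n)). Qed.

Lemma SnS n k : Sn n k.+1 = Sn n k + tick n * a0 * Un n k (Nn n k).
Proof. exact: SS. Qed.

Lemma Sn0 n : Sn n 0 = s0. Proof. by []. Qed.

Lemma Nn_itv n k : (Nn n k)%:R * mesh n <= Sn n k < (Nn n k)%:R * mesh n + mesh n.
Proof. by have [h1 h2 _] := mesh_small n; exact: (@Nk_itv R a0 gamma beta M (mesh n) s0 _ _ a0_gt0 beta_gt0 (mesh_gt0 n) s0_gt0 h1 h2 (b_n n) (v_n n)). Qed.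

Lemma Nn_homo n k m : (k <= m)%N -> (Nn n k <= Nn n m)%N.
Proof. by have [h1 h2 _] := mesh_small n; exact: (@Nk_homo R a0 gamma beta M (mesh n) s0 _ _ a0_gt0 beta_gt0 (mesh_gt0 n) h1 h2 (b_n n) (v_n n)). Qed.

Lemma Un_front n k j : (Nn n k <= j)%N -> Un n k j = Un n k (Nn n k).
Proof. by have [h1 h2 _] := mesh_small n; exact: (@U_front R a0 gamma beta M (mesh n) s0 _ _ a0_gt0 beta_gt0 (mesh_gt0 n) h1 h2 (b_n n) (v_n n)). Qed.

Definition ebound : R := `|energy_bound a0 gamma beta M D B| + 1.
Let C := ebound.

Lemma ebound_gt0 : 0 < C. Proof. by rewrite ltr_wpDl. Qed.
Hint Resolve ebound_gt0 : core.

Let meshC n : mesh n * energy_bound a0 gamma beta M D B <= mesh n * C.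
Proof. by rewrite ler_pM2l// (le_trans (ler_norm _))// lerDl. Qed.

Lemma Un_dirichlet n k : \sum_(j < Nn n k) (Un n k j.+1 - Un n k j) ^+ 2 <= mesh n * C.
Proof.
have [h1 h2 h3] := mesh_small n; apply: le_trans (meshC n).
have := @energy_estimate R a0 gamma beta M (mesh n) s0 _ _ a0_gt0 gamma_gt0 beta_gt0
  M_gt0 (mesh_gt0 n) h1 h2 (b_n n) (v_n n) D B h3 (u0_dirichlet (mesh_gt0 n))
  (fun K => b_variation K (tick_gt0 n)) k.
by case.
Qed.

Lemma Un_dissipation n K :
  \sum_(k < K) \sum_(j < (Nn n k).+1) dn n k j ^+ 2 <= mesh n * C.
Proof.
have [h1 h2 h3] := mesh_small n; apply: le_trans (meshC n).
have := @energy_estimate R a0 gamma beta M (mesh n) s0 _ _ a0_gt0 gamma_gt0 beta_gt0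
  M_gt0 (mesh_gt0 n) h1 h2 (b_n n) (v_n n) D B h3 (u0_dirichlet (mesh_gt0 n))
  (fun K => b_variation K (tick_gt0 n)) K.
by case.
Qed.

Lemma Un_flux n k j : (j <= Nn n k)%N -> 8 * dn n k j =
  flux_right a0 (mesh n) (Nn n k) (Un n k) j
  - flux_left gamma beta (mesh n) (b (k%:R * tick n)) (Un n k) j.
Proof. exact: (@delta_inner R a0 gamma beta (mesh n) s0 _ _). Qed.

Let norm_le_sqrt (x y : R) : x ^+ 2 <= y -> `|x| <= Num.sqrt y.
Proof. by move=> xy; rewrite -sqrtr_sqr ler_wsqrtr. Qed.

Lemma Un_space n k i j : `|Un n k i - Un n k j| <= Num.sqrt (`|i%:R - j%:R| * (mesh n * C)).
Proof.
wlog ij : i j / (i <= j)%N.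
  move=> H; case/orP: (leq_total i j) => /H //.
  by rewrite distrC [`|j%:R - _|]distrC.
have [h1 h2 h3] := mesh_small n; rewrite distrC; apply: norm_le_sqrt.
have -> : `|i%:R - j%:R| = (j - i)%:R :> R.
  by rewrite natrB// distrC ger0_norm// subr_ge0 ler_nat.
apply: le_trans (ler_wpM2l (ler0n _ _) (meshC n)).
exact: (@U_space R a0 gamma beta M (mesh n) s0 _ _ a0_gt0 gamma_gt0 beta_gt0
  M_gt0 (mesh_gt0 n) h1 h2 (b_n n) (v_n n) D B h3 (u0_dirichlet (mesh_gt0 n))
  (fun K => b_variation K (tick_gt0 n)) k i j ij).
Qed.

Lemma mesh_sqr n : mesh n * mesh n = 8 * tick n.
Proof. by rewrite /tick -expr2; field. Qed.

(** Three hops: from [j] to a node [i] at distance at most [x], one increment in time at [i], and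
    back. The length [x] stays free, to be chosen before the elapsed time; [x + mesh n <= s0]
    ensures that the window fits left of the front. *)
Lemma Un_time_inner n k m j (x : R) : (j <= Nn n k)%N -> 0 < x -> x + mesh n <= s0 ->
  `|Un n (k + m) j - Un n k j| <=
    2 * Num.sqrt (C * x) + Num.sqrt (8 * C * (m%:R * tick n) / x).
Proof.
move=> jN x0 xs; have h0 := mesh_gt0 n.
have /andP[r1 r2] := truncn_div_itv h0 (ltW x0).
set r := Num.truncn (x / mesh n) in r1 r2.
have rN : (r <= Nn n k)%N.
  rewrite leqNgt; apply/negP => Nr.
  have := Sn_ge n k; have /andP[_ h] := Nn_itv n k.
  have : (Nn n k).+1%:R * mesh n <= r%:R * mesh n by rewrite ler_pM2r// ler_nat.
  rewrite -natr1 mulrDl mul1r; lra.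
have [h1 h2 h3] := mesh_small n.
have [i [iN ij ji hi]] := @U_time R a0 gamma beta M (mesh n) s0 _ _ a0_gt0 gamma_gt0 beta_gt0
  M_gt0 (mesh_gt0 n) h1 h2 (b_n n) (v_n n) D B h3 (u0_dirichlet (mesh_gt0 n))
  (fun K => b_variation K (tick_gt0 n)) k m j r jN rN.
have hij : `|j%:R - i%:R| <= r%:R :> R.
  rewrite ler_norml; apply/andP; split.
    by rewrite lerBrDr addrC lerBlDr -natrD ler_nat.
  by rewrite lerBlDr addrC -natrD ler_nat.
have sp k' : `|Un n k' j - Un n k' i| <= Num.sqrt (C * x).
  apply: le_trans (Un_space n k' j i) _; apply: ler_wsqrtr.
  rewrite mulrA mulrC; apply: ler_wpM2l; first exact: ltW.
  by apply: le_trans r1; rewrite ler_pM2r.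
have ti : `|Un n (k + m) i - Un n k i| <= Num.sqrt (8 * C * (m%:R * tick n) / x).
  apply: norm_le_sqrt; rewrite ler_pdivlMr//.
  apply: (@le_trans _ _ ((Un n (k + m) i - Un n k i) ^+ 2 * (r.+1%:R * mesh n))).
    by apply: ler_wpM2l; [exact: sqr_ge0|rewrite -natr1 mulrDl mul1r ltW].
  have e1 : 8 * C * (m%:R * tick n) = m%:R * (mesh n * C) * mesh n.
    have H (c y t z : R) : z * z = 8 * t -> 8 * c * (y * t) = y * (z * c) * z.
      move=> e; have -> : y * (z * c) * z = y * c * (z * z) by ring.
      by rewrite e; ring.
    exact: H (mesh_sqr n).
  rewrite e1 mulrA ler_pM2r//; apply: le_trans hi _.
  by apply: ler_wpM2l => //; exact: meshC.
apply: le_trans (ler_distD (Un n (k + m) i) _ _) _.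
apply: le_trans (lerD (lexx _) (ler_distD (Un n k i) _ _)) _.
have := sp (k + m)%N; have := sp k; rewrite [`|Un n k i - _|]distrC; lra.
Qed.

(** A node right of the front carries the value of the front node. Up to the later time the front
    passes over a length at most [a0 M] times the elapsed time plus one cell, and [Un_space] bounds
    the variation of the state over it. *)
Lemma Un_time n k m j (x : R) : 0 < x -> x + mesh n <= s0 ->
  `|Un n (k + m) j - Un n k j| <=
    2 * Num.sqrt (C * x) + Num.sqrt (8 * C * (m%:R * tick n) / x) +
    Num.sqrt (C * (m%:R * tick n * (a0 * M) + mesh n)).
Proof.
move=> x0 xs; have h0 := mesh_gt0 n.
have [jN|Nj] := leqP j (Nn n k).
  by apply: le_trans (Un_time_inner _ jN x0 xs) _; rewrite lerDl sqrtr_ge0.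
rewrite [Un n k j](Un_front (ltnW Nj)).
apply: le_trans (ler_distD (Un n (k + m) (Nn n k)) _ _) _.
rewrite addrC; apply: lerD; first exact: Un_time_inner.
pose j' := minn j (Nn n (k + m)).
have -> : Un n (k + m) j = Un n (k + m) j'.
  rewrite /j'; case: (leqP j (Nn n (k + m))) => // h.
  exact: Un_front (ltnW h).
apply: le_trans (Un_space n _ _ _) _; apply: ler_wsqrtr.
rewrite [leLHS](_ : _ = C * (`|j'%:R - (Nn n k)%:R| * mesh n)); last by ring.
rewrite (ler_pM2l ebound_gt0).
have Nj' : (Nn n k <= j')%N by rewrite leq_min (ltnW Nj) Nn_homo// leq_addr.
rewrite ger0_norm ?subr_ge0 ?ler_nat// mulrBl.
have j'N : j'%:R * mesh n <= (Nn n (k + m))%:R * mesh n.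
  by rewrite ler_pM2r// ler_nat geq_minr.
have /andP[h1 _] := Nn_itv n (k + m); have /andP[_ h2] := Nn_itv n k.
have h3 := Sn_increment n k m; lra.
Qed.

Definition uh n (p : R * R) : R := Un n (Num.truncn (p.1 / tick n)) (Num.truncn (p.2 / mesh n)).
Definition sh n (p : R * R) : R := Sn n (Num.truncn (p.1 / tick n)).

Lemma truncn_tick_dist n (t t' d : R) : `|t - t'| <= d -> tick n <= d ->
  (Num.truncn (t' / tick n) <= Num.truncn (t / tick n))%N ->
  (Num.truncn (t / tick n) - Num.truncn (t' / tick n))%:R * tick n <= 2 * d.
Proof.
move=> td nd le; rewrite natrB//.
have h := truncn_dist (t / tick n) (t' / tick n).
rewrite -mulrBl normrM [`|_^-1|]gtr0_norm ?invr_gt0// in h.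
apply: (@le_trans _ _ ((`|t - t'| / tick n + 1) * tick n)).
  by rewrite ler_pM2r// ltW.
by rewrite mulrDl mulfVK ?gt_eqF// mul1r; lra.
Qed.

Variable F : set_system nat.
Hypothesis FU : UltraFilter F.
Hypothesis Foo : \oo `<=` F.
Local Instance FF2 : ProperFilter F := @ultra_proper _ _ FU.

Lemma near_mesh (e : R) : 0 < e -> F [set n | mesh n <= e].
Proof.
move=> e0; apply: Foo; near=> n; rewrite /= /mesh ler_pdivrMr//.
rewrite [leRHS]mulrC -ler_pdivrMr//; apply: (@le_trans _ _ n%:R); last by rewrite ler_nat.
by near: n; exact: nbhs_infty_ger.
Unshelve. all: by end_near. Qed.

Lemma near_tick (e : R) : 0 < e -> F [set n | tick n <= e].
Proof.
move=> e0; have e1 : 0 < Num.min e 1 by rewrite lt_min e0 ltr01.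
apply: filterS (near_mesh e1) => n /=; rewrite le_min => /andP[h1 h2].
have h0 := mesh_gt0 n; rewrite /tick ler_pdivrMr// expr2.
have : mesh n * mesh n <= e * 1 by apply: ler_pM => //; exact: ltW.
lra.
Qed.

(** The interpolants are step functions, so a modulus can hold only once [mesh n] and [tick n] are
    below [d], that is on a set of the filter. *)
Lemma uh_equicontinuous (e : R) : 0 < e -> exists2 d : R, 0 < d &
  F [set n | forall p q, `|p.1 - q.1| <= d -> `|p.2 - q.2| <= d ->
    `|uh n p - uh n q| <= e].
Proof.
(* Every error is the square root of a quantity made at most [e1], and five such errors occur, each
   costing [e / 8]. *)
move=> e0; pose e1 := (e / 8) ^+ 2.
have e10 : 0 < e1 by rewrite exprn_gt0// divr_gt0.
have C0 := ebound_gt0; rewrite -/C in C0.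
pose x := Num.min (s0 / 2) (e1 / C).
have x0 : 0 < x by rewrite lt_min !divr_gt0.
have xs : x <= s0 / 2 by rewrite ge_min lexx.
have xe : C * x <= e1 by rewrite mulrC -ler_pdivlMr// ge_min lexx orbT.
have aM2 : 0 < 2 * (a0 * M) + 2 by rewrite addr_gt0// mulr_gt0.
(* The three bounds serve, in this order, [x + mesh n <= s0], the increment in time within the
   window of width [x], and the spatial hop together with the advance of the front. *)
pose d := Num.min (s0 / 2) (Num.min (e1 * x / (16 * C)) (e1 / (C * (2 * (a0 * M) + 2)))).
have C16 : 0 < 16 * C by rewrite mulr_gt0.
have CaM : 0 < C * (2 * (a0 * M) + 2) by rewrite mulr_gt0.
have d0 : 0 < d by rewrite !lt_min !divr_gt0// mulr_gt0.
have ds : d <= s0 / 2 by rewrite ge_min lexx.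
have dx : 8 * C * (2 * d) / x <= e1.
  have : d <= e1 * x / (16 * C) by rewrite /d !ge_min lexx orbT.
  rewrite ler_pdivlMr// ler_pdivrMr//; lra.
have da : C * (2 * d * (a0 * M) + 2 * d) <= e1.
  have : d <= e1 / (C * (2 * (a0 * M) + 2)) by rewrite /d !ge_min lexx !orbT.
  rewrite ler_pdivlMr//; lra.
have sq (y : R) : y <= e1 -> Num.sqrt y <= e / 8.
  move=> ye; rewrite -[e / 8]gtr0_norm ?divr_gt0// -sqrtr_sqr.
  by apply: ler_wsqrtr.
have daM : 0 <= 2 * d * (a0 * M) by rewrite !mulr_ge0// ltW.
exists d => //; apply: filterS2 (near_mesh d0) (near_tick d0) => n /= md td.
have H (p q : R * R) : `|p.1 - q.1| <= d -> `|p.2 - q.2| <= d ->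
    (Num.truncn (q.1 / tick n) <= Num.truncn (p.1 / tick n))%N -> `|uh n p - uh n q| <= e.
  move=> h1 h2 kk.
  have hm := truncn_tick_dist h1 td kk.
  rewrite /uh -(subnKC kk); set k := Num.truncn (q.1 / tick n) in hm kk *.
  set m := (_ - k)%N in hm *.
  set i := Num.truncn (p.2 / mesh n); set j := Num.truncn (q.2 / mesh n).
  apply: le_trans (ler_distD (Un n (k + m) j) _ _) _.
  have A : `|Un n (k + m) i - Un n (k + m) j| <= e / 8.
    apply: le_trans (Un_space _ _ _ _) _; apply: sq.
    rewrite mulrA mulrC; apply: (@le_trans _ _ (C * (2 * d))).
      apply: ler_wpM2l; first exact: ltW.
      have ij : `|i%:R - j%:R| <= `|p.2 / mesh n - q.2 / mesh n| + 1 :> R.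
        rewrite ler_norml; apply/andP; split; last exact: truncn_dist.
        by rewrite lerNl opprB distrC; exact: truncn_dist.
      rewrite -mulrBl normrM [`|_^-1|]gtr0_norm ?invr_gt0// in ij.
      apply: (@le_trans _ _ ((`|p.2 - q.2| / mesh n + 1) * mesh n)).
        by rewrite ler_pM2r.
      by rewrite mulrDl mulfVK ?gt_eqF// mul1r; lra.
    apply: le_trans da; rewrite ler_pM2l//; lra.
  have xs2 : x + mesh n <= s0 by lra.
  have T := Un_time k m j x0 xs2.
  have T1 := sq _ xe.
  have T2 : Num.sqrt (8 * C * (m%:R * tick n) / x) <= e / 8.
    apply: sq; apply: le_trans dx; rewrite ler_pM2r ?invr_gt0//.
    by rewrite ler_pM2l ?mulr_gt0.
  have T3 : Num.sqrt (C * (m%:R * tick n * (a0 * M) + mesh n)) <= e / 8.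
    apply: sq; apply: le_trans da; rewrite ler_pM2l//.
    have : m%:R * tick n * (a0 * M) <= 2 * d * (a0 * M) by rewrite ler_pM2r.
    lra.
  lra.
move=> p q h1 h2; case/orP: (leq_total (Num.truncn (q.1 / tick n)) (Num.truncn (p.1 / tick n))).
  exact: H.
by move=> h; rewrite distrC; apply: H => //; rewrite distrC.
Qed.

Lemma sh_equicontinuous (e : R) : 0 < e -> exists2 d : R, 0 < d &
  F [set n | forall p q, `|p.1 - q.1| <= d -> `|p.2 - q.2| <= d ->
    `|sh n p - sh n q| <= e].
Proof.
move=> e0; pose d := e / (2 * (a0 * M)).
have d0 : 0 < d by rewrite divr_gt0// mulr_gt0.
exists d => //; apply: filterS (near_tick d0) => n /= td.
have H (p q : R * R) : `|p.1 - q.1| <= d ->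
    (Num.truncn (q.1 / tick n) <= Num.truncn (p.1 / tick n))%N -> `|sh n p - sh n q| <= e.
  move=> h1 kk; have hm := truncn_tick_dist h1 td kk.
  rewrite /sh; have hS := Sn_homo n kk.
  rewrite ger0_norm ?subr_ge0//; rewrite -(subnKC kk).
  apply: le_trans (Sn_increment _ _ _) _.
  apply: (@le_trans _ _ (2 * d * (a0 * M))); first by rewrite ler_pM2r.
  by rewrite /d le_eqVlt; apply/orP; left; apply/eqP; field; rewrite !gt_eqF.
move=> p q h1 _; case/orP: (leq_total (Num.truncn (q.1 / tick n)) (Num.truncn (p.1 / tick n))).
  exact: H.
by move=> h; rewrite distrC; apply: H => //; rewrite distrC.
Qed.

Lemma sh_bounded p : exists K : R, forall n, `|sh n p| <= K.
Proof.
exists (s0 + `|p.1| * (a0 * M)) => n; rewrite /sh.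
have := Sn_increment n 0 (Num.truncn (p.1 / tick n)); rewrite add0n Sn0 => h.
rewrite ger0_norm; last by rewrite (le_trans (ltW s0_gt0))// Sn_ge.
have : (Num.truncn (p.1 / tick n))%:R * tick n <= `|p.1|.
  have [p0|p0] := ltP p.1 0.
    rewrite (_ : Num.truncn _ = 0%N) ?mul0r//.
    by rewrite truncn_floor leNgt pmulr_llt0 ?invr_gt0// p0.
  by have /andP[h1 _] := truncn_div_itv (tick_gt0 n) p0; rewrite ger0_norm.
rewrite -(ler_pM2r aM0); lra.
Qed.

Lemma uh_bounded p : exists K : R, forall n, `|uh n p| <= K.
Proof. by exists M => n; have /andP[h1 h2] := Un_itv n (Num.truncn (p.1 / tick n)) (Num.truncn (p.2 / mesh n)); rewrite ger0_norm. Qed.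


Variables (T : R) (u : R * R -> R) (s : R -> R).
Hypothesis T_gt0 : 0 < T.
Hypothesis cb : continuous b.
Hypothesis cu0 : continuous u0.
Hypothesis cu : continuous u.
Hypothesis cs : continuous s.
Hypothesis uh_cvg : forall L e : R, 0 <= L -> 0 < e -> F [set n | forall p,
  0 <= p.1 <= L -> 0 <= p.2 <= L -> `|uh n p - u p| <= e].
Hypothesis sh_cvg : forall L e : R, 0 <= L -> 0 < e -> F [set n | forall p,
  0 <= p.1 <= L -> 0 <= p.2 <= L -> `|sh n p - s p.1| <= e].

(** The side of a square that contains all grid points in use: times up to [T], fronts up to
    [s0 + a0 M T], one more cell, and hats reaching a unit past the front. *)
Let L := T + s0 + a0 * M * T + 2.
Let L_gt0 : 0 < L. Proof. by rewrite !addr_gt0// mulr_gt0. Qed.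
Let TL : T <= L. Proof. by rewrite /L; have := mulr_gt0 aM0 T_gt0; have := s0_gt0; lra. Qed.

Definition Kn n t := Num.truncn (t / tick n).

Lemma Kn_itv n t : 0 <= t -> (Kn n t)%:R * tick n <= t < (Kn n t)%:R * tick n + tick n.
Proof. by move=> t0; exact: truncn_div_itv. Qed.

Lemma lt_Kn n t k : 0 <= t -> (k < Kn n t)%N -> k%:R * tick n <= t.
Proof.
move=> t0 kK; have /andP[h _] := Kn_itv n t0; apply: le_trans h.
by rewrite ler_pM2r// ler_nat ltnW.
Qed.

Let grid0 n k : 0 <= k%:R * tick n. Proof. by rewrite mulr_ge0// ltW. Qed.
Let hgrid0 n j : 0 <= j%:R * mesh n. Proof. by rewrite mulr_ge0// ltW. Qed.

Lemma near_Un e : 0 < e -> F [set n | forall k j, k%:R * tick n <= L -> j%:R * mesh n <= L ->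
  `|Un n k j - u (k%:R * tick n, j%:R * mesh n)| <= e].
Proof.
move=> e0; apply: filterS (uh_cvg (ltW L_gt0) e0) => n /= hn k j kL jL.
have := hn (k%:R * tick n, j%:R * mesh n); rewrite /uh /= !truncn_mul//; apply.
  by rewrite grid0.
by rewrite hgrid0.
Qed.

Lemma near_Sn e : 0 < e -> F [set n | forall k, k%:R * tick n <= L ->
  `|Sn n k - s (k%:R * tick n)| <= e].
Proof.
move=> e0; apply: filterS (sh_cvg (ltW L_gt0) e0) => n /= hn k kL.
have := hn (k%:R * tick n, 0); rewrite /sh /= truncn_mul//; apply.
  by rewrite grid0.
by rewrite lexx ltW.
Qed.

Lemma mesh_le1 n : mesh n <= 1.
Proof.
apply: le_trans (mesh_le n); rewrite ler_peMr ?ltW//.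
by have := bg0; have := aM0; lra.
Qed.

Lemma Sn_le n k : Sn n k <= s0 + k%:R * tick n * (a0 * M).
Proof. by have := Sn_increment n 0 k; rewrite add0n Sn0; lra. Qed.

Lemma Nn_le n k : k%:R * tick n <= T -> (Nn n k).+1%:R * mesh n <= L.
Proof.
move=> kT; have /andP[h1 _] := Nn_itv n k; have h2 := Sn_le n k; have h3 := mesh_le1 n.
have h4 : k%:R * tick n * (a0 * M) <= T * (a0 * M) by rewrite ler_pM2r.
rewrite -natr1 mulrDl mul1r /L; have := T_gt0; lra.
Qed.

Lemma near_tick_le (e t : R) : 0 < e -> 0 <= t -> F [set n | `|(Kn n t)%:R * tick n - t| <= e].
Proof.
move=> e0 t0; apply: filterS (near_tick e0) => n /= td.
have /andP[h1 h2] := Kn_itv n t0; rewrite distrC ger0_norm; lra.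
Qed.

Let norm_lim (x : R) : (forall e : R, 0 < e -> `|x| <= e) -> x = 0.
Proof.
move=> h; apply/eqP; rewrite -normr_le0; apply/ler_addgt0Pl => e e0.
by rewrite addr0; exact: h.
Qed.

Let sqr_le (x P : R) : `|x| <= P -> x ^+ 2 <= P ^+ 2.
Proof.
move=> h; rewrite -[x ^+ 2]real_normK ?num_real// ler_pXn2r ?nnegrE//.
exact: le_trans h.
Qed.

Lemma s_bounds t : 0 <= t <= T -> s0 <= s t <= s0 + T * (a0 * M).
Proof.
move=> /andP[t0 tT].
have tL : 0 <= t <= L by rewrite t0 (le_trans tT TL).
have H e : 0 < e -> s0 - e <= s t <= s0 + T * (a0 * M) + e.
  move=> e0; have [n hn] := filter_ex (sh_cvg (ltW L_gt0) e0).
  have := hn (t, 0); rewrite /= lexx (ltW L_gt0) => /(_ tL isT).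
  have h1 := Sn_ge n (Kn n t); have h2 := Sn_le n (Kn n t).
  have /andP[h3 _] := Kn_itv n t0.
  have : (Kn n t)%:R * tick n * (a0 * M) <= T * (a0 * M) by rewrite ler_pM2r// (le_trans h3).
  rewrite /sh /= -/(Kn n t) ler_distl => h4 /andP[h5 h6]; lra.
apply/andP; split; apply/ler_addgt0Pl => e e0; have := H _ e0; lra.
Qed.

Lemma u_bounds t y : 0 <= t <= L -> 0 <= y <= L -> 0 <= u (t, y) <= M.
Proof.
move=> tL yL.
have H e : 0 < e -> - e <= u (t, y) <= M + e.
  move=> e0; have [n hn] := filter_ex (uh_cvg (ltW L_gt0) e0).
  have := hn (t, y) tL yL; rewrite /uh/= ler_distl.
  have := Un_itv n (Num.truncn (t / tick n)) (Num.truncn (y / mesh n)); lra.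
apply/andP; split; apply/ler_addgt0Pl => e e0; have := H _ e0; lra.
Qed.

Lemma u_initial0 z : 0 <= z <= s0 -> u (0, z) = u0 z.
Proof.
move=> /andP[z0 zs]; apply/eqP; rewrite -subr_eq0; apply/eqP; apply: norm_lim => e e0.
have e2 : 0 < e / 2 by rewrite divr_gt0.
have sL : s0 <= L by rewrite /L; have := mulr_gt0 aM0 T_gt0; have := T_gt0; lra.
have zL : 0 <= z <= L by rewrite z0 (le_trans zs).
have /cvgrPdist_le /(_ _ e2) [d /= d0 hd] : u0 x @[x --> z] --> u0 z by exact: cu0.
have d2 : 0 < d / 2 by rewrite divr_gt0.
have [n [h1 h2]] := filter_ex (filterI (uh_cvg (ltW L_gt0) e2) (near_mesh d2)).
have := h1 (0, z); rewrite /= lexx (ltW L_gt0) => /(_ isT zL) h3.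
have /andP[h4 h5] := truncn_div_itv (mesh_gt0 n) z0.
have E : uh n (0, z) = u0 ((Num.truncn (z / mesh n))%:R * mesh n).
  rewrite /uh /= mul0r (_ : Num.truncn 0 = 0%N) ?truncn0//.
  rewrite /Un /U /=; congr (u0 (_%:R * _)); apply/minn_idPl.
  by apply: le_truncn; rewrite ler_pM2r ?invr_gt0.
rewrite E distrC in h3.
have h6 : `|u0 z - u0 ((Num.truncn (z / mesh n))%:R * mesh n)| <= e / 2.
  apply: hd => /=; rewrite ger0_norm ?subr_ge0//; move: h2 => /=; lra.
apply: le_trans (ler_distD (u0 ((Num.truncn (z / mesh n))%:R * mesh n)) _ _) _.
rewrite [X in _ + X]distrC; lra.
Qed.

(** Far enough along the filter the discrete front lies left of [y], and the discrete state is
    constant from there on. *)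
Lemma u_front t y : 0 <= t <= T -> s t <= y -> y <= L -> u (t, y) = u (t, s t).
Proof.
move=> tT; rewrite le_eqVlt => /orP[/eqP -> //|sy yL].
have /andP[t0 tT'] := tT; have /andP[ss sS] := s_bounds tT.
have st0 : 0 < s t by apply: lt_le_trans ss.
have tL : 0 <= t <= L by rewrite t0 (le_trans tT' TL).
have y0 : 0 <= y <= L by rewrite (le_trans (ltW st0) (ltW sy)).
apply/eqP; rewrite -subr_eq0; apply/eqP; apply: norm_lim => e e0.
have e3 : 0 < e / 3 by rewrite divr_gt0.
have [d d0 hd] := unif_continuous_square L cu e3.
pose d' := Num.min d (y - s t).
have d'0 : 0 < d' by rewrite lt_min d0 subr_gt0.
have [n [h1 h2]] := filter_ex (filterI (uh_cvg (ltW L_gt0) e3) (sh_cvg (ltW L_gt0) d'0)).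
pose k := Kn n t; pose S := Sn n k.
have hS : `|S - s t| <= d'.
  by have := h2 (t, 0); rewrite /= lexx (ltW L_gt0); apply.
have S0 : 0 <= S by rewrite (le_trans (ltW s0_gt0))// Sn_ge.
move: hS; rewrite le_min => /andP[hSd]; rewrite ler_distl => /andP[_ Sy].
have SL : 0 <= S <= L by rewrite S0; case/andP: y0 => _; lra.
have E : uh n (t, y) = uh n (t, S).
  rewrite /uh /= -/(Kn n t) -/k -/(Nn n k) Un_front// /Nn.
  by apply: le_truncn; rewrite ler_pM2r ?invr_gt0// -/S; lra.
have A := h1 (t, y) tL y0; have B1 := h1 (t, S) tL SL; rewrite E in A.
have C1 : `|u (t, S) - u (t, s t)| <= e / 3.
  apply: hd => //; rewrite ?subrr ?normr0 ?(ltW d0)// (ltW st0)/=; case/andP: y0 => _; lra.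
apply: le_trans (ler_distD (uh n (t, S)) _ _) _; rewrite distrC.
apply: le_trans (lerD (lexx _) (ler_distD (u (t, S)) _ _)) _; lra.
Qed.

Lemma time_sum (A : nat -> nat -> R) (f : R -> R) t : 0 <= t <= T -> continuous f ->
  (forall e, 0 < e -> F [set n | forall k, k%:R * tick n <= t ->
     `|A n k - f (k%:R * tick n)| <= e]) ->
  \sum_(k < Kn n t) tick n * A n k @[n --> F] --> \int[leb]_(r in `[0, t]) f r.
Proof.
move=> /andP[t0 tT] cf hA; apply/cvgrPdist_le => e e0.
have cf2 : continuous (fun p : R * R => f p.2).
  by move=> p; apply: (cvg_comp snd f); [exact: cvg_snd|exact: cf].
have [d d0 hd] := riemann_sum2 cf2 (ltW L_gt0) e0.
apply: filterS3 (near_tick d0) (near_tick_le d0 t0) (hA d d0) => n /= h1 h2 h3.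
rewrite distrC; apply: (hd 0) => //; rewrite ?lexx ?(ltW L_gt0) ?t0 ?(le_trans tT TL)//.
  by have /andP[h _] := Kn_itv n t0; rewrite (le_trans h)// (le_trans tT TL).
by move=> k kK; apply: h3; exact: lt_Kn kK.
Qed.

Lemma plane_sum (B2 : nat -> nat -> nat -> R) (J : nat -> nat -> nat) (Psi : R * R -> R) (z : R -> R) :
  continuous Psi -> continuous z -> (forall t, 0 <= t <= T -> 0 <= z t <= L) ->
  (forall e, 0 < e -> F [set n | forall k, k%:R * tick n <= T ->
     `|(J n k)%:R * mesh n - z (k%:R * tick n)| <= e /\ (J n k)%:R * mesh n <= L]) ->
  (forall e, 0 < e -> F [set n | forall k j, k%:R * tick n <= T -> (j < J n k)%N ->
     `|B2 n k j - Psi (k%:R * tick n, j%:R * mesh n)| <= e]) ->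
  \sum_(k < Kn n T) tick n * \sum_(j < J n k) mesh n * B2 n k j @[n --> F] -->
    \int[leb]_(t in `[0, T]) \int[leb]_(y in `[0, z t]) Psi (t, y).
Proof.
move=> cP cz zL hJ hB.
have -> : \int[leb]_(t in `[0, T]) \int[leb]_(y in `[0, z t]) Psi (t, y) =
    \int[leb]_(t in `[0, T]) \int[leb]_(y in `[0, z (clamp 0 T t)]) Psi (clamp 0 T t, y).
  by apply: eq_Rintegral => t; rewrite inE/= in_itv/= => tT; rewrite clamp_id.
apply: (@time_sum (fun n k => \sum_(j < J n k) mesh n * B2 n k j)
  (fun t => \int[leb]_(y in `[0, z (clamp 0 T t)]) Psi (clamp 0 T t, y)) T); first by rewrite lexx ltW.
  by apply: (@continuous_slice_integral _ Psi z T L) => //; exact: ltW.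
move=> e e0; have [d d0 hd] := riemann_sum2 cP (ltW L_gt0) e0.
apply: filterS3 (near_mesh d0) (hJ d d0) (hB d d0) => n /= h1 h2 h3 k kT.
have kT' : 0 <= k%:R * tick n <= T by rewrite grid0.
have [h4 h5] := h2 k kT; rewrite clamp_id//; apply: hd => //.
- by rewrite grid0 (le_trans kT TL).
- exact: zL.
- by move=> j jJ; apply: h3.
Qed.

Lemma near_Nn e : 0 < e -> F [set n | forall k, k%:R * tick n <= T ->
  `|(Nn n k).+1%:R * mesh n - s (k%:R * tick n)| <= e /\ (Nn n k).+1%:R * mesh n <= L].
Proof.
move=> e0; have e2 : 0 < e / 2 by rewrite divr_gt0.
apply: filterS2 (near_mesh e2) (near_Sn e2) => n /= h1 h2 k kT; split; last exact: Nn_le.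
have h3 := h2 k (le_trans kT TL); have /andP[h4 h5] := Nn_itv n k.
move: h3; rewrite !ler_distl -[(Nn n k).+1%:R]natr1 mulrDl mul1r; lra.
Qed.

Lemma continuous_front (f : R * R -> R) : continuous f -> continuous (fun t => f (t, s t)).
Proof.
move=> cf t; have cst : s r @[r --> t] --> s t by exact: cs.
have h : ((r, s r) @[r --> t] --> (t, s t)) by exact: (cvg_pair cvg_id cst).
exact: (cvg_comp _ _ h (cf _)).
Qed.

Lemma near_Un_front e : 0 < e -> F [set n | forall k, k%:R * tick n <= T ->
  `|Un n k (Nn n k) - u (k%:R * tick n, s (k%:R * tick n))| <= e].
Proof.
move=> e0; have e2 : 0 < e / 2 by rewrite divr_gt0.
have [d d0 hd] := unif_continuous_square L cu e2.
have d2 : 0 < d / 2 by rewrite divr_gt0.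
apply: filterS3 (near_Un e2) (near_mesh d2) (near_Nn d2) => n /= h1 h2 h4 k kT.
have /andP[h5 h6] := Nn_itv n k; have [_ h7] := h4 k kT.
have kT' : 0 <= k%:R * tick n <= T by rewrite grid0.
have /andP[s1 s2] := s_bounds kT'.
have NL : (Nn n k)%:R * mesh n <= L.
  by apply: le_trans h7; rewrite ler_pM2r// ler_nat.
have A := h1 k (Nn n k) (le_trans kT TL) NL.
pose z := (Nn n k)%:R * mesh n.
have sL : s (k%:R * tick n) <= L by rewrite /L; have := T_gt0; lra.
have zs : `|z - s (k%:R * tick n)| <= d.
  have [h8 _] := h4 k kT; move: h8; rewrite !ler_distl -[(Nn n k).+1%:R]natr1 mulrDl mul1r -/z; lra.
have B1 : `|u (k%:R * tick n, z) - u (k%:R * tick n, s (k%:R * tick n))| <= e / 2.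
  apply: hd => //; rewrite ?subrr ?normr0 ?(ltW d0) ?grid0 ?hgrid0 ?(le_trans kT TL)// sL andbT.
  exact: le_trans (ltW s0_gt0) s1.
apply: le_trans (ler_distD (u (k%:R * tick n, z)) _ _) _; rewrite /z in B1 *; lra.
Qed.

Lemma front_integral t : 0 <= t <= T ->
  s t = s0 + a0 * \int[leb]_(r in `[0, t]) u (r, s r).
Proof.
move=> /andP[t0 tT]; have tT' : 0 <= t <= T by rewrite t0.
have A : \sum_(k < Kn n t) tick n * Un n k (Nn n k) @[n --> F] --> \int[leb]_(r in `[0, t]) u (r, s r).
  apply: (@time_sum (fun n k => Un n k (Nn n k)) (fun r => u (r, s r))) => //; first exact: continuous_front.
  move=> e e0; apply: filterS (near_Un_front e0) => n /= h k kt; apply: h; exact: le_trans kt tT.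
have SE n K : Sn n K = s0 + a0 * \sum_(k < K) tick n * Un n k (Nn n k).
  elim: K => [|K IH]; first by rewrite Sn0 big_ord0 mulr0 addr0.
  by rewrite SnS IH big_ord_recr /=; ring.
have B1 : Sn n (Kn n t) @[n --> F] --> s0 + a0 * \int[leb]_(r in `[0, t]) u (r, s r).
  under eq_fun do rewrite SE.
  by apply: cvgD; [exact: cvg_cst|apply: cvgMr].
have B2 : Sn n (Kn n t) @[n --> F] --> s t.
  apply/cvgrPdist_le => e e0; apply: filterS (sh_cvg (ltW L_gt0) e0) => n /= h.
  have := h (t, 0); rewrite /= t0 (le_trans tT TL) lexx (ltW L_gt0) distrC; exact.
exact: (cvg_unique _ B2 B1).
Qed.

(** [dn n k j] stands for [tick n] times [u_t], and [mesh n * tick n] is the area of a cell of the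
    plane: [Lam n phi] approximates the integral of [u_t phi] over the domain. *)
Definition Lam n (phi : R * R -> R) := \sum_(k < Kn n T) \sum_(j < (Nn n k).+1)
  mesh n * dn n k j * phi (k%:R * tick n, j%:R * mesh n).

(** Completing the square against the dissipation. In this inhomogeneous form the L2 bound passes to
    the limit term by term, and it is the form that the Riesz theorem takes. *)
Lemma Lam_bound n phi : 2 * Lam n phi <= 8 * C +
  \sum_(k < Kn n T) tick n * \sum_(j < (Nn n k).+1) mesh n * phi (k%:R * tick n, j%:R * mesh n) ^+ 2.
Proof.
have h0 := mesh_gt0 n.
have E : 8 * C >= 8 / mesh n * \sum_(k < Kn n T) \sum_(j < (Nn n k).+1) dn n k j ^+ 2.
  have := Un_dissipation n (Kn n T); rewrite -(ler_pM2l (_ : 0 < 8 / mesh n)); last exact: divr_gt0.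
  by rewrite [8 / _ * (_ * C)]mulrA mulfVK ?gt_eqF.
apply: le_trans (lerD E (lexx _)); rewrite /Lam !mulr_sumr -big_split/=.
apply: ler_sum => k _; rewrite !mulr_sumr -big_split/=; apply: ler_sum => j _.
set d := dn n k j; set p := phi _; rewrite -subr_ge0 /tick.
have -> : 8 / mesh n * d ^+ 2 + mesh n ^+ 2 / 8 * (mesh n * p ^+ 2) - 2 * (mesh n * d * p) =
    8 / mesh n * (d - mesh n ^+ 2 * p / 8) ^+ 2 by field; rewrite gt_eqF.
by rewrite mulr_ge0 ?sqr_ge0// divr_ge0// ltW.
Qed.

Lemma Lam_lin n (f g : R * R -> R) (x y : R) :
  Lam n (fun p => x * f p + y * g p) = x * Lam n f + y * Lam n g.
Proof.
rewrite /Lam !mulr_sumr -big_split/=; apply: eq_bigr => k _.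
by rewrite !mulr_sumr -big_split/=; apply: eq_bigr => j _; ring.
Qed.

Lemma Lam_cvg phi : continuous phi -> exists l : R, Lam n phi @[n --> F] --> l.
Proof.
move=> cp; have [P P0 hP] := bounded_square L cp.
have H n (f : R * R -> R) : (forall t y, 0 <= t <= L -> 0 <= y <= L -> `|f (t, y)| <= P) ->
    Lam n f <= 4 * C + L * L * P ^+ 2.
  move=> hf; have := Lam_bound n f.
  set X := \sum_(k < _) _; suff : X <= L * L * P ^+ 2.
    have : 0 <= L * L * P ^+ 2 by rewrite !mulr_ge0 ?sqr_ge0 ?ltW.
    lra.
  have Y k : (k < Kn n T)%N ->
      \sum_(j < (Nn n k).+1) mesh n * f (k%:R * tick n, j%:R * mesh n) ^+ 2 <= L * P ^+ 2.
    move=> kK; have kT := lt_Kn (ltW T_gt0) kK; have NL := Nn_le kT.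
    apply: (@le_trans _ _ (\sum_(j < (Nn n k).+1) mesh n * P ^+ 2)).
      apply: ler_sum => j _; rewrite ler_pM2l// sqr_le// hf//.
        by rewrite grid0 (le_trans kT TL).
      by rewrite hgrid0 (le_trans _ NL)// ler_pM2r// ler_nat ltnW// ltn_ord.
    rewrite sumr_const card_ord -[leLHS]mulr_natl mulrA ler_wpM2r ?sqr_ge0//.
  apply: (@le_trans _ _ (\sum_(k < Kn n T) tick n * (L * P ^+ 2))).
    by apply: ler_sum => k _; rewrite ler_pM2l// Y.
  rewrite sumr_const card_ord -[leLHS]mulr_natl mulrA [leRHS](_ : _ = L * (L * P ^+ 2)); last by ring.
  apply: ler_wpM2r; first by rewrite mulr_ge0 ?sqr_ge0// ltW.
  by have /andP[h _] := Kn_itv n (ltW T_gt0); exact: le_trans h TL.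
apply: (@ultra_cvg _ _ _ (4 * C + L * L * P ^+ 2) FU) => n.
rewrite ler_norml H// andbT lerNl.
have -> : - Lam n phi = Lam n (fun p => (-1) * phi p + 0 * phi p) by rewrite Lam_lin; ring.
by apply: H => t y ht hy; rewrite mul0r addr0 mulN1r normrN hP.
Qed.

Lemma s_itv t : 0 <= t <= T -> 0 <= s t <= L.
Proof.
move=> tT; have /andP[h1 h2] := s_bounds tT; rewrite (le_trans (ltW s0_gt0) h1)/= /L.
have := T_gt0; lra.
Qed.

Lemma sqint_continuous_Q phi : continuous phi -> sqint (@leb2 R) (Q s T) phi.
Proof.
move=> cp; have mp : measurable_fun (Q s T) phi by apply: measurable_funTS; exact: measurable_continuous2.
split => //; have [P P0 hP] := bounded_square L cp.
have sL t : 0 < t < T -> s t <= L.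
  move=> /andP[t0 tT]; have tT' : 0 <= t <= T by rewrite !ltW.
  by have /andP[] := s_itv tT'.
apply: (integrable_Q_bounded cs sL (M := P ^+ 2)); first exact: measurable_funX.
move=> [t y] [/= /andP[t0 tT] /andP[y0 ys]]; rewrite normrX sqr_le// normr_id hP//.
  by rewrite (ltW t0)/= (le_trans (ltW tT) TL).
by rewrite (ltW y0)/= (le_trans (ltW ys))// sL// t0.
Qed.

Lemma Lam_repr : exists2 ut, sqint (@leb2 R) (Q s T) ut &
  forall phi, continuous phi ->
    Lam n phi @[n --> F] --> \int[@leb2 R]_(p in Q s T) (ut p * phi p).
Proof.
pose Lf phi := lim (Lam n phi @[n --> F]).
have hL phi : continuous phi -> Lam n phi @[n --> F] --> Lf phi.
  by move=> cp; have [l hl] := Lam_cvg cp; apply/cvgP; exact: hl.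
have [| | | | |ut sut [_ hut]] := @riesz_representation _ _ R (@leb2 R) (Q s T) (measurable_Q T cs)
  [set phi | continuous phi] Lf (8 * C).
- by move=> phi; exact: sqint_continuous_Q.
- by move=> p; exact: cvg_cst.
- by move=> f g x y cf cg p; apply: cvgD; apply: cvgMr; [exact: cf|exact: cg].
- move=> f g x y cf cg; apply: (@cvg_lim _ (@Rhausdorff R)).
  under eq_fun do rewrite Lam_lin.
  by apply: cvgD; apply: cvgMr; exact: hL.
- move=> phi cp.
  have A : 2 * Lam n phi @[n --> F] --> 2 * Lf phi by apply: cvgMr; exact: hL.
  have c2 : continuous (fun p => phi p ^+ 2).
    by move=> p; apply: (@continuous_comp _ _ _ phi (fun x => x ^+ 2)); [exact: cp|exact: exprn_continuous].
  have B1 : \sum_(k < Kn n T) tick n * \sum_(j < (Nn n k).+1) mesh n * phi (k%:R * tick n, j%:R * mesh n) ^+ 2 @[n --> F]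
     --> \int[leb]_(t in `[0, T]) \int[leb]_(y in `[0, s t]) phi (t, y) ^+ 2.
    apply: (@plane_sum (fun n k j => phi (k%:R * tick n, j%:R * mesh n) ^+ 2) (fun n k => (Nn n k).+1) (fun p => phi p ^+ 2)) => //.
    + exact: s_itv.
    + exact: near_Nn.
    + by move=> e e0; apply: filterE => n k j _ _; rewrite subrr normr0 ltW.
  have [_ i2] := sqint_continuous_Q cp.
  have [_ _ ->] := Fubini_Q cs i2.
  apply: (ler_cvg_to A (cvgD (cvg_cst (8 * C)) B1)).
  by apply: filterE => n; exact: Lam_bound.
exists ut => // phi cp; rewrite -hut//; exact: hL.
Qed.

Lemma Lam_slice n k (psi : nat -> R) :
  \sum_(j < (Nn n k).+1) mesh n * dn n k j * psi j =
  tick n * (- (a0 * Un n k (Nn n k) ^+ 2 * psi (Nn n k))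
    + beta * (b (k%:R * tick n) - gamma * Un n k 0) * psi 0%N
    - (mesh n)^-1 * \sum_(j < Nn n k) (Un n k j.+1 - Un n k j) * (psi j.+1 - psi j)).
Proof.
have h0 := mesh_gt0 n.
have := @summation_by_parts R psi (fun j => Un n k j.+1 - Un n k j)
  (flux_left gamma beta (mesh n) (b (k%:R * tick n)) (Un n k))
  (- (mesh n * a0 * Un n k (Nn n k) ^+ 2)) (Nn n k) (fun j => erefl).
set S := \sum_(j < Nn n k) (Un n k j.+1 - Un n k j) * _ => E.
rewrite big_ord_recr /=.
transitivity (mesh n / 8 * (\sum_(j < Nn n k) psi j * (Un n k j.+1 - Un n k j -
    flux_left gamma beta (mesh n) (b (k%:R * tick n)) (Un n k) j) +
  psi (Nn n k) * (- (mesh n * a0 * Un n k (Nn n k) ^+ 2) -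
    flux_left gamma beta (mesh n) (b (k%:R * tick n)) (Un n k) (Nn n k)))).
  rewrite [RHS]mulrDr mulr_sumr; congr (_ + _).
    apply: eq_bigr => j _; have := @Un_flux n k j (ltnW (ltn_ord j)).
    by rewrite /flux_right ltn_ord => e; rewrite -e; field.
  have := @Un_flux n k (Nn n k) (leqnn _).
  by rewrite /flux_right ltnn => e; rewrite -e; field.
rewrite E /= /tick; field; rewrite gt_eqF//.
Qed.

(** The increments of the hat are [- h] up to the last node [J] before [Z], [- th] in the cell of
    [Z], and 0 afterwards. The sum telescopes up to a fraction of one increment of [v]. *)
Lemma hat_sum (v : nat -> R) (h Z : R) N : 0 < h -> 0 <= Z ->
  (forall j, (N <= j)%N -> v j = v N) ->
  `|- (h^-1 * \sum_(j < N) (v j.+1 - v j) * (Num.max (Z - j.+1%:R * h) 0 - Num.max (Z - j%:R * h) 0))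
    - (v (Num.truncn (Z / h)) - v 0%N)| <=
  `|v (Num.truncn (Z / h)).+1 - v (Num.truncn (Z / h))|.
Proof.
move=> h0 Z0 vN; have /andP[J1 J2] := truncn_div_itv h0 Z0.
set J := Num.truncn (Z / h) in J1 J2 *.
pose psi (j : nat) := Num.max (Z - j%:R * h) 0.
have p1 j : (j <= J)%N -> psi j = Z - j%:R * h.
  move=> jJ; apply/max_idPl; rewrite subr_ge0; apply: le_trans J1.
  by rewrite ler_pM2r// ler_nat.
have p2 j : (J < j)%N -> psi j = 0.
  move=> Jj; apply/max_idPr; rewrite subr_le0; apply: le_trans (ltW J2) _.
  rewrite -[X in _ + X <= _]mul1r -mulrDl ler_pM2r// natr1 ler_nat//.
have S1 n : (n <= J)%N -> \sum_(j < n) (v j.+1 - v j) * (psi j.+1 - psi j) = - h * (v n - v 0%N).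
  elim: n => [_|n IH nJ]; first by rewrite big_ord0 subrr mulr0.
  rewrite big_ord_recr /= IH ?(ltnW nJ)// !p1 ?(ltnW nJ)// -natr1; ring.
pose th := Z - J%:R * h.
have S2 n : (J < n)%N -> \sum_(j < n) (v j.+1 - v j) * (psi j.+1 - psi j) =
    - h * (v J - v 0%N) - th * (v J.+1 - v J).
  elim: n => // n IH; rewrite ltnS leq_eqVlt => /orP[/eqP Jn|Jn].
    by rewrite big_ord_recr /= -Jn S1// p2// p1// /th; ring.
  by rewrite big_ord_recr /= IH// !p2// ?ltnS ?(ltnW Jn)//; ring.
have hn : h != 0 by rewrite gt_eqF.
have [NJ|JN] := leqP N J.
  rewrite [X in h^-1 * X]S1// (vN J NJ) (_ : _ - _ = 0) ?normr0//.
  by field.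
rewrite [X in h^-1 * X]S2//.
have -> : - (h^-1 * (- h * (v J - v 0%N) - th * (v J.+1 - v J))) - (v J - v 0%N) =
    (th / h) * (v J.+1 - v J) by field.
rewrite normrM ler_piMl// ger0_norm; last by rewrite divr_ge0 ?(ltW h0)// /th subr_ge0.
by rewrite ler_pdivrMr// mul1r /th lerBlDl ltW.
Qed.

Let ucv (A : nat -> nat -> R) (f : R -> R) := forall e : R, 0 < e ->
  F [set n | forall k, k%:R * tick n <= T -> `|A n k - f (k%:R * tick n)| <= e].

Let ucvD A A' f f' : ucv A f -> ucv A' f' -> ucv (fun n k => A n k + A' n k) (fun t => f t + f' t).
Proof.
move=> h h' e e0; have e2 : 0 < e / 2 by rewrite divr_gt0.
apply: filterS2 (h _ e2) (h' _ e2) => n /= k k' i iT.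
have := k i iT; have := k' i iT; rewrite !ler_distl; lra.
Qed.

Let ucv_grid (f : R -> R) : ucv (fun n k => f (k%:R * tick n)) f.
Proof. by move=> e e0; apply: filterE => n k _; rewrite subrr normr0 ltW. Qed.

Let ucvM A A' f f' : continuous f -> continuous f' ->
  ucv A f -> ucv A' f' -> ucv (fun n k => A n k * A' n k) (fun t => f t * f' t).
Proof.
move=> cf cf' h h' e e0.
have [P P0 hP] := continuous_itv_bound (ltW T_gt0) (continuous_subspaceT cf).
have [P' P'0 hP'] := continuous_itv_bound (ltW T_gt0) (continuous_subspaceT cf').
pose e1 := Num.min 1 (e / (P + P' + 1)).
have q0 : 0 < P + P' + 1 by lra.
have e10 : 0 < e1 by rewrite lt_min ltr01 divr_gt0.
apply: filterS2 (h _ e10) (h' _ e10) => n /= k k' i iT.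
have iT' : 0 <= i%:R * tick n <= T by rewrite grid0.
have := k i iT; have := k' i iT; have := hP _ iT'; have := hP' _ iT'.
set x := A n i; set y := A' n i; set a := f _; set b' := f' _ => h1 h2 h3 h4.
have -> : x * y - a * b' = (x - a) * (y - b') + (x - a) * b' + a * (y - b') by ring.
have e11 : e1 <= 1 by rewrite ge_min lexx.
have e12 : e1 * (P + P' + 1) <= e by rewrite -ler_pdivlMr// ge_min lexx orbT.
apply: le_trans (ler_normD _ _) _; apply: le_trans (lerD (ler_normD _ _) (lexx _)) _.
rewrite !normrM.
have m1 : `|x - a| * `|y - b'| <= e1 * 1 by apply: ler_pM => //; exact: le_trans h3 e11.
have m2 : `|x - a| * `|b'| <= e1 * P' by apply: ler_pM.
have m3 : `|a| * `|y - b'| <= P * e1 by apply: ler_pM.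
lra.
Qed.

Lemma hat_cvg (eta : R -> R) (Z : R) : continuous eta -> 0 <= Z <= L - 1 ->
  Lam n (fun p : R * R => eta p.1 * Num.max (Z - p.2) 0) @[n --> F] -->
  \int[leb]_(t in `[0, T]) (eta t * (- (a0 * u (t, s t) ^+ 2 * Num.max (Z - s t) 0)
    + beta * (b t - gamma * u (t, 0)) * Z + (u (t, Z) - u (t, 0)))).
Proof.
move=> ce /andP[Z0 ZL].
pose J n := Num.truncn (Z / mesh n).
(* The defect estimated by [hat_sum]; it is at most one spatial increment and tends to 0 by
   [Un_space]. *)
pose err n k := - ((mesh n)^-1 * \sum_(j < Nn n k) (Un n k j.+1 - Un n k j) *
    (Num.max (Z - j.+1%:R * mesh n) 0 - Num.max (Z - j%:R * mesh n) 0))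
    - (Un n k (J n) - Un n k 0).
pose A n k := - a0 * (Un n k (Nn n k) * Un n k (Nn n k) * Num.max (Z - (Nn n k)%:R * mesh n) 0)
  + beta * Z * (b (k%:R * tick n) + - gamma * Un n k 0) + (Un n k (J n) + (-1) * Un n k 0) + err n k.
have -> : (fun n => Lam n (fun p : R * R => eta p.1 * Num.max (Z - p.2) 0)) =
    (fun n => \sum_(k < Kn n T) tick n * (eta (k%:R * tick n) * A n k)).
  apply/funext => n; rewrite /Lam; apply: eq_bigr => k _.
  transitivity (eta (k%:R * tick n) * \sum_(j < (Nn n k).+1) mesh n * dn n k j * Num.max (Z - j%:R * mesh n) 0).
    by rewrite mulr_sumr; apply: eq_bigr => j _; rewrite mulrCA.
  rewrite (Lam_slice n k (fun j => Num.max (Z - j%:R * mesh n) 0)) mulrCA; congr (_ * (_ * _)).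
  rewrite /A /err (_ : Num.max (Z - 0%:R * mesh n) 0 = Z); last by rewrite mul0r subr0; apply/max_idPl.
  ring.
have cc (c : R) : continuous (fun _ : R => c) by move=> x; exact: cvg_cst.
have cuf : continuous (fun t => u (t, s t)) by exact: continuous_front.
have cm : continuous (fun t => Num.max (Z - s t) 0).
  move=> t; apply: (@continuous_max _ _ (fun t => Z - s t) (fun=> 0)); last exact: cvg_cst.
  by apply: cvgB; [exact: cvg_cst|exact: cs].
have cu_ y : continuous (fun t => u (t, y)) by exact: continuous_slice1.
have L1 : 1 <= L by rewrite /L; have := mulr_gt0 aM0 T_gt0; have := s0_gt0; have := T_gt0; lra.
have ZL' : 0 <= Z <= L by rewrite Z0/= (le_trans ZL)// lerBlDr lerDl.
have V1 : ucv (fun n k => Un n k (Nn n k)) (fun t => u (t, s t)) by exact: near_Un_front.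
have V2 : ucv (fun n k => Num.max (Z - (Nn n k)%:R * mesh n) 0) (fun t => Num.max (Z - s t) 0).
  move=> e e0; have e2 : 0 < e / 2 by rewrite divr_gt0.
  apply: filterS2 (near_mesh e2) (near_Nn e2) => n /= h1 h2 k kT.
  have [h3 _] := h2 k kT; have h0 := mesh_gt0 n; move: h3; rewrite -[(Nn n k).+1%:R]natr1 mulrDl mul1r !ler_distl.
  rewrite /Num.max; case: ifP; case: ifP; lra.
have V3 : ucv (fun n k => Un n k 0) (fun t => u (t, 0)).
  move=> e e0; apply: filterS (near_Un e0) => n /= h k kT.
  by have := h k 0%N (le_trans kT TL); rewrite mul0r; apply; exact: ltW.
have V4 : ucv (fun n k => Un n k (J n)) (fun t => u (t, Z)).
  move=> e e0; have e2 : 0 < e / 2 by rewrite divr_gt0.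
  have [d d0 hd] := unif_continuous_square L cu e2.
  apply: filterS2 (near_Un e2) (near_mesh d0) => n /= h md k kT.
  have /andP[j1 j2] := truncn_div_itv (mesh_gt0 n) Z0; rewrite -/(J n) in j1 j2.
  have JL : (J n)%:R * mesh n <= L by case/andP: ZL' => _; exact: le_trans.
  have := h k (J n) (le_trans kT TL) JL.
  have B1 : `|u (k%:R * tick n, (J n)%:R * mesh n) - u (k%:R * tick n, Z)| <= e / 2.
    apply: hd => //; rewrite ?subrr ?normr0 ?(ltW d0) ?grid0 ?hgrid0 ?(le_trans kT TL)//.
    by rewrite distrC ger0_norm ?subr_ge0//; lra.
  move=> B2; apply: le_trans (ler_distD (u (k%:R * tick n, (J n)%:R * mesh n)) _ _) _; lra.
have V5 : ucv err (fun=> 0).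
  move=> e e0; have eC : 0 < e ^+ 2 / C by rewrite divr_gt0// exprn_gt0.
  apply: filterS (near_mesh eC) => n /= md k kT; rewrite subr0.
  apply: le_trans (hat_sum (mesh_gt0 n) Z0 (fun j => @Un_front n k j)) _.
  apply: le_trans (Un_space _ _ _ _) _; 
  have -> : e = Num.sqrt (e ^+ 2) by rewrite sqrtr_sqr ger0_norm ?ltW.
  apply: ler_wsqrtr; rewrite -natr1 [_ - _](_ : _ = 1) ?normr1 ?mul1r; last by ring.
  by rewrite -ler_pdivlMr.
have VA : ucv A (fun t => - a0 * (u (t, s t) * u (t, s t) * Num.max (Z - s t) 0)
   + beta * Z * (b t + - gamma * u (t, 0)) + (u (t, Z) + (-1) * u (t, 0)) + 0).
  have cst_ucv (c : R) : ucv (fun _ _ => c) (fun=> c) by exact: (ucv_grid (fun=> c)).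
  apply: ucvD V5; apply: ucvD.
    apply: ucvD.
      apply: ucvM (cst_ucv _) _ => //.
        by move=> t; apply: cvgM; [apply: cvgM; exact: cuf|exact: cm].
      apply: ucvM V2 => //; first by move=> t; apply: cvgM; exact: cuf.
      exact: ucvM.
    apply: ucvM (cst_ucv _) _ => //.
      by move=> t; apply: cvgD; [exact: cb|apply: cvgM; [exact: cvg_cst|exact: cu_]].
    apply: ucvD; first exact: (ucv_grid b).
    by apply: ucvM (cst_ucv _) _.
  apply: ucvD => //; exact: ucvM (cst_ucv _) _.
have -> : \int[leb]_(t in `[0, T]) (eta t * (- (a0 * u (t, s t) ^+ 2 * Num.max (Z - s t) 0)
    + beta * (b t - gamma * u (t, 0)) * Z + (u (t, Z) - u (t, 0)))) =
  \int[leb]_(t in `[0, T]) (eta t * (- a0 * (u (t, s t) * u (t, s t) * Num.max (Z - s t) 0)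
   + beta * Z * (b t + - gamma * u (t, 0)) + (u (t, Z) + (-1) * u (t, 0)) + 0)).
  by apply: eq_Rintegral => t _; congr (_ * _); ring.
have cA : continuous (fun t => - a0 * (u (t, s t) * u (t, s t) * Num.max (Z - s t) 0)
   + beta * Z * (b t + - gamma * u (t, 0)) + (u (t, Z) + (-1) * u (t, 0)) + 0).
  move=> t; apply: cvgD; last exact: cvg_cst.
  apply: cvgD; [apply: cvgD|].
  - apply: cvgM; [exact: cvg_cst|apply: cvgM; [apply: cvgM; exact: cuf|exact: cm]].
  - by apply: cvgM; [exact: cvg_cst|apply: cvgD; [exact: cb|apply: cvgM; [exact: cvg_cst|exact: cu_]]].
  - by apply: cvgD; [exact: cu_|apply: cvgM; [exact: cvg_cst|exact: cu_]].
apply: (@time_sum (fun n k => eta (k%:R * tick n) * A n k) (fun t => eta t * _)).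
- by rewrite lexx ltW.
- by move=> t; apply: cvgM; [exact: ce|exact: cA].
- exact: (ucvM ce cA (ucv_grid eta) VA).
Qed.

Lemma abel_sum (v p : nat -> R) n : \sum_(j < n) (v j.+1 - v j) * p j =
  v n * p n - v 0%N * p 0%N - \sum_(j < n) v j.+1 * (p j.+1 - p j).
Proof.
elim: n => [|n IH]; first by rewrite !big_ord0 !subrr.
by rewrite !big_ord_recr /= IH; ring.
Qed.

(** * The spatial derivative of the limit at a fixed time *)

Section slice.
Variable t : R.
Hypothesis tT : 0 <= t <= T.
Let t0 : 0 <= t. Proof. by case/andP: tT. Qed.
Let tL : 0 <= t <= L. Proof. by rewrite t0/=; case/andP: tT => _ /le_trans; apply; exact: TL. Qed.
Let v n j := Un n (Kn n t) j.
Let N n := Nn n (Kn n t).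
Let KT n : (Kn n t)%:R * tick n <= T.
Proof. by case/andP: tT => _; apply: le_trans; have /andP[] := Kn_itv n t0. Qed.

Lemma slice_front e : 0 < e -> F [set n | `|(N n)%:R * mesh n - s t| <= e /\ (N n)%:R * mesh n <= L].
Proof.
move=> e0; have e2 : 0 < e / 2 by rewrite divr_gt0.
apply: filterS2 (near_mesh e2) (sh_cvg (ltW L_gt0) e2) => n /= h1 h2; split.
  have := h2 (t, 0); rewrite /sh/= -/(Kn n t) lexx (ltW L_gt0) => /(_ tL isT).
  have /andP[h3 h4] := Nn_itv n (Kn n t); rewrite /N !ler_distl; lra.
by apply: le_trans (Nn_le (KT n)); rewrite ler_pM2r// ler_nat.
Qed.

Lemma slice_sum (B2 : nat -> nat -> R) (f : R -> R) : continuous f ->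
  (forall e, 0 < e -> F [set n | forall j, (j < N n)%N -> `|B2 n j - f (j%:R * mesh n)| <= e]) ->
  \sum_(j < N n) mesh n * B2 n j @[n --> F] --> \int[leb]_(y in `[0, s t]) f y.
Proof.
move=> cf hB; apply/cvgrPdist_le => e e0.
have cf2 : continuous (fun p : R * R => f p.2).
  by move=> p; apply: (cvg_comp snd f); [exact: cvg_snd|exact: cf].
have [d d0 hd] := riemann_sum2 cf2 (ltW L_gt0) e0.
apply: filterS3 (near_mesh d0) (slice_front d0) (hB d d0) => n /= h1 [h2 h3] h4.
rewrite distrC; apply: (hd 0) => //; rewrite ?lexx ?(ltW L_gt0)//.
exact: s_itv.
Qed.

Let G n (psi : R -> R) := \sum_(j < N n) (v n j.+1 - v n j) * psi (j%:R * mesh n).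

Let G_lin n (f g : R -> R) (x y : R) : G n (fun p => x * f p + y * g p) = x * G n f + y * G n g.
Proof. by rewrite /G !mulr_sumr -big_split/=; apply: eq_bigr => j _; ring. Qed.

Let G_bound n psi : 2 * G n psi <= C + \sum_(j < N n) mesh n * psi (j%:R * mesh n) ^+ 2.
Proof.
have h0 := mesh_gt0 n.
have E : C >= (mesh n)^-1 * \sum_(j < N n) (v n j.+1 - v n j) ^+ 2.
  by rewrite mulrC ler_pdivrMr// mulrC; exact: Un_dirichlet.
apply: le_trans (lerD E (lexx _)); rewrite /G !mulr_sumr -big_split/=; apply: ler_sum => j _.
set d := _ - v n j; set p := psi _; rewrite -subr_ge0.
have -> : (mesh n)^-1 * d ^+ 2 + mesh n * p ^+ 2 - 2 * (d * p) =
    (mesh n)^-1 * (d - mesh n * p) ^+ 2 by field; rewrite gt_eqF.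
by rewrite mulr_ge0 ?sqr_ge0// invr_ge0 ltW.
Qed.

Let G_cvg psi : continuous psi -> exists l : R, G n psi @[n --> F] --> l.
Proof.
move=> cp; have [P P0 hP] := continuous_itv_bound (ltW L_gt0) (continuous_subspaceT cp).
have H n (f : R -> R) : (forall y, 0 <= y <= L -> `|f y| <= P) -> G n f <= C + L * P ^+ 2.
  move=> hf; have := G_bound n f.
  set X := \sum_(j < _) _; suff : X <= L * P ^+ 2.
    have : 0 <= L * P ^+ 2 by rewrite mulr_ge0 ?sqr_ge0// ltW.
    by have := ebound_gt0; rewrite -/C; lra.
  have NL : (N n)%:R * mesh n <= L.
    by apply: le_trans (Nn_le (KT n)); rewrite ler_pM2r// ler_nat.
  apply: (@le_trans _ _ (\sum_(j < N n) mesh n * P ^+ 2)).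
    apply: ler_sum => j _; rewrite ler_pM2l// sqr_le// hf//.
    by rewrite hgrid0 (le_trans _ NL)// ler_pM2r// ler_nat ltnW// ltn_ord.
  by rewrite sumr_const card_ord -[leLHS]mulr_natl mulrA ler_wpM2r ?sqr_ge0.
apply: (@ultra_cvg _ _ _ (C + L * P ^+ 2) FU) => n.
rewrite ler_norml H// andbT lerNl.
have -> : - G n psi = G n (fun p => (-1) * psi p + 0 * psi p) by rewrite G_lin; ring.
by apply: H => y hy; rewrite mul0r addr0 mulN1r normrN hP.
Qed.

(** The Riesz argument once more, for the discrete gradient at a fixed time; Abel summation then
    identifies the representative as a weak derivative. The bound [C] is the same for all times, as
    the boundedness of the norm of [u_z (t, _)] in (S1) demands. *)
Lemma slice_derivative : exists2 g, sqint leb `[0, s t] g &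
  \int[leb]_(y in `[0, s t]) g y ^+ 2 <= C /\
  weak_derivative1 `]0, s t[ (fun y => u (t, y)) g.
Proof.
have /andP[st0 stL] := s_itv tT.
pose Gf psi := lim (G n psi @[n --> F]).
have hG psi : continuous psi -> G n psi @[n --> F] --> Gf psi.
  by move=> cp; have [l hl] := G_cvg cp; apply/cvgP; exact: hl.
have sq psi : continuous psi -> sqint leb `[0, s t] psi.
  move=> cp; split; first by apply: measurable_funTS; exact: continuous_measurable_fun.
  apply: integrable_continuous => y.
  by apply: (@continuous_comp _ _ _ psi (fun x => x ^+ 2)); [exact: cp|exact: exprn_continuous].
have [| | | | |g sg [gC hg]] := @riesz_representation _ _ R leb `[0, s t]%classic (measurable_itv _)
  [set psi | continuous psi] Gf C.
- exact: sq.
- by move=> p; exact: cvg_cst.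
- by move=> f g x y cf cg p; apply: cvgD; apply: cvgMr; [exact: cf|exact: cg].
- move=> f g x y cf cg; apply: (@cvg_lim _ (@Rhausdorff R)).
  under eq_fun do rewrite G_lin.
  by apply: cvgD; apply: cvgMr; exact: hG.
- move=> psi cp.
  have A : 2 * G n psi @[n --> F] --> 2 * Gf psi by apply: cvgMr; exact: hG.
  have B1 : \sum_(j < N n) mesh n * psi (j%:R * mesh n) ^+ 2 @[n --> F]
     --> \int[leb]_(y in `[0, s t]) psi y ^+ 2.
    apply: (@slice_sum (fun n j => psi (j%:R * mesh n) ^+ 2) (fun y => psi y ^+ 2)).
      by move=> y; apply: (@continuous_comp _ _ _ psi (fun x => x ^+ 2)); [exact: cp|exact: exprn_continuous].
    by move=> e e0; apply: filterE => n j _; rewrite subrr normr0 ltW.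
  apply: (ler_cvg_to A (cvgD (cvg_cst C) B1)).
  by apply: filterE => n; exact: G_bound.
exists g => //; split => //.
have cut : continuous (fun y => u (t, y)) by exact: continuous_slice2.
apply: weak_derivative1_of_C1 => [||phi dphi e cd dp e0 he].
- exact: continuous_subspaceT.
- exact: sqint_itv_integrable.
have cp : continuous phi by exact: is_derive_continuous dp.
rewrite -hg//; apply: esym.
have A : - G n phi @[n --> F] --> - Gf phi by apply: cvgN; exact: hG.
pose B2 n j := v n j.+1 * ((phi (j.+1%:R * mesh n) - phi (j%:R * mesh n)) / mesh n).
suff B1 : \sum_(j < N n) mesh n * B2 n j @[n --> F] --> \int[leb]_(y in `[0, s t]) (u (t, y) * dphi y).
  have E : F [set n | - G n phi = \sum_(j < N n) mesh n * B2 n j].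
    have e2 : 0 < e / 2 by rewrite divr_gt0.
    apply: filterS (slice_front e2) => n /= [h1 _].
    have phi0 : phi (0%N%:R * mesh n) = 0.
      by rewrite mul0r; apply/eqP; apply: contraTT isT => /he; rewrite add0r leNgt e0.
    have phiN : phi ((N n)%:R * mesh n) = 0.
      apply/eqP; apply: contraTT isT => /he /andP[_]; move: h1; rewrite ler_distl => /andP[h1 _] h3; lra.
    rewrite /G (abel_sum (v n) (fun j => phi (j%:R * mesh n))) phi0 phiN !mulr0 subrr sub0r opprK.
    by apply: eq_bigr => j _; rewrite /B2; field; rewrite gt_eqF.
  apply: (cvg_unique _ A); first exact: Rhausdorff.
  apply: cvg_trans B1; apply: near_eq_cvg.
  by apply: filterS E => n /= ->.
apply: slice_sum; first by move=> y; apply: cvgM; [exact: cut|exact: cd].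
move=> d d0.
have [P P0 hP] := continuous_itv_bound (ltW L_gt0) (continuous_subspaceT cd).
pose e1 := d / (2 * P + M + 1).
have q0 : 0 < 2 * P + M + 1 by have := M_gt0; lra.
have e10 : 0 < e1 by exact: divr_gt0.
have [d1 d10 hd1] := unif_continuous_square L cu e10.
have cd2 : continuous (fun p : R * R => dphi p.1).
  by move=> p; apply: (cvg_comp fst dphi); [exact: cvg_fst|exact: cd].
have [d2 d20 hd2] := @difference_quotient R (fun p => phi p.1) _ L e1 cd2 e10 (fun x _ => dp x).
apply: filterS3 (uh_cvg (ltW L_gt0) e10) (filterI (near_mesh d10) (near_mesh d20)) (slice_front e0) => n /= h1 [h2 h3] [_ h4] j jN.
have j1L : j.+1%:R * mesh n <= L by apply: le_trans h4; rewrite ler_pM2r// ler_nat.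
have jE : j.+1%:R * mesh n = j%:R * mesh n + mesh n by rewrite -natr1 mulrDl mul1r.
have jL : 0 <= j%:R * mesh n <= L by rewrite hgrid0/= (le_trans _ j1L)// jE lerDl ltW.
have j1L' : 0 <= j.+1%:R * mesh n <= L by rewrite hgrid0.
have m1 : `|v n j.+1 - u (t, j%:R * mesh n)| <= 2 * e1.
  apply: le_trans (ler_distD (u (t, j.+1%:R * mesh n)) _ _) _.
  have := h1 (t, j.+1%:R * mesh n) tL j1L'; rewrite /uh /= truncn_mul// -/(Kn n t) -/(v n j.+1).
  have : `|u (t, j.+1%:R * mesh n) - u (t, j%:R * mesh n)| <= e1.
    apply: hd1 => //; rewrite ?subrr ?normr0 ?(ltW d10)// jE addrAC subrr add0r gtr0_norm//.
  lra.
have m2 : `|(phi (j.+1%:R * mesh n) - phi (j%:R * mesh n)) / mesh n - dphi (j%:R * mesh n)| <= e1.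
  by rewrite jE; apply: (hd2 _ 0) => //; rewrite ?lexx ?(ltW L_gt0) -?jE.
rewrite /B2; set x := v n j.+1 in m1 *; set y := _ / mesh n in m2 *.
set a := u _ in m1 *; set c := dphi _ in m2 *.
have vM : `|x| <= M.
  by have /andP[g1 g2] := Un_itv n (Kn n t) j.+1; rewrite /x /v ger0_norm.
have cP : `|c| <= P by exact: hP.
have -> : x * y - a * c = x * (y - c) + (x - a) * c by ring.
apply: le_trans (ler_normD _ _) _; rewrite !normrM.
have k1 : `|x| * `|y - c| <= M * e1 by apply: ler_pM.
have k2 : `|x - a| * `|c| <= 2 * e1 * P by apply: ler_pM.
have -> : d = e1 * (2 * P + M + 1) by rewrite /e1 mulfVK// gt_eqF.
lra.
Qed.

End slice.

Let widen_sum (a : nat -> R) m n : (m <= n)%N -> (forall j, (m <= j)%N -> a j = 0) ->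
  \sum_(j < m) a j = \sum_(j < n) a j.
Proof.
move=> mn az; rewrite -(subnKC mn) big_split_ord/= [X in _ = _ + X]big1 ?addr0// => j _.
by apply: az; exact: leq_addr.
Qed.

Lemma time_test_cvg (phi : R * R -> R) : test_function (Q s T) phi ->
  Lam n phi @[n --> F] -->
    - \int[@leb2 R]_(p in Q s T) (u p * 'D_(1, 0) phi p).
Proof.
move=> tp; have [e e0 he] := test_function_margin cs tp.
have [[sp _] [cd dp]] := (tp, smooth_partial1 tp.1).
have iu := @sqintM _ _ R (@leb2 R) (Q s T) (measurable_Q T cs) _ _
  (sqint_continuous_Q cu) (sqint_continuous_Q cd).
have [_ _ ->] := Fubini_Q cs iu.
pose p n k j := phi (k%:R * tick n, j%:R * mesh n).
pose B2 n k j := Un n k.+1 j * ((p n k.+1 j - p n k j) / tick n).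
have e4 : 0 < e / 4 by rewrite divr_gt0.
have cs2 : continuous (fun q : R * R => s q.1).
  by move=> q; apply: (cvg_comp fst s); [exact: cvg_fst|exact: cs].
have [ds ds0 hds] := unif_continuous_square L cs2 e4.
have E : F [set n | Lam n phi = - \sum_(k < Kn n T) tick n * \sum_(j < (Nn n k).+1) mesh n * B2 n k j].
  apply: filterS3 (near_Nn e4) (filterI (near_mesh e4) (near_Sn e4)) (filterI (near_tick e4) (near_tick ds0)) => n /= h1 [h2 h2'] [h3 h4].
  have T0 : 0 <= T by exact: ltW.
  have /andP[K1 K2] := Kn_itv n T0.
  have p0 j : p n 0%N j = 0.
    by apply/eqP; apply: contraTT isT => /he [/andP[+ _] _]; rewrite mul0r leNgt e0.
  have pK j : p n (Kn n T) j = 0.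
    by apply/eqP; apply: contraTT isT => /he [/andP[_ +] _]; lra.
  have pout k j : (k < Kn n T)%N -> (Nn n k < j)%N -> p n k j = 0 /\ p n k.+1 j = 0.
    move=> kK Nj; have kT := lt_Kn T0 kK; have [h5 _] := h1 k kT.
    have jj : (Nn n k).+1%:R * mesh n <= j%:R * mesh n by rewrite ler_pM2r// ler_nat.
    have k1T : k.+1%:R * tick n <= T by apply: le_trans K1; rewrite ler_pM2r// ler_nat.
    have ss : `|s (k%:R * tick n) - s (k.+1%:R * tick n)| <= e / 4.
      have dk : `|k%:R * tick n - k.+1%:R * tick n| <= ds.
        have -> : k.+1%:R * tick n = k%:R * tick n + tick n by rewrite -natr1 mulrDl mul1r.
        by rewrite opprD addrA subrr sub0r normrN gtr0_norm.
      by apply: (hds _ 0 _ 0); rewrite ?lexx ?(ltW L_gt0) ?subrr ?normr0 ?(ltW ds0) ?grid0 ?(le_trans kT TL) ?(le_trans k1T TL)//.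
    move: h5 ss; rewrite !ler_distl => /andP[h5 h6] /andP[h7 h8].
    split; apply/eqP; apply: contraTT isT => /he [_ /andP[_]]; lra.
  (* The number of nodes varies with [k]. Since [phi] vanishes near the front, all sums can be
     widened to [J] nodes; the order of summation is then exchanged and Abel's formula applied in
     time. *)
  pose J := (Nn n (Kn n T)).+1.
  have NJ k : (k < Kn n T)%N -> ((Nn n k).+1 <= J)%N by move=> kK; rewrite ltnS Nn_homo// ltnW.
  transitivity (\sum_(k < Kn n T) \sum_(j < J) mesh n * dn n k j * p n k j).
    apply: eq_bigr => k _; apply: (widen_sum (NJ k (ltn_ord k)) (a := fun j => mesh n * dn n k j * p n k j)) => j Nj.
    by have [-> _] := pout k j (ltn_ord k) Nj; rewrite mulr0.
  rewrite exchange_big /=.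
  transitivity (- \sum_(k < Kn n T) \sum_(j < J) tick n * (mesh n * B2 n k j)).
    rewrite [in RHS]exchange_big /= -sumrN; apply: eq_bigr => j _.
    transitivity (mesh n * \sum_(k < Kn n T) (Un n k.+1 j - Un n k j) * p n k j).
      by rewrite mulr_sumr; apply: eq_bigr => k _; rewrite /dn mulrA.
    rewrite (abel_sum (fun k => Un n k j) (fun k => p n k j)) pK p0 !mulr0 subrr sub0r mulrN mulr_sumr.
    by congr (- _); apply: eq_bigr => k _; rewrite /B2; field; rewrite gt_eqF.
  congr (- _); apply: eq_bigr => k _; rewrite mulr_sumr; apply: esym.
  apply: (widen_sum (NJ k (ltn_ord k)) (a := fun j => tick n * (mesh n * B2 n k j))) => j Nj.
  by have [z1 z2] := pout k j (ltn_ord k) Nj; rewrite /B2 z1 z2 subrr mul0r !mulr0.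
apply: cvg_trans (near_eq_cvg (_ : {near F, _ =1 _})) _; last first.
  apply: cvgN; apply: (@plane_sum B2 (fun n k => (Nn n k).+1) (fun q => u q * 'D_(1, 0) phi q)).
  - by move=> q; apply: cvgM; [exact: cu|exact: cd].
  - exact: cs.
  - exact: s_itv.
  - exact: near_Nn.
  - move=> d d0.
    have [P P0 hP] := bounded_square L cd.
    pose e1 := d / (2 * P + M + 1).
    have q0 : 0 < 2 * P + M + 1 by have := M_gt0; lra.
    have e10 : 0 < e1 by exact: divr_gt0.
    have [d1 d10 hd1] := unif_continuous_square L cu e10.
    have [d2 d20 hd2] := difference_quotient L cd e10 dp.
    apply: filterS3 (near_Un e10) (filterI (near_tick d10) (near_tick d20)) (near_tick ltr01) => n /= h1 [h2 h3] h4 k j kT jN.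
    have k1L : k.+1%:R * tick n <= L.
      rewrite -natr1 mulrDl mul1r /L; have := mulr_gt0 aM0 T_gt0; have := s0_gt0; lra.
    have kE : k.+1%:R * tick n = k%:R * tick n + tick n by rewrite -natr1 mulrDl mul1r.
    have kL : 0 <= k%:R * tick n <= L by rewrite grid0/= (le_trans kT TL).
    have k1L' : 0 <= k.+1%:R * tick n <= L by rewrite grid0.
    have jL : 0 <= j%:R * mesh n <= L.
      by rewrite hgrid0/= (le_trans _ (Nn_le kT))// ler_pM2r// ler_nat ltnW.
    have jL' : j%:R * mesh n <= L by case/andP: jL.
    have m1 : `|Un n k.+1 j - u (k%:R * tick n, j%:R * mesh n)| <= 2 * e1.
      apply: le_trans (ler_distD (u (k.+1%:R * tick n, j%:R * mesh n)) _ _) _.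
      have := h1 k.+1 j k1L jL'.
      have : `|u (k.+1%:R * tick n, j%:R * mesh n) - u (k%:R * tick n, j%:R * mesh n)| <= e1.
        by apply: hd1 => //; rewrite ?subrr ?normr0 ?(ltW d10)// kE addrAC subrr add0r gtr0_norm.
      lra.
    have m2 : `|(p n k.+1 j - p n k j) / tick n - 'D_(1, 0) phi (k%:R * tick n, j%:R * mesh n)| <= e1.
      by rewrite /p kE; apply: hd2; rewrite -?kE.
    rewrite /B2; set x := Un n k.+1 j in m1 *; set y := _ / tick n in m2 *.
    set a := u _ in m1 *; set c := 'D_(1, 0) phi _ in m2 *.
    have vM : `|x| <= M.
      by have /andP[g1 g2] := Un_itv n k.+1 j; rewrite /x ger0_norm.
    have cP : `|c| <= P by apply: hP.
    have -> : x * y - a * c = x * (y - c) + (x - a) * c by ring.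
    apply: le_trans (ler_normD _ _) _; rewrite !normrM.
    have k1 : `|x| * `|y - c| <= M * e1 by apply: ler_pM.
    have k2 : `|x - a| * `|c| <= 2 * e1 * P by apply: ler_pM.
    have -> : d = e1 * (2 * P + M + 1) by rewrite /e1 mulfVK// gt_eqF.
    lra.
by apply: filterS E => n /= ->.
Qed.

Lemma time_test (ut phi : R * R -> R) : sqint (@leb2 R) (Q s T) ut ->
  (forall psi : R * R -> R, continuous psi ->
    Lam n psi @[n --> F] --> \int[@leb2 R]_(p in Q s T) (ut p * psi p)) ->
  test_function (Q s T) phi ->
  \int[@leb2 R]_(p in Q s T) (ut p * phi p) =
    - \int[@leb2 R]_(p in Q s T) (u p * 'D_(1, 0) phi p).
Proof.
move=> sut hut tp; have cp : continuous phi by have [] := tp.1 [::].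
by apply: (cvg_unique _ (hut phi cp)); [exact: Rhausdorff|exact: time_test_cvg].
Qed.

Lemma scheme_limit_holds : exists ut, scheme_limit a0 gamma beta M T s0 b u0 s u ut.
Proof.
have [ut sut hut] := Lam_repr.
have aMT := mulr_gt0 aM0 T_gt0.
have st1 t : 0 <= t <= T -> s t + 1 <= L - 1.
  by move=> tT; have /andP[_ h] := s_bounds tT; rewrite /L; have := T_gt0; lra.
exists ut; split => //.
- by move=> t tT; have /andP[] := s_bounds tT.
- move=> t y tT /andP[y0 ys]; apply: u_bounds.
    by case/andP: tT => -> /= /le_trans; apply; exact: TL.
  by rewrite y0 (le_trans ys)//; have := st1 t tT; lra.
- exact: front_integral.
- exact: u_initial0.
- by move=> phi; exact: time_test.
- exists (L - 1) => // eta Z ce /andP[Z0 ZL]; split.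
    by move=> t tT sZ; apply: u_front => //; lra.
  have ZL' : 0 <= Z <= L - 1 by rewrite Z0.
  have cphi : continuous (fun p : R * R => eta p.1 * Num.max (Z - p.2) 0).
    move=> p; apply: cvgM; first by apply: (cvg_comp fst eta); [exact: cvg_fst|exact: ce].
    apply: (@continuous_max _ _ (fun p : R * R => Z - p.2) (fun=> 0)); last exact: cvg_cst.
    by apply: cvgB; [exact: cvg_cst|exact: cvg_snd].
  by apply: (cvg_unique _ (hut _ cphi)); [exact: Rhausdorff|exact: hat_cvg].
- by exists C => t tT; exact: slice_derivative.
Qed.

End approximation.

Theorem scheme_limit_exists (R : realType) (a0 gamma beta M T s0 D B : R) (b u0 : R -> R) :
  0 < a0 -> 0 < gamma -> 0 < beta -> 0 < M -> 0 < s0 -> 0 < T ->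
  (forall t, 0 <= b t <= gamma * M) -> (forall z, 0 <= u0 z <= M) ->
  (forall h : R, 0 < h ->
    \sum_(j < Num.truncn (s0 / h)) (u0 (j.+1%:R * h) - u0 (j%:R * h)) ^+ 2 <= h * D) ->
  (forall (tau : R) K, 0 < tau ->
    \sum_(k < K) `|b (k.+1%:R * tau) - b (k%:R * tau)| <= B) ->
  continuous b -> continuous u0 ->
  exists s u ut, scheme_limit a0 gamma beta M T s0 b u0 s u ut.
Proof.
move=> a00 g0 be0 M0 s00 T0 hb hu hD hB cb cu0.
(* The same ultrafilter serves the states and the fronts, so that their limits belong together. *)
have [F [FU Foo]] := ultraFilterLemma (eventually_filter : ProperFilter eventually).
have [v [_ vcu vF]] := @ultra_ascoli R F FU _
  (@uh_bounded _ _ _ _ _ s0 _ _ a00 g0 be0 M0 hb hu)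
  (@uh_equicontinuous _ _ _ _ _ _ _ _ _ _ a00 g0 be0 M0 s00 hb hu hD hB F FU Foo).
have [r [_ rcu rF]] := @ultra_ascoli R F FU _
  (@sh_bounded _ _ _ _ _ _ _ _ a00 g0 be0 M0 s00 hb hu)
  (@sh_equicontinuous _ _ _ _ _ s0 _ _ a00 g0 be0 M0 hb hu F FU Foo).
(* [sh] ignores its second variable, which it has only in order to share [ultra_ascoli]. *)
pose s t := r (t, 0).
exists s, v; apply: (@scheme_limit_holds R a0 gamma beta M s0 b u0 D B a00 g0 be0 M0 s00 hb hu hD hB F FU Foo T v s) => //.
- move=> p; apply/cvgrPdist_le => e e0; have [d d0 hd] := vcu e e0.
  have : nbhs p (ball p d) by exact: nbhsx_ballx.
  apply: filterS => q [/= q1 q2]; apply: hd; exact: ltW.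
- apply: continuous_modulus => e e0; have [d d0 hd] := rcu e e0.
  by exists d => // x y xy; apply: hd => //=; rewrite subrr normr0 ltW.
- move=> L e L0 e0; apply: filterS (rF L e L0 e0) => n /= h [t y] /= tL yL.
  by have := h (t, 0); rewrite /sh /= lexx L0; apply.
Qed.

(** * Existence *)

Section upper_derivative.
Context {R : realType}.
Notation leb := (@lebesgue_measure R).
Notation leb2 := (@leb2 R).

Lemma Rintegral_fineK d (X : measurableType d) (mu : {measure set X -> \bar R}) (D : set X) (f : X -> R) :
  measurable D -> mu.-integrable D (EFin \o f) ->
  (\int[mu]_(x in D) (f x)%:E = (\int[mu]_(x in D) f x)%:E)%E.
Proof. by move=> mD i; rewrite /Rintegral fineK//; exact: integrable_fin_num. Qed.

(* [u_z] has to be jointly measurable; an upper limit of difference quotients is. *)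
Definition upper_derivative (u : R * R -> R) (p : R * R) : R :=
  fine (limn_esup (fun n => (n.+1%:R * (u (p.1, p.2 + n.+1%:R^-1) - u p))%:E)).

Lemma measurable_upper_derivative (u : R * R -> R) : continuous u ->
  measurable_fun setT (upper_derivative u).
Proof.
move=> cu; apply: measurableT_comp; first exact: fine_measurable.
apply: measurable_fun_limn_esup => n; apply/measurable_EFinP.
apply: measurable_continuous2 => p; apply: cvgM; first exact: cvg_cst.
apply: cvgB; last exact: cu.
have h : ((q.1, q.2 + n.+1%:R^-1) @[q --> p] --> (p.1, p.2 + n.+1%:R^-1)).
  have h1 : q.1 @[q --> p] --> p.1 by exact: cvg_fst.
  have h2 : q.2 + n.+1%:R^-1 @[q --> p] --> p.2 + n.+1%:R^-1.
    by apply: cvgD; [exact: cvg_snd|exact: cvg_cst].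
  exact: (cvg_pair h1 h2).
exact: (cvg_comp _ _ h (cu _)).
Qed.

Lemma upper_derivativeE (u : R * R -> R) (t y l : R) :
  is_derive y 1 (fun z => u (t, z)) l -> upper_derivative u (t, y) = l.
Proof.
move=> [du <-]; rewrite /upper_derivative.
have h : (n.+1%:R * (u (t, y + n.+1%:R^-1) - u (t, y))) @[n --> \oo] --> 'D_1 (fun z => u (t, z)) y.
  have hn : (fun n => n.+1%:R^-1 : R) @ \oo --> 0^'.
    move=> A hA; have H : \forall n \near \oo, harmonic n != 0 :> R -> A (harmonic n) by exact: (@cvg_harmonic R _ hA).
    by apply: filterS H => n; apply; rewrite /harmonic/= invr_eq0.
  apply: cvg_trans (cvg_comp _ _ hn du); apply: near_eq_cvg; apply: nearW => n /=; rewrite invrK.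
  have -> : (n.+1%:R^-1%:A : R) = n.+1%:R^-1 by exact: mulr1.
  by rewrite [_ + y]addrC.
have he : (n.+1%:R * (u (t, y + n.+1%:R^-1) - u (t, y)))%:E @[n --> \oo] -->
    ('D_1 (fun z => u (t, z)) y)%:E.
  by apply: cvg_EFin => //; exact: nearW.
rewrite is_cvg_limn_esupE; last by apply/cvg_ex; eexists; exact: he.
by rewrite (cvg_lim _ he).
Qed.

Lemma sqint_continuous (s : R -> R) (T : R) (phi : R * R -> R) : 0 <= T -> continuous s ->
  continuous phi -> sqint leb2 (Q s T) phi.
Proof.
move=> T0 cs cp; have mp : measurable_fun (Q s T) phi by apply: measurable_funTS; exact: measurable_continuous2.
split => //; have [A A0 hA] := continuous_itv_bound T0 (continuous_subspaceT cs).
pose L := Num.max T A.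
have [P P0 hP] := bounded_square L cp.
have sL t : 0 < t < T -> s t <= L.
  move=> /andP[t0 tT]; rewrite (le_trans (ler_norm _))// (le_trans (hA t _)) ?(ltW t0) ?(ltW tT)//.
  by rewrite le_max lexx orbT.
apply: (integrable_Q_bounded cs sL (M := P ^+ 2)); first exact: measurable_funX.
move=> [t y] [/= /andP[t0 tT] /andP[y0 ys]]; rewrite normrX ler_pXn2r ?nnegrE ?(ltW P0)// hP//.
  by rewrite (ltW t0)/= (le_trans (ltW tT))// le_max lexx.
by rewrite (ltW y0)/= (le_trans (ltW ys))// sL// t0.
Qed.

End upper_derivative.

Section existence.
Context {R : realType}.
Notation leb := (@lebesgue_measure R).
Notation leb2 := (@leb2 R).
Variables (a0 gamma beta M T s0 : R) (b u0 s : R -> R) (u ut : R * R -> R).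
Hypotheses (T_gt0 : 0 < T) (s0_gt0 : 0 < s0).
Hypothesis cb : continuous b.
Hypothesis sl : scheme_limit a0 gamma beta M T s0 b u0 s u ut.
Let cs : continuous s := sl_front_continuous sl.
Let cu : continuous u := sl_continuous sl.
Let s_gt0 t : 0 <= t <= T -> 0 < s t.
Proof. by move=> tT; apply: lt_le_trans (sl_front_ge sl tT). Qed.
Let cut t : continuous (fun y => u (t, y)). Proof. exact: continuous_slice2. Qed.
Let cuft : continuous (fun t => u (t, s t)).
Proof.
move=> t; have cst : s r @[r --> t] --> s t by exact: cs.
have h : ((r, s r) @[r --> t] --> (t, s t)) by exact: (cvg_pair cvg_id cst).
exact: (cvg_comp _ _ h (@cu (t, s t))).
Qed.

Let uz := upper_derivative u.

Let muz t : measurable_fun setT (fun y => uz (t, y)).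
Proof.
exact: (measurableT_comp (measurable_upper_derivative cu) (pair1_measurable t)).
Qed.

(** At each fixed time [u (t, _)] is a primitive of its weak derivative, so it is differentiable
    almost everywhere with that derivative. Hence [upper_derivative], one function for all points of
    the plane, represents the weak derivative on every slice. *)
Lemma slice_uz : exists C : R, forall t, 0 <= t <= T ->
  [/\ sqint leb `[0, s t] (fun y => uz (t, y)),
      \int[leb]_(y in `[0, s t]) uz (t, y) ^+ 2 <= C &
      forall p q, 0 <= p -> p <= q -> q <= s t ->
        u (t, q) - u (t, p) = \int[leb]_(y in `[p, q]) uz (t, y)].
Proof.
have [C hC] := sl_slice sl; exists C => t tT; have [g sg [gC wg]] := hC t tT.
have st := s_gt0 tT.
have ig := sqint_itv_integrable sg.
have inc := increment_of_weak_derivative (continuous_subspaceT (@cut t)) ig wg.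
have A : {ae leb, forall y, 0 < y < s t -> uz (t, y) = g y}.
  by apply: ae_mono (is_derive_ae ig inc) => y h /h; exact: upper_derivativeE.
have [mg ig2] := sg.
have mu2 : measurable_fun `[0, s t]%classic (fun y => uz (t, y) ^+ 2).
  by apply: measurable_funX; exact: measurable_funTS.
have mo (h : R -> R) (p q : R) : measurable_fun `[p, q]%classic h -> measurable_fun `]p, q[%classic h.
  by apply: measurable_funS => //; exact: subset_itv_oo_cc.
have Eo (h h' : R -> R) (p q : R) : 0 <= p -> q <= s t -> measurable_fun `[p, q]%classic h -> measurable_fun `[p, q]%classic h' ->
    {ae leb, forall y, 0 < y < s t -> h y = h' y} ->
    \int[leb]_(y in `[p, q]) h y = \int[leb]_(y in `[p, q]) h' y.
  move=> p0 qs mh mh' hh'; rewrite -!Rintegral_oo_cc; [|exact: mo|exact: mo].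
  apply: ae_eq_Rintegral => //; [exact: mo|exact: mo|].
  apply: ae_mono hh' => y h1; rewrite /= in_itv/= => /andP[py yq]; apply: h1.
  by rewrite (le_lt_trans p0 py) (lt_le_trans yq qs).
have isq : leb.-integrable `[0, s t] (EFin \o (fun y => uz (t, y) ^+ 2)).
  apply: integrable_oo_cc.
  have ig2o : leb.-integrable `]0, s t[ (EFin \o (fun y => g y ^+ 2)).
    by apply: integrableS ig2 => //; exact: subset_itv_oo_cc.
  apply/integrableP; split; first by apply/measurable_EFinP; exact: mo.
  have /integrableP[_] := ig2o; congr (_ < _)%E; apply: ae_eq_integral => //.
  - by apply: measurableT_comp => //; apply/measurable_EFinP; apply: mo; exact: measurable_funX.
  - by apply: measurableT_comp => //; apply/measurable_EFinP; exact: mo.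
  - by apply: ae_mono A => y h; rewrite /= in_itv/= => /h ->.
split.
- by split => //; apply: measurable_funTS; exact: muz.
- rewrite (Eo _ (fun y => g y ^+ 2))//; first exact: measurable_funX.
  by apply: ae_mono A => y h /h ->.
- move=> p q p0 pq qs; rewrite inc//; apply: esym; apply: Eo => //.
  + exact: measurable_funTS.
  + by apply: measurable_funS mg => //; apply: subset_itv; rewrite bnd_simp.
Qed.

Let sut := sl_sqint sl.
Let mQ : measurable (Q s T). Proof. exact: measurable_Q. Qed.

Let iutM (f : R * R -> R) : continuous f -> leb2.-integrable (Q s T) (EFin \o (fun p => ut p * f p)).
Proof. by move=> cf; exact: (@sqintM _ _ R leb2 (Q s T) mQ _ _ sut (sqint_continuous (ltW T_gt0) cs cf)). Qed.

Let Rf t (Z : R) := - (a0 * u (t, s t) ^+ 2 * Num.max (Z - s t) 0)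
      + beta * (b t - gamma * u (t, 0)) * Z + (u (t, Z) - u (t, 0)).

Let cmax (f g : R -> R) : continuous f -> continuous g -> continuous (fun x => Num.max (f x) (g x)).
Proof. by move=> cf cg x; apply: (@continuous_max _ _ f g); [exact: cf|exact: cg]. Qed.

Let cc (c : R) : continuous (fun _ : R => c). Proof. by move=> x; exact: cvg_cst. Qed.

Let cRf1 Z : continuous (fun t => Rf t Z).
Proof.
move=> t; apply: cvgD; [apply: cvgD|].
- apply: cvgN; apply: cvgM.
    apply: cvgMr; apply: (@continuous_comp _ _ _ (fun t => u (t, s t)) (fun x => x ^+ 2)); [exact: cuft|exact: exprn_continuous].
  apply: (@continuous_max _ _ (fun t => Z - s t) (fun=> 0)); last exact: cvg_cst.
  by apply: cvgB; [exact: cvg_cst|exact: cs].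
- apply: cvgM; last exact: cvg_cst.
  apply: cvgMr; apply: cvgB; first exact: cb.
  by apply: cvgMr; exact: (@continuous_slice1 R u 0 (@cu)).
- by apply: cvgB; [exact: (@continuous_slice1 R u Z (@cu))|exact: (@continuous_slice1 R u 0 (@cu))].
Qed.

Let cRf2 t : continuous (Rf t).
Proof.
move=> Z; apply: cvgD; [apply: cvgD|].
- apply: cvgN; apply: cvgMr.
  apply: (@continuous_max _ _ (fun Z => Z - s t) (fun=> 0)); last exact: cvg_cst.
  by apply: cvgB; [exact: cvg_id|exact: cvg_cst].
- by apply: cvgMr; exact: cvg_id.
- by apply: cvgB; [exact: cut|exact: cvg_cst].
Qed.

Let hat (Z : R) (p : R * R) : R := Num.max (Z - p.2) 0.

Let chat Z : continuous (hat Z).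
Proof.
move=> p; apply: (@continuous_max _ _ (fun p : R * R => Z - p.2) (fun=> 0)); last exact: cvg_cst.
by apply: cvgB; [exact: cvg_cst|exact: cvg_snd].
Qed.

(** The factor [eta] is arbitrary, so [du_bois_reymond] localises the hat identity in time. *)
Lemma hat_ae (Z : R) : (forall (eta : R -> R), continuous eta ->
    \int[leb2]_(p in Q s T) (ut p * (eta p.1 * Num.max (Z - p.2) 0)) =
    \int[leb]_(t in `[0, T]) (eta t * Rf t Z)) ->
  {ae leb, forall t, 0 < t < T ->
    \int[leb]_(y in `[0, s t]) (ut (t, y) * Num.max (Z - y) 0) = Rf t Z}.
Proof.
move=> hZ; have [A B _] := Fubini_Q cs (iutM (@chat Z)).
pose k t := \int[leb]_(y in `[0, s t]) (ut (t, y) * Num.max (Z - y) 0) - Rf t Z.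
have ik : leb.-integrable `[0, T] (EFin \o k).
  by apply: integrableRB => //; apply: integrable_continuous; exact: cRf1.
suff : {ae leb, forall t, t \in `[0, T] -> k t = 0}.
  apply: ae_mono => t h /andP[t0 tT]; apply/eqP; rewrite -subr_eq0; apply/eqP; apply: h.
  by rewrite in_itv/= !ltW.
apply: du_bois_reymond => // phi cphi _; have cp := Cinf_continuous cphi.
have cphi2 : continuous (fun p : R * R => phi p.1 * hat Z p).
  by move=> p; apply: cvgM; [apply: (cvg_comp fst phi); [exact: cvg_fst|exact: cp]|exact: chat].
have [_ B' E] := Fubini_Q cs (iutM cphi2).
have iB := integrable_itvMc B cp.
have iR : leb.-integrable `[0, T] (EFin \o (fun t => Rf t Z * phi t)).
  by apply: integrable_itvMc cp; apply: integrable_continuous; exact: cRf1.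
transitivity (\int[leb]_(t in `[0, T]) ((\int[leb]_(y in `[0, s t]) (ut (t, y) * Num.max (Z - y) 0)) * phi t)
   - \int[leb]_(t in `[0, T]) (Rf t Z * phi t)).
  by rewrite -RintegralB//; apply: eq_Rintegral => t _; rewrite /k mulrBl.
have -> : \int[leb]_(t in `[0, T]) (Rf t Z * phi t) = \int[leb]_(t in `[0, T]) (phi t * Rf t Z).
  by apply: eq_Rintegral => t _; rewrite mulrC.
rewrite -(hZ _ cp) E.
apply/eqP; rewrite subr_eq0; apply/eqP.
have mo (h : R -> R) : leb.-integrable `[0, T] (EFin \o h) -> measurable_fun `]0, T[%classic h.
  move=> ih; have /measurable_EFinP := measurable_int _ ih.
  by apply: measurable_funS => //; exact: subset_itv_oo_cc.
rewrite -!Rintegral_oo_cc; [|exact: mo|exact: mo].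
apply: ae_eq_Rintegral => //; [exact: mo|exact: mo|].
apply: ae_mono A => t h; rewrite /= in_itv/= => /h it.
rewrite mulrC -RintegralZl//; apply: eq_Rintegral => y _; rewrite /hat /=; ring.
Qed.

(** The null set given by [hat_ae] depends on [Z]. Rational [Z] leave a single one, and both sides
    of the identity are continuous in [Z]. *)
Lemma good_times : exists2 Zm : R, (forall t, 0 <= t <= T -> s t + 1 <= Zm /\ u (t, Zm) = u (t, s t)) &
  {ae leb, forall t, 0 < t < T -> leb.-integrable `[0, s t] (EFin \o (fun y => ut (t, y))) /\
    forall Z, 0 <= Z <= Zm ->
      \int[leb]_(y in `[0, s t]) (ut (t, y) * Num.max (Z - y) 0) = Rf t Z}.
Proof.
have [Zm sZm hZm] := sl_hat sl.
have Zm0 : 0 < Zm.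
  have T00 : (0 : R) <= 0 <= T by rewrite lexx ltW.
  by have := sZm 0 T00; have := s_gt0 T00; lra.
exists Zm.
  move=> t tT; split; first exact: sZm.
  have h : 0 <= Zm <= Zm by rewrite lexx ltW.
  by have [+ _] := hZm (fun=> 0) Zm (@cc 0) h; apply => //; have := sZm t tT; lra.
have c1 : continuous (fun _ : R * R => 1 : R) by move=> p; exact: cvg_cst.
have [A _ _] := Fubini_Q cs (iutM c1).
have H : {ae leb, forall t : R, forall q : rat, 0 <= (ratr q : R) <= Zm -> 0 < t < T ->
    \int[leb]_(y in `[0, s t]) (ut (t, y) * Num.max (ratr q - y) 0) = Rf t (ratr q)}.
  apply: ae_countable => q.
  have [h|h] := pselect (0 <= (ratr q : R) <= Zm); last by apply: aeW => t h'.
  have := @hat_ae (ratr q) (fun eta ce => (hZm eta (ratr q) ce h).2).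
  by apply: ae_mono => t ht _.
apply: ae_mono (ae_and A H) => t [h1 h2] tT.
have it : leb.-integrable `[0, s t] (EFin \o (fun y => ut (t, y))).
  by apply: eq_integrable (h1 tT) => // y _ /=; rewrite mulr1.
split => // Z ZZm.
have ia : leb.-integrable `[0, s t] (EFin \o (fun y => `|ut (t, y)|)) by exact: integrable_norm.
pose f Z := \int[leb]_(y in `[0, s t]) (ut (t, y) * Num.max (Z - y) 0) - Rf t Z.
have cm Z' : continuous (fun y : R => Num.max (Z' - y) 0).
  by apply: cmax => // y; apply: cvgB; [exact: cvg_cst|exact: cvg_id].
have ih Z' : leb.-integrable `[0, s t] (EFin \o (fun y => ut (t, y) * Num.max (Z' - y) 0)).
  exact: integrable_itvMc.
have cf : continuous f.
  move=> x; apply: cvgB; last exact: cRf2.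
  move: x; apply: continuous_modulus => e e0.
  set I := \int[leb]_(y in `[0, s t]) `|ut (t, y)|.
  have I0 : 0 <= I by apply: Rintegral_itv_ge0.
  have I1 : 0 < I + 1 by rewrite ltr_wpDl.
  exists (e / (I + 1)) => [|x y xy]; first exact: divr_gt0.
  have i3 : leb.-integrable `[0, s t]
      (EFin \o (fun z => ut (t, z) * Num.max (x - z) 0 - ut (t, z) * Num.max (y - z) 0)).
    by apply: integrableRB.
  rewrite -RintegralB//; apply: le_trans (le_normr_Rintegral _ i3) _ => //.
  apply: (@le_trans _ _ (\int[leb]_(z in `[0, s t]) (`|x - y| * `|ut (t, z)|))).
    apply: le_Rintegral => //.
    - exact: (integrable_norm i3).
    - exact: integrableRZ.
    move=> z _; rewrite -mulrBr normrM mulrC; apply: ler_wpM2r => //.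
    have := ler_norm (x - y); have := ler_norm (y - x); rewrite [`|y - x|]distrC.
    rewrite ler_norml /Num.max; case: ifP; case: ifP; lra.
  rewrite RintegralZl// -/I; move: xy; rewrite ler_pdivlMr// mulrDr mulr1.
  by apply: le_trans; rewrite lerDl.
apply/eqP; rewrite -subr_eq0; apply/eqP; apply: (@rat_dense_zero R f 0 Zm) => // q /andP[q0 qZ].
by rewrite /f h2 ?subrr// !ltW.
Qed.

(** The candidate for [u_z]: the flux that the Robin condition imposes at 0, plus the integral of
    [u_t = u_zz]. *)
Let prim t z := - (beta * (b t - gamma * u (t, 0))) + \int[leb]_(y in `[0, z]) ut (t, y).

(** For [Z <= s t] the hat identity, integrated by parts, says that [u (t, _)] is a primitive of
    [prim t]. The case [Z = Zm], where [u] has its value at the front, minus the case [Z = s t]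
    leaves [Zm - s t] times the total integral of [u_t]; this yields the condition at the front. *)
Lemma flux_good t (Zm : R) : 0 < t < T -> s t + 1 <= Zm -> u (t, Zm) = u (t, s t) ->
  leb.-integrable `[0, s t] (EFin \o (fun y => ut (t, y))) ->
  (forall Z, 0 <= Z <= Zm ->
      \int[leb]_(y in `[0, s t]) (ut (t, y) * Num.max (Z - y) 0) = Rf t Z) ->
  [/\ {within `[0, s t], continuous (prim t)},
      forall z, 0 < z < s t -> uz (t, z) = prim t z &
      prim t (s t) = - (a0 * u (t, s t) ^+ 2)].
Proof.
move=> tT sZ uZ ik hZ; have st : 0 < s t by apply: s_gt0; case/andP: tT => *; rewrite !ltW.
pose K z := \int[leb]_(y in `[0, z]) ut (t, y).
have cK : {within `[0, s t], continuous K} by exact: parameterized_integral_continuous (ltW st) ik.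
have cp : {within `[0, s t], continuous (prim t)}.
  by move=> z; apply: cvgD; [exact: cvg_cst|exact: cK].
have Kinc (a p q : R) : a <= s t -> 0 <= p -> p <= q -> q <= a -> K q - K p = \int[leb]_(x in `[p, q]) ut (t, x).
  move=> as_ p0 pq qa; rewrite /K (Rintegral_split p0 pq); first by rewrite addrC addKr.
  by apply: integrable_itvS ik => //; exact: le_trans qa as_.
have E Z : 0 <= Z <= s t -> u (t, Z) - u (t, 0) = \int[leb]_(z in `[0, Z]) prim t z.
  move=> /andP[Z0 Zs].
  have ikZ : leb.-integrable `[0, Z] (EFin \o (fun y => ut (t, y))) by exact: integrable_itvS ik.
  have cKZ : {within `[0, Z], continuous K}.
    by apply: continuous_subspaceW cK; apply: subset_itvl; rewrite bnd_simp.
  have dZ (x : R) : is_derive x 1 (fun y : R => Z - y) ((fun=> -1) x).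
    by have := is_deriveB (is_derive_cst Z x 1) (is_derive_id x 1); rewrite sub0r.
  have h1 : \int[leb]_(y in `[0, Z]) (ut (t, y) * (Z - y)) = \int[leb]_(y in `[0, Z]) K y.
    rewrite (ac_by_parts Z0 ikZ (fun p q p0 pq qZ => Kinc Z p q Zs p0 pq qZ) (@cc (-1)) dZ cKZ).
    rewrite subrr mulr0 [K 0]Rintegral_point mul0r !sub0r.
    have -> : \int[leb]_(x in `[0, Z]) (K x * -1) = - \int[leb]_(x in `[0, Z]) K x.
      rewrite -[RHS]mulN1r -RintegralZl//; last exact: integrable_within.
      by apply: eq_Rintegral => y _; rewrite mulrC.
    by rewrite oppr0 add0r opprK.
  have hm : leb.-integrable `[0, s t] (EFin \o (fun y => ut (t, y) * Num.max (Z - y) 0)).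
    apply: integrable_itvMc => //; apply: cmax => // y; by apply: cvgB; [exact: cvg_cst|exact: cvg_id].
  have h2 : \int[leb]_(y in `[0, s t]) (ut (t, y) * Num.max (Z - y) 0) = \int[leb]_(y in `[0, Z]) K y.
    rewrite (Rintegral_split Z0 Zs)// -h1 [X in _ + X](@eq_Rintegral _ _ _ _ _ (cst 0)).
      rewrite Rintegral_cst// mul0r addr0; apply: eq_Rintegral => y; rewrite inE/= in_itv/= => /andP[_ yZ].
      by congr (_ * _); apply/max_idPl; rewrite subr_ge0.
    move=> y; rewrite inE/= in_itv/= => /andP[Zy _].
    by rewrite (_ : Num.max _ _ = 0) ?mulr0//; apply/max_idPr; rewrite subr_le0.
  have ZZm : 0 <= Z <= Zm by rewrite Z0; lra.
  have := hZ Z ZZm; rewrite h2 /Rf (_ : Num.max (Z - s t) 0 = 0); last by apply/max_idPr; rewrite subr_le0.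
  move=> h3.
  have -> : \int[leb]_(z in `[0, Z]) prim t z = - (beta * (b t - gamma * u (t, 0))) * Z + \int[leb]_(y in `[0, Z]) K y.
    have -> : - (beta * (b t - gamma * u (t, 0))) * Z = \int[leb]_(z in `[0, Z]) (- (beta * (b t - gamma * u (t, 0)))).
      by rewrite Rintegral_itv_cst// subr0.
    rewrite -RintegralD//; [exact: integrable_continuous|exact: integrable_within].
  rewrite h3; ring.
split => //.
  move=> z /andP[z0 zs]; apply: upper_derivativeE.
  have cpc := continuous_comp_clamp (ltW st) cp.
  have D := is_deriveD (is_derive_cst (u (t, 0)) z 1) (is_derive_prim z0 cpc).
  have zc : clamp 0 (s t) z = z by apply: clamp_id; rewrite !ltW.
  rewrite add0r /= zc in D.
  have D' : is_derive z 1 (fun y => u (t, 0) + \int[leb]_(r in `[0, y]) prim t (clamp 0 (s t) r)) (prim t z).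
    exact: D.
  apply: near_eq_is_derive D'; near=> y.
  have y0 : 0 <= y by apply: ltW; near: y; exact: lt_nbhsr.
  have ys : y <= s t by apply: ltW; near: y; exact: lt_nbhsl.
  have := E y; rewrite y0 ys => /(_ isT) /eqP; rewrite subr_eq addrC => /eqP ->.
  have -> // : \int[leb]_(r in `[0, y]) prim t (clamp 0 (s t) r) = \int[leb]_(r in `[0, y]) prim t r.
  apply: eq_Rintegral => x; rewrite inE/= in_itv/= => /andP[x0 xy].
  by rewrite clamp_id// x0 (le_trans xy).
have h1 : 0 <= s t <= Zm by rewrite (ltW st); lra.
have h2 : 0 <= Zm <= Zm by rewrite lexx andbT; lra.
have := hZ _ h1; have := hZ _ h2; rewrite /Rf subrr maxxx mulr0 oppr0 add0r uZ.
rewrite (_ : Num.max (Zm - s t) 0 = Zm - s t); last by apply/max_idPl; lra.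
move=> e1 e2.
have e3 : (Zm - s t) * K (s t) = \int[leb]_(y in `[0, s t]) (ut (t, y) * Num.max (Zm - y) 0) -
    \int[leb]_(y in `[0, s t]) (ut (t, y) * Num.max (s t - y) 0).
  rewrite /K -RintegralZl// -RintegralB//.
  - apply: eq_Rintegral => y; rewrite inE/= in_itv/= => /andP[y0 ys].
    rewrite (_ : Num.max (Zm - y) 0 = Zm - y); last by apply/max_idPl; lra.
    rewrite (_ : Num.max (s t - y) 0 = s t - y); last by apply/max_idPl; lra.
    ring.
  - apply: integrable_itvMc => //; apply: cmax => // y; by apply: cvgB; [exact: cvg_cst|exact: cvg_id].
  - apply: integrable_itvMc => //; apply: cmax => // y; by apply: cvgB; [exact: cvg_cst|exact: cvg_id].
have Z0 : Zm - s t != 0 by rewrite gt_eqF//; lra.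
apply: (mulfI Z0); rewrite /prim -/(K (s t)) mulrDr e3 e1 e2; ring.
Unshelve. all: by end_near. Qed.

(** Tonelli reduces the claim to the slices, whose squared norms have a common bound. *)
Lemma sqint_uz : sqint leb2 (Q s T) uz.
Proof.
have muzT : measurable_fun setT uz by exact: measurable_upper_derivative.
split; first exact: measurable_funTS.
have [C hC] := slice_uz.
apply/integrable_restrictT => //.
set f := EFin \o _.
have mf : measurable_fun setT f.
  apply/measurable_EFinP; apply/(measurable_restrictT _ _).1 => //.
  by apply: measurable_funX; exact: measurable_funTS.
apply/(integrable12ltyP _ _ mf).
have fE t y : f (t, y) = if 0 < t < T then ((EFin \o (fun y => uz (t, y) ^+ 2)) \_ `]0, s t[) y else 0%E.
  rewrite /f /= patchE; case: ifPn => [|/negP].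
    rewrite inE /Q/= => -[-> ys]; rewrite patchE ifT// inE/= in_itv/=; exact: ys.
  rewrite inE /Q/= => hQ; case: ifPn => // tT; rewrite patchE ifF//.
  by apply/negP; rewrite inE/= in_itv/= => ys; exact: hQ.
pose g t := (\int[leb]_y `|f (t, y)|)%E.
have lT : (leb `]0%R, T[%classic < +oo)%E.
  by rewrite lebesgue_measure_itv/=; case: ifP => _; rewrite -?EFinB ltry.
have g1 t : `]0, T[%classic t -> (g t <= `|C|%:E)%E.
  rewrite /= in_itv/= => tT; have tT' : 0 <= t <= T by case/andP: tT => *; rewrite !ltW.
  have [[_ i2] h2 _] := hC t tT'.
  rewrite /g (_ : (\int[leb]_y _)%E = (\int[leb]_(y in `]0%R, s t[%classic) (uz (t, y) ^+ 2)%:E)%E).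
    by rewrite Rintegral_EFin// lee_fin (le_trans h2)// ler_norm.
  rewrite [RHS]integral_mkcond; apply: eq_integral => y _; rewrite fE tT.
  by rewrite !patchE; case: ifP => _ /=; rewrite ?normr0// ger0_norm// sqr_ge0.
have g0 t : (0 <= g t)%E by apply: integral_ge0.
have gE : (\int[leb]_t g t = \int[leb]_(t in `]0%R, T[%classic) g t)%E.
  rewrite [RHS]integral_mkcond; apply: eq_integral => t _; rewrite patchE; case: ifPn => //.
  rewrite notin_setE/= in_itv/= => tT; rewrite /g integral0_eq// => y _.
  by rewrite fE ifF ?abse0//; apply/negP.
rewrite -/(g _) gE.
apply: (@le_lt_trans _ _ (\int[leb]_(t in `]0%R, T[) (cst `|C|%:E) t)%E).
  apply: ge0_le_integral => //.
  - apply: measurable_funTS; apply: (measurable_fun_fubini_tonelli_F (abse \o f)) => //=.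
    exact: measurableT_comp.
by rewrite integral_cst//; apply: lte_mul_pinfty; rewrite ?lee_fin.
Qed.

Lemma weak_derivative2_of_slices (f k : R * R -> R) :
  sqint leb2 (Q s T) f -> sqint leb2 (Q s T) k ->
  (forall phi : R * R -> R, test_function (Q s T) phi -> {ae leb, forall t, 0 < t < T ->
    \int[leb]_(y in `[0, s t]) (f (t, y) * 'D_(0, 1) phi (t, y)) =
    - \int[leb]_(y in `[0, s t]) (k (t, y) * phi (t, y))}) ->
  weak_derivative2 (Q s T) (0, 1) f k.
Proof.
move=> sf sk h phi tp; have [cd _] := smooth_partial2 tp.1.
have cp : continuous phi by have [] := tp.1 [::].
have i1 := @sqintM _ _ R leb2 (Q s T) mQ _ _ sf (sqint_continuous (ltW T_gt0) cs cd).
have i2 := @sqintM _ _ R leb2 (Q s T) mQ _ _ sk (sqint_continuous (ltW T_gt0) cs cp).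
rewrite (@Rintegral_fineK R _ _ leb2 (Q s T) _ mQ i1) (@Rintegral_fineK R _ _ leb2 (Q s T) _ mQ i2) -EFinN; congr EFin.
have [_ j1 ->] := Fubini_Q cs i1; have [_ j2 ->] := Fubini_Q cs i2.
have mo (r : R -> R) : leb.-integrable `[0, T] (EFin \o r) -> measurable_fun `]0, T[%classic r.
  move=> ir; have /measurable_EFinP := measurable_int _ ir.
  by apply: measurable_funS => //; exact: subset_itv_oo_cc.
rewrite -mulN1r -RintegralZl//.
rewrite -!Rintegral_oo_cc; [|by apply: mo; exact: integrableRZ|exact: mo].
apply: ae_eq_Rintegral => //; [exact: mo|by apply: mo; exact: integrableRZ|].
by apply: ae_mono (h phi tp) => t ht; rewrite /= in_itv/= mulN1r => /ht.
Qed.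

Let ds t := a0 * u (t, s t).
Let cds : continuous ds. Proof. by move=> t; apply: cvgMr; exact: cuft. Qed.
Let T0 : 0 <= T. Proof. exact: ltW. Qed.

Lemma front_W1oo : W1p_deriv +oo%E 0 T s ds.
Proof.
have bd (f : R -> R) : continuous f -> in_Lp1 +oo%E `]0, T[ f.
  move=> cf; have [A A0 hA] := continuous_itv_bound T0 (continuous_subspaceT cf).
  apply: (@Lfun_pinfty_of_bounded _ _ R leb `]0, T[%classic (measurable_itv _) f A).
    by apply: measurable_funTS; exact: continuous_measurable_fun.
  by move=> x; rewrite /= in_itv/= => /andP[x0 xT]; apply: hA; rewrite !ltW.
split; [exact: continuous_subspaceT|exact: bd|exact: bd|].
have ids : leb.-integrable `[0, T] (EFin \o ds) by exact: integrable_continuous.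
apply: weak_derivative1_of_C1 => // [|phi dphi e cd dp e0 he].
  exact: continuous_subspaceT.
have inc p q : 0 <= p -> p <= q -> q <= T -> s q - s p = \int[leb]_(x in `[p, q]) ds x.
  move=> p0 pq qT; have pT : 0 <= p <= T by rewrite p0 (le_trans pq).
  have qT' : 0 <= q <= T by rewrite (le_trans p0 pq).
  rewrite (sl_front sl pT) (sl_front sl qT') (Rintegral_split p0 pq); last exact: integrable_continuous.
  rewrite /ds RintegralZl//; [ring|exact: integrable_continuous].
have /= E := ac_by_parts T0 ids inc cd dp (continuous_subspaceT (@cs)).
have p0 : phi 0 = 0 by apply/eqP; apply: contraTT isT => /he /andP[]; lra.
have pT : phi T = 0 by apply/eqP; apply: contraTT isT => /he /andP[]; lra.
by rewrite E p0 pT !mulr0 subrr sub0r opprK.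
Qed.

Let slice_bc (phi : R * R -> R) t : test_function (Q s T) phi -> phi (t, 0) = 0 /\ phi (t, s t) = 0.
Proof.
move=> tp; have [e e0 he] := test_function_margin cs tp.
by split; apply/eqP; apply: contraTT isT => /he [_ /andP[]]; lra.
Qed.

Theorem scheme_limit_solution : is_solution a0 gamma beta T b s0 u0 s u.
Proof.
have [C hC] := slice_uz; have suz := sqint_uz.
have [Zm sZm hgood] := good_times.
have good : {ae leb, forall t, 0 < t < T -> [/\ leb.-integrable `[0, s t] (EFin \o (fun y => ut (t, y))),
    {within `[0, s t], continuous (prim t)},
    forall z, 0 < z < s t -> uz (t, z) = prim t z & prim t (s t) = - (a0 * u (t, s t) ^+ 2)]}.
  apply: ae_mono hgood => t h tT; have [h1 h2] := h tT.
  have tT' : 0 <= t <= T by case/andP: tT => *; rewrite !ltW.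
  have [h3 h4] := sZm t tT'.
  by have [] := flux_good tT h3 h4 h1 h2.
have cQ (f : R * R -> R) : continuous f -> sqint leb2 (Q s T) f.
  exact: (sqint_continuous (ltW T_gt0) cs).
have ends (P : R -> Prop) : {ae leb, forall t, 0 < t < T -> P t} -> {ae leb, forall t, t \in `[0, T] -> P t}.
  move=> hP; have hne (c : R) : {ae leb, forall t, t != c}.
    exists [set c]; split => //; first exact: lebesgue_measure_set1.
    by move=> t /= /negP; rewrite negbK => /eqP.
  apply: ae_mono (ae_and hP (ae_and (hne 0) (hne T))) => t [h [h1 h2]].
  rewrite in_itv/= => /andP[t0 tT]; apply: h.
  by rewrite !lt_neqAle t0 tT eq_sym h1 h2.
have tr t : 0 < t < T -> {within `[0, s t], continuous (prim t)} -> 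
    (forall z, 0 < z < s t -> uz (t, z) = prim t z) ->
    forall c, has_trace 0 (s t) (fun z => uz (t, z)) c (prim t c).
  move=> tT cp uzp c; exists (prim t); split => //.
  by apply: aeW => x; rewrite in_itv/=; exact: uzp.
(* [ut] also serves as [u_zz]: the heat equation becomes trivial, and its content moves to the weak
   derivative of [uz]. *)
exists ds, ut, uz, ut; split; split.
- exact: front_W1oo.
- by move=> t; rewrite in_itv/=; exact: s_gt0.
- exact: continuous_subspaceT.
- apply: (@Lfun_pinfty_of_bounded _ _ R leb2 (Q s T) mQ u M).
    by apply: measurable_funTS; exact: measurable_continuous2.
  move=> [t y] [/= /andP[t0 tT] /andP[y0 ys]].
  have tT' : 0 <= t <= T by rewrite !ltW.
  have ys' : 0 <= y <= s t by rewrite !ltW.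
  by have /andP[h1 h2] := sl_bounds sl tT' ys'; rewrite ger0_norm.
- move=> phi tp; have [cd _] := smooth_partial1 tp.1.
  have cp : continuous phi by have [] := tp.1 [::].
  have i1 := @sqintM _ _ R leb2 (Q s T) mQ _ _ (cQ _ (@cu)) (cQ _ cd).
  have i2 := @sqintM _ _ R leb2 (Q s T) mQ _ _ sut (cQ _ cp).
  rewrite (@Rintegral_fineK R _ _ leb2 (Q s T) _ mQ i1) (@Rintegral_fineK R _ _ leb2 (Q s T) _ mQ i2).
  by rewrite (sl_weak sl tp) EFinN oppeK.
- exact: Lfun_of_sqint.
- apply: weak_derivative2_of_slices => //; first exact: cQ.
  move=> phi tp; apply: aeW => t /andP[t0 tT].
  have tT' : 0 <= t <= T by rewrite !ltW.
  have [s1 _ inc] := hC t tT'; have [cd dp] := smooth_partial2 tp.1.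
  have cdt := @continuous_slice2 R _ t cd.
  have [p0 ps] := slice_bc t tp.
  have := ac_by_parts (ltW (s_gt0 tT')) (sqint_itv_integrable s1) inc cdt (dp t) (continuous_subspaceT (@cut t)).
  by rewrite p0 ps !mulr0 subrr sub0r => ->; rewrite opprK.
- exact: Lfun_of_sqint.
- apply: weak_derivative2_of_slices => //.
  move=> phi tp; apply: ae_mono good => t h tT; have [ik cpr uzp _] := h tT.
  have tT' : 0 <= t <= T by case/andP: tT => *; rewrite !ltW.
  have [cd dp] := smooth_partial2 tp.1.
  have cdt := @continuous_slice2 R _ t cd.
  have [p0 ps] := slice_bc t tp.
  have inc p q : 0 <= p -> p <= q -> q <= s t -> prim t q - prim t p = \int[leb]_(y in `[p, q]) ut (t, y).
    move=> pp pq qs; rewrite /prim (Rintegral_split pp pq); last exact: integrable_itvS ik.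
    ring.
  have := ac_by_parts (ltW (s_gt0 tT')) ik inc cdt (dp t) cpr.
  rewrite p0 ps !mulr0 subrr sub0r => ->; rewrite opprK.
  have [s1 _ _] := hC t tT'.
  have mo (r : R -> R) : leb.-integrable `[0, s t] (EFin \o r) -> measurable_fun `]0, s t[%classic r.
    move=> ir; have /measurable_EFinP := measurable_int _ ir.
    by apply: measurable_funS => //; exact: subset_itv_oo_cc.
  have j1 : leb.-integrable `[0, s t] (EFin \o (fun y => uz (t, y) * 'D_(0, 1) phi (t, y))).
    by apply: integrable_itvMc => //; exact: sqint_itv_integrable.
  have j2 : leb.-integrable `[0, s t] (EFin \o (fun y => prim t y * 'D_(0, 1) phi (t, y))).
    by apply: integrable_itvMc => //; exact: integrable_within.
  rewrite -!Rintegral_oo_cc; [|exact: mo|exact: mo].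
  by apply: eq_Rintegral => y; rewrite inE/= in_itv/= => /uzp ->.
- exact: Lfun_of_sqint.
- move=> t; rewrite in_itv/= => tT; have [s1 _ inc] := hC t tT.
  have st := s_gt0 tT.
  split.
  + exact: continuous_subspaceT.
  + apply: Lfun_of_sqint => //; apply: sqint_cc_oo; split.
      by apply: measurable_funTS; exact: continuous_measurable_fun.
    apply: integrable_continuous => y.
    by apply: (@continuous_comp _ _ _ (fun y => u (t, y)) (fun x => x ^+ 2)); [exact: cut|exact: exprn_continuous].
  + by apply: Lfun_of_sqint => //; exact: sqint_cc_oo.
  + apply: weak_derivative1_of_C1 => [||phi dphi e cd dp e0 he].
    * exact: continuous_subspaceT.
    * exact: sqint_itv_integrable.
    have p0 : phi 0 = 0 by apply/eqP; apply: contraTT isT => /he /andP[]; lra.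
    have ps : phi (s t) = 0 by apply/eqP; apply: contraTT isT => /he /andP[]; lra.
    have := ac_by_parts (ltW st) (sqint_itv_integrable s1) inc cd dp (continuous_subspaceT (@cut t)).
    by rewrite p0 ps !mulr0 subrr sub0r => ->; rewrite opprK.
- exists (Num.sqrt C) => t; rewrite in_itv/= => tT; have [s1 hs _] := hC t tT.
  rewrite Lnorm2_restrict//; last exact: sqint_cc_oo.
  rewrite lee_fin ler_wsqrtr//; apply: le_trans hs; rewrite Rintegral_oo_cc//.
  have [_ i2] := s1; have /measurable_EFinP := measurable_int _ i2.
  by apply: measurable_funS => //; exact: subset_itv_oo_cc.
- by apply: aeW => p _; rewrite subrr.
- apply: ends; apply: ae_mono good => t h tT; have [ik cpr uzp _] := h tT.
  exists (prim t 0); first exact: tr.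
  by rewrite /prim Rintegral_point addr0 opprK.
- apply: ends; apply: ae_mono good => t h tT; have [ik cpr uzp es] := h tT.
  exists (prim t (s t)); first exact: tr.
  by rewrite es opprK /ds; ring.
- apply: aeW => t; rewrite in_itv/= => tT; rewrite /ds /sigma.
  have st : 0 <= s t <= s t by rewrite lexx ltW// s_gt0.
  by have /andP[-> _] := sl_bounds sl tT st.
- have T00 : (0 : R) <= 0 <= T by rewrite lexx.
  by rewrite (sl_front sl T00) Rintegral_point mulr0 addr0.
- by move=> z; rewrite in_itv/=; exact: (sl_initial sl).
Qed.

End existence.

(** * Extension of the data *)

Section data.
Context {R : realType}.
Notation leb := (@lebesgue_measure R).

(** The violation of the bounds is a continuous function that vanishes at the rational points of the
    open interval, hence also at the end points. *)
Lemma within_bounds (f : R -> R) (a b m M : R) : a < b -> {within `[a, b], continuous f} ->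
  (forall x, a < x < b -> m <= f x <= M) -> forall x, a <= x <= b -> m <= f x <= M.
Proof.
move=> ab cf hf; have cc := continuous_comp_clamp (ltW ab) cf.
have cz : continuous (fun x => Num.max (Num.max (m - (f \o clamp a b) x) ((f \o clamp a b) x - M)) 0).
  have cm (g h : R -> R) : continuous g -> continuous h -> continuous (fun x => Num.max (g x) (h x)).
    by move=> cg ch x; apply: (@continuous_max _ _ g h); [exact: cg|exact: ch].
  apply: (cm (fun x => Num.max (m - (f \o clamp a b) x) ((f \o clamp a b) x - M)) (fun=> 0)).
    apply: (cm (fun x => m - (f \o clamp a b) x) (fun x => (f \o clamp a b) x - M)) => x.
      by apply: cvgB; [exact: cvg_cst|exact: cc].
    by apply: cvgB; [exact: cc|exact: cvg_cst].
  by move=> x; exact: cvg_cst.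
move=> x xab; have := rat_dense_zero ab cz _ xab.
rewrite /= clamp_id// => h; suff : Num.max (Num.max (m - f x) (f x - M)) 0 = 0.
  by move/max_idPr; rewrite ge_max !subr_le0.
apply: h => q /andP[q1 q2]; rewrite clamp_id; last by rewrite !ltW.
have /andP[h1 h2] : m <= f (ratr q) <= M by apply: hf; rewrite q1.
by apply/max_idPr; rewrite ge_max !subr_le0 h1.
Qed.

Lemma W12_sqint (f f' : R -> R) (a b : R) : W1p_deriv 2%:E a b f f' -> a <= b ->
  sqint leb `[a, b] f' /\
  forall p q, a <= p -> p <= q -> q <= b -> f q - f p = \int[leb]_(x in `[p, q]) f' x.
Proof.
move=> [cf _ lf wf] ab.
have sf : sqint leb `[a, b] f' by apply: sqint_oo_cc; exact: sqint_of_Lfun.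
by split => //; apply: increment_of_weak_derivative => //; exact: sqint_itv_integrable.
Qed.

Theorem solution_exists (a0 gamma beta T : R) (b : R -> R) (bmin bmax s0 : R) (u0 : R -> R) :
  0 < a0 -> 0 < gamma -> 0 < beta -> 0 < T -> W1p 2%:E 0 T b -> 0 < bmin -> 0 < bmax ->
  (forall t, t \in `]0, T[ -> bmin <= b t <= bmax) -> 0 < s0 -> W1p 2%:E 0 s0 u0 ->
  (forall z, z \in `[0, s0] -> 0 <= u0 z <= bmax / gamma) ->
  exists (s : R -> R) (u : R * R -> R), is_solution a0 gamma beta T b s0 u0 s u /\
     (forall p, Q s T p -> 0 <= u p <= bmax / gamma).
Proof.
move=> a00 g0 be0 T0 [b' bW] bm0 bM0 hb s00 [u0' uW] hu.
have [sb incb] := W12_sqint bW (ltW T0); have [su incu] := W12_sqint uW (ltW s00).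
have [cb _ _ _] := bW; have [cu _ _ _] := uW.
pose M := bmax / gamma; have M0 : 0 < M by rewrite divr_gt0.
(* Constant extensions, since the scheme samples its data at every multiple of its steps. *)
pose bc := b \o clamp 0 T; pose uc := u0 \o clamp 0 s0.
have hb' x : 0 < x < T -> bmin <= b x <= bmax by move=> xT; apply: hb; rewrite in_itv.
have hb2 := within_bounds T0 cb hb'.
have bcM t : 0 <= bc t <= gamma * M.
  have /hb2/andP[h1 h2] := clamp_itv t (ltW T0).
  by rewrite (le_trans (ltW bm0) h1) /M mulrC divfK ?gt_eqF.
have ucM z : 0 <= uc z <= M by apply: hu; rewrite in_itv/=; exact: clamp_itv (ltW s00).
have hD (h : R) : 0 < h -> \sum_(j < Num.truncn (s0 / h)) (uc (j.+1%:R * h) - uc (j%:R * h)) ^+ 2 <=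
    h * \int[leb]_(x in `[0, s0]) u0' x ^+ 2.
  move=> h0; have /andP[n1 n2] := truncn_div_itv h0 (ltW s00).
  set n := Num.truncn _ in n1 n2 *.
  have n0 : 0 <= n%:R * h by rewrite mulr_ge0// ltW.
  have [mu iu2] := su.
  have su' : sqint leb `[0, n%:R * h] u0'.
    split; first by apply: measurable_funS mu => //; apply: subset_itvl; rewrite bnd_simp.
    exact: integrable_itvS iu2.
  have E := @dirichlet_samples R u0 u0' h n h0 su'
     (fun p q p0 pq qn => incu p q p0 pq (le_trans qn n1)).
  apply: (@le_trans _ _ (h * \int[leb]_(x in `[0, n%:R * h]) u0' x ^+ 2)).
    apply: le_trans E; apply: ler_sum => j _; rewrite /uc /= !clamp_id//.
      by rewrite mulr_ge0 ?(ltW h0)//= (le_trans _ n1)// ler_pM2r// ler_nat ltnW// ltn_ord.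
    by rewrite mulr_ge0 ?(ltW h0)//= (le_trans _ n1)// ler_pM2r// ler_nat ltn_ord.
  rewrite ler_pM2l// (Rintegral_split n0 n1 iu2) lerDl.
  by apply: Rintegral_itv_ge0 => x _; exact: sqr_ge0.
have hB (tau : R) K : 0 < tau -> \sum_(k < K) `|bc (k.+1%:R * tau) - bc (k%:R * tau)| <=
    \int[leb]_(x in `[0, T]) `|b' x|.
  move=> t0; apply: (variation_clamp (t := fun k => k%:R * tau) _ (ltW T0) (sqint_itv_integrable sb) incb).
  by move=> k; rewrite ler_pM2r// ler_nat.
have cbc : continuous bc by exact: continuous_comp_clamp (ltW T0) cb.
have cuc : continuous uc by exact: continuous_comp_clamp (ltW s00) cu.
have [s [u [ut sl]]] := scheme_limit_exists a00 g0 be0 M0 s00 T0 bcM ucM hD hB cbc cuc.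
have [ds [vt [vz [vzz [reg [e1 e2 e3 e4 e5 e6]]]]]] := scheme_limit_solution T0 s00 cbc sl.
exists s, u; split.
  exists ds, vt, vz, vzz; split => //; split => //.
    apply: ae_mono e2 => t h tT; have [q hq hq2] := h tT.
    by exists q => //; move: hq2; rewrite /bc /= clamp_id//; move: tT; rewrite in_itv.
  by move=> z zs; rewrite e6// /uc /= clamp_id//; move: zs; rewrite in_itv.
move=> [t y] [/= /andP[t0 tT] /andP[y0 ys]].
by apply: (sl_bounds sl); rewrite !ltW.
Qed.

End data.

(** * Absolutely continuous functions *)

Section primitives.
Context {R : realType}.
Notation leb := (@lebesgue_measure R).
Implicit Types (f g : R -> R) (a b p q x : R).

Lemma Rintegral_supp f a b p q : a <= p -> q <= b ->
  (forall x, ~~ (p <= x <= q) -> f x = 0) ->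
  \int[leb]_(x in `[a, b]) f x = \int[leb]_(x in `[p, q]) f x.
Proof.
move=> ap qb f0; rewrite [LHS]Rintegral_mkcond [RHS]Rintegral_mkcond.
congr Rintegral; apply/funext => x; rewrite !patchE !mem_setE !in_itv/=.
case: ifPn => h; case: ifPn => // h'; first by rewrite (f0 x h').
by case/andP: h' => px xq; move: h; rewrite (le_trans ap px) (le_trans xq qb).
Qed.

Lemma continuous_primitive g a b : leb.-integrable `[a, b] (EFin \o g) ->
  {within `[a, b], continuous (fun x => \int[leb]_(t in `[a, x]) g t)}.
Proof.
move=> ig; have [ab|ab] := leP a b; last by rewrite set_itv_ge -?leNgt ?bnd_simp -?ltNge//; move=> x; exact: continuous_subspace0.
exact: parameterized_integral_continuous ig.
Qed.

Lemma primitive_increment g a b p q : leb.-integrable `[a, b] (EFin \o g) ->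
  a <= p -> p <= q -> q <= b ->
  \int[leb]_(x in `[a, q]) g x - \int[leb]_(x in `[a, p]) g x = \int[leb]_(x in `[p, q]) g x.
Proof.
move=> ig ap pq qb; rewrite (Rintegral_split ap pq); first by rewrite addrC addKr.
exact: integrable_itvS ig.
Qed.

Lemma zero_of_primitive f b : 0 < b -> {within `[0, b], continuous f} ->
  (forall x, 0 < x < b -> \int[leb]_(t in `[0, x]) f t = 0) ->
  forall x, 0 <= x <= b -> f x = 0.
Proof.
move=> b0 cf f0 x xb; rewrite -(clamp_id xb).
have cfc : continuous (f \o clamp 0 b) by apply: continuous_comp_clamp => //; exact: ltW.
apply: (@rat_dense_zero R (f \o clamp 0 b) 0 b) => // {x xb} q; move: (ratr q) => x xb.
have D := @is_derive_prim R (f \o clamp 0 b) 0 x (proj1 (andP xb)) cfc.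
have D0 : is_derive x 1 (fun=> 0 : R) ((f \o clamp 0 b) x).
  apply: near_eq_is_derive D; near=> y.
  have yb : 0 < y < b.
    by apply/andP; split; near: y; case/andP: xb => x0 xb; [exact: lt_nbhsr|exact: lt_nbhsl].
  rewrite -[RHS](f0 y yb); apply: eq_Rintegral => z; rewrite inE/= in_itv/= => /andP[z0 zy].
  by rewrite clamp_id// z0 (le_trans zy)//; case/andP: yb => _ /ltW.
by have := @derive_val _ _ _ _ _ _ _ D0; rewrite derive_cst.
Unshelve. all: by end_near. Qed.

Lemma zero_of_integral_ge0 f b : 0 < b -> {within `[0, b], continuous f} ->
  (forall x, 0 <= x <= b -> 0 <= f x) -> \int[leb]_(t in `[0, b]) f t <= 0 ->
  forall x, 0 <= x <= b -> f x = 0.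
Proof.
move=> b0 cf f0 i0; apply: zero_of_primitive => // y /andP[y0 yb].
apply/eqP; rewrite eq_le; apply/andP; split; last first.
  by apply: Rintegral_itv_ge0 => z /andP[z0 zy]; rewrite f0// z0 (le_trans zy)// ltW.
apply: le_trans i0; rewrite (Rintegral_split (ltW y0) (ltW yb)); last exact: integrable_within.
rewrite lerDl; apply: Rintegral_itv_ge0 => z /andP[yz zb].
by rewrite f0// zb andbT (le_trans (ltW y0)).
Qed.

Lemma eq_of_increments (H V : R -> R) a b : a <= b ->
  (forall e : R, 0 < e -> exists2 d : R, 0 < d & forall p q,
     a <= p -> p <= q -> q <= b -> q - p <= d -> `|H q - H p| <= e * (V q - V p)) ->
  H b = H a.
Proof.
move=> ab hH; apply/eqP; rewrite eq_le; apply/andP; split.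
  apply: (@le_of_increments R H V) => // e e0; have [d d0 hd] := hH e e0.
  by exists d => // p q ap pq qb pqd; apply: le_trans (ler_norm _) (hd _ _ ap pq qb pqd).
rewrite -lerN2; apply: (@le_of_increments R (fun x => - H x) V) => // e e0; have [d d0 hd] := hH e e0.
exists d => // p q ap pq qb pqd; rewrite -opprD; apply: le_trans (hd _ _ ap pq qb pqd).
by rewrite ler_normr lexx orbT.
Qed.

Lemma unif_continuous_itv f a b (e : R) : {within `[a, b], continuous f} -> 0 < e ->
  exists2 d : R, 0 < d & forall x y, a <= x <= b -> a <= y <= b -> `|x - y| <= d ->
    `|f x - f y| <= e.
Proof.
move=> cf e0; have [d d0 hd] := compact_unif_continuous (@segment_compact R a b) cf e0.
exists (d / 2) => [|x y xab yab xy]; first by rewrite divr_gt0.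
apply: ltW; apply: hd; rewrite /= ?in_itv//.
by apply: le_lt_trans xy _; rewrite ltr_pdivrMr// mulr_natr mulr2n ltrDl.
Qed.

(** Chain rule for a function of an absolutely continuous [f]. The quadratic remainder is how a
    function with a Lipschitz derivative such as [neg x ^+ 2] enters; the constant 1 is the one that
    holds for it. *)
Lemma ac_comp f g (F dF : R -> R) a b : a <= b ->
  leb.-integrable `[a, b] (EFin \o g) ->
  (forall p q, a <= p -> p <= q -> q <= b -> f q - f p = \int[leb]_(x in `[p, q]) g x) ->
  {within `[a, b], continuous f} -> continuous dF ->
  (forall x y, `|F x - F y - dF y * (x - y)| <= (x - y) ^+ 2) ->
  F (f b) - F (f a) = \int[leb]_(x in `[a, b]) (dF (f x) * g x).
Proof.
move=> ab ig fg cf cdF hF.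
have cdf : {within `[a, b], continuous (fun x => dF (f x))}.
  by move=> x; apply: (@continuous_comp _ _ _ (f : subspace _ -> R) dF); [exact: cf|exact: cdF].
have iag : leb.-integrable `[a, b] (EFin \o (fun x => `|g x|)) by exact: integrable_norm.
have igd : leb.-integrable `[a, b] (EFin \o (fun x => dF (f x) * g x)).
  have -> : (fun x => dF (f x) * g x) = (fun x => g x * dF (f x)) by apply/funext => x; rewrite mulrC.
  exact: integrable_itvM.
pose V x := \int[leb]_(y in `[a, x]) `|g y|.
pose H x := F (f x) - \int[leb]_(y in `[a, x]) (dF (f y) * g y).
suff : H b = H a by rewrite /H Rintegral_point; lra.
apply: (@eq_of_increments H V) => // e e0; have e20 : 0 < e / 2 by rewrite divr_gt0.
have [d1 d10 h1] := unif_continuous_itv cf e20.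
have [d2 d20 h2] := unif_continuous_itv cdf e20.
exists (Num.min d1 d2) => [|p q ap pq qb]; first by rewrite lt_min d10.
rewrite le_min => /andP[pq1 pq2].
have i1 h : leb.-integrable `[a, b] (EFin \o h) -> leb.-integrable `[p, q] (EFin \o h).
  exact: integrable_itvS.
have -> : V q - V p = \int[leb]_(y in `[p, q]) `|g y| by exact: primitive_increment iag _ _ _.
have fV : `|f q - f p| <= \int[leb]_(y in `[p, q]) `|g y|.
  by rewrite fg//; apply: le_normr_Rintegral => //; exact: i1.
have pab : a <= p <= b by rewrite ap (le_trans pq).
have qab : a <= q <= b by rewrite qb (le_trans ap).
have fe : `|f q - f p| <= e / 2.
  by apply: h1 => //; rewrite ger0_norm// subr_ge0.
have -> : H q - H p = (F (f q) - F (f p) - dF (f p) * (f q - f p)) +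
    \int[leb]_(y in `[p, q]) (g y * (dF (f p) - dF (f y))).
  have -> : \int[leb]_(y in `[p, q]) (g y * (dF (f p) - dF (f y))) =
      dF (f p) * (f q - f p) - \int[leb]_(y in `[p, q]) (dF (f y) * g y).
    rewrite fg// -RintegralZl//; last exact: i1.
    rewrite -RintegralB//; [|by apply: integrableRZ => //; exact: i1|exact: i1].
    by apply: eq_Rintegral => y _; ring.
  rewrite -(primitive_increment igd ap pq qb) /H; ring.
have spq : (`[p, q]%classic : set R) `<=` `[a, b]%classic.
  by move=> y /=; rewrite !in_itv/= => /andP[py yq]; rewrite (le_trans ap py) (le_trans yq qb).
have i3 : leb.-integrable `[p, q] (EFin \o (fun y => g y * (dF (f p) - dF (f y)))).
  apply: integrable_itvM; first exact: i1.
  have c : {within `[p, q], continuous (fun x => dF (f x))} by apply: continuous_subspaceW cdf.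
  by move=> y; apply: cvgB; [exact: cvg_cst|exact: c].
apply: le_trans (ler_normD _ _) _; rewrite [e]splitr [leRHS]mulrDl; apply: lerD.
  apply: le_trans (hF _ _) _; rewrite -real_normK ?num_real// expr2.
  by apply: ler_pM.
apply: le_trans (le_normr_Rintegral _ i3) _ => //.
rewrite -RintegralZl//; last exact: i1.
apply: le_Rintegral => //; first exact: (integrable_norm i3).
  by apply: integrableRZ => //; exact: i1.
move=> y; rewrite /= in_itv/= => /andP[py yq]; rewrite normrM mulrC ler_wpM2r//.
apply: h2 => //; first by rewrite (le_trans ap py) (le_trans yq qb).
by rewrite distrC ger0_norm ?subr_ge0//; lra.
Qed.

End primitives.

(** * Products of functions of time and of space as test functions *)

Section product_test_functions.
Context {R : realType}.
Notation leb := (@lebesgue_measure R).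
Notation leb2 := (@leb2 R).
Implicit Types (eta psi deta dpsi : R -> R) (a b c d T : R).

Lemma test_function_product eta psi a b c d (A : set (R * R)) : Cinf eta -> Cinf psi ->
  in_open_support a b eta -> in_open_support c d psi -> `]a, b[ `*` `]c, d[ `<=` A ->
  test_function A (fun p : R * R => eta p.1 * psi p.2).
Proof.
move=> ceta cpsi [a' [b' [aa bb heta]]] [c' [d' [cc dd hpsi]]] hA; split.
  exact: smooth_product.
exists (`[a', b']%classic `*` `[c', d']%classic); split.
- by apply: compact_setX; exact: segment_compact.
- move=> p [/=]; rewrite !in_itv/= => /andP[h1 h2] /andP[h3 h4]; apply: hA; split => /=.
    by rewrite in_itv/= (lt_le_trans aa h1) (le_lt_trans h2 bb).
  by rewrite in_itv/= (lt_le_trans cc h3) (le_lt_trans h4 dd).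
- move=> p hp; have [h1|h1] := boolP (a' <= p.1 <= b'); last by rewrite heta ?mul0r.
  have [h2|h2] := boolP (c' <= p.2 <= d'); last by rewrite hpsi ?mulr0.
  by exfalso; apply: hp; split => /=; rewrite in_itv.
Qed.

Lemma partial1_product eta deta psi (p : R * R) : Cinf eta -> Cinf psi ->
  (forall x : R, is_derive x 1 eta (deta x)) ->
  'D_(1, 0) (fun p : R * R => eta p.1 * psi p.2) p = deta p.1 * psi p.2.
Proof.
move=> ceta cpsi deta1; case: p => t y /=.
have [_ /(_ t y) D] := smooth_partial1 (smooth_product ceta cpsi).
have D' : is_derive t 1 (fun r => eta r * psi y) (deta t * psi y).
  have := is_deriveM (deta1 t) (is_derive_cst (psi y) t 1).
  by rewrite scaler0 add0r (_ : _ *: _ = deta t * psi y)//; exact: mulrC.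
by rewrite -(@derive_val _ _ _ _ _ _ _ D) -(@derive_val _ _ _ _ _ _ _ D').
Qed.

Lemma partial2_product eta psi dpsi (p : R * R) : Cinf eta -> Cinf psi ->
  (forall x : R, is_derive x 1 psi (dpsi x)) ->
  'D_(0, 1) (fun p : R * R => eta p.1 * psi p.2) p = eta p.1 * dpsi p.2.
Proof.
move=> ceta cpsi dpsi1; case: p => t y /=.
have [_ /(_ t y) D] := smooth_partial2 (smooth_product ceta cpsi).
have D' : is_derive y 1 (fun r => eta t * psi r) (eta t * dpsi y).
  have := is_deriveM (is_derive_cst (eta t) y 1) (dpsi1 y).
  by rewrite scaler0 addr0.
by rewrite -(@derive_val _ _ _ _ _ _ _ D) -(@derive_val _ _ _ _ _ _ _ D').
Qed.

Lemma continuous_product eta psi : continuous eta -> continuous psi ->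
  continuous (fun p : R * R => eta p.1 * psi p.2).
Proof.
move=> ce cp p; apply: cvgM.
  by apply: (cvg_comp fst eta); [exact: cvg_fst|exact: ce].
by apply: (cvg_comp snd psi); [exact: cvg_snd|exact: cp].
Qed.

(** Fubini turns the hypothesis into a test of the slice integrals against every [eta] supported
    after [t1]. The starting time is there because product test functions fit into the domain only
    once the front is far enough to the right. *)
Lemma ae_slice_zero (s : R -> R) T (k : R * R -> R) t1 : continuous s -> 0 <= t1 -> t1 <= T ->
  leb2.-integrable (Q s T) (EFin \o k) ->
  (forall eta, Cinf eta -> in_open_support t1 T eta ->
    leb2.-integrable (Q s T) (EFin \o (fun p => k p * eta p.1)) /\
    \int[leb2]_(p in Q s T) (k p * eta p.1) = 0) ->
  {ae leb, forall t, t1 < t < T -> \int[leb]_(y in `[0, s t]) k (t, y) = 0}.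
Proof.
move=> cs t10 tT ik h; have [A B _] := Fubini_Q cs ik.
set kap := fun t => \int[leb]_(y in `[0, s t]) k (t, y) in B.
have iB : leb.-integrable `[t1, T] (EFin \o kap) by exact: integrable_itvS B.
suff : {ae leb, forall t, t \in `[t1, T] -> kap t = 0}.
  by apply: ae_mono => t ht /andP[h1 h2]; apply: ht; rewrite in_itv/= !ltW.
apply: du_bois_reymond => // eta ceta seta.
have [ie E] := h _ ceta seta; have [_ B' E'] := Fubini_Q cs ie.
have [p [q [tp qT eta0]]] := seta.
have e0 x : ~~ (t1 <= x <= T) -> eta x = 0.
  move=> hx; apply: eta0; apply: contra hx => /andP[px xq].
  by rewrite (le_trans (ltW tp) px) (le_trans xq (ltW qT)).
rewrite -[RHS]E E' -(@Rintegral_supp R _ 0 T t1 T) //; last first.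
  by move=> x /e0 ->; rewrite mulr0.
have mo (g : R -> R) : leb.-integrable `[0, T] (EFin \o g) -> measurable_fun `]0, T[%classic g.
  move=> ih; have /measurable_EFinP := measurable_int _ ih.
  by apply: measurable_funS => //; exact: subset_itv_oo_cc.
have iBe := integrable_itvMc B (Cinf_continuous ceta).
rewrite -!Rintegral_oo_cc; [|exact: mo|exact: mo].
apply: ae_eq_Rintegral => //; [exact: mo|exact: mo|].
apply: ae_mono A => t ht; rewrite /= in_itv/= => /ht it.
by rewrite -RintegralZr.
Qed.

End product_test_functions.

(** * Integral identities for solutions *)

Section traces.
Context {R : realType}.
Notation leb := (@lebesgue_measure R).

Lemma ae_eq_Rintegral_oo (f g : R -> R) (a b p q : R) : a <= p -> q <= b ->
  leb.-integrable `[p, q] (EFin \o f) -> leb.-integrable `[p, q] (EFin \o g) ->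
  {ae leb, forall x, x \in `]a, b[ -> f x = g x} ->
  \int[leb]_(x in `[p, q]) f x = \int[leb]_(x in `[p, q]) g x.
Proof.
move=> ap qb i1 i2 fg.
have mo (h : R -> R) : leb.-integrable `[p, q] (EFin \o h) -> measurable_fun `]p, q[%classic h.
  move=> ih; have /measurable_EFinP := measurable_int _ ih.
  by apply: measurable_funS => //; exact: subset_itv_oo_cc.
rewrite -!Rintegral_oo_cc; [|exact: mo|exact: mo].
apply: ae_eq_Rintegral => //; [exact: mo|exact: mo|].
apply: ae_mono fg => x h; rewrite /= in_itv/= => /andP[px xq]; apply: h.
by rewrite in_itv/= (le_lt_trans ap px) (lt_le_trans xq qb).
Qed.

Variables (S : R) (k h : R -> R).
Hypothesis S0 : 0 < S.
Hypothesis ik : leb.-integrable `[0, S] (EFin \o k).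
Hypothesis ih : leb.-integrable `[0, S] (EFin \o h).
Hypothesis kh : forall (p q : rat) n, 0 < (ratr p : R) -> (ratr p : R) < ratr q -> (ratr q : R) < S ->
  \int[leb]_(y in `[ratr p, ratr q]) (k y * (dplat1 (ratr p) (ratr q) n y - dplat2 (ratr p) (ratr q) n y)
     + h y * plat (ratr p) (ratr q) n y) = 0.

(** Plateaus with rational ends give the increments of [g] minus the primitive of [h] between
    rational points, and continuity does the rest. *)
Lemma representative_increment (g : R -> R) : {within `[0, S], continuous g} ->
  {ae leb, forall x, x \in `]0, S[ -> k x = g x} ->
  forall z, 0 <= z <= S -> g z = g 0 + \int[leb]_(y in `[0, z]) h y.
Proof.
move=> cg kg.
pose Phi z := g z - \int[leb]_(y in `[0, z]) h y.
have cPhi : {within `[0, S], continuous Phi}.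
  by move=> z; apply: cvgB; [exact: cg|exact: (continuous_primitive ih)].
have step (p q : rat) : 0 < (ratr p : R) -> (ratr p : R) < ratr q -> (ratr q : R) < S ->
    Phi (ratr q) = Phi (ratr p).
  move=> p0 pq qS; have p0' := ltW p0; have qS' := ltW qS.
  have spq : (`[ratr p, ratr q]%classic : set R) `<=` `[0, S]%classic.
    by move=> y /=; rewrite !in_itv/= => /andP[py yq]; rewrite (le_trans p0' py) (le_trans yq qS').
  have ih' : leb.-integrable `[ratr p, ratr q] (EFin \o h) by exact: integrable_itvS ih.
  have ik' : leb.-integrable `[ratr p, ratr q] (EFin \o k) by exact: integrable_itvS ik.
  have cg' : {within `[ratr p, ratr q], continuous g} by exact: continuous_subspaceW cg.
  rewrite /Phi; suff : g (ratr q) - g (ratr p) = \int[leb]_(y in `[ratr p, ratr q]) h y.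
    by rewrite -(primitive_increment ih p0' (ltW pq) qS'); lra.
  apply: increment_of_plateaux => // n.
  have cd : continuous (fun y : R => dplat1 (ratr p) (ratr q) n y - dplat2 (ratr p) (ratr q) n y).
    by move=> y; apply: cvgB; [exact: continuous_dplat1|exact: continuous_dplat2].
  have cp : continuous (plat (ratr p) (ratr q : R) n) by exact/Cinf_continuous/Cinf_plat.
  have i1 := integrable_itvMc ik' cd; have i2 := integrable_itvMc ih' cp.
  have := kh n p0 pq qS; rewrite RintegralD// => E.
  transitivity (\int[leb]_(y in `[ratr p, ratr q]) (k y * (dplat1 (ratr p) (ratr q) n y - dplat2 (ratr p) (ratr q) n y))); last lra.
  apply/esym; apply: (@ae_eq_Rintegral_oo _ _ 0 S) => //.
    by apply: integrable_itvMc => //; exact: integrable_within.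
  by apply: ae_mono kg => x kgx /kgx ->.
have [p] := @rat_in_itvoo R 0 S S0; rewrite in_itv/= => /andP[p0 pS].
have cPc : continuous (Phi \o clamp 0 S) by apply: continuous_comp_clamp => //; exact: ltW.
have all0 : forall z, 0 <= z <= S -> Phi (clamp 0 S z) - Phi (ratr p) = 0.
  apply: rat_dense_zero => // [z|q /andP[q0 qS]]; first by apply: cvgB; [exact: cPc|exact: cvg_cst].
  rewrite clamp_id ?ltW//; have [pq|pq|->] := ltgtP (ratr p : R) (ratr q); last by rewrite subrr.
    by rewrite (step p q)// subrr.
  by rewrite -(step q p)// subrr.
move=> z zS; have := all0 z zS; have := all0 0; rewrite lexx/= (ltW S0) => /(_ isT).
rewrite [clamp 0 S z]clamp_id// [clamp 0 S 0]clamp_id ?lexx ?ltW// /Phi Rintegral_point; lra.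
Qed.

(** A trace is the end value of some continuous representative, a priori a different one at each
    end. Both are primitives of [h], so they differ by a constant, and their equal integrals force
    that constant to be 0. *)
Lemma primitive_of_traces (f : R -> R) (q0 qS : R) :
  (forall z, 0 <= z <= S -> f z - f 0 = \int[leb]_(y in `[0, z]) k y) ->
  has_trace 0 S k 0 q0 -> has_trace 0 S k S qS ->
  qS = q0 + \int[leb]_(y in `[0, S]) h y /\
  forall z, 0 <= z <= S ->
    f z - f 0 = \int[leb]_(y in `[0, z]) (q0 + \int[leb]_(x in `[0, y]) h x).
Proof.
move=> fk [g [cg kg g0]] [g' [cg' kg' gS]].
have gE := representative_increment cg kg; have gE' := representative_increment cg' kg'.
have S0' := ltW S0.
have E (l : R -> R) z : 0 <= z <= S -> {within `[0, S], continuous l} ->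
    {ae leb, forall x, x \in `]0, S[ -> k x = l x} ->
    \int[leb]_(y in `[0, z]) k y = \int[leb]_(y in `[0, z]) l y.
  move=> /andP[z0 zS] cl kl; apply: (@ae_eq_Rintegral_oo _ _ 0 S) => //; first exact: integrable_itvS ik.
  by apply: integrable_itvS (integrable_within cl).
split; last first.
  move=> z zS; rewrite fk// (E g z zS cg kg); apply: eq_Rintegral => y.
  rewrite inE/= in_itv/= => /andP[y0 yz]; rewrite gE ?g0// y0 (le_trans yz)//.
  by case/andP: zS.
have SS : 0 <= S <= S by rewrite S0' lexx.
have : \int[leb]_(y in `[0, S]) (g' y - g y) = 0.
  rewrite RintegralB//; [|exact: integrable_within|exact: integrable_within].
  by rewrite -(E g S SS cg kg) -(E g' S SS cg' kg') subrr.
rewrite (@eq_Rintegral _ _ _ _ _ (cst (g' 0 - g 0))).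
  rewrite Rintegral_itv_cst// subr0 => /eqP; rewrite mulf_eq0 (gt_eqF S0) orbF subr_eq0 => /eqP gg.
  by rewrite -gS gE'// gg g0.
move=> y; rewrite inE/= in_itv/= => yS; rewrite gE// gE'//=; lra.
Qed.

End traces.

(** * Continuous extension of a solution and its slices *)

Section extension.
Context {R : realType}.
Notation leb := (@lebesgue_measure R).
Notation leb2 := (@leb2 R).

(** A solution is constrained only on the closure of its domain. It is frozen outside [[0, T]] in
    time and extended by its end values in space, which makes it continuous on the whole plane. *)
Definition front_ext (s : R -> R) T t : R := s (clamp 0 T t).
Definition state_ext (s : R -> R) T (u : R * R -> R) (p : R * R) : R :=
  u (clamp 0 T p.1, clamp 0 (front_ext s T p.1) p.2).

Variables (a0 gamma beta T : R) (b : R -> R) (s0 : R) (u0 s ds : R -> R) (u ut uz uzz : R * R -> R).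
Hypotheses (T_gt0 : 0 < T) (a0_gt0 : 0 < a0).
Hypothesis reg : solution_regularity T s ds u ut uz uzz.
Hypothesis eqs : solution_equations a0 gamma beta T b s0 u0 s ds u ut uz uzz.

Notation sg := (front_ext s T).
Notation v := (state_ext s T u).

Let T0 : 0 <= T. Proof. exact: ltW. Qed.

Lemma front_ext_continuous : continuous sg.
Proof. by apply: continuous_comp_clamp => //; case: (s_W1oo reg). Qed.
Let csg := front_ext_continuous.

Lemma front_ext_gt0 t : 0 < sg t.
Proof. by apply: (s_gt0 reg); rewrite in_itv/= clamp_itv. Qed.

Lemma front_extE t : 0 <= t <= T -> sg t = s t.
Proof. by move=> tT; rewrite /front_ext clamp_id. Qed.

Lemma Q_front_ext : Q s T = Q sg T.
Proof.
apply/seteqP; split => p; rewrite /Q/= => -[h1 h2]; split => //; move: h2;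
  by rewrite front_extE//; case/andP: h1 => *; rewrite !ltW.
Qed.

Lemma state_extE t y : 0 <= t <= T -> 0 <= y <= s t -> v (t, y) = u (t, y).
Proof. by move=> tT ys; rewrite /state_ext/= front_extE// !clamp_id. Qed.

Lemma state_ext_frontE t : 0 <= t <= T -> v (t, sg t) = u (t, s t).
Proof.
move=> tT; rewrite front_extE// state_extE//.
by have := front_ext_gt0 t; rewrite front_extE// lexx andbT => /ltW.
Qed.

Lemma state_ext_0E t : 0 <= t <= T -> v (t, 0) = u (t, 0).
Proof. by move=> tT; rewrite state_extE// lexx -(front_extE tT) ltW// front_ext_gt0. Qed.

Lemma state_ext_out t y : sg t <= y -> v (t, y) = v (t, sg t).
Proof.
move=> h; rewrite /state_ext/=; congr (u (_, _)).
have s0' := ltW (front_ext_gt0 t).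
by rewrite /clamp (min_idPl h) minxx.
Qed.

Lemma state_ext_continuous : continuous v.
Proof.
have hs t : sg (clamp 0 T t) = sg t by rewrite /front_ext [clamp 0 T (clamp 0 T t)]clamp_id// clamp_itv.
pose k (p : R * R) := (clamp 0 T p.1, clamp 0 (sg p.1) p.2).
have kQ p : Qclosed s T (k p).
  rewrite /Qclosed/= clamp_itv//; split => //; rewrite -[s (clamp _ _ _)]/(sg p.1).
  by apply: clamp_itv; rewrite ltW// front_ext_gt0.
have ck : continuous k.
  have c1 : continuous (fun p : R * R => p.1) by move=> p; exact: cvg_fst.
  have c2 : continuous (fun p : R * R => p.2) by move=> p; exact: cvg_snd.
  have cs1 : continuous (fun p : R * R => sg p.1).
    by move=> q; apply: (cvg_comp fst sg); [exact: c1|exact: csg].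
  have k1 : continuous (fun p : R * R => clamp 0 T p.1).
    by move=> p; apply: (cvg_comp fst (clamp 0 T)); [exact: c1|exact: continuous_clamp].
  have k2 : continuous (fun p : R * R => clamp 0 (sg p.1) p.2).
    move=> p; rewrite /clamp; apply: (@continuous_max _ _ (fun=> 0) (fun p : R * R => Num.min (sg p.1) p.2)).
      exact: cvg_cst.
    apply: (@continuous_min _ _ (fun p : R * R => sg p.1) (fun p : R * R => p.2)); [exact: cs1|exact: c2].
  by move=> p; exact: (cvg_pair (k1 p) (k2 p)).
move=> p; have /subspace_continuousP /(_ _ (kQ p)) cu := u_continuous reg.
apply: (@cvg_comp _ _ _ k u _ _ _ _ cu) => A /=; rewrite /within/= => hA.
have [i i12 hi] := ck p _ hA; exists i => // q iq; exact: (hi q iq (kQ q)).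
Qed.
Let cv := state_ext_continuous.

Lemma state_ext_front_continuous : continuous (fun t => v (t, sg t)).
Proof.
move=> r; have h : ((x, sg x) @[x --> r] --> (r, sg r)) by exact: (cvg_pair cvg_id (@csg r)).
exact: (cvg_comp _ _ h (@cv _)).
Qed.

Lemma front_speed_continuous : continuous (fun r => a0 * sigma (v (r, sg r))).
Proof.
have csig : continuous (@sigma R).
  have -> : @sigma R = (fun r => Num.max 0 r) by apply/funext => r; rewrite /sigma maxEle.
  by move=> r; apply: (@continuous_max _ _ (fun=> 0) id); [exact: cvg_cst|exact: cvg_id].
move=> r; apply: cvgMr; apply: (cvg_comp (fun r => v (r, sg r)) (@sigma R)); last exact: csig.
exact: state_ext_front_continuous.
Qed.

Lemma front_ext_increment p q : 0 <= p -> p <= q -> q <= T ->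
  sg q - sg p = \int[leb]_(r in `[p, q]) (a0 * sigma (v (r, sg r))).
Proof.
move=> p0 pq qT; pose g r := a0 * sigma (v (r, sg r)).
have cg : continuous g by exact: front_speed_continuous.
have [cs _ lds wds] := s_W1oo reg.
rewrite !front_extE ?p0 ?(le_trans p0) ?(le_trans pq)//.
apply: (@increment_of_weak_derivative R s g 0 T) => //; first exact: integrable_continuous.
move=> phi tphi; rewrite wds//; congr (- _)%E.
have [cdp dp _] := test_function_C1 tphi.
have cp : continuous phi by exact: is_derive_continuous dp.
have mds : measurable_fun `]0, T[%classic ds.
  move: lds; rewrite /in_Lp1 inE => /andP[+ _]; rewrite inE/= => mf.
  exact/(measurable_restrictT _ _).
apply: ae_eq_integral => //.
- by apply/measurable_EFinP; apply: measurable_funM => //; apply: measurable_funTS; exact: continuous_measurable_fun.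
- by apply/measurable_EFinP; apply: measurable_funTS; apply: measurable_funM; exact: continuous_measurable_fun.
apply: ae_mono (free_boundary eqs) => t h; rewrite /= in_itv/= => /andP[t0 tT].
rewrite /g h ?in_itv/= ?ltW//.
by rewrite state_ext_frontE// !ltW.
Qed.

Let mQ : measurable (Q sg T). Proof. exact: measurable_Q. Qed.
Let sut : sqint leb2 (Q sg T) ut.
Proof. by apply: sqint_of_Lfun => //; have := ut_L2 reg; rewrite /in_Lp2 Q_front_ext. Qed.
Let suz : sqint leb2 (Q sg T) uz.
Proof. by apply: sqint_of_Lfun => //; have := uz_L2 reg; rewrite /in_Lp2 Q_front_ext. Qed.
Let suzz : sqint leb2 (Q sg T) uzz.
Proof. by apply: sqint_of_Lfun => //; have := uzz_L2 reg; rewrite /in_Lp2 Q_front_ext. Qed.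

Let iM (f g : R * R -> R) : sqint leb2 (Q sg T) f -> continuous g ->
  leb2.-integrable (Q sg T) (EFin \o (fun p => f p * g p)).
Proof. by move=> sf cg; apply: (@sqintM _ _ R leb2 (Q sg T) mQ _ _ sf); exact: sqint_continuous. Qed.

Lemma space_weak_derivative (phi : R * R -> R) : test_function (Q sg T) phi ->
  \int[leb2]_(p in Q sg T) (uz p * 'D_(0, 1) phi p) = - \int[leb2]_(p in Q sg T) (ut p * phi p).
Proof.
move=> tphi; have [cd _] := smooth_partial2 (proj1 tphi).
have cphi : continuous phi by have [+ _] := proj1 tphi [::].
have i1 := iM suz cd; have i2 := iM suzz cphi; have i3 := iM sut cphi.
have := uzz_weak reg; rewrite Q_front_ext => /(_ _ tphi).
rewrite (@Rintegral_fineK R _ _ leb2 (Q sg T) _ mQ i1) (@Rintegral_fineK R _ _ leb2 (Q sg T) _ mQ i2).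
rewrite -EFinN => -[->]; congr (- _).
apply: ae_eq_Rintegral => //.
- by have /measurable_EFinP := measurable_int _ i2.
- by have /measurable_EFinP := measurable_int _ i3.
have := heat_equation eqs; rewrite Q_front_ext; apply: ae_mono => p h Qp.
by have := h Qp => /eqP; rewrite subr_eq0 => /eqP ->.
Qed.

Lemma time_weak_derivative (phi : R * R -> R) : test_function (Q sg T) phi ->
  \int[leb2]_(p in Q sg T) (v p * 'D_(1, 0) phi p) = - \int[leb2]_(p in Q sg T) (ut p * phi p).
Proof.
move=> tphi; have [cd _] := smooth_partial1 (proj1 tphi).
have cphi : continuous phi by have [+ _] := proj1 tphi [::].
have sv : sqint leb2 (Q sg T) v by exact: sqint_continuous.
have i1 := iM sv cd; have i3 := iM sut cphi.
have := ut_weak reg; rewrite Q_front_ext => /(_ _ tphi).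
rewrite (@Rintegral_fineK R _ _ leb2 (Q sg T) _ mQ i3).
have -> : (\int[leb2]_(p in Q sg T) (u p * 'D_(1, 0) phi p)%:E =
    \int[leb2]_(p in Q sg T) (v p * 'D_(1, 0) phi p)%:E)%E.
  apply: eq_integral => -[t y]; rewrite inE /Q/= => -[/andP[t0 tT] /andP[y0 ys]].
  have tT' : 0 <= t <= T by rewrite !ltW.
  by rewrite state_extE// -(front_extE tT') !ltW.
by rewrite (@Rintegral_fineK R _ _ leb2 (Q sg T) _ mQ i1) -EFinN => -[].
Qed.

Lemma front_ext_homo p q : 0 <= p -> p <= q -> q <= T -> sg p <= sg q.
Proof.
move=> p0 pq qT; rewrite -subr_ge0 front_ext_increment//; apply: Rintegral_itv_ge0 => x _.
by rewrite mulr_ge0//; [exact: ltW|rewrite /sigma; case: ifP].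
Qed.

Let plat0 (p q : R) n x : p < q -> ~~ (p <= x <= q) -> plat p q n x = 0.
Proof.
move=> pq; rewrite negb_and -!ltNge => h; apply: plat_out => //.
have k0 : 0 <= (slope p q n)^-1 by rewrite invr_ge0 ltW// slope_gt0.
by case/orP: h => h; apply/orP; [left|right]; apply: ltW; move: h k0; lra.
Qed.
Let dplat0 (p q : R) n x : p < q -> ~~ (p <= x <= q) -> dplat1 p q n x - dplat2 p q n x = 0.
Proof.
by move=> pq; rewrite negb_and -!ltNge => h; apply: dplat_out => //; case/orP: h => /ltW ->; rewrite ?orbT.
Qed.
Let cdplat (p q : R) n : continuous (fun y : R => dplat1 p q n y - dplat2 p q n y).
Proof. by move=> y; apply: cvgB; [exact: continuous_dplat1|exact: continuous_dplat2]. Qed.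
Let csnd (f : R -> R) : continuous f -> continuous (fun p : R * R => f p.2).
Proof. by move=> cf p; apply: (cvg_comp snd f); [exact: cvg_snd|exact: cf]. Qed.
Let cfst (f : R -> R) : continuous f -> continuous (fun p : R * R => f p.1).
Proof. by move=> cf p; apply: (cvg_comp fst f); [exact: cvg_fst|exact: cf]. Qed.
Let iD (f g : R * R -> R) : leb2.-integrable (Q sg T) (EFin \o f) ->
  leb2.-integrable (Q sg T) (EFin \o g) -> leb2.-integrable (Q sg T) (EFin \o (fun p => f p + g p)).
Proof. exact: (@integrableRD _ _ R leb2 (Q sg T) _ _ mQ). Qed.

(** The front is nondecreasing, so []p, q[] stays inside the domain at all times after [t1], and
    products of the plateau with functions of time supported there are test functions. *)
Lemma slice_plateau (p q t1 : R) n : 0 <= p -> p < q -> 0 <= t1 -> t1 <= T -> q <= sg t1 ->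
  {ae leb, forall t, t1 < t < T -> \int[leb]_(y in `[p, q])
    (uz (t, y) * (dplat1 p q n y - dplat2 p q n y) + ut (t, y) * plat p q n y) = 0}.
Proof.
move=> p0 pq t10 t1T qs.
pose k (x : R * R) := uz x * (dplat1 p q n x.2 - dplat2 p q n x.2) + ut x * plat p q n x.2.
have cp : Cinf (plat p q n) by exact: Cinf_plat.
have cp' := Cinf_continuous cp.
have ik : leb2.-integrable (Q sg T) (EFin \o k).
  exact: (iD (iM suz (csnd (@cdplat p q n))) (iM sut (csnd cp'))).
have := @ae_slice_zero R sg T k t1 csg t10 t1T ik; have H eta : Cinf eta -> in_open_support t1 T eta ->
    leb2.-integrable (Q sg T) (EFin \o (fun p => k p * eta p.1)) /\
    \int[leb2]_(p in Q sg T) (k p * eta p.1) = 0.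
  move=> ceta seta; pose phi (x : R * R) := eta x.1 * plat p q n x.2.
  have tphi : test_function (Q sg T) phi.
    apply: (test_function_product ceta cp seta (plat_support n pq (lexx p) (lexx q))).
    move=> [t y]; rewrite /Q/= !in_itv/= => -[/andP[h1 h2] /andP[h3 h4]].
    rewrite h2 (le_lt_trans t10 h1) (le_lt_trans p0 h3); split => //=.
    by apply: lt_le_trans h4 _; apply: le_trans qs _; apply: front_ext_homo => //; exact: ltW.
  have i1 := iM suz (continuous_product (Cinf_continuous ceta) (@cdplat p q n)).
  have i2 := iM sut (continuous_product (Cinf_continuous ceta) cp').
  have kE : (fun x : R * R => k x * eta x.1) = (fun x =>
      uz x * (eta x.1 * (dplat1 p q n x.2 - dplat2 p q n x.2)) + ut x * phi x).
    by apply/funext => x; rewrite /k /phi; ring.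
  rewrite kE; split; first exact: iD.
  rewrite (@RintegralD _ _ R leb2 (Q sg T) _ _ mQ i1 i2).
  apply/eqP; rewrite addr_eq0 -(space_weak_derivative tphi); apply/eqP.
  by apply: eq_Rintegral => x _; rewrite /phi (partial2_product _ ceta cp (@is_derive_plat R p q n)).
move/(_ H); apply: ae_mono => t ht tT; rewrite -[RHS](ht tT) /k/=.
apply/esym/Rintegral_supp => //.
  by apply: le_trans qs _; apply: front_ext_homo => //; case/andP: tT => *; exact: ltW.
by move=> x hx; rewrite plat0// dplat0// !mulr0 addr0.
Qed.

Definition flux t z := - (beta * (b t - gamma * v (t, 0))) + \int[leb]_(y in `[0, z]) ut (t, y).

(** On almost every slice the weak equation makes [u_z] a primitive of [u_t]; the trace at 0 fixes
    the constant and the trace at the front gives the end value. *)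
Lemma slice_flux : {ae leb, forall t, 0 < t < T ->
  [/\ leb.-integrable `[0, sg t] (EFin \o (fun y => ut (t, y))),
      leb.-integrable `[0, sg t] (EFin \o (fun y => ut (t, y) ^+ 2)),
      forall z, 0 <= z <= sg t -> v (t, z) - v (t, 0) = \int[leb]_(y in `[0, z]) flux t y &
      flux t (sg t) = - (v (t, sg t) * (a0 * sigma (v (t, sg t))))]}.
Proof.
have c1 : continuous (fun _ : R * R => 1 : R) by move=> p; exact: cvg_cst.
have [A1 _ _] := Fubini_Q csg (iM sut c1).
have [A2 _ _] := Fubini_Q csg (proj2 sut).
(* Rational end points, rational starting times and indices of plateaus: countably many null sets in
   all. *)
pose C (x : rat * rat * rat * nat) := [/\ 0 < (ratr x.1.1.1 : R), (ratr x.1.1.1 : R) < ratr x.1.1.2,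
   0 < (ratr x.1.2 : R), (ratr x.1.2 : R) < T & (ratr x.1.1.2 : R) <= sg (ratr x.1.2)].
have A3 : {ae leb, forall t, forall x : rat * rat * rat * nat, C x -> (ratr x.1.2 : R) < t < T ->
    \int[leb]_(y in `[ratr x.1.1.1, ratr x.1.1.2])
    (uz (t, y) * (dplat1 (ratr x.1.1.1) (ratr x.1.1.2) x.2 y - dplat2 (ratr x.1.1.1) (ratr x.1.1.2) x.2 y)
      + ut (t, y) * plat (ratr x.1.1.1) (ratr x.1.1.2) x.2 y) = 0}.
  apply: ae_countable => x; have [[h1 h2 h3 h4 h5]|nC] := pselect (C x); last by apply: aeW => t /nC.
  by apply: ae_mono (slice_plateau x.2 (ltW h1) h2 (ltW h3) (ltW h4) h5) => t h _; exact: h.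
apply: ae_mono (ae_and (ae_and (ae_and A1 A2) A3) (ae_and (ae_and (flux_at_0 eqs) (flux_at_s eqs)) (free_boundary eqs))).
move=> t [[[a1 a2] a3] [[f0 fs] fb]] tT.
have tT' : 0 <= t <= T by case/andP: tT => *; rewrite !ltW.
have tin : t \in `[0, T] by rewrite in_itv.
have i1 : leb.-integrable `[0, sg t] (EFin \o (fun y => ut (t, y))).
  have := a1 tT; have -> : (fun y => ut (t, y) * 1) = (fun y => ut (t, y)) by apply/funext => y; rewrite mulr1.
  by [].
have sgt : sg t = s t by exact: front_extE.
have [suzt fE] := W12_sqint (uz_slice reg tin) (ltW (s_gt0 reg tin)).
rewrite -sgt in suzt fE.
have iuz := sqint_itv_integrable suzt.
have [q0 tr0 e0] := f0 tin; have [qS trS eS] := fs tin; rewrite -sgt in tr0 trS.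
have kh (p q : rat) n : 0 < (ratr p : R) -> (ratr p : R) < ratr q -> (ratr q : R) < sg t ->
  \int[leb]_(y in `[ratr p, ratr q]) (uz (t, y) * (dplat1 (ratr p) (ratr q) n y - dplat2 (ratr p) (ratr q) n y)
     + ut (t, y) * plat (ratr p) (ratr q) n y) = 0.
  move=> p0 pq qs.
  (* By continuity of the front there is a rational time [r < t] at which [ratr q] is already inside
     the domain. *)
  have [d d0 hd] : exists2 d : R, 0 < d & forall x, `|t - x| < d -> ratr q < sg x.
    have /cvgrPdist_lt := @csg t; move/(_ (sg t - ratr q)); rewrite subr_gt0 => /(_ qs)[d /= d0 hd].
    by exists d => // x /hd /=; rewrite ltr_distlC; lra.
  have [r] : exists r : rat, ratr r \in `]Num.max 0 (t - d), t[.
    by apply: rat_in_itvoo; rewrite gt_max; case/andP: tT => -> _ /=; lra.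
  rewrite in_itv/= gt_max => /andP[/andP[r0 rd] rt].
  apply: (a3 (p, q, r, n)) => /=; last by rewrite rt; case/andP: tT.
  split => //=; first by case/andP: tT => _; exact: lt_trans.
  by apply: ltW; apply: hd; rewrite ger0_norm; lra.
have sg0 := front_ext_gt0 t.
have := primitive_of_traces sg0 iuz i1 kh (f := fun z => u (t, z)) _ tr0 trS.
case=> [z /andP[z0 zs]|hS hz]; first by rewrite fE.
have E0 : q0 = - (beta * (b t - gamma * v (t, 0))) by rewrite state_ext_0E// -e0 opprK.
split => //; first exact: (a2 tT).
  move=> z zs; rewrite [v (t, z)]state_extE -?sgt// state_ext_0E//.
  by rewrite hz// E0; apply: eq_Rintegral => y _.
by rewrite /flux -E0 -hS state_ext_frontE// -(fb tin) -eS opprK.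
Qed.

Let c1 : continuous (fun _ : R * R => 1 : R). Proof. by move=> p; exact: cvg_cst. Qed.
Let iut : leb2.-integrable (Q sg T) (EFin \o ut).
Proof.
have := iM sut c1; have -> : (fun p => ut p * 1) = ut by apply/funext => y; rewrite mulr1.
by [].
Qed.

Lemma rectangle_subset p q : 0 <= p -> p < q -> q <= T -> `]p, q[ `*` `]0, sg p[ `<=` Q sg T.
Proof.
move=> p0 pq qT [t y]; rewrite /Q/= !in_itv/= => -[/andP[pt tq] /andP[y0 ys]].
rewrite y0 (le_lt_trans p0 pt) (lt_le_trans tq qT); split => //=.
by apply: lt_le_trans ys _; apply: front_ext_homo => //; [exact: ltW|exact: le_trans (ltW tq) qT].
Qed.

Lemma integrable_rectangle k p q : 0 <= p -> p < q -> q <= T -> leb2.-integrable (Q sg T) (EFin \o k) ->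
  leb2.-integrable (`]p, q[%classic `*` `]0, sg p[%classic) (EFin \o k).
Proof.
move=> p0 pq qT ik; apply: (@integrableS _ _ R leb2 (Q sg T)) => //; first exact: measurableX.
exact: rectangle_subset.
Qed.

(** The plateau argument with the variables exchanged: plateaus in time on [[p, q]], arbitrary tests
    in space. For [y < sg p] the domain contains [(t, y)] for all [t] strictly between [p] and
    [q]. *)
Lemma time_increment p q : 0 <= p -> p < q -> q <= T ->
  {ae leb, forall y, 0 < y < sg p -> v (q, y) - v (p, y) = \int[leb]_(t in `[p, q]) ut (t, y)}.
Proof.
move=> p0 pq qT; have sp0 := ltW (front_ext_gt0 p).
have [_ _ B _ _] := Fubini_rect (integrable_rectangle p0 pq qT iut).
pose k n (x : R * R) := v x * (dplat1 p q n x.1 - dplat2 p q n x.1) + ut x * plat p q n x.1.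
have cp n : Cinf (plat p q n) by exact: Cinf_plat.
have sv : sqint leb2 (Q sg T) v by exact: sqint_continuous.
have ik n : leb2.-integrable (Q sg T) (EFin \o k n).
  exact: (iD (iM sv (cfst (@cdplat p q n))) (iM sut (cfst (Cinf_continuous (cp n))))).
have Z : {ae leb, forall y n, 0 < y < sg p -> \int[leb]_(t in `[p, q]) k n (t, y) = 0}.
  apply: ae_countable => n.
  have [_ _ A' B' _] := Fubini_rect (integrable_rectangle p0 pq qT (ik n)).
  pose kap y := \int[leb]_(t in `[p, q]) k n (t, y); have {}B' : leb.-integrable `[0, sg p] (EFin \o kap) by [].
  suff : {ae leb, forall y, y \in `[0, sg p] -> kap y = 0}.
    by apply: ae_mono => y h /andP[y0 ys]; apply: h; rewrite in_itv/= !ltW.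
  apply: du_bois_reymond => // eta ceta seta.
  pose phi (x : R * R) := plat p q n x.1 * eta x.2.
  have tphi : test_function (Q sg T) phi.
    apply: (test_function_product (cp n) ceta (plat_support n pq (lexx p) (lexx q)) seta).
    exact: rectangle_subset.
  pose ke x := k n x * eta x.2.
  have i1 := iM sv (continuous_product (@cdplat p q n) (Cinf_continuous ceta)).
  have i2 := iM sut (continuous_product (Cinf_continuous (cp n)) (Cinf_continuous ceta)).
  have keE : ke = (fun x => v x * ((dplat1 p q n x.1 - dplat2 p q n x.1) * eta x.2) + ut x * phi x).
    by apply/funext => x; rewrite /ke /k /phi; ring.
  have ike : leb2.-integrable (Q sg T) (EFin \o ke) by rewrite keE; exact: iD.
  have E1 : \int[leb2]_(x in Q sg T) ke x = 0.
    rewrite keE (@RintegralD _ _ R leb2 (Q sg T) _ _ mQ i1 i2).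
    apply/eqP; rewrite addr_eq0 -(time_weak_derivative tphi); apply/eqP.
    by apply: eq_Rintegral => x _; rewrite /phi (partial1_product _ (cp n) ceta (@is_derive_plat R p q n)).
  have [_ _ E2] := Fubini_Q csg ike.
  have [_ _ C' D' E3] := Fubini_rect (integrable_rectangle p0 pq qT ike).
  have [p' [q' [ap' qb' eta0]]] := seta.
  have e0 y : ~~ (0 <= y <= sg p) -> eta y = 0.
    move=> hy; apply: eta0; apply: contra hy => /andP[h1 h2].
    by rewrite (le_trans (ltW ap') h1) (le_trans h2 (ltW qb')).
  have E4 : \int[leb]_(t in `[0, T]) \int[leb]_(y in `[0, sg t]) ke (t, y) =
      \int[leb]_(t in `[p, q]) \int[leb]_(y in `[0, sg p]) ke (t, y).
    pose I t := \int[leb]_(y in `[0, sg t]) ke (t, y).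
    have I0 t : ~~ (p <= t <= q) -> I t = 0.
      move=> ht; rewrite /I (@eq_Rintegral _ _ _ _ _ (cst 0)); first by rewrite Rintegral_cst// mul0r.
      by move=> y _; rewrite /ke /k/= plat0// dplat0// !mulr0 addr0 mul0r.
    transitivity (\int[leb]_(t in `[p, q]) I t); first exact: Rintegral_supp.
    apply: eq_Rintegral => t; rewrite inE/= in_itv/= => /andP[pt tq].
    apply: Rintegral_supp => //; last by move=> y hy; rewrite /ke/= e0// mulr0.
    by apply: front_ext_homo => //; exact: le_trans tq qT.
  pose J y := \int[leb]_(t in `[p, q]) ke (t, y).
  have iJ : leb.-integrable `[0, sg p] (EFin \o J) by exact: D'.
  suff -> : \int[leb]_(y in `[0, sg p]) (kap y * eta y) = \int[leb]_(y in `[0, sg p]) J y.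
    by rewrite -[RHS]E1 E2 E4; exact: (esym E3).
  have iBe := integrable_itvMc B' (Cinf_continuous ceta).
  apply: (@ae_eq_Rintegral_oo R (fun y => kap y * eta y) J 0 (sg p) 0 (sg p) (lexx _) (lexx _) iBe iJ).
  apply: ae_mono A' => y hy; rewrite in_itv/= => /hy iy.
  by rewrite /J /ke /kap -RintegralZr.
apply: ae_mono (ae_and B Z) => y [hB hZ] ys; have iy := hB ys.
have cvy : continuous (fun t => v (t, y)) by exact: continuous_slice1.
apply: (@increment_of_plateaux R p q pq (fun t => v (t, y))) => // [|n].
  exact: continuous_subspaceT.
have := hZ n ys; rewrite /k/= RintegralD//.
- by move=> /eqP; rewrite addr_eq0 => /eqP.
- by apply: integrable_itvMc; [exact: integrable_continuous|exact: cdplat].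
- by apply: integrable_itvMc => //; exact/Cinf_continuous.
Qed.

End extension.

(** * Moments of a solution and their increments in time *)

Section hat.
Context {R : realType}.
Notation leb := (@lebesgue_measure R).

Definition hat (z y : R) : R := Num.max (z - y) 0.

Lemma hat_continuous z : continuous (hat z).
Proof.
move=> y; apply: (@continuous_max _ _ (fun y => z - y) (fun=> 0)); last exact: cvg_cst.
by apply: cvgB; [exact: cvg_cst|exact: cvg_id].
Qed.

Lemma hat_ge0 z y : 0 <= hat z y. Proof. by rewrite /hat le_max lexx orbT. Qed.

Lemma hat_dist z x y : `|hat z x - hat z y| <= `|x - y|.
Proof.
have le_hat a c : a <= c + `|x - y| -> Num.max a 0 <= Num.max c 0 + `|x - y|.
  move=> h; rewrite ge_max; apply/andP; split.
    by apply: le_trans h _; rewrite lerD2r le_max lexx.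
  by rewrite addr_ge0// le_max lexx orbT.
have := ler_norm (x - y); have := ler_norm (y - x); rewrite [`|y - x|]distrC => n1 n2.
by rewrite /hat ler_distl lerBlDr !le_hat//; lra.
Qed.

(* In the time derivative of [moment], the term due to the motion of the front
   cancels the flux [- u s_t]; what remains is [moment_rate]. *)
Definition moment (sg : R -> R) (v : R * R -> R) (t z : R) : R :=
  \int[leb]_(y in `[0, sg t]) (hat z y * v (t, y)).

Definition moment_rate (gamma beta : R) (b : R -> R) (v : R * R -> R) (z r : R) : R :=
  z * (beta * (b r - gamma * v (r, 0))) + (v (r, z) - v (r, 0)).

End hat.

Section moments.
Context {R : realType}.
Notation leb := (@lebesgue_measure R).
Notation leb2 := (@leb2 R).
Lemma ae_le_Rintegral_oo (f g : R -> R) (p q : R) :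
  leb.-integrable `[p, q] (EFin \o f) -> leb.-integrable `[p, q] (EFin \o g) ->
  {ae leb, forall x, p < x < q -> f x <= g x} ->
  \int[leb]_(x in `[p, q]) f x <= \int[leb]_(x in `[p, q]) g x.
Proof.
move=> i1 i2 fg.
have io (h : R -> R) : leb.-integrable `[p, q] (EFin \o h) -> leb.-integrable `]p, q[ (EFin \o h).
  by move=> ih; apply: integrableS ih => //; exact: subset_itv_oo_cc.
have mo (h : R -> R) : leb.-integrable `[p, q] (EFin \o h) -> measurable_fun `]p, q[%classic h.
  by move=> /io ih; have /measurable_EFinP := measurable_int _ ih.
rewrite -!Rintegral_oo_cc; [|exact: mo|exact: mo].
apply: (@ae_le_Rintegral _ _ R leb `]p, q[%classic f g (measurable_itv _) (io _ i1) (io _ i2)).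
by apply: ae_mono fg => x h; rewrite /= in_itv/= => /h.
Qed.

Variables (a0 gamma beta T : R) (b : R -> R) (s0 : R) (u0 s ds : R -> R) (u ut uz uzz : R * R -> R).
Hypotheses (T_gt0 : 0 < T) (a0_gt0 : 0 < a0).
Hypothesis reg : solution_regularity T s ds u ut uz uzz.
Hypothesis eqs : solution_equations a0 gamma beta T b s0 u0 s ds u ut uz uzz.
Hypothesis cb : {within `[0, T], continuous b}.

Notation sg := (front_ext s T).
Notation v := (state_ext s T u).
Notation G := (flux gamma beta T b s u ut).

Let csg : continuous sg. Proof. exact: (front_ext_continuous T_gt0 reg). Qed.
Let cv : continuous v. Proof. exact: (state_ext_continuous T_gt0 reg). Qed.
Let sg_gt0 t : 0 < sg t. Proof. exact: (front_ext_gt0 T_gt0 reg). Qed.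
Let mQ : measurable (Q sg T). Proof. exact: measurable_Q. Qed.
Let sut : sqint leb2 (Q sg T) ut.
Proof. by apply: sqint_of_Lfun => //; have := ut_L2 reg; rewrite /in_Lp2 Q_front_ext. Qed.

Let iut : leb2.-integrable (Q sg T) (EFin \o ut).
Proof.
have c1 : continuous (fun _ : R * R => 1 : R) by move=> p; exact: cvg_cst.
have := @sqintM _ _ R leb2 (Q sg T) mQ _ _ sut (sqint_continuous (ltW T_gt0) csg c1).
have -> : (fun p => ut p * 1) = ut by apply/funext => y; rewrite mulr1.
by [].
Qed.

(** The width is frozen at [sg p], so that the region is a rectangle inside the domain and Fubini
    applies. Integration by parts and [slice_flux] then turn [u_t] into the flux at [sg p] and
    values of [v]. At later times [sg p] lies behind the front; [moment_step] estimates the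
    difference. *)
Lemma rectangle_moment p q z : 0 <= p -> p < q -> q <= T -> 0 <= z ->
  let kap r := \int[leb]_(y in `[0, sg p]) (hat z y * ut (r, y)) in
  [/\ leb.-integrable `[p, q] (EFin \o kap),
      \int[leb]_(y in `[0, sg p]) (hat z y * (v (q, y) - v (p, y))) = \int[leb]_(r in `[p, q]) kap r &
      {ae leb, forall r, p < r < q -> kap r = hat z (sg p) * G r (sg p) +
        (z * (beta * (b r - gamma * v (r, 0))) + (v (r, Num.min z (sg p)) - v (r, 0)))}].
Proof.
move=> p0 pq qT z0 kap; have m0 := sg_gt0 p.
pose k (x : R * R) := hat z x.2 * ut x.
have ik : leb2.-integrable (Q sg T) (EFin \o k).
  apply: (@sqintM _ _ R leb2 (Q sg T) mQ _ _ _ sut); apply: sqint_continuous => //; first exact: ltW.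
  by move=> x; apply: (cvg_comp snd (hat z)); [exact: cvg_snd|exact: hat_continuous].
have irk := integrable_rectangle T_gt0 a0_gt0 reg eqs p0 pq qT ik.
have [_ B1 C1 D1 E1] := Fubini_rect irk.
split; first exact: B1.
  rewrite [RHS](_ : _ = \int[leb]_(y in `[0, sg p]) \int[leb]_(t in `[p, q]) k (t, y)); last exact: E1.
  pose J y := \int[leb]_(t in `[p, q]) k (t, y).
  have iJ : leb.-integrable `[0, sg p] (EFin \o J) by exact: D1.
  have ih : leb.-integrable `[0, sg p] (EFin \o (fun y => hat z y * (v (q, y) - v (p, y)))).
    apply: integrable_continuous => y; apply: cvgM; first exact: hat_continuous.
    by apply: cvgB; exact: (continuous_slice2 cv).
  apply: (@ae_eq_Rintegral_oo R _ J 0 (sg p) 0 (sg p) (lexx _) (lexx _) ih iJ).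
  have irut : leb2.-integrable (`]p, q[%classic `*` `]0, sg p[%classic) (EFin \o ut).
    exact: (integrable_rectangle T_gt0 a0_gt0 reg eqs p0 pq qT).
  have [_ _ C2 _ _] := Fubini_rect irut.
  apply: ae_mono (ae_and C2 (time_increment T_gt0 a0_gt0 reg eqs p0 pq qT)) => y [hi hy].
  by rewrite in_itv/= => ys; rewrite /J /k/= RintegralZl ?hy//; exact: hi.
have := slice_flux T_gt0 a0_gt0 reg eqs; apply: ae_mono => r hr /andP[pr rq].
have rT : 0 < r < T by rewrite (le_lt_trans p0 pr) (lt_le_trans rq qT).
have [iu _ hv _] := hr rT.
have ms : sg p <= sg r by apply: (front_ext_homo T_gt0 a0_gt0 reg eqs) => //; case/andP: rT => *; exact: ltW.
set mu := Num.min z (sg p); have mu0 : 0 <= mu by rewrite le_min z0 ltW.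
have mum : mu <= sg p by rewrite ge_min lexx orbT.
have ium : leb.-integrable `[0, sg p] (EFin \o (fun y => ut (r, y))) by exact: integrable_itvS iu.
have ihu : leb.-integrable `[0, sg p] (EFin \o (fun y => hat z y * ut (r, y))).
  have -> : (fun y => hat z y * ut (r, y)) = (fun y => ut (r, y) * hat z y) by apply/funext => y; rewrite mulrC.
  by apply: integrable_itvMc => //; exact: hat_continuous.
have Ginc x y : 0 <= x -> x <= y -> y <= sg r -> G r y - G r x = \int[leb]_(c in `[x, y]) ut (r, c).
  by move=> x0 xy ys; rewrite /flux -(primitive_increment iu x0 xy ys); ring.
have cG : {within `[0, sg p], continuous (G r)}.
  move=> y; apply: cvgD; [exact: cvg_cst|exact: (continuous_primitive ium)].
have s2 : \int[leb]_(y in `[mu, sg p]) (hat z y * ut (r, y)) = 0.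
  rewrite /mu; have [zm|zm] := leP z (sg p); last by rewrite Rintegral_point.
  rewrite (@eq_Rintegral _ _ _ _ _ (cst 0)); first by rewrite Rintegral_cst// mul0r.
  move=> y; rewrite inE/= in_itv/= => /andP[zy _].
  by rewrite /hat (max_idPr _) ?mul0r// subr_le0.
rewrite /kap (Rintegral_split mu0 mum ihu) s2 addr0.
have -> : \int[leb]_(y in `[0, mu]) (hat z y * ut (r, y)) = \int[leb]_(y in `[0, mu]) (ut (r, y) * (z - y)).
  apply: eq_Rintegral => y; rewrite inE/= in_itv/= => /andP[_ ymu]; rewrite /hat (max_idPl _) 1?mulrC// subr_ge0.
  by apply: le_trans ymu _; rewrite ge_min lexx.
have smu : (`[0, mu]%classic : set R) `<=` `[0, sg p]%classic.
  by move=> y /=; rewrite !in_itv/= => /andP[-> yq]; rewrite (le_trans yq mum).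
have mur := le_trans mum ms.
have D (y : R) : is_derive y 1 (fun y => z - y) (-1 : R).
  by have := is_deriveB (is_derive_cst z y 1) (is_derive_id y 1); rewrite sub0r.
have inc x y : 0 <= x -> x <= y -> y <= mu -> G r y - G r x = \int[leb]_(c in `[x, y]) ut (r, c).
  by move=> x0 xy ymu; apply: Ginc => //; exact: le_trans ymu mur.
have iumu : leb.-integrable `[0, mu] (EFin \o (fun y => ut (r, y))) by exact: integrable_itvS iu.
have cGmu : {within `[0, mu], continuous (G r)} by exact: continuous_subspaceW cG.
have c1 : continuous (fun _ : R => -1 : R) by move=> y; exact: cvg_cst.
rewrite (ac_by_parts mu0 iumu inc c1 D cGmu).
have -> : \int[leb]_(y in `[0, mu]) (G r y * -1) = - (v (r, mu) - v (r, 0)).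
  rewrite hv ?mu0// -[RHS]mulrN1 -RintegralZr//; exact: integrable_within.
have -> : G r mu * (z - mu) = hat z (sg p) * G r (sg p).
  rewrite /mu /hat; have [zm|zm] := leP z (sg p).
    by rewrite subrr mulr0 (max_idPr _) ?mul0r// subr_le0.
  by rewrite (max_idPl _) 1?mulrC// subr_ge0 ltW.
have -> : G r 0 = - (beta * (b r - gamma * v (r, 0))) by rewrite /flux Rintegral_point addr0.
by rewrite subr0; ring.
Qed.

Lemma state_bounded : exists2 B : R, 0 < B & forall t y, 0 <= t <= T -> 0 <= y -> `|v (t, y)| <= B.
Proof.
have [L L0 hL] := continuous_itv_bound (ltW T_gt0) (continuous_subspaceT csg).
have [B B0 hB] := @bounded_square R v (T + L) cv.
exists B => // t y tT y0; have tTL : 0 <= t <= T + L by case/andP: tT => -> h; rewrite (le_trans h)// lerDl.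
have sL : sg t <= T + L.
  by apply: le_trans (ler_norm _) _; apply: le_trans (hL t tT) _; rewrite lerDr ltW.
have [ys|ys] := leP y (sg t); first by apply: hB => //; rewrite y0 (le_trans ys).
by rewrite (state_ext_out T_gt0 reg (ltW ys)); apply: hB => //; rewrite sL ltW.
Qed.

Lemma front_lipschitz : exists2 C : R, 0 < C & forall p q, 0 <= p -> p <= q -> q <= T ->
  0 <= sg q - sg p <= C * (q - p).
Proof.
have [B B0 hB] := state_bounded; exists (a0 * B) => [|p q p0 pq qT]; first exact: mulr_gt0.
rewrite subr_ge0 (front_ext_homo T_gt0 a0_gt0 reg eqs)//=.
rewrite (front_ext_increment T_gt0 reg eqs)//; apply: le_trans (ler_norm _) _.
apply: Rintegral_itv_bound => //; first by apply: integrable_continuous; exact: (@front_speed_continuous R a0 T s ds u ut uz uzz T_gt0 reg).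
move=> r /andP[pr rq]; rewrite normrM gtr0_norm// ler_pM2l//.
have rT : 0 <= r <= T by rewrite (le_trans p0 pr) (le_trans rq qT).
apply: le_trans (hB r (sg r) rT (ltW (sg_gt0 r))); rewrite /sigma; case: ifP => // _.
by rewrite normr0.
Qed.

Notation bc := (b \o clamp 0 T).
Notation mom := (moment sg v).
Notation rate := (moment_rate gamma beta bc v).

Let cbc : continuous (b \o clamp 0 T). Proof. by apply: continuous_comp_clamp => //; exact: ltW. Qed.

Lemma moment_rate_continuous z : continuous (rate z).
Proof.
move=> r; apply: cvgD; last by apply: cvgB; exact: continuous_slice1.
apply: cvgMr; apply: cvgMr; apply: cvgB; first exact: cbc.
by apply: cvgMr; exact: continuous_slice1.
Qed.

Let Th r := \int[leb]_(y in `[0, sg r]) ut (r, y) ^+ 2.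
Let iTh : leb.-integrable `[0, T] (EFin \o Th).
Proof. by have [_ h _] := Fubini_Q csg (proj2 sut). Qed.

(** Young's inequality with a free weight, because [u_t] is controlled through its square. *)
Lemma le_weighted_abs (lam x : R) : 0 < lam -> `|x| <= (lam^-1 + lam * x ^+ 2) / 2.
Proof.
move=> l0; have l0' : lam != 0 by rewrite gt_eqF.
have : 0 <= lam * (`|x| - lam^-1) ^+ 2 by rewrite mulr_ge0 ?sqr_ge0// ltW.
have -> : lam * (`|x| - lam^-1) ^+ 2 = lam * x ^+ 2 - 2 * `|x| + lam^-1.
  by rewrite -[x ^+ 2]real_normK ?num_real//; field.
lra.
Qed.

Let phi r := v (r, sg r) * (a0 * sigma (v (r, sg r))).

(** Three replacements are made over a short interval: the flux at the old position of the front for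
    that at the moving front, the integrand at the front for that in the strip it sweeps, and the
    final value of [v] at the front for its earlier ones. The integral of [u_t^2] over a slice is
    only integrable in time, so it stays in the bound as the integral of [Th]. *)
Lemma moment_step (z e B C d p q : R) : 0 <= z -> 0 < e ->
  (forall t y, 0 <= t <= T -> 0 <= y -> `|v (t, y)| <= B) ->
  0 <= C -> (forall p q, 0 <= p -> p <= q -> q <= T -> 0 <= sg q - sg p <= C * (q - p)) ->
  (forall t y t' y', 0 <= t <= T -> 0 <= t' <= T -> 0 <= y <= sg t -> 0 <= y' <= sg t' ->
     `|t - t'| <= d -> `|y - y'| <= d -> `|v (t, y) - v (t', y')| <= e) ->
  0 <= p -> p < q -> q <= T -> q - p <= d -> C * (q - p) <= d ->
  forall lam : R, 0 < lam ->
  `|mom q z - mom p z - \int[leb]_(r in `[p, q]) rate z r| <=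
    (q - p) * (z * C * (q - p) / (2 * lam) + e + 2 * z * e * C + C ^+ 2 * B * (q - p))
     + z * lam / 2 * \int[leb]_(r in `[p, q]) Th r.
Proof.
move=> z0 e0 hB C0 hC hd p0 pq qT qpd Cqpd lam lam0.
have [ik E1 A] := rectangle_moment p0 pq qT z0.
set kap := (fun r : R => \int[leb]_(y in `[0, sg p]) (hat z y * ut (r, y))) in ik E1 A.
have pq' := ltW pq; have qp0 : 0 <= q - p by rewrite subr_ge0.
have q0 : 0 <= q by exact: le_trans pq'.
have qqT : 0 <= q <= T by rewrite q0.
have sp0 := ltW (sg_gt0 p); have sq0 := ltW (sg_gt0 q).
have /andP[D0 DC] := hC p q p0 pq' qT.
have spq : sg p <= sg q by rewrite -subr_ge0.
set vq := v (q, sg q); set hz := hat z (sg p).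
have hatz y : 0 <= y -> `|hat z y| <= z.
  by move=> y0; rewrite ger0_norm ?hat_ge0// /hat ge_max z0 lerBlDr lerDl y0.
have chv t : continuous (fun y => hat z y * v (t, y)).
  by move=> y; apply: cvgM; [exact: hat_continuous|exact: continuous_slice2].
pose S2 := \int[leb]_(y in `[sg p, sg q]) (hat z y * v (q, y)).
have dE : mom q z - mom p z = \int[leb]_(r in `[p, q]) kap r + S2.
  rewrite -E1 /moment (Rintegral_split sp0 spq) -/S2; last exact: integrable_continuous.
  rewrite addrAC; congr (_ + _).
  rewrite -RintegralB//; [|exact: integrable_continuous|exact: integrable_continuous].
  by apply: eq_Rintegral => y _; rewrite mulrBr.
have cphi1 : continuous (fun r => a0 * sigma (v (r, sg r))).
  exact: (@front_speed_continuous R a0 T s ds u ut uz uzz T_gt0 reg).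
have cfr : continuous (fun r => v (r, sg r)) by exact: (state_ext_front_continuous T_gt0 reg).
have cphi : continuous phi by move=> r; apply: cvgM; [exact: cfr|exact: cphi1].
have iphi : leb.-integrable `[p, q] (EFin \o phi) by exact: integrable_continuous.
have irate : leb.-integrable `[p, q] (EFin \o rate z).
  by apply: integrable_continuous; exact: moment_rate_continuous.
have iThpq : leb.-integrable `[p, q] (EFin \o Th) by exact: integrable_itvS iTh.
have rin r : p <= r <= q -> [/\ 0 <= r <= T, sg p <= sg r, sg r <= sg q, sg r - sg p <= d & sg q - sg r <= d].
  move=> /andP[pr rq]; have r0 := le_trans p0 pr; have rT := le_trans rq qT.
  have /andP[a1 a2] := hC p r p0 pr rT; have /andP[a3 a4] := hC r q r0 rq qT.
  move: a1 a3; rewrite !subr_ge0 r0 rT => a1 a3; split=> //.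
    by apply: le_trans a2 (le_trans _ Cqpd); rewrite ler_wpM2l// lerB.
  by apply: le_trans a4 (le_trans _ Cqpd); rewrite ler_wpM2l// lerB.
(* The fluxes at [sg p] and at the front differ by the integral of [u_t] over [[sg p, sg r]], whose
   length is at most [C (q - p)]; Young's inequality with weight [lam] bounds it. *)
have T1 : `|\int[leb]_(r in `[p, q]) kap r - \int[leb]_(r in `[p, q]) rate z r
    + hz * \int[leb]_(r in `[p, q]) phi r| <=
    (q - p) * (z * C * (q - p) / (2 * lam) + e) + z * lam / 2 * \int[leb]_(r in `[p, q]) Th r.
  pose f r := kap r - rate z r + hz * phi r.
  pose g r := (z * C * (q - p) / (2 * lam) + e) + z * lam / 2 * Th r.
  have i_f : leb.-integrable `[p, q] (EFin \o f).
    by apply: integrableRD => //; [exact: integrableRB|exact: integrableRZ].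
  have ic : leb.-integrable `[p, q] (EFin \o (fun=> z * C * (q - p) / (2 * lam) + e)).
    by apply: integrable_continuous => x; exact: cvg_cst.
  have iz : leb.-integrable `[p, q] (EFin \o (fun r => z * lam / 2 * Th r)) by exact: integrableRZ.
  have ig : leb.-integrable `[p, q] (EFin \o g) by exact: integrableRD.
  have -> : \int[leb]_(r in `[p, q]) kap r - \int[leb]_(r in `[p, q]) rate z r
    + hz * \int[leb]_(r in `[p, q]) phi r = \int[leb]_(r in `[p, q]) f r.
    rewrite -RintegralZl// -RintegralB// -RintegralD//; first exact: integrableRB.
    exact: integrableRZ.
  have -> : (q - p) * (z * C * (q - p) / (2 * lam) + e) + z * lam / 2 * \int[leb]_(r in `[p, q]) Th r
      = \int[leb]_(r in `[p, q]) g r.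
    by rewrite RintegralD// Rintegral_itv_cst// RintegralZl// [(q - p) * _]mulrC.
  apply: le_trans (le_normr_Rintegral _ i_f) _ => //.
  apply: ae_le_Rintegral_oo => //; first exact: (integrable_norm i_f).
  have := slice_flux T_gt0 a0_gt0 reg eqs => F.
  apply: ae_mono (ae_and A F) => r [hA hF] rpq.
  have [pr rq] := andP rpq.
  have [rT ms sm dm dm'] := rin r (introT andP (conj (ltW pr) (ltW rq))).
  have rT' : 0 < r < T by rewrite (le_lt_trans p0 pr) (lt_le_trans rq qT).
  have [iu iu2 hv hG] := hF rT'; have hA' : kap r = _ := hA rpq; rewrite /f hA' -/hz /moment_rate /= clamp_id//.
  set w := beta * (b r - gamma * v (r, 0)).
  have -> : hz * G r (sg p) + (z * w + (v (r, Num.min z (sg p)) - v (r, 0))) -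
     (z * w + (v (r, z) - v (r, 0))) + hz * phi r =
     hz * (G r (sg p) + phi r) + (v (r, Num.min z (sg p)) - v (r, z)) by ring.
  have Gphi : G r (sg p) + phi r = - \int[leb]_(y in `[sg p, sg r]) ut (r, y).
    rewrite -(primitive_increment iu sp0 ms (lexx _)).
    move: hG; rewrite -/(phi r) /flux.
    move: (\int[leb]_(y in `[0, sg r]) _) (\int[leb]_(y in `[0, sg p]) _) (phi r) (v (r, 0)) (b r) => x1 x2 x3 x4 x5.
    move=> hG'; have -> : x3 = beta * (x5 - gamma * x4) - x1 by rewrite -[x3]opprK -hG' opprD opprK.
    ring.
  have iu' : leb.-integrable `[sg p, sg r] (EFin \o (fun y => ut (r, y))) by exact: integrable_itvS iu.
  have iu2' : leb.-integrable `[sg p, sg r] (EFin \o (fun y => ut (r, y) ^+ 2)) by exact: integrable_itvS iu2.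
  have icl : leb.-integrable `[sg p, sg r] (EFin \o (fun=> lam^-1)).
    by apply: integrable_continuous => x; exact: cvg_cst.
  have izl : leb.-integrable `[sg p, sg r] (EFin \o (fun y => lam * ut (r, y) ^+ 2)) by exact: integrableRZ.
  have bG : `|G r (sg p) + phi r| <= C * (q - p) / (2 * lam) + lam / 2 * Th r.
    rewrite Gphi normrN; apply: le_trans (le_normr_Rintegral _ iu') _ => //.
    apply: (@le_trans _ _ (\int[leb]_(y in `[sg p, sg r]) (2^-1 * (lam^-1 + lam * ut (r, y) ^+ 2)))).
      apply: le_Rintegral => //; first exact: (integrable_norm iu').
        by apply: integrableRZ => //; exact: integrableRD.
      by move=> y _; rewrite [leRHS]mulrC; exact: le_weighted_abs.
    rewrite RintegralZl//; last exact: integrableRD.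
    rewrite RintegralD// Rintegral_itv_cst// RintegralZl//.
    have h1 : \int[leb]_(y in `[sg p, sg r]) ut (r, y) ^+ 2 <= Th r.
      rewrite /Th [leRHS](Rintegral_split sp0 ms)// lerDr.
      by apply: Rintegral_itv_ge0 => y _; exact: sqr_ge0.
    have h2 : sg r - sg p <= C * (q - p).
      have /andP[_ h] := hC p r p0 (ltW pr) (ltW (proj2 (andP rT'))).
      by apply: le_trans h _; rewrite ler_wpM2l// lerB// ltW.
    have h3 : lam^-1 * (sg r - sg p) <= lam^-1 * (C * (q - p)) by rewrite ler_wpM2l// invr_ge0 ltW.
    have h4 : lam * \int[leb]_(y in `[sg p, sg r]) ut (r, y) ^+ 2 <= lam * Th r by rewrite ler_wpM2l// ltW.
    have -> : C * (q - p) / (2 * lam) = 2^-1 * (lam^-1 * (C * (q - p))) by rewrite invfM; ring.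
    have -> : lam / 2 * Th r = 2^-1 * (lam * Th r) by ring.
    by rewrite mulrDr lerD// ler_wpM2l// invr_ge0.
  have bv : `|v (r, Num.min z (sg p)) - v (r, z)| <= e.
    have -> : v (r, z) = v (r, Num.min z (sg r)).
      by have [//|zr] := leP z (sg r); rewrite (state_ext_out T_gt0 reg (ltW zr)).
    apply: hd => //.
    - by rewrite le_min z0 sp0/= ge_min ms orbT.
    - by rewrite le_min z0 (ltW (sg_gt0 r))/= ge_min lexx orbT.
    - by rewrite subrr normr0 (le_trans qp0).
    - have [h1|h1] := leP z (sg p).
        by rewrite (min_idPl (le_trans h1 ms)) subrr normr0 (le_trans qp0).
      have h2 : sg p <= Num.min z (sg r) by rewrite le_min (ltW h1).
      rewrite distrC ger0_norm ?subr_ge0//; apply: le_trans dm; rewrite lerB//.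
      by rewrite ge_min lexx orbT.
  have -> : g r = (z * C * (q - p) / (2 * lam) + z * lam / 2 * Th r) + e by rewrite /g; ring.
  apply: le_trans (ler_normD _ _) _; apply: lerD => //.
  rewrite normrM; apply: (@le_trans _ _ (z * `|G r (sg p) + phi r|)).
    by rewrite ler_wpM2r// hatz.
  apply: (@le_trans _ _ (z * (C * (q - p) / (2 * lam) + lam / 2 * Th r))); first by rewrite ler_wpM2l.
  by rewrite le_eqVlt; apply/orP; left; apply/eqP; ring.
(* The strip swept by the front contributes its width times the integrand at the front, up to a
   small error. *)
have T2 : `|S2 - hz * (vq * (sg q - sg p))| <= (z * e + C * (q - p) * B) * (C * (q - p)).
  pose f y := hat z y * v (q, y) - hz * vq.
  have cf : continuous f by move=> y; apply: cvgB; [exact: chv|exact: cvg_cst].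
  have -> : S2 - hz * (vq * (sg q - sg p)) = \int[leb]_(y in `[sg p, sg q]) f y.
    rewrite RintegralB//; [|exact: integrable_continuous|by apply: integrable_continuous => x; exact: cvg_cst].
    by rewrite Rintegral_itv_cst// mulrA.
  have B0 : 0 <= B by exact: le_trans (hB q 0 qqT (lexx _)).
  apply: (@le_trans _ _ ((z * e + C * (q - p) * B) * (sg q - sg p))); last first.
    by rewrite ler_wpM2l// addr_ge0// ?mulr_ge0// ltW.
  apply: Rintegral_itv_bound => //; first exact: integrable_continuous.
  move=> y /andP[py yq]; have y0 := le_trans sp0 py.
  have -> : f y = hat z y * (v (q, y) - vq) + (hat z y - hz) * vq by rewrite /f; ring.
  apply: le_trans (ler_normD _ _) _; rewrite !normrM; apply: lerD; apply: ler_pM => //; try exact: hatz.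
  - apply: hd => //; rewrite ?y0 ?sq0 ?lexx//.
      by rewrite subrr normr0 (le_trans qp0).
    by rewrite distrC ger0_norm ?subr_ge0//; apply: le_trans (le_trans DC Cqpd); rewrite lerB.
  - apply: le_trans (hat_dist _ _ _) _; rewrite ger0_norm ?subr_ge0//.
    by apply: le_trans DC; rewrite lerB.
  - exact: hB.
(* The flux through the front is [v] times the front speed, so it integrates to nearly [vq] times
   the advance. This cancels the contribution of the strip. *)
have T3 : `|hz * (\int[leb]_(r in `[p, q]) phi r - vq * (sg q - sg p))| <= z * (e * (C * (q - p))).
  rewrite normrM; apply: ler_pM => //; first exact: hatz.
  rewrite (front_ext_increment T_gt0 reg eqs)// -RintegralZl//; last exact: integrable_continuous.
  pose f r := phi r - vq * (a0 * sigma (v (r, sg r))).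
  have cf : continuous f by move=> y; apply: cvgB; [exact: cphi|apply: cvgMr; exact: cphi1].
  rewrite -RintegralB//; last by apply: integrable_continuous => x; apply: cvgMr; exact: cphi1.
  have i_f : leb.-integrable `[p, q] (EFin \o f) by exact: integrable_continuous.
  apply: le_trans (le_normr_Rintegral _ i_f) _ => //.
  apply: (@le_trans _ _ (\int[leb]_(r in `[p, q]) (e * (a0 * sigma (v (r, sg r)))))).
    apply: le_Rintegral => //; first exact: (integrable_norm i_f).
      by apply: integrable_continuous => x; apply: cvgMr; exact: cphi1.
    move=> r; rewrite /= in_itv/= => rpq; have [rT ms sm dm dm'] := rin r rpq.
    have g0 : 0 <= a0 * sigma (v (r, sg r)).
      by rewrite mulr_ge0//; [exact: ltW|rewrite /sigma; case: ifP].
    rewrite /f /phi -mulrBl normrM [`|_ * sigma _|]ger0_norm// ler_wpM2r//; apply: hd => //.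
    + by rewrite ltW//= .
    + by rewrite sq0 lexx.
    + have /andP[pr rq] := rpq; rewrite distrC ger0_norm ?subr_ge0//; apply: le_trans qpd; exact: lerB.
    + by rewrite distrC ger0_norm ?subr_ge0.
  rewrite RintegralZl//; last exact: integrable_continuous.
  by rewrite -(front_ext_increment T_gt0 reg eqs)// ler_wpM2l// ltW.
rewrite dE; move: T1 T2 T3.
set i1 := \int[leb]_(r in `[p, q]) kap r; set i2 := \int[leb]_(r in `[p, q]) rate z r.
set i3 := \int[leb]_(r in `[p, q]) phi r; set i4 := \int[leb]_(r in `[p, q]) Th r => T1 T2 T3.
have -> : i1 + S2 - i2 = (i1 - i2 + hz * i3) + (S2 - hz * (vq * (sg q - sg p)))
   - hz * (i3 - vq * (sg q - sg p)) by ring.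
apply: le_trans (ler_normB _ _) _; apply: le_trans (lerD (le_trans (ler_normD _ _) (lerD T1 T2)) T3) _.
by rewrite le_eqVlt; apply/orP; left; apply/eqP; ring.
Qed.

Lemma moment_identity p q z : 0 <= p -> p <= q -> q <= T -> 0 <= z ->
  mom q z - mom p z = \int[leb]_(r in `[p, q]) rate z r.
Proof.
move=> p0 pq qT z0.
have irate x y : leb.-integrable `[x, y] (EFin \o rate z).
  by apply: integrable_continuous; exact: moment_rate_continuous.
pose I t := \int[leb]_(r in `[0, t]) rate z r; pose H t := mom t z - I t.
have IE x y : 0 <= x -> x <= y -> y <= T -> \int[leb]_(r in `[x, y]) rate z r = I y - I x.
  by move=> x0 xy yT; rewrite -(primitive_increment (irate 0 T) x0 xy yT).
rewrite IE//; suff : H q = H p by rewrite /H; lra.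
(* The errors of [moment_step] are of two kinds, small multiples of [q - p] and small multiples of
   the integral of [Th]; [V] collects both. *)
pose V t := t + \int[leb]_(r in `[0, t]) Th r.
apply: (@eq_of_increments R H V) => // e e0.
have [B B0 hB] := state_bounded; have [C C0 hC] := front_lipschitz.
have [L L0 hL] := continuous_itv_bound (ltW T_gt0) (continuous_subspaceT csg).
have k1 : 0 < 1 + 2 * z * C by rewrite ltr_pwDl// !mulr_ge0// ltW.
pose e1 := e / 4 / (1 + 2 * z * C); have e10 : 0 < e1 by rewrite !divr_gt0.
(* [lam] is fixed first and makes [z lam <= e]; the length of the interval is then chosen small in
   terms of [1 / lam]. *)
pose lam := e / (z + 1); have lam0 : 0 < lam by rewrite divr_gt0// ltr_wpDl.
have [d1 d10 hd1] := @unif_continuous_square R v (T + L) e1 cv e10.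
pose k2 := z * C / (2 * lam) + C ^+ 2 * B + 1.
have k20 : 0 < k2.
  have h1 : 0 <= z * C / (2 * lam) by rewrite divr_ge0// mulr_ge0// ltW.
  have h2 : 0 <= C ^+ 2 * B by rewrite mulr_ge0 ?sqr_ge0// ltW.
  rewrite /k2; lra.
pose d := Num.min d1 (Num.min (d1 / C) (e / 4 / k2)).
exists d => [|x y px xy yq]; first by rewrite !lt_min d10 !divr_gt0.
rewrite !le_min => /andP[xy1 /andP[xy2 xy3]].
have x0 : 0 <= x by exact: le_trans px.
have yT : y <= T by exact: le_trans qT.
have HE : H y - H x = mom y z - mom x z - \int[leb]_(r in `[x, y]) rate z r.
  by rewrite IE// /H; ring.
have VE : V y - V x = (y - x) + \int[leb]_(r in `[x, y]) Th r.
  by rewrite -(primitive_increment iTh x0 xy yT) /V; ring.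
have Th0 : 0 <= \int[leb]_(r in `[x, y]) Th r.
  by apply: Rintegral_itv_ge0 => r _; apply: Rintegral_itv_ge0 => w _; exact: sqr_ge0.
have [xyE|xyN] := eqVneq x y.
  by rewrite -xyE !subrr normr0 mulr0.
have xy' : x < y by rewrite lt_neqAle xyN.
rewrite HE VE; have in1 t : 0 <= t <= T -> 0 <= t <= T + L.
  by case/andP => -> h; rewrite (le_trans h)// lerDl.
have in2 t w : 0 <= t <= T -> 0 <= w <= sg t -> 0 <= w <= T + L.
  move=> tT /andP[-> h]; apply: le_trans h _; apply: le_trans (ler_norm _) _.
  by apply: le_trans (hL t tT) _; rewrite lerDr ltW.
have := @moment_step z e1 B C d1 x y z0 e10 hB (ltW C0) hC _ x0 xy' yT xy1 _ lam lam0.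
have H1 : forall t y t' y', 0 <= t <= T -> 0 <= t' <= T -> 0 <= y <= sg t -> 0 <= y' <= sg t' ->
     `|t - t'| <= d1 -> `|y - y'| <= d1 -> `|v (t, y) - v (t', y')| <= e1.
  by move=> t w t' w' tT tT' ws ws' tt ww; apply: hd1 => //;
    [exact: in1|exact: (in2 t)|exact: in1|exact: (in2 t')].
have H2 : C * (y - x) <= d1 by rewrite mulrC -ler_pdivlMr.
move/(_ H1 H2) => H3; apply: le_trans H3 _; rewrite mulrDr addrC.
apply: (@le_trans _ _ (e * (\int[leb]_(r in `[x, y]) Th r) + (y - x) * (e / 2))).
  apply: lerD.
    apply: ler_wpM2r => //; have : z * lam <= e by rewrite /lam mulrA ler_pdivrMr ?ltr_wpDl//; lra.
    lra.
  rewrite -mulrDr; apply: ler_wpM2l; first by rewrite subr_ge0.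
  have E1 : e1 * (1 + 2 * z * C) = e / 4 by rewrite /e1 divfK// gt_eqF.
  have E2 : (y - x) * k2 <= e / 4 by rewrite -ler_pdivlMr.
  have xy0 : 0 <= y - x by rewrite subr_ge0.
  move: E1 E2 xy0; rewrite /k2; set w := (2 * lam)^-1; lra.
rewrite [leRHS]mulrDr [leRHS]addrC lerD2l [leLHS]mulrC ler_wpM2r ?subr_ge0//; lra.
Qed.

End moments.

(** * Tails of an integral *)

Section tails.
Context {R : realType}.
Notation leb := (@lebesgue_measure R).
Implicit Types (s L B x y z : R) (f h : R -> R).

Definition cut s f y : R := if y < s then f y else 0.

(** The integral of [f] over [[z, s]], written as a difference of primitives up to a bound [L] of
    the front so that it also makes sense, and vanishes, for [z] between [s] and [L]. *)
Definition tail s f L z : R := \int[leb]_(y in `[0, L]) cut s f y - \int[leb]_(y in `[0, z]) cut s f y.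

Lemma cut_bound s f B y : (forall x, 0 <= x -> `|f x| <= B) -> 0 <= y -> `|cut s f y| <= B.
Proof.
move=> fB y0; rewrite /cut; case: ifP => _; first exact: fB.
by rewrite normr0 (le_trans _ (fB 0 (lexx _))).
Qed.

Lemma measurable_cut s f : continuous f -> measurable_fun setT (cut s f).
Proof.
move=> cf; apply: measurable_fun_if => //.
- exact: measurable_fun_ltr.
- by apply: measurable_funTS; exact: continuous_measurable_fun.
Qed.

Lemma integrable_cut s f a b : continuous f -> leb.-integrable `[a, b] (EFin \o cut s f).
Proof.
move=> cf; have cn : continuous (fun y => `|f y|).
  by move=> y; apply: (cvg_comp f (fun x => `|x|)); [exact: cf|exact: norm_continuous].
have mc : measurable_fun `[a, b]%classic (cut s f) by apply: measurable_funTS; exact: measurable_cut.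
apply: (@integrable_le _ _ R leb `[a, b]%classic (cut s f) (fun y => `|f y|)) => //; last exact: integrable_continuous.
by move=> y _; rewrite /cut; case: ifP => // _; rewrite normr0.
Qed.

Lemma integrable_cutM s f h a b : continuous f -> continuous h ->
  leb.-integrable `[a, b] (EFin \o (fun y => h y * cut s f y)).
Proof.
move=> cf ch; have -> : (fun y => h y * cut s f y) = (fun y => cut s f y * h y) by apply/funext => y; rewrite mulrC.
by apply: integrable_itvMc => //; exact: integrable_cut.
Qed.

Lemma Rintegral_cut s f h x L : x <= s -> s <= L -> continuous f -> continuous h ->
  \int[leb]_(y in `[x, L]) (h y * cut s f y) = \int[leb]_(y in `[x, s]) (h y * f y).
Proof.
move=> xs sL cf ch; rewrite (Rintegral_split xs sL); last exact: integrable_cutM.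
rewrite [X in _ + X](@eq_Rintegral _ _ _ _ _ (cst 0)); last first.
  by move=> y; rewrite inE/= in_itv/= /cut => /andP[sy _]; rewrite ltNge sy mulr0.
rewrite Rintegral_cst// mul0r addr0.
apply: (@ae_eq_Rintegral_oo _ _ _ x s) => //; first exact: integrable_cutM.
  by apply: integrable_continuous => y; apply: cvgM; [exact: ch|exact: cf].
by apply: aeW => y; rewrite in_itv/= /cut => /andP[_ ->].
Qed.

Lemma Rintegral_cut1 s f x L : x <= s -> s <= L -> continuous f ->
  \int[leb]_(y in `[x, L]) cut s f y = \int[leb]_(y in `[x, s]) f y.
Proof.
move=> xs sL cf; have c1 : continuous (fun _ : R => 1 : R) by move=> y; exact: cvg_cst.
have := @Rintegral_cut s f (fun=> 1) x L xs sL cf c1.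
have E (k : R -> R) : (fun y => 1 * k y) = k by apply/funext => y; rewrite mul1r.
by rewrite !E.
Qed.

Lemma tail_increment s f L x y : continuous f -> 0 <= x -> x <= y -> y <= L ->
  tail s f L y - tail s f L x = \int[leb]_(c in `[x, y]) (- cut s f c).
Proof.
move=> cf x0 xy yL; have i1 a b := @integrable_cut s f a b cf.
have -> : (fun c => - cut s f c) = (fun c => -1 * cut s f c) by apply/funext => c; rewrite mulN1r.
by rewrite RintegralZl// -(primitive_increment (i1 0 L) x0 xy yL) /tail; ring.
Qed.

Lemma tail_continuous s f L : continuous f -> {within `[0, L], continuous (tail s f L)}.
Proof.
move=> cf x; apply: cvgB; first exact: cvg_cst.
exact: (continuous_primitive (@integrable_cut s f 0 L cf)).
Qed.

Lemma tail_end s f L : tail s f L L = 0. Proof. exact: subrr. Qed.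

Lemma tail_start s f L : tail s f L 0 = \int[leb]_(y in `[0, L]) cut s f y.
Proof. by rewrite /tail Rintegral_point subr0. Qed.

Lemma tailE s f L z : continuous f -> 0 <= z -> z <= s -> s <= L ->
  tail s f L z = \int[leb]_(y in `[z, s]) f y.
Proof.
move=> cf z0 zs sL; rewrite /tail.
by rewrite (primitive_increment (@integrable_cut s f 0 L cf) z0 (le_trans zs sL) (lexx _)) Rintegral_cut1.
Qed.

Lemma tail_out s f L z : continuous f -> 0 <= s -> s <= z -> z <= L -> tail s f L z = 0.
Proof.
move=> cf s0 sz zL; rewrite /tail.
rewrite (primitive_increment (@integrable_cut s f 0 L cf) (le_trans s0 sz) zL (lexx _)).
rewrite (@eq_Rintegral _ _ _ _ _ (cst 0)); first by rewrite Rintegral_cst// mul0r.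
by move=> y; rewrite inE/= in_itv/= /cut => /andP[zy _]; rewrite ltNge (le_trans sz zy).
Qed.

Lemma tail_bound s f L B z : continuous f -> (forall x, 0 <= x -> `|f x| <= B) ->
  0 <= z -> z <= L -> `|tail s f L z| <= B * L.
Proof.
move=> cf fB z0 zL; have B0 : 0 <= B by exact: le_trans (fB 0 (lexx _)).
rewrite /tail (primitive_increment (@integrable_cut s f 0 L cf) z0 zL (lexx _)).
apply: le_trans (Rintegral_itv_bound zL (@integrable_cut s f z L cf) (M := B) _) _.
  by move=> x /andP[zx _]; apply: cut_bound => //; exact: le_trans zx.
by rewrite ler_wpM2l// gerBl.
Qed.

(** Integration by parts: the hat has slope -1 up to [z], and the tail is a primitive of minus the
    cut function. *)
Lemma hat_moment s f L z : continuous f -> 0 <= s -> s <= L -> 0 <= z -> z <= L ->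
  \int[leb]_(y in `[0, s]) (hat z y * f y) =
  z * tail s f L 0 - \int[leb]_(y in `[0, z]) tail s f L y.
Proof.
move=> cf s0 sL z0 zL; have i1 a b := @integrable_cut s f a b cf.
rewrite -(Rintegral_cut s0 sL cf (@hat_continuous R z)).
rewrite (Rintegral_split z0 zL); last by apply: integrable_cutM => //; exact: hat_continuous.
rewrite [X in _ + X](@eq_Rintegral _ _ _ _ _ (cst 0)); last first.
  by move=> y; rewrite inE/= in_itv/= => /andP[zy _]; rewrite /hat (max_idPr _) ?mul0r// subr_le0.
rewrite Rintegral_cst// mul0r addr0.
have -> : \int[leb]_(y in `[0, z]) (hat z y * cut s f y) = \int[leb]_(y in `[0, z]) (- cut s f y * (y - z)).
  apply: eq_Rintegral => y; rewrite inE/= in_itv/= => /andP[_ yz].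
  by rewrite /hat (max_idPl _) ?subr_ge0//; ring.
have D (y : R) : is_derive y 1 (fun y => y - z) (1 : R).
  by have := is_deriveB (is_derive_id y 1) (is_derive_cst z y 1); rewrite subr0.
have c1 : continuous (fun _ : R => 1 : R) by move=> y; exact: cvg_cst.
have ct : {within `[0, z], continuous (tail s f L)}.
  apply: continuous_subspaceW (@tail_continuous s f L cf) => y /=; rewrite !in_itv/= => /andP[-> yz].
  exact: le_trans zL.
have iN : leb.-integrable `[0, z] (EFin \o (fun y => - cut s f y)).
  have -> : (fun y => - cut s f y) = (fun y => -1 * cut s f y) by apply/funext => y; rewrite mulN1r.
  exact: integrableRZ.
rewrite (@ac_by_parts R (tail s f L) (fun y => - cut s f y) _ _ 0 z z0 iN _ c1 D ct); last first.
  by move=> x y x0 xy yz; rewrite tail_increment//; exact: le_trans zL.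
have -> : (fun x => tail s f L x * 1) = tail s f L by apply/funext => x; rewrite mulr1.
ring.
Qed.

(** A negative value at [s] would persist slightly to the left of [s] and make the tail negative
    there. *)
Lemma trace_ge0 s f L : continuous f -> 0 < s -> s <= L ->
  (forall z, 0 <= z <= L -> 0 <= tail s f L z) -> 0 <= f s.
Proof.
move=> cf s0 sL h; rewrite leNgt; apply/negP => fs.
have fs2 : 0 < - f s / 2 by rewrite divr_gt0// oppr_gt0.
have /cvgrPdist_lt /(_ _ fs2)[d /= d0 hd] : f z @[z --> s] --> f s by exact: cf.
pose z := Num.max 0 (s - d / 2).
have d20 : 0 < d / 2 by rewrite divr_gt0.
have z0 : 0 <= z by rewrite /z le_max lexx.
have zs : z < s by rewrite /z gt_max s0 gtrBl.
have zd : s - d / 2 <= z by rewrite /z le_max lexx orbT.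
have : 0 <= tail s f L z by apply: h; rewrite z0 (le_trans (ltW zs)).
rewrite tailE// ?(ltW zs)// leNgt => /negP; apply.
apply: (@le_lt_trans _ _ (\int[leb]_(y in `[z, s]) (f s / 2))); last first.
  by rewrite Rintegral_itv_cst ?ltW// nmulr_rlt0 ?subr_gt0//; lra.
apply: le_Rintegral => //; [exact: integrable_continuous|by apply: integrable_continuous => x; exact: cvg_cst|].
move=> y; rewrite /= in_itv/= => /andP[zy ys].
have : `|f s - f y| < - f s / 2.
  by apply: hd => /=; rewrite ger0_norm ?subr_ge0//; lra.
by rewrite ltr_distlC; lra.
Qed.

Lemma tail_inj s f g L : continuous f -> continuous g -> 0 < s -> s <= L ->
  (forall z, 0 <= z <= L -> tail s f L z = tail s g L z) -> forall y, 0 <= y <= s -> f y = g y.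
Proof.
move=> cf cg s0 sL h y ys; apply/eqP; rewrite -subr_eq0; apply/eqP.
have cfg : continuous (fun y => f y - g y) by move=> x; apply: cvgB; [exact: cf|exact: cg].
apply: (@zero_of_primitive R (fun y => f y - g y) s) => //; first exact: continuous_subspaceT.
move=> x /andP[x0 xs]; have zL : 0 <= x <= L by rewrite ltW//= (le_trans (ltW xs)).
rewrite RintegralB//; [|exact: integrable_continuous|exact: integrable_continuous].
have E k : continuous k -> \int[leb]_(t in `[0, x]) k t = tail s k L 0 - tail s k L x.
  move=> ck; rewrite !tailE ?(ltW x0) ?(ltW xs) ?(ltW s0)//; apply/eqP; rewrite eq_sym subr_eq; apply/eqP.
  by apply: Rintegral_split; [exact: ltW|exact: ltW|exact: integrable_continuous].
by rewrite !E// !h// ?lexx ?(le_trans (ltW s0) sL)// subrr.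
Qed.

End tails.

(** * Uniqueness *)

Section negative_part.
Context {R : realType}.
Implicit Types x y : R.

Definition neg x := Num.max (- x) 0.

Lemma neg_continuous : continuous neg.
Proof.
move=> x; apply: (@continuous_max _ _ (fun x => - x) (fun=> 0)); last exact: cvg_cst.
by apply: cvgN; exact: cvg_id.
Qed.

Lemma neg_ge0 x : 0 <= neg x. Proof. by rewrite /neg le_max lexx orbT. Qed.

Lemma neg_le_norm x : neg x <= `|x|.
Proof. by rewrite /neg ge_max normr_ge0 -normrN ler_norm. Qed.

Lemma negE x : (0 <= x /\ neg x = 0) \/ (x <= 0 /\ neg x = - x).
Proof.
have [x0|x0] := leP 0 x; first by left; rewrite /neg (max_idPr _)// oppr_le0.
by right; rewrite /neg (max_idPl _)// ?oppr_ge0 ltW.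
Qed.

(** Convexity of [(x^-)^3 / 3], whose derivative is [- (x^-)^2]. This inequality between finite
    increments takes the place of a derivative of the energy in time. *)
Lemma neg_cube_convex x y : neg x ^+ 3 / 3 - neg y ^+ 3 / 3 <= - neg x ^+ 2 * (x - y).
Proof.
have [[x0 ->]|[x0 xE]] := negE x.
  rewrite !expr0n/= oppr0 !mul0r sub0r oppr_le0; apply: divr_ge0 => //.
  by rewrite exprn_ge0// neg_ge0.
have y0 := neg_ge0 y; have yn : - y <= neg y by rewrite /neg le_max lexx.
have x0' := neg_ge0 x; rewrite xE in x0'; rewrite xE.
have : 0 <= (neg y + x) ^+ 2 * (neg y - 2 * x) by rewrite mulr_ge0 ?sqr_ge0//; lra.
have : 0 <= x ^+ 2 * (neg y + y) by rewrite mulr_ge0 ?sqr_ge0//; lra.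
set n := neg y; move=> h1 h2.
have -> : (- x) ^+ 3 / 3 - n ^+ 3 / 3 = - (x ^+ 3 + n ^+ 3) / 3 by rewrite !exprS expr0; ring.
have -> : - (- x) ^+ 2 * (x - y) = - x ^+ 2 * (x - y) by rewrite sqrrN.
move: h1 h2; rewrite !exprS expr0; lra.
Qed.

(** The remainder bound that [ac_comp] asks for. *)
Lemma neg_sqr_expansion x y : `|neg x ^+ 2 - neg y ^+ 2 - (-2 * neg y) * (x - y)| <= (x - y) ^+ 2.
Proof.
have [[x0 ->]|[x0 ->]] := negE x; have [[y0 ->]|[y0 ->]] := negE y.
- by rewrite expr0n/= mulr0 mul0r !subr0 normr0 sqr_ge0.
- have -> : 0 ^+ 2 - (- y) ^+ 2 - -2 * - y * (x - y) = y ^+ 2 - 2 * (x * y) by ring.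
  have xy : x * y <= 0 by rewrite mulr_ge0_le0.
  rewrite ger0_norm; last by have := sqr_ge0 y; lra.
  by have := sqr_ge0 x; rewrite !expr2; lra.
- rewrite expr0n/= mulr0 mul0r !subr0 sqrrN ger0_norm ?sqr_ge0//.
  have xy : x * y <= 0 by rewrite mulr_le0_ge0.
  by have := sqr_ge0 y; rewrite !expr2; lra.
- have -> : (- x) ^+ 2 - (- y) ^+ 2 - -2 * - y * (x - y) = (x - y) ^+ 2 by ring.
  by rewrite ger0_norm// sqr_ge0.
Qed.

End negative_part.

(** What uniqueness uses of a continuously extended solution. [L], [B] and [C] bound the front, the
    state and the front speed, and are parameters so that two solutions can share them. *)
Record trajectory (R : realType) (a0 gamma beta T L B C : R) (b : R -> R)
    (sg : R -> R) (v : R * R -> R) : Prop := Trajectory {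
  tr_front_continuous : continuous sg;
  tr_continuous : continuous v;
  tr_front_gt0 : forall t, 0 < sg t;
  tr_front_le : forall t, 0 <= t <= T -> sg t <= L;
  tr_front_lipschitz : forall p q, 0 <= p -> p <= q -> q <= T -> 0 <= sg q - sg p <= C * (q - p);
  tr_front : forall p q, 0 <= p -> p <= q -> q <= T ->
    sg q - sg p = \int[lebesgue_measure]_(r in `[p, q]) (a0 * sigma (v (r, sg r)));
  tr_out : forall t y, sg t <= y -> v (t, y) = v (t, sg t);
  tr_bound : forall t y, 0 <= t <= T -> 0 <= y -> `|v (t, y)| <= B;
  tr_moment : forall p q z, 0 <= p -> p <= q -> q <= T -> 0 <= z ->
    moment sg v q z - moment sg v p z =
      \int[lebesgue_measure]_(r in `[p, q]) moment_rate gamma beta b v z r }.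

(** * Sign of the mass and law of the potential for one solution *)

Section one_trajectory.
Context {R : realType}.
Notation leb := (@lebesgue_measure R).
Variables (a0 gamma beta T L B C : R) (b sg : R -> R) (v : R * R -> R).
Hypotheses (gamma_gt0 : 0 < gamma) (beta_gt0 : 0 < beta) (T_gt0 : 0 < T) (L_gt0 : 0 < L).
Hypothesis cb : continuous b.
Hypothesis b_ge0 : forall t, 0 <= b t.
Hypothesis tr : trajectory a0 gamma beta T L B C b sg v.

(* [mass t z] is the integral of [v (t, _)] over [z, sg t]. *)
Definition mass t := tail (sg t) (fun y => v (t, y)) L.
Notation w := mass.
Notation vh t := (cut (sg t) (fun y => v (t, y))).

Let csg : continuous sg := tr_front_continuous tr.
Let cv : continuous v := tr_continuous tr.
Let cvt t : continuous (fun y => v (t, y)). Proof. exact: continuous_slice2. Qed.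
Let cvy y : continuous (fun t => v (t, y)). Proof. exact: continuous_slice1. Qed.
Let sg0 t : 0 <= sg t. Proof. exact/ltW/(tr_front_gt0 tr). Qed.
Let L0 : 0 <= L. Proof. exact: ltW. Qed.
Let B0 : 0 <= B. Proof. by apply: le_trans (tr_bound tr (t := 0) (y := 0) _ _) => //; rewrite lexx ltW. Qed.

Lemma mass_continuous t : {within `[0, L], continuous (w t)}.
Proof. exact: tail_continuous. Qed.

Lemma mass_bound t z : 0 <= t <= T -> 0 <= z -> z <= L -> `|w t z| <= B * L.
Proof. by move=> tT z0 zL; apply: tail_bound => // y y0; exact: (tr_bound tr). Qed.

Lemma moment_mass t z : 0 <= t <= T -> 0 <= z -> z <= L ->
  moment sg v t z = z * w t 0 - \int[leb]_(y in `[0, z]) w t y.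
Proof. by move=> tT z0 zL; apply: hat_moment => //; exact: (tr_front_le tr). Qed.

(** The hats at [L + 1] and at [L] differ by 1 on the whole slice, so the total mass is a difference
    of two moments. The values of [v] at [L] and at [L + 1] are equal and drop out of the rate. *)
Lemma mass_identity p q : 0 <= p -> p <= q -> q <= T ->
  w q 0 - w p 0 = \int[leb]_(r in `[p, q]) (beta * (b r - gamma * v (r, 0))).
Proof.
move=> p0 pq qT.
have E t : 0 <= t <= T -> w t 0 = moment sg v t (L + 1) - moment sg v t L.
  move=> tT; have tL := tr_front_le tr tT; rewrite /mass tail_start Rintegral_cut1// /moment.
  have ch z : continuous (fun y => hat z y * v (t, y)).
    by move=> y; apply: cvgM; [exact: hat_continuous|exact: cvt].
  rewrite -RintegralB//; [|exact: integrable_continuous|exact: integrable_continuous].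
  apply: eq_Rintegral => y; rewrite inE/= in_itv/= => /andP[y0 ys].
  have yL := le_trans ys tL; rewrite /hat !(max_idPl _) ?subr_ge0//; first by ring.
  by rewrite (le_trans yL)// lerDl.
have crate z : continuous (moment_rate gamma beta b v z).
  move=> r; apply: cvgD; last by apply: cvgB; exact: cvy.
  apply: cvgMr; apply: cvgMr; apply: cvgB; first exact: cb.
  by apply: cvgMr; exact: cvy.
have pT : 0 <= p <= T by rewrite p0 (le_trans pq).
have qT' : 0 <= q <= T by rewrite (le_trans p0 pq).
rewrite !E//.
have -> : moment sg v q (L + 1) - moment sg v q L - (moment sg v p (L + 1) - moment sg v p L) =
  (moment sg v q (L + 1) - moment sg v p (L + 1)) - (moment sg v q L - moment sg v p L) by ring.
rewrite (tr_moment tr p0 pq qT (addr_ge0 L0 ler01)) (tr_moment tr p0 pq qT L0).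
rewrite -RintegralB//; [|exact: integrable_continuous|exact: integrable_continuous].
apply: eq_Rintegral => r; rewrite inE/= in_itv/= => /andP[pr rq].
have rT : 0 <= r <= T by rewrite (le_trans p0 pr) (le_trans rq qT).
have rL := tr_front_le tr rT; have rL1 : sg r <= L + 1 by rewrite (le_trans rL)// lerDl.
by rewrite /moment_rate (tr_out tr rL) (tr_out tr rL1); ring.
Qed.

Lemma mass_primitive_identity p q z : 0 <= p -> p <= q -> q <= T -> 0 <= z -> z <= L ->
  \int[leb]_(y in `[0, z]) (w q y - w p y) = \int[leb]_(r in `[p, q]) (v (r, 0) - v (r, z)).
Proof.
move=> p0 pq qT z0 zL.
have pT : 0 <= p <= T by rewrite p0 (le_trans pq).
have qT' : 0 <= q <= T by rewrite (le_trans p0 pq).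
have im t : leb.-integrable `[0, z] (EFin \o w t).
  by apply: integrable_itvS (integrable_within (@mass_continuous t)).
rewrite RintegralB//.
have E t : 0 <= t <= T -> \int[leb]_(y in `[0, z]) w t y = z * w t 0 - moment sg v t z.
  by move=> tT; rewrite moment_mass//; ring.
rewrite !E//.
have -> : z * w q 0 - moment sg v q z - (z * w p 0 - moment sg v p z) =
   z * (w q 0 - w p 0) - (moment sg v q z - moment sg v p z) by ring.
rewrite mass_identity// (tr_moment tr)//.
have c1 : continuous (fun r => beta * (b r - gamma * v (r, 0))).
  move=> r; apply: cvgMr; apply: cvgB; first exact: cb.
  by apply: cvgMr; exact: cvy.
have c2 : continuous (moment_rate gamma beta b v z).
  by move=> r; apply: cvgD; [apply: cvgMr; exact: c1|apply: cvgB; exact: cvy].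
rewrite -RintegralZl//; last exact: integrable_continuous.
rewrite -RintegralB//; [|by apply: integrable_continuous => r; apply: cvgMr; exact: c1|exact: integrable_continuous].
by apply: eq_Rintegral => r _; rewrite /moment_rate; ring.
Qed.

Lemma trajectory_modulus e : 0 < e -> exists2 d : R, 0 < d & forall r q y,
  0 <= r <= T -> 0 <= q <= T -> 0 <= y -> y <= L -> `|r - q| <= d -> `|v (r, y) - v (q, y)| <= e.
Proof.
move=> e0; have [d d0 hd] := @unif_continuous_square R v (T + L) e cv e0.
exists d => // r q y /andP[r0 rT] /andP[q0 qT] y0 yL rq; apply: hd => //.
- by rewrite r0 (le_trans rT)// lerDl.
- by rewrite y0 (le_trans yL)// lerDr ltW.
- by rewrite q0 (le_trans qT)// lerDl.
- by rewrite y0 (le_trans yL)// lerDr ltW.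
- by rewrite subrr normr0 ltW.
Qed.

Lemma mean_modulus e d p q y : (forall r q y,
  0 <= r <= T -> 0 <= q <= T -> 0 <= y -> y <= L -> `|r - q| <= d -> `|v (r, y) - v (q, y)| <= e) ->
  0 <= p -> p <= q -> q <= T -> q - p <= d -> 0 <= y -> y <= L ->
  `|\int[leb]_(r in `[p, q]) v (r, y) - (q - p) * v (q, y)| <= e * (q - p).
Proof.
move=> hd p0 pq qT pqd y0 yL.
have -> : \int[leb]_(r in `[p, q]) v (r, y) - (q - p) * v (q, y) = \int[leb]_(r in `[p, q]) (v (r, y) - v (q, y)).
  rewrite RintegralB//; [|exact: integrable_continuous|by apply: integrable_continuous => x; exact: cvg_cst].
  by rewrite Rintegral_itv_cst// mulrC.
apply: Rintegral_itv_bound => //.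
  by apply: integrable_continuous => x; apply: cvgB; [exact: cvy|exact: cvg_cst].
move=> r /andP[pr rq]; apply: hd => //.
- by rewrite (le_trans p0 pr) (le_trans rq qT).
- by rewrite (le_trans p0 pq).
- by rewrite distrC ger0_norm ?subr_ge0//; apply: le_trans pqd; exact: lerB.
Qed.

Let cw t (F : R -> R) : continuous F -> {within `[0, L], continuous (fun z => F (w t z))}.
Proof.
by move=> cF z; apply: (@continuous_comp _ _ _ (w t : subspace _ -> R) F); [exact: mass_continuous|exact: cF].
Qed.

Let cube : continuous (fun x : R => neg x ^+ 3 / 3).
Proof.
move=> x; apply: cvgMl; rewrite (_ : (fun x => neg x ^+ 3) = (fun x => neg x * (neg x * neg x))).
  by apply: cvgM; [|apply: cvgM]; exact: neg_continuous.
by apply/funext => y; rewrite !exprS expr0 mulr1.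
Qed.

Let sqr : continuous (fun x : R => neg x ^+ 2).
Proof.
have -> : (fun x : R => neg x ^+ 2) = (fun x => neg x * neg x) by apply/funext => y; rewrite expr2.
by move=> x; apply: cvgM; exact: neg_continuous.
Qed.

(* The second term cancels the boundary term at [z = 0] of the first. *)
Definition mass_energy t := \int[leb]_(z in `[0, L]) (neg (w t z) ^+ 3 / 3) + neg (w t 0) ^+ 3 / 3 / (beta * gamma).

(** Convexity at the later time [q] bounds the increment by the pairing of [- phi], where
    [phi = (w^-)^2], with [w q - w p]. Integration by parts moves it onto the primitive [N], which
    [mass_primitive_identity] expresses through [v] alone. Replacing means over [[p, q]] by values
    at [q] costs the error in [e]. *)
Lemma mass_energy_step e d p q : 0 <= e -> (forall r q y,
  0 <= r <= T -> 0 <= q <= T -> 0 <= y -> y <= L -> `|r - q| <= d -> `|v (r, y) - v (q, y)| <= e) ->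
  0 <= p -> p <= q -> q <= T -> q - p <= d ->
  mass_energy q - mass_energy p <= e * (4 * (B * L) ^+ 2 + (B * L) ^+ 2) * (q - p).
Proof.
move=> e0 hd p0 pq qT pqd; have bg0 : 0 < beta * gamma by exact: mulr_gt0.
have qT' : 0 <= q <= T by rewrite (le_trans p0 pq).
have pq0 : 0 <= q - p by rewrite subr_ge0.
pose phi z := neg (w q z) ^+ 2; pose dphi z := (-2 * neg (w q z)) * (- vh q z).
have cphi : {within `[0, L], continuous phi} by exact: (cw (F := fun x => neg x ^+ 2)).
have cdF : continuous (fun x : R => -2 * neg x) by move=> x; apply: cvgMr; exact: neg_continuous.
have sub x y : 0 <= x -> y <= L -> (`[x, y]%classic : set R) `<=` `[0, L]%classic.
  by move=> x0 yL z /=; rewrite !in_itv/= => /andP[xz zy]; rewrite (le_trans x0 xz) (le_trans zy yL).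
have ivh x y : leb.-integrable `[x, y] (EFin \o (fun c => - vh q c)).
  have -> : (fun c => - vh q c) = (fun c => -1 * vh q c) by apply/funext => c; rewrite mulN1r.
  by apply: integrableRZ => //; exact: integrable_cut.
have phiE x y : 0 <= x -> x <= y -> y <= L -> phi y - phi x = \int[leb]_(c in `[x, y]) dphi c.
  move=> x0 xy yL; apply: (@ac_comp R (w q) (fun c => - vh q c) (fun x => neg x ^+ 2) (fun x => -2 * neg x)) => //.
  - by move=> c c' xc cc' cy; apply: tail_increment => //; [exact: le_trans xc|exact: le_trans yL].
  - exact: (continuous_subspaceW (sub x y x0 yL) (@mass_continuous q)).
  - exact: neg_sqr_expansion.
have idphi : leb.-integrable `[0, L] (EFin \o dphi).
  have -> : dphi = (fun z => - vh q z * (-2 * neg (w q z))) by apply/funext => z; rewrite /dphi mulrC.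
  by apply: integrable_itvM => //; exact: (cw (F := fun x => -2 * neg x)).
have negB z : 0 <= z <= L -> neg (w q z) <= B * L.
  by move=> /andP[z0 zL]; apply: le_trans (neg_le_norm _) (mass_bound qT' z0 zL).
have BL0 : 0 <= B * L by rewrite mulr_ge0.
have dphiA z : 0 <= z <= L -> `|dphi z| <= 2 * (B * L) * B.
  move=> zL; rewrite /dphi normrM normrN normrM normrN [`|2|]ger0_norm//.
  rewrite [`|neg _|]ger0_norm ?neg_ge0//; apply: ler_pM => //.
  - by rewrite mulr_ge0// neg_ge0.
  - by rewrite ler_pM2l// negB.
  - by apply: cut_bound; [move=> y y0; exact: (tr_bound tr)|case/andP: zL].
pose A := 2 * (B * L) * B; have A0 : 0 <= A by rewrite !mulr_ge0.
pose g z := w q z - w p z; pose N z := \int[leb]_(y in `[0, z]) g y.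
have cg : {within `[0, L], continuous g} by move=> z; apply: cvgB; exact: mass_continuous.
have ig : leb.-integrable `[0, L] (EFin \o g) by exact: integrable_within.
have cN := continuous_primitive ig.
have NE z : 0 <= z -> z <= L -> N z = \int[leb]_(r in `[p, q]) v (r, 0) - \int[leb]_(r in `[p, q]) v (r, z).
  move=> z0 zL; rewrite /N mass_primitive_identity// RintegralB//; exact: integrable_continuous.
have phiL : phi L = 0 by rewrite /phi /mass tail_end /neg oppr0 maxxx expr0n.
have N0 : N 0 = 0 by rewrite /N Rintegral_point.
have BP : \int[leb]_(z in `[0, L]) (g z * phi z) = - \int[leb]_(z in `[0, L]) (N z * dphi z).
  rewrite (@ac_by_parts_bounded R N g phi dphi 0 L A L0 ig _ idphi phiE A0 dphiA cN cphi).
    by rewrite phiL N0 mulr0 mul0r subr0 sub0r.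
  by move=> x y x0 xy yL; rewrite /N (primitive_increment ig).
have iNd : leb.-integrable `[0, L] (EFin \o (fun z => N z * dphi z)).
  have -> : (fun z => N z * dphi z) = (fun z => dphi z * N z) by apply/funext => z; rewrite mulrC.
  exact: integrable_itvM.
pose I0 := \int[leb]_(r in `[p, q]) v (r, 0).
have hI0 : `|I0 - (q - p) * v (q, 0)| <= e * (q - p) by exact: (mean_modulus hd).
have Nd : \int[leb]_(z in `[0, L]) (N z * dphi z) <= - ((q - p) * v (q, 0) * phi 0) + 2 * e * (q - p) * A * L.
  have -> : - ((q - p) * v (q, 0) * phi 0) + 2 * e * (q - p) * A * L =
     \int[leb]_(z in `[0, L]) ((q - p) * v (q, 0) * dphi z + 2 * e * (q - p) * A).
    rewrite RintegralD//; [|exact: integrableRZ|by apply: integrable_continuous => x; exact: cvg_cst].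
    by rewrite Rintegral_itv_cst// subr0 RintegralZl// -phiE// phiL sub0r mulrN.
  apply: le_Rintegral => //.
    by apply: integrableRD => //; [exact: integrableRZ|apply: integrable_continuous => x; exact: cvg_cst].
  move=> z; rewrite /= in_itv/= => zL; have /andP[z0 zL'] := zL; rewrite NE//.
  have hIz := mean_modulus hd p0 pq qT pqd z0 zL'.
  (* Inside the front this is [2 w^- v^2]: the dissipated part, which is dropped. *)
  have pos : 0 <= v (q, z) * dphi z.
    rewrite /dphi /cut; case: ifP => _; last by rewrite oppr0 !mulr0.
    have -> : v (q, z) * (-2 * neg (w q z) * - v (q, z)) = 2 * neg (w q z) * v (q, z) ^+ 2 by ring.
    by rewrite mulr_ge0 ?sqr_ge0// mulr_ge0// neg_ge0.
  set Iz := \int[leb]_(r in `[p, q]) v (r, z); rewrite -/I0.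
  have -> : (I0 - Iz) * dphi z = (q - p) * v (q, 0) * dphi z - (q - p) * (v (q, z) * dphi z)
     + ((I0 - (q - p) * v (q, 0)) - (Iz - (q - p) * v (q, z))) * dphi z by ring.
  rewrite lerD//; first by rewrite gerBl mulr_ge0.
  apply: le_trans (ler_norm _) _; rewrite normrM; apply: ler_pM => //; last exact: dphiA.
  by apply: le_trans (ler_normB _ _) _; apply: le_trans (lerD hI0 hIz) _; lra.
have c3 t : leb.-integrable `[0, L] (EFin \o (fun z => neg (w t z) ^+ 3 / 3)).
  by apply: integrable_within; exact: (cw (F := fun x => neg x ^+ 3 / 3)).
have P1 : \int[leb]_(z in `[0, L]) (neg (w q z) ^+ 3 / 3) - \int[leb]_(z in `[0, L]) (neg (w p z) ^+ 3 / 3)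
    <= \int[leb]_(z in `[0, L]) (N z * dphi z).
  have igp : leb.-integrable `[0, L] (EFin \o (fun z => g z * phi z)) by exact: integrable_itvM.
  have -> : \int[leb]_(z in `[0, L]) (N z * dphi z) = \int[leb]_(z in `[0, L]) (-1 * (g z * phi z)).
    by rewrite RintegralZl// BP mulN1r opprK.
  rewrite -RintegralB//.
  apply: le_Rintegral => //; [exact: integrableRB|exact: integrableRZ|].
  by move=> z _; apply: le_trans (neg_cube_convex _ _) _; rewrite /g /phi le_eqVlt; apply/orP; left; apply/eqP; ring.
(* [b >= 0] bounds the increment of [w] at 0 from below. After division by [beta gamma] the
   resulting term [phi 0 * I0] cancels, up to the error in [e], the boundary term in [Nd]. *)
have P2 : neg (w q 0) ^+ 3 / 3 / (beta * gamma) - neg (w p 0) ^+ 3 / 3 / (beta * gamma) <= phi 0 * I0.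
  rewrite -mulrBl ler_pdivrMr//; apply: le_trans (neg_cube_convex _ _) _.
  have : - (beta * gamma * I0) <= w q 0 - w p 0.
    rewrite mass_identity// -mulNr /I0 -RintegralZl//; last exact: integrable_continuous.
    apply: le_Rintegral => //.
    - by apply: integrable_continuous => x; apply: cvgMr; exact: cvy.
    - apply: integrable_continuous => r; apply: cvgMr; apply: cvgB; first exact: cb.
      by apply: cvgMr; exact: cvy.
    - by move=> r _; rewrite mulrBr mulrA mulNr lerDr mulr_ge0// ltW.
  have f0 : 0 <= phi 0 by exact: sqr_ge0.
  move=> h; have := ler_wpM2l f0 h; rewrite mulrN lerNl -mulNr => h'; apply: le_trans h' _.
  by rewrite le_eqVlt; apply/orP; left; apply/eqP; ring.
have f0 : 0 <= phi 0 by exact: sqr_ge0.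
have f1 : phi 0 <= (B * L) ^+ 2.
  have h : 0 <= (0 : R) <= L by rewrite lexx.
  by rewrite /phi ler_sqr ?nnegrE ?neg_ge0// negB.
have P3 : phi 0 * I0 <= (q - p) * v (q, 0) * phi 0 + e * (q - p) * (B * L) ^+ 2.
  have : phi 0 * (I0 - (q - p) * v (q, 0)) <= (B * L) ^+ 2 * (e * (q - p)).
    apply: le_trans (ler_norm _) _; rewrite normrM ger0_norm//; exact: ler_pM.
  lra.
have P4 : 2 * e * (q - p) * A * L = e * (4 * (B * L) ^+ 2) * (q - p) by rewrite /A; ring.
rewrite P4 in Nd; rewrite /mass_energy opprD addrACA.
apply: le_trans (lerD (le_trans P1 Nd) (le_trans P2 P3)) _.
by rewrite le_eqVlt; apply/orP; left; apply/eqP; ring.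
Qed.

Lemma mass_ge0 : (forall y, 0 <= y <= sg 0 -> 0 <= v (0, y)) ->
  forall t z, 0 <= t <= T -> 0 <= z <= L -> 0 <= w t z.
Proof.
move=> v0 t z tT zL; have [t0 tT'] := andP tT.
have bg0 : 0 < beta * gamma by exact: mulr_gt0.
have w0 y : 0 <= y <= L -> 0 <= w 0 y.
  move=> /andP[y0 yL]; rewrite /mass /tail.
  rewrite (primitive_increment (@integrable_cut R (sg 0) _ 0 L (@cvt 0)) y0 yL (lexx _)).
  apply: Rintegral_itv_ge0 => x /andP[yx xL]; rewrite /cut; case: ifP => // xs.
  by rewrite v0// (le_trans y0 yx) ltW.
have E : mass_energy t <= mass_energy 0.
  apply: (@le_of_increments R mass_energy id) => // e e0.
  pose K := 4 * (B * L) ^+ 2 + (B * L) ^+ 2 + 1.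
  have K0 : 0 < K by rewrite ltr_wpDl// addr_ge0// ?mulr_ge0// sqr_ge0.
  have eK : 0 < e / K by rewrite divr_gt0.
  have [d d0 hd] := trajectory_modulus eK; exists d => // p q p0 pq qt pqd.
  apply: le_trans (mass_energy_step (ltW eK) hd p0 pq (le_trans qt tT') pqd) _.
  rewrite ler_wpM2r ?subr_ge0// mulrAC ler_pdivrMr// ler_pM2l// lerDl//.
have n0 (x : R) : 0 <= x -> neg x ^+ 3 / 3 = 0.
  by move=> x0; rewrite /neg (max_idPr _) ?oppr_le0// expr0n/= mul0r.
have Z : mass_energy 0 = 0.
  rewrite /mass_energy n0 ?w0 ?lexx// mul0r addr0 (@eq_Rintegral _ _ _ _ _ (cst 0)).
    by rewrite Rintegral_cst// mul0r.
  by move=> y; rewrite inE/= in_itv/= => yL; rewrite n0// w0.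
have p3 (x : R) : 0 <= neg x ^+ 3 / 3 by rewrite divr_ge0// exprn_ge0// neg_ge0.
have E0 : \int[leb]_(z in `[0, L]) (neg (w t z) ^+ 3 / 3) <= 0.
  have : 0 <= neg (w t 0) ^+ 3 / 3 / (beta * gamma) by rewrite divr_ge0 ?p3// ltW.
  by move: E; rewrite Z /mass_energy; set x1 := \int[leb]_(z in `[0, L]) _; lra.
have c3 : {within `[0, L], continuous (fun z => neg (w t z) ^+ 3 / 3)} by exact: (cw (F := fun x => neg x ^+ 3 / 3)).
have /eqP := @zero_of_integral_ge0 R _ L L_gt0 c3 (fun y _ => p3 _) E0 z zL.
rewrite mulf_eq0 invr_eq0 pnatr_eq0 orbF expf_eq0/= => /eqP nw.
have [[]//|[wle wE]] := negE (w t z).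
by rewrite nw in wE; rewrite -[w t z]opprK -wE oppr0.
Qed.

Hypothesis a0_gt0 : 0 < a0.
Hypothesis front_ge0 : forall t, 0 <= t <= T -> 0 <= v (t, sg t).

Definition below t z : R := cut (sg t) (fun=> 1) z.

(* The first two terms are the integral of [w t] over [0, z], and the third that of
   [below sg t / a0].  The last one is chosen to remove [v (t, 0)] from the rate,
   which becomes [b / gamma - vh]. *)
Definition potential t z :=
  z * w t 0 - moment sg v t z + Num.min z (sg t) / a0 + w t 0 / (beta * gamma).

Let c1 : continuous (fun _ : R => 1 : R). Proof. by move=> x; exact: cvg_cst. Qed.

Lemma Rintegral_below t x y : 0 <= x -> x <= y ->
  \int[leb]_(c in `[x, y]) below t c = Num.min y (sg t) - Num.min x (sg t).
Proof.
move=> x0 xy; rewrite /below; have [sx|sx] := leP (sg t) x.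
  rewrite (min_idPr (le_trans sx xy)) subrr (@eq_Rintegral _ _ _ _ _ (cst 0)).
    by rewrite Rintegral_cst// mul0r.
  by move=> c; rewrite inE/= in_itv/= /cut => /andP[xc _]; rewrite ltNge (le_trans sx xc).
have [ys|ys] := leP (sg t) y.
  by rewrite (Rintegral_cut1 (ltW sx) ys c1) Rintegral_itv_cst ?(ltW sx)// mul1r.
rewrite (@eq_Rintegral _ _ _ _ _ (cst 1)).
  by rewrite Rintegral_itv_cst// mul1r.
by move=> c; rewrite inE/= in_itv/= /cut => /andP[_ cy]; rewrite (le_lt_trans cy).
Qed.

Lemma potential_start t : potential t 0 = w t 0 / (beta * gamma).
Proof.
rewrite /potential mul0r (min_idPl (sg0 t)) mul0r addr0 /moment (@eq_Rintegral _ _ _ _ _ (cst 0)).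
  by rewrite Rintegral_cst// mul0r subrr add0r.
by move=> y; rewrite inE/= in_itv/= => /andP[y0 _]; rewrite /hat (max_idPr _) ?mul0r// sub0r oppr_le0.
Qed.

Lemma integrable_slope t x y : 0 <= x -> y <= L ->
  leb.-integrable `[x, y] (EFin \o (fun c => w t c + a0^-1 * below t c)).
Proof.
move=> x0 yL; apply: integrableRD => //.
  by apply: integrable_itvS (integrable_within (@mass_continuous t)).
by apply: integrableRZ => //; exact: (@integrable_cut R (sg t) (fun=> 1) x y c1).
Qed.

Lemma potential_increment t x y : 0 <= t <= T -> 0 <= x -> x <= y -> y <= L ->
  potential t y - potential t x = \int[leb]_(c in `[x, y]) (w t c + a0^-1 * below t c).
Proof.
move=> tT x0 xy yL; have iw := integrable_within (@mass_continuous t).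
have ib : leb.-integrable `[x, y] (EFin \o below t) by exact: (@integrable_cut R (sg t) (fun=> 1) x y c1).
rewrite RintegralD//; [|exact: integrable_itvS iw|exact: integrableRZ].
rewrite RintegralZl// Rintegral_below// -(primitive_increment iw x0 xy yL) /potential.
rewrite !moment_mass// ?(le_trans x0 xy) ?(le_trans xy yL)//.
ring.
Qed.

Lemma potential_continuous t : 0 <= t <= T -> {within `[0, L], continuous (potential t)}.
Proof.
move=> tT; have ip := integrable_slope t (lexx 0) (lexx L).
have cp := continuous_primitive ip.
have E z : 0 <= z <= L -> potential t z =
    \int[leb]_(c in `[0, z]) (w t c + a0^-1 * below t c) + potential t 0.
  by move=> /andP[z0 zL]; rewrite -potential_increment// subrK.
apply: (@subspace_eq_continuous R `[0, L]%classic R (fun z => \int[leb]_(c in `[0, z]) (w t c + a0^-1 * below t c) + potential t 0)).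
  by move=> z; rewrite inE/= in_itv/= => /E.
by move=> z; apply: cvgD; [exact: cp|exact: cvg_cst].
Qed.

Lemma potential_bound t z : 0 <= t <= T -> 0 <= z -> z <= L ->
  `|potential t z| <= B * L * L + L / a0 + B * L / (beta * gamma).
Proof.
move=> tT z0 zL; have bg0 : 0 < beta * gamma by exact: mulr_gt0.
rewrite /potential moment_mass// opprB [z * _ + _]addrC subrK.
apply: le_trans (ler_normD _ _) _; apply: lerD.
  apply: le_trans (ler_normD _ _) _; apply: lerD.
    have iz : leb.-integrable `[0, z] (EFin \o w t) by apply: integrable_itvS (integrable_within (@mass_continuous t)).
    apply: le_trans (Rintegral_itv_bound z0 iz (M := B * L) _) _.
      by move=> x /andP[x0 xz]; apply: mass_bound => //; exact: le_trans xz zL.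
    by rewrite subr0 ler_wpM2l// mulr_ge0.
  rewrite normrM [`|a0^-1|]gtr0_norm ?invr_gt0// ler_pM2r ?invr_gt0//.
  by rewrite ger0_norm ?le_min ?z0 ?sg0// ge_min zL.
by rewrite normrM [`|_^-1|]gtr0_norm ?invr_gt0// ler_pM2r ?invr_gt0// mass_bound.
Qed.

(** The rate is accurate up to [e] except for the [z] that the front sweeps between [p] and [q],
    where only a crude bound holds; [below q z - below p z] is the indicator of these. The strip has
    width at most [C (q - p)], so after integration in [z] the crude bound becomes quadratic in
    [q - p]. *)
Lemma potential_step e d p q z : 0 <= e -> (forall r q y,
  0 <= r <= T -> 0 <= q <= T -> 0 <= y -> y <= L -> `|r - q| <= d -> `|v (r, y) - v (q, y)| <= e) ->
  0 <= p -> p <= q -> q <= T -> q - p <= d -> 0 <= z -> z <= L ->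
  `|potential q z - potential p z - \int[leb]_(r in `[p, q]) (b r / gamma) + (q - p) * vh q z| <=
  e * (q - p) + (2 * B + C / a0) * (q - p) * (below q z - below p z).
Proof.
move=> e0 hd p0 pq qT pqd z0 zL; have bg0 : 0 < beta * gamma by exact: mulr_gt0.
have pT : 0 <= p <= T by rewrite p0 (le_trans pq).
have qT' : 0 <= q <= T by rewrite (le_trans p0 pq).
have pq0 : 0 <= q - p by rewrite subr_ge0.
have cbg : continuous (fun r => b r / gamma) by move=> r; apply: cvgMl; exact: cb.
have cw1 : continuous (fun r => beta * (b r - gamma * v (r, 0))).
  move=> r; apply: cvgMr; apply: cvgB; first exact: cb.
  by apply: cvgMr; exact: cvy.
set Jb := \int[leb]_(r in `[p, q]) (b r / gamma).
pose J y := \int[leb]_(r in `[p, q]) v (r, y).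
have im t : leb.-integrable `[0, z] (EFin \o w t).
  by apply: integrable_itvS (integrable_within (@mass_continuous t)).
have E1 : (z * w q 0 - moment sg v q z) - (z * w p 0 - moment sg v p z) = J 0 - J z.
  have Em t : 0 <= t <= T -> z * w t 0 - moment sg v t z = \int[leb]_(y in `[0, z]) w t y.
    by move=> tT; rewrite moment_mass//; ring.
  rewrite !Em// -RintegralB// mass_primitive_identity//.
  by rewrite RintegralB//; exact: integrable_continuous.
have E2 : (w q 0 - w p 0) / (beta * gamma) = Jb - J 0.
  rewrite mass_identity// mulrC -RintegralZl//; last exact: integrable_continuous.
  rewrite -RintegralB//; [|exact: integrable_continuous|exact: integrable_continuous].
  apply: eq_Rintegral => r _; field.
  by rewrite !gt_eqF.
have -> : potential q z - potential p z - Jb + (q - p) * vh q z =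
   (Num.min z (sg q) - Num.min z (sg p)) / a0 - J z + (q - p) * vh q z.
  transitivity ((z * w q 0 - moment sg v q z - (z * w p 0 - moment sg v p z)) + (w q 0 - w p 0) / (beta * gamma)
    + (Num.min z (sg q) - Num.min z (sg p)) / a0 - Jb + (q - p) * vh q z); first by rewrite /potential; ring.
  by rewrite E1 E2; ring.
have /andP[D0 DC] := tr_front_lipschitz tr p0 pq qT.
have spq : sg p <= sg q by rewrite -subr_ge0.
have hJ := mean_modulus hd p0 pq qT pqd z0 zL; rewrite -/(J z) in hJ.
(* Three positions of [z]. Beyond the front at both times, the advance over [a0] equals the integral
   of [v] exactly, because [front_ge0] removes the truncation [sigma]. Inside at both times, only
   the modulus of [v] matters. The swept strip comes last. *)
rewrite /below /cut; have [zq|zq] := ltP z (sg q); last first.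
  have zp := le_trans spq zq; rewrite ltNge zp/= subrr !mulr0 !addr0.
  rewrite (min_idPr zp) (tr_front tr)//.
  have -> : J z = \int[leb]_(r in `[p, q]) v (r, sg r).
    apply: eq_Rintegral => r; rewrite inE/= in_itv/= => /andP[pr rq].
    apply: (tr_out tr); apply: le_trans zq; rewrite -subr_ge0.
    by have /andP[] := tr_front_lipschitz tr (le_trans p0 pr) rq qT.
  have cfr : continuous (fun r => v (r, sg r)).
    move=> r; have h : ((x, sg x) @[x --> r] --> (r, sg r)) by exact: (cvg_pair cvg_id (@csg r)).
    exact: (cvg_comp _ _ h (@cv _)).
  have -> : \int[leb]_(r in `[p, q]) (a0 * sigma (v (r, sg r))) = a0 * \int[leb]_(r in `[p, q]) v (r, sg r).
    rewrite -RintegralZl//; last exact: integrable_continuous.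
    apply: eq_Rintegral => r; rewrite inE/= in_itv/= => /andP[pr rq].
    by rewrite /sigma front_ge0// (le_trans p0 pr) (le_trans rq qT).
  by rewrite mulrAC divff ?gt_eqF// mul1r subrr normr0 mulr_ge0.
have [zp|zp] := ltP z (sg p).
  rewrite !subrr mulr0 addr0 mul0r sub0r.
  by rewrite addrC -opprB normrN.
rewrite subr0 mulr1.
have zs : 0 <= z - sg p by rewrite subr_ge0.
have zC : (z - sg p) / a0 <= C / a0 * (q - p).
  by rewrite mulrAC ler_pM2r ?invr_gt0//; apply: le_trans DC; apply: lerB => //; exact: ltW.
have zs0 : 0 <= (z - sg p) / a0 by rewrite divr_ge0// ltW.
have -> : (z - sg p) / a0 - J z + (q - p) * v (q, z) = (z - sg p) / a0 - (J z - (q - p) * v (q, z)) by ring.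
apply: le_trans (ler_normB _ _) _; rewrite ger0_norm// addrC lerD//.
apply: le_trans zC _; rewrite -[C / a0 * _]add0r [leRHS]mulrDl lerD2r !mulr_ge0//.
Qed.

End one_trajectory.

(** * Comparison of two solutions *)

Section two_trajectories.
Context {R : realType}.
Notation leb := (@lebesgue_measure R).
Variables (a0 gamma beta T L B C : R) (b sg1 sg2 : R -> R) (v1 v2 : R * R -> R).
Hypotheses (a0_gt0 : 0 < a0) (gamma_gt0 : 0 < gamma) (beta_gt0 : 0 < beta) (T_gt0 : 0 < T) (L_gt0 : 0 < L).
Hypothesis C_ge0 : 0 <= C.
Hypothesis cb : continuous b.
Hypothesis b_ge0 : forall t, 0 <= b t.
Hypothesis tr1 : trajectory a0 gamma beta T L B C b sg1 v1.
Hypothesis tr2 : trajectory a0 gamma beta T L B C b sg2 v2.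
Hypothesis v10 : forall y, 0 <= y <= sg1 0 -> 0 <= v1 (0, y).
Hypothesis sg0 : sg1 0 = sg2 0.
Hypothesis v0 : forall y, 0 <= y <= sg1 0 -> v1 (0, y) = v2 (0, y).

Notation w1 := (mass L sg1 v1).
Notation w2 := (mass L sg2 v2).
Notation U1 := (potential a0 gamma beta L sg1 v1).
Notation U2 := (potential a0 gamma beta L sg2 v2).
Notation vh1 t := (cut (sg1 t) (fun y => v1 (t, y))).
Notation vh2 t := (cut (sg2 t) (fun y => v2 (t, y))).

Let L0 : 0 <= L. Proof. exact: ltW. Qed.
Let w1_ge0 : forall t z, 0 <= t <= T -> 0 <= z <= L -> 0 <= w1 t z.
Proof. exact: (mass_ge0 gamma_gt0 beta_gt0 T_gt0 L_gt0 cb b_ge0 tr1). Qed.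
Let w2_ge0 : forall t z, 0 <= t <= T -> 0 <= z <= L -> 0 <= w2 t z.
Proof.
apply: (mass_ge0 gamma_gt0 beta_gt0 T_gt0 L_gt0 cb b_ge0 tr2) => y; rewrite -sg0 => ys.
by rewrite -v0// v10.
Qed.
Let cv1 t : continuous (fun y => v1 (t, y)). Proof. by apply: continuous_slice2; exact: tr_continuous tr1. Qed.
Let cv2 t : continuous (fun y => v2 (t, y)). Proof. by apply: continuous_slice2; exact: tr_continuous tr2. Qed.
Let front1 t : 0 <= t <= T -> 0 <= v1 (t, sg1 t).
Proof.
move=> tT; apply: (trace_ge0 (@cv1 t) (tr_front_gt0 tr1 t) (tr_front_le tr1 tT)) => z zL.
exact: w1_ge0.
Qed.
Let front2 t : 0 <= t <= T -> 0 <= v2 (t, sg2 t).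
Proof.
move=> tT; apply: (trace_ge0 (@cv2 t) (tr_front_gt0 tr2 t) (tr_front_le tr2 tT)) => z zL.
exact: w2_ge0.
Qed.

Let U t z := U1 t z - U2 t z.
Let om t z := w1 t z - w2 t z.
Let slope t z := om t z + a0^-1 * (below sg1 t z - below sg2 t z).

Let cU t : 0 <= t <= T -> {within `[0, L], continuous (U t)}.
Proof.
move=> tT z; apply: cvgB.
  exact: (potential_continuous tr1 tT).
exact: (potential_continuous tr2 tT).
Qed.
Let com t : {within `[0, L], continuous (om t)}.
Proof. by move=> z; apply: cvgB; [exact: (mass_continuous tr1)|exact: (mass_continuous tr2)]. Qed.

Let U_increment t x y : 0 <= t <= T -> 0 <= x -> x <= y -> y <= L ->
  leb.-integrable `[x, y] (EFin \o slope t) /\ U t y - U t x = \int[leb]_(c in `[x, y]) slope t c.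
Proof.
move=> tT x0 xy yL.
have i1 := integrable_slope tr1 t x0 yL; have i2 := integrable_slope tr2 t x0 yL.
have sE : slope t = (fun c => (w1 t c + a0^-1 * below sg1 t c) - (w2 t c + a0^-1 * below sg2 t c)).
  by apply/funext => c; rewrite /slope /om; ring.
rewrite sE; split; first exact: integrableRB.
rewrite RintegralB// -(potential_increment tr1)// -(potential_increment tr2)// /U; ring.
Qed.

Lemma slope_mass_ge0 t z : 0 <= t <= T -> 0 <= z <= L -> 0 <= slope t z * om t z.
Proof.
move=> tT zL; have /andP[z0 zL'] := zL.
rewrite /slope mulrDl -expr2 addr_ge0 ?sqr_ge0// -mulrA mulr_ge0 ?invr_ge0 ?(ltW a0_gt0)//.
rewrite /below /cut /om; have [z1|z1] := ltP z (sg1 t); have [z2|z2] := ltP z (sg2 t).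
- by rewrite subrr mul0r.
- have -> : w2 t z = 0 by apply: tail_out => //; exact/ltW/(tr_front_gt0 tr2).
  by rewrite !subr0 mul1r w1_ge0.
- have -> : w1 t z = 0 by apply: tail_out => //; exact/ltW/(tr_front_gt0 tr1).
  by rewrite !sub0r mulN1r opprK w2_ge0.
- by rewrite subrr mul0r.
Qed.

Let cut_integrable2 t x y : leb.-integrable `[x, y] (EFin \o (fun z => vh1 t z - vh2 t z)).
Proof. by apply: integrableRB => //; exact: integrable_cut. Qed.

Let om_increment t x y : 0 <= x -> x <= y -> y <= L ->
  om t y - om t x = \int[leb]_(c in `[x, y]) (vh2 t c - vh1 t c).
Proof.
move=> x0 xy yL; rewrite RintegralB//; [|exact: integrable_cut|exact: integrable_cut].
have E (s : R) f : continuous f -> tail s f L y - tail s f L x = - \int[leb]_(c in `[x, y]) cut s f c.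
  move=> cf; rewrite tail_increment//.
  have -> : (fun c => - cut s f c) = (fun c => -1 * cut s f c) by apply/funext => c; rewrite mulN1r.
  by rewrite RintegralZl ?mulN1r//; exact: integrable_cut.
have := E (sg1 t) _ (@cv1 t); have := E (sg2 t) _ (@cv2 t).
by rewrite /om /mass => h1 h2; lra.
Qed.

(** Integration by parts with [slope] as derivative of [U] and [vh2 - vh1] as derivative of [om].
    The boundary term vanishes at [L], and at 0 it is a square because [U] equals
    [om / (beta gamma)] there. *)
Lemma potential_pairing t : 0 <= t <= T ->
  0 <= \int[leb]_(z in `[0, L]) (U t z * (vh1 t z - vh2 t z)).
Proof.
move=> tT; have bg0 : 0 < beta * gamma by exact: mulr_gt0.
have [iS US] := U_increment tT (lexx 0) L0 (lexx L).
have inc x y : 0 <= x -> x <= y -> y <= L -> U t y - U t x = \int[leb]_(c in `[x, y]) slope t c.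
  by move=> x0 xy yL; have [] := U_increment tT x0 xy yL.
have B0 : 0 <= B by apply: le_trans (tr_bound tr1 tT (lexx 0)).
have BB z : 0 <= z <= L -> `|vh2 t z - vh1 t z| <= B + B.
  move=> /andP[z0 zL]; apply: le_trans (ler_normB _ _) _; apply: lerD.
    by apply: cut_bound => // y y0; exact: (tr_bound tr2).
  by apply: cut_bound => // y y0; exact: (tr_bound tr1).
have i21 : leb.-integrable `[0, L] (EFin \o (fun c => vh2 t c - vh1 t c)).
  by apply: integrableRB => //; exact: integrable_cut.
have BP := @ac_by_parts_bounded R (U t) (slope t) (om t) (fun c => vh2 t c - vh1 t c) 0 L (B + B)
  L0 iS inc i21 (@om_increment t) (addr_ge0 B0 B0) BB (@cU t tT) (@com t).
have -> : \int[leb]_(z in `[0, L]) (U t z * (vh1 t z - vh2 t z)) =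
    - \int[leb]_(z in `[0, L]) (U t z * (vh2 t z - vh1 t z)).
  have iU : leb.-integrable `[0, L] (EFin \o (fun z => U t z * (vh2 t z - vh1 t z))).
    have -> : (fun z => U t z * (vh2 t z - vh1 t z)) = (fun z => (vh2 t z - vh1 t z) * U t z) by apply/funext => z; rewrite mulrC.
    by apply: integrable_itvM => //; exact: cU.
  by rewrite -mulN1r -RintegralZl//; apply: eq_Rintegral => z _; ring.
have omL : om t L = 0 by rewrite /om /mass !tail_end subrr.
have U0 : U t 0 = om t 0 / (beta * gamma).
  by rewrite /U (potential_start tr1) (potential_start tr2) -mulrBl.
move: BP; rewrite omL mulr0 sub0r U0 => BP.
have : 0 <= \int[leb]_(z in `[0, L]) (slope t z * om t z).
  by apply: Rintegral_itv_ge0 => z zL; exact: slope_mass_ge0.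
have : 0 <= om t 0 / (beta * gamma) * om t 0.
  by rewrite mulrAC -expr2 divr_ge0 ?sqr_ge0// ltW.
move: BP; set x1 := \int[leb]_(z in `[0, L]) _; set x2 := \int[leb]_(z in `[0, L]) _; lra.
Qed.

Let energy t := \int[leb]_(z in `[0, L]) (U t z ^+ 2 / 2).

Let K0 := B * L * L + L / a0 + B * L / (beta * gamma).
Let K1 := 2 * B + C / a0.

Let B_ge0 : 0 <= B.
Proof. by apply: le_trans (tr_bound tr1 (t := 0) (y := 0) _ _) => //; rewrite lexx ltW. Qed.
Let K0_ge0 : 0 <= K0.
Proof. by rewrite !addr_ge0// ?divr_ge0 ?mulr_ge0// ltW// mulr_gt0. Qed.
Let K1_ge0 : 0 <= K1.
Proof. by apply: addr_ge0; [exact: mulr_ge0|apply: divr_ge0 => //; exact: ltW]. Qed.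

Let U_bound t z : 0 <= t <= T -> 0 <= z -> z <= L -> `|U t z| <= 2 * K0.
Proof.
move=> tT z0 zL; apply: le_trans (ler_normB _ _) _; rewrite mulr2n mulrDl mul1r; apply: lerD.
  exact: (potential_bound gamma_gt0 beta_gt0 T_gt0 L_gt0 tr1 a0_gt0 tT z0 zL).
exact: (potential_bound gamma_gt0 beta_gt0 T_gt0 L_gt0 tr2 a0_gt0 tT z0 zL).
Qed.

Let iU2 t : 0 <= t <= T -> leb.-integrable `[0, L] (EFin \o (fun z => U t z ^+ 2 / 2)).
Proof.
move=> tT; have -> : (fun z => U t z ^+ 2 / 2) = (fun z => 2^-1 * (U t z * U t z)).
  by apply/funext => z; rewrite expr2 mulrC.
apply: integrableRZ => //; apply: integrable_within => z.
by apply: cvgM; exact: cU.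
Qed.

Let int_below sg v t : trajectory a0 gamma beta T L B C b sg v -> 0 <= t <= T ->
  \int[leb]_(z in `[0, L]) below sg t z = sg t.
Proof.
move=> tr tT; rewrite Rintegral_below// (min_idPr (tr_front_le tr tT)).
by rewrite (min_idPl (ltW (tr_front_gt0 tr t))) subr0.
Qed.

Let i_below (sg : R -> R) t : leb.-integrable `[0, L] (EFin \o below sg t).
Proof. by apply: integrable_cut => x; exact: cvg_cst. Qed.

(** The increment of the energy is compared with the pairing at the later time [q], where
    [potential_pairing] gives the sign. The swept strips contribute the term with [K1 * C],
    quadratic in [q - p]. *)
Lemma potential_gap_step e d p q : 0 <= e ->
  (forall r q y, 0 <= r <= T -> 0 <= q <= T -> 0 <= y -> y <= L -> `|r - q| <= d ->
    `|v1 (r, y) - v1 (q, y)| <= e) ->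
  (forall r q y, 0 <= r <= T -> 0 <= q <= T -> 0 <= y -> y <= L -> `|r - q| <= d ->
    `|v2 (r, y) - v2 (q, y)| <= e) ->
  0 <= p -> p <= q -> q <= T -> q - p <= d ->
  energy q - energy p <= 4 * K0 * (e * L + K1 * C * (q - p)) * (q - p).
Proof.
move=> e0 h1 h2 p0 pq qT pqd.
have pT : 0 <= p <= T by rewrite p0 (le_trans pq).
have qT' : 0 <= q <= T by rewrite (le_trans p0 pq).
have pq0 : 0 <= q - p by rewrite subr_ge0.
pose f z := U q z * (vh1 q z - vh2 q z).
pose k z := (below sg1 q z - below sg1 p z) + (below sg2 q z - below sg2 p z).
pose g z := - (q - p) * f z + 2 * K0 * (2 * e * (q - p) + K1 * (q - p) * k z).
have i_f : leb.-integrable `[0, L] (EFin \o f).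
  have -> : f = (fun z => (vh1 q z - vh2 q z) * U q z) by apply/funext => z; rewrite /f mulrC.
  by apply: integrable_itvM; [exact: cut_integrable2|exact: cU].
have ik1 : leb.-integrable `[0, L] (EFin \o (fun z => below sg1 q z - below sg1 p z)).
  by apply: integrableRB => //; exact: i_below.
have ik2 : leb.-integrable `[0, L] (EFin \o (fun z => below sg2 q z - below sg2 p z)).
  by apply: integrableRB => //; exact: i_below.
have ik : leb.-integrable `[0, L] (EFin \o k) by exact: integrableRD.
have icst (c : R) : leb.-integrable `[0, L] (EFin \o (fun=> c)).
  by apply: integrable_continuous => x; exact: cvg_cst.
have ikk : leb.-integrable `[0, L] (EFin \o (fun z => 2 * e * (q - p) + K1 * (q - p) * k z)).
  by apply: integrableRD => //; exact: integrableRZ.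
have i1 : leb.-integrable `[0, L] (EFin \o (fun z => - (q - p) * f z)) by exact: integrableRZ.
have i2 : leb.-integrable `[0, L] (EFin \o (fun z => 2 * K0 * (2 * e * (q - p) + K1 * (q - p) * k z))).
  exact: integrableRZ.
have ig : leb.-integrable `[0, L] (EFin \o g) by exact: integrableRD.
have E : energy q - energy p <= \int[leb]_(z in `[0, L]) g z.
  rewrite /energy -RintegralB//; [|exact: iU2|exact: iU2].
  apply: le_Rintegral => //; first by apply: integrableRB => //; exact: iU2.
  move=> z; rewrite /= in_itv/= => /andP[z0 zL].
  have A1 := potential_step gamma_gt0 beta_gt0 T_gt0 L_gt0 cb tr1 a0_gt0 front1 e0 h1 p0 pq qT pqd z0 zL.
  have A2 := potential_step gamma_gt0 beta_gt0 T_gt0 L_gt0 cb tr2 a0_gt0 front2 e0 h2 p0 pq qT pqd z0 zL.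
  move: A1 A2; set Jb := \int[leb]_(r in `[p, q]) _.
  set D1 := U1 q z - U1 p z - Jb + _; set D2 := U2 q z - U2 p z - Jb + _ => A1 A2.
  have UE : U q z - U p z = - (q - p) * (vh1 q z - vh2 q z) + (D1 - D2) by rewrite /U /D1 /D2; ring.
  (* Convexity of the square: [(x^2 - y^2) / 2 <= x (x - y)]. *)
  apply: (@le_trans _ _ (U q z * (U q z - U p z))).
    have := sqr_ge0 (U q z - U p z); rewrite !expr2; lra.
  rewrite UE mulrDr /g /f; apply: lerD; first by rewrite le_eqVlt; apply/orP; left; apply/eqP; ring.
  apply: le_trans (ler_norm _) _; rewrite normrM; apply: ler_pM => //; first exact: U_bound.
  apply: le_trans (ler_normB _ _) _; apply: le_trans (lerD A1 A2) _.
  by rewrite /k -/K1 le_eqVlt; apply/orP; left; apply/eqP; ring.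
apply: le_trans E _.
rewrite RintegralD// RintegralZl// RintegralZl// RintegralD//; last exact: integrableRZ.
rewrite Rintegral_itv_cst// subr0 RintegralZl// RintegralD// RintegralB//; try exact: i_below.
rewrite RintegralB//; try exact: i_below.
rewrite !(int_below tr1)// !(int_below tr2)//.
have P := potential_pairing qT'; rewrite -/(f _) in P.
have /andP[_ C1] := tr_front_lipschitz tr1 p0 pq qT.
have /andP[_ C2] := tr_front_lipschitz tr2 p0 pq qT.
have Q1 : - (q - p) * \int[leb]_(x in `[0, L]) f x <= 0 by rewrite mulNr oppr_le0 mulr_ge0.
have Q2 : K1 * (q - p) * (sg1 q - sg1 p + (sg2 q - sg2 p)) <= K1 * (q - p) * (2 * C * (q - p)).
  by rewrite ler_wpM2l ?mulr_ge0//; lra.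
have Q3 : 2 * K0 * (2 * e * (q - p) * L + K1 * (q - p) * (sg1 q - sg1 p + (sg2 q - sg2 p))) <=
    2 * K0 * (2 * e * (q - p) * L + K1 * (q - p) * (2 * C * (q - p))).
  by rewrite ler_wpM2l ?mulr_ge0// lerD2l.
apply: le_trans (lerD Q1 Q3) _; rewrite add0r le_eqVlt; apply/orP; left; apply/eqP; ring.
Qed.

Lemma potential_eq t z : 0 <= t <= T -> 0 <= z <= L -> U t z = 0.
Proof.
move=> tT zL; have [t0 tT'] := andP tT.
have E : energy t <= energy 0.
  apply: (@le_of_increments R energy id) => // e e0.
  (* [k] and [k'] split the bound of [potential_gap_step] into two halves, one made small by the
     moduli of [v1] and [v2], the other by the length [q - p]. *)
  pose k := 4 * K0 * L + 1; have k0 : 0 < k by rewrite ltr_wpDl// !mulr_ge0.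
  pose k' := 4 * K0 * K1 * C + 1; have k'0 : 0 < k' by rewrite ltr_wpDl// !mulr_ge0.
  have ek : 0 < e / 2 / k by rewrite !divr_gt0.
  have [d1 d10 h1] := trajectory_modulus T_gt0 L_gt0 tr1 ek.
  have [d2 d20 h2] := trajectory_modulus T_gt0 L_gt0 tr2 ek.
  exists (Num.min (Num.min d1 d2) (e / 2 / k')) => [|p q p0 pq qt].
    by rewrite !lt_min d10 d20 !divr_gt0.
  rewrite le_min => /andP[pq1 pq2]; set d := Num.min d1 d2 in pq1.
  have pq0 : 0 <= q - p by rewrite subr_ge0.
  have hd1 r s y : 0 <= r <= T -> 0 <= s <= T -> 0 <= y -> y <= L -> `|r - s| <= d ->
      `|v1 (r, y) - v1 (s, y)| <= e / 2 / k.
    by move=> rT sT y0 yL rs; apply: h1 => //; apply: le_trans rs _; rewrite ge_min lexx.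
  have hd2 r s y : 0 <= r <= T -> 0 <= s <= T -> 0 <= y -> y <= L -> `|r - s| <= d ->
      `|v2 (r, y) - v2 (s, y)| <= e / 2 / k.
    by move=> rT sT y0 yL rs; apply: h2 => //; apply: le_trans rs _; rewrite ge_min lexx orbT.
  apply: le_trans (potential_gap_step (ltW ek) hd1 hd2 p0 pq (le_trans qt tT') pq1) _.
  rewrite ler_wpM2r//.
  have E1 : e / 2 / k * k = e / 2 by rewrite divfK// gt_eqF.
  have E2 : (q - p) * k' <= e / 2 by rewrite -ler_pdivlMr.
  move: E1 E2 pq0 (ltW ek); rewrite /k /k'; set x := e / 2 / _; lra.
have Z : energy 0 = 0.
  rewrite /energy (@eq_Rintegral _ _ _ _ _ (cst 0)); first by rewrite Rintegral_cst// mul0r.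
  move=> y _; suff -> : U 0 y = 0 by rewrite /= expr0n/= mul0r.
  have mE x : \int[leb]_(y in `[0, sg1 0]) (x y * v1 (0, y)) = \int[leb]_(y in `[0, sg2 0]) (x y * v2 (0, y)).
    by rewrite -sg0; apply: eq_Rintegral => c; rewrite inE/= in_itv/= => /v0 ->.
  have T00 : 0 <= (0 : R) <= T by rewrite lexx ltW.
  have s1 := ltW (tr_front_gt0 tr1 0); have s2 := ltW (tr_front_gt0 tr2 0).
  have mass0 : w1 0 0 = w2 0 0.
    rewrite /mass !tail_start (Rintegral_cut1 s1 (tr_front_le tr1 T00) (@cv1 0)).
    rewrite (Rintegral_cut1 s2 (tr_front_le tr2 T00) (@cv2 0)) -sg0.
    by apply: eq_Rintegral => c; rewrite inE/= in_itv/= => /v0 ->.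
  by rewrite /U /potential /moment mE mass0 sg0 subrr.
have iE : \int[leb]_(z in `[0, L]) (U t z ^+ 2 / 2) <= 0 by move: E; rewrite Z.
have cU2 : {within `[0, L], continuous (fun z => U t z ^+ 2 / 2)}.
  move=> x; apply: cvgMl; have -> : (fun z => U t z ^+ 2) = (fun z => U t z * U t z) by apply/funext => c; rewrite expr2.
  by apply: cvgM; exact: cU.
have p2 y : 0 <= y <= L -> 0 <= U t y ^+ 2 / 2 by rewrite divr_ge0// sqr_ge0.
have /eqP := zero_of_integral_ge0 L_gt0 cU2 p2 iE zL.
by rewrite mulf_eq0 invr_eq0 pnatr_eq0 orbF sqrf_eq0 => /eqP.
Qed.

(** [U = 0] makes the integral of [slope] vanish on every interval. Between two different fronts
    only one mass and one indicator survive in [slope], with the same sign, and the indicator alone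
    contributes the gap over [a0]; so the fronts agree. The masses then agree, and the states agree
    since their primitives do. *)
Theorem trajectory_unique t : 0 <= t <= T ->
  sg1 t = sg2 t /\ forall y, 0 <= y <= sg1 t -> v1 (t, y) = v2 (t, y).
Proof.
move=> tT; have s1 := tr_front_gt0 tr1 t; have s2 := tr_front_gt0 tr2 t.
have l1 := tr_front_le tr1 tT; have l2 := tr_front_le tr2 tT.
have incr x y : 0 <= x -> x <= y -> y <= L -> leb.-integrable `[x, y] (EFin \o slope t) /\
    \int[leb]_(c in `[x, y]) slope t c = 0.
  move=> x0 xy yL; have [iS <-] := U_increment tT x0 xy yL; split => //.
  by rewrite !potential_eq ?subrr// ?x0 ?(le_trans x0 xy)// (le_trans xy).
have ib sg x y : leb.-integrable `[x, y] (EFin \o (fun c => a0^-1 * below sg t c)).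
  by apply: integrableRZ => //; apply: integrable_cut => c; exact: cvg_cst.
have i0 : 0 < a0^-1 by rewrite invr_gt0.
have sgE : sg1 t = sg2 t.
  apply/eqP; rewrite eq_le !leNgt; apply/andP; split; apply/negP => lt.
    have [iS S0] := incr _ _ (ltW s2) (ltW lt) l1.
    have : \int[leb]_(c in `[sg2 t, sg1 t]) (a0^-1 * below sg1 t c) <= \int[leb]_(c in `[sg2 t, sg1 t]) slope t c.
      apply: le_Rintegral => // c; rewrite /= in_itv/= => /andP[c2 c1]; rewrite /slope.
      have -> : below sg2 t c = 0 by rewrite /below /cut ltNge c2.
      rewrite subr0 lerDr /om; have -> : w2 t c = 0.
        by apply: (tail_out (@cv2 t) (ltW s2) c2); exact: le_trans l1.
      by rewrite subr0 w1_ge0// (le_trans (ltW s2) c2) (le_trans c1).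
    rewrite S0 RintegralZl//; last by apply: integrable_cut => c; exact: cvg_cst.
    rewrite Rintegral_below ?(ltW s2) ?(ltW lt)// minxx (min_idPl (ltW lt)).
    by rewrite pmulr_rle0// subr_le0 leNgt lt.
  have [iS S0] := incr _ _ (ltW s1) (ltW lt) l2.
  have : \int[leb]_(c in `[sg1 t, sg2 t]) slope t c <= \int[leb]_(c in `[sg1 t, sg2 t]) (-1 * (a0^-1 * below sg2 t c)).
    apply: le_Rintegral => //; first exact: integrableRZ.
    move=> c; rewrite /= in_itv/= => /andP[c1 c2]; rewrite /slope.
    have -> : below sg1 t c = 0 by rewrite /below /cut ltNge c1.
    rewrite /om; have -> : w1 t c = 0.
      by apply: (tail_out (@cv1 t) (ltW s1) c1); exact: le_trans l2.
    have : 0 <= w2 t c by rewrite w2_ge0// (le_trans (ltW s1) c1) (le_trans c2).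
    lra.
  rewrite S0 RintegralZl// RintegralZl//; last by apply: integrable_cut => c; exact: cvg_cst.
  rewrite Rintegral_below ?(ltW s1) ?(ltW lt)// minxx (min_idPl (ltW lt)) mulN1r oppr_ge0.
  by rewrite pmulr_rle0// subr_le0 leNgt lt.
split => // y ys.
have om0 z : 0 <= z <= L -> om t z = 0.
  apply: (zero_of_primitive L_gt0 (@com t)) => x /andP[x0 xL].
  have [_ S0] := incr 0 x (lexx 0) (ltW x0) (ltW xL); rewrite -[RHS]S0.
  by apply: eq_Rintegral => c _; rewrite /slope /below sgE subrr mulr0 addr0.
apply: (tail_inj (@cv1 t) (@cv2 t) s1 l1 _ ys) => z zL.
have := om0 z zL; rewrite /om /mass -sgE => /eqP; rewrite subr_eq0 => /eqP ->//.
Qed.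

End two_trajectories.

(** The constants are given up to enlargement, so that two solutions can be put under common
    ones. *)
Lemma solution_trajectory (R : realType) (a0 gamma beta T : R) (b : R -> R) (s0 : R) (u0 s : R -> R)
    (u : R * R -> R) : 0 < a0 -> 0 < T -> {within `[0, T], continuous b} ->
  is_solution a0 gamma beta T b s0 u0 s u ->
  exists sg v, [/\ forall t, 0 <= t <= T -> sg t = s t,
    forall t y, 0 <= t <= T -> 0 <= y <= s t -> v (t, y) = u (t, y),
    sg 0 = s0, forall y, 0 <= y <= s0 -> v (0, y) = u0 y &
    exists L B C, forall L' B' C', L <= L' -> B <= B' -> C <= C' ->
      trajectory a0 gamma beta T L' B' C' (b \o clamp 0 T) sg v].
Proof.
move=> a0_gt0 T_gt0 cb [ds [ut [uz [uzz [reg eqs]]]]].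
have T00 : 0 <= (0 : R) <= T by rewrite lexx ltW.
exists (front_ext s T), (state_ext s T u); split.
- by move=> t tT; exact: front_extE.
- by move=> t y tT ys; exact: state_extE.
- by rewrite front_extE// (s_initial eqs).
- move=> y ys; rewrite state_extE// ?(s_initial eqs)//.
  by rewrite (u_initial eqs)// in_itv.
have csg := front_ext_continuous T_gt0 reg.
have [L L0 hL] := continuous_itv_bound (ltW T_gt0) (continuous_subspaceT csg).
have [B B0 hB] := state_bounded T_gt0 reg.
have [C C0 hC] := front_lipschitz T_gt0 a0_gt0 reg eqs.
exists L, B, C => L' B' C' LL BB CC; split.
- exact: csg.
- exact: (state_ext_continuous T_gt0 reg).
- exact: (front_ext_gt0 T_gt0 reg).
- by move=> t tT; apply: le_trans LL; apply: le_trans (ler_norm _) (hL t tT).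
- move=> p q p0 pq qT; have /andP[-> h] := hC p q p0 pq qT.
  by apply: le_trans h _; rewrite ler_wpM2r// subr_ge0.
- exact: (front_ext_increment T_gt0 reg eqs).
- by move=> t y h; exact: (state_ext_out T_gt0 reg).
- by move=> t y tT y0; apply: le_trans (hB t y tT y0) BB.
- exact: (moment_identity T_gt0 a0_gt0 reg eqs cb).
Qed.

Theorem theorem2p5 (R : realType) (a0 gamma beta T : R)
    (b : R -> R) (bmin bmax : R) (s0 : R) (u0 : R -> R)
    (a0_gt0 : 0 < a0) (gamma_gt0 : 0 < gamma) (beta_gt0 : 0 < beta)
    (T_gt0 : 0 < T)
    (b_W12 : W1p 2%:E 0 T b)
    (bmin_gt0 : 0 < bmin) (bmax_gt0 : 0 < bmax)
    (b_bounds : forall t, t \in `]0, T[ -> bmin <= b t <= bmax)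
    (s0_gt0 : 0 < s0)
    (u0_H1 : W1p 2%:E 0 s0 u0)
    (u0_bounds : forall z, z \in `[0, s0] -> 0 <= u0 z <= bmax / gamma) :
  (exists (s : R -> R) (u : R * R -> R),
     is_solution a0 gamma beta T b s0 u0 s u /\
     (forall p, Q s T p -> 0 <= u p <= bmax / gamma)) /\
  (forall (s1 s2 : R -> R) (u1 u2 : R * R -> R),
     is_solution a0 gamma beta T b s0 u0 s1 u1 ->
     is_solution a0 gamma beta T b s0 u0 s2 u2 ->
     (forall t, t \in `[0, T] -> s1 t = s2 t) /\
     (forall p, Q s1 T p -> u1 p = u2 p)).
Proof.
split; first exact: solution_exists b_bounds s0_gt0 u0_H1 u0_bounds.
move=> s1 s2 u1 u2 sol1 sol2.
have cb : {within `[0, T], continuous b} by case: b_W12 => b' [].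
have [sg1 [v1 [sgE1 vE1 sg10 v10 [L1 [B1 [C1 tr1]]]]]] := solution_trajectory a0_gt0 T_gt0 cb sol1.
have [sg2 [v2 [sgE2 vE2 sg20 v20 [L2 [B2 [C2 tr2]]]]]] := solution_trajectory a0_gt0 T_gt0 cb sol2.
pose L := Num.max (Num.max L1 L2) 1; pose B := Num.max B1 B2; pose C := Num.max (Num.max C1 C2) 0.
have L_gt0 : 0 < L by rewrite /L lt_max ltr01 orbT.
have C_ge0 : 0 <= C by rewrite /C le_max lexx orbT.
have {}tr1 : trajectory a0 gamma beta T L B C (b \o clamp 0 T) sg1 v1.
  by apply: tr1; rewrite /L /B /C !le_max lexx.
have {}tr2 : trajectory a0 gamma beta T L B C (b \o clamp 0 T) sg2 v2.
  by apply: tr2; rewrite /L /B /C !le_max lexx ?orbT.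
have cbc : continuous (b \o clamp 0 T) by apply: continuous_comp_clamp => //; exact: ltW.
have b_ge0 t : 0 <= (b \o clamp 0 T) t.
  have bb : forall t, 0 < t < T -> bmin <= b t <= bmax by move=> x xT; apply: b_bounds; rewrite in_itv.
  have := within_bounds T_gt0 cb bb (clamp_itv t (ltW T_gt0)).
  by move=> /andP[h _]; apply: le_trans h; exact: ltW.
have v1_ge0 y : 0 <= y <= sg1 0 -> 0 <= v1 (0, y).
  by rewrite sg10 => ys; rewrite v10//; have /andP[] := u0_bounds y ys.
have sg0 : sg1 0 = sg2 0 by rewrite sg10 sg20.
have v0 y : 0 <= y <= sg1 0 -> v1 (0, y) = v2 (0, y) by rewrite sg10 => ys; rewrite v10// v20.
have H t : 0 <= t <= T -> sg1 t = sg2 t /\ forall y, 0 <= y <= sg1 t -> v1 (t, y) = v2 (t, y).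
  exact: (trajectory_unique a0_gt0 gamma_gt0 beta_gt0 T_gt0 L_gt0 C_ge0 cbc b_ge0 tr1 tr2 v1_ge0 sg0 v0).
have sE t : 0 <= t <= T -> s1 t = s2 t by move=> tT; rewrite -sgE1// -sgE2//; case: (H t tT).
split; first by move=> t; rewrite in_itv/= => /sE.
move=> [t y]; rewrite /Q/= => -[/andP[t0 tT] /andP[y0 ys]].
have tT' : 0 <= t <= T by rewrite !ltW.
have ys1 : 0 <= y <= s1 t by rewrite !ltW.
have ys2 : 0 <= y <= s2 t by rewrite -sE.
rewrite -(vE1 t y tT' ys1) -(vE2 t y tT' ys2); apply: (H t tT').2.
by rewrite sgE1.
Qed.
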